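(* Let $\delta\in(0,1)$, $k\ge2$ an integer, $1/(k-1)<d<(1-\delta)\frac{2^{k-1}-1}{k-1}$, and $m=dn/k$ an integer. Let $\mu$ be the uniform distribution over the NAE-satisfying assignments of the random formula $\mathbf{F}_k(n,m)$. Then there is a randomized algorithm which on input a $k$-CNF formula on $n$ variables outputs a Boolean assignment and runs in time $O((n\log n)^2)$ with probability 1, such that with probability $1-o(1)$ over $\mathbf{F}_k(n,m)$ the distribution $\bar\mu$ of its output on input $\mathbf{F}_k(n,m)$ satisfies $\|\bar\mu-\mu\|_{tv}\le n^{-\frac{\delta}{55\log(dk)}}$.
   Context: $\mathbf{F}_k(n,m)$ is a random propositional formula over Boolean variables $x_1,\dots,x_n$ obtained by inserting $m$ independent uniformly random clauses of length $k$ (each a disjunction of $k$ literals) such that no variable appears twice in the same clause. An assignment $\sigma$ is NAE-satisfying if under both $\sigma$ and its complement $\bar\sigma$ all $m$ clauses evaluate to true (equivalently, in every clause not all literals have the same value). $\|\cdot\|_{tv}$ is total variation distance. *)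

(* Defs.v *)
From HB Require Import structures.
From mathcomp Require Import all_boot all_order all_algebra.
From mathcomp Require Import all_classical all_reals all_analysis.

Set Implicit Arguments.
Unset Strict Implicit.
Unset Printing Implicit Defensive.

Import Order.TTheory GRing.Theory Num.Theory.
Import numFieldNormedType.Exports.

Definition assignment (n : nat) := {ffun 'I_n -> bool}.

(* [(x, true)] is the literal x, [(x, false)] its negation. *)
Definition literal (n : nat) := ('I_n * bool)%type.

Definition clause (n k : nat) := (k.-tuple (literal n))%type.

Definition formula (n k m : nat) := (m.-tuple (clause n k))%type.

Definition proper_clause (n k : nat) (c : clause n k) : bool :=
  uniq [seq l.1 | l <- c].

Definition proper_formula (n k m : nat) (F : formula n k m) : bool :=
  all (@proper_clause n k) F.

Definition sat_literal (n : nat) (s : assignment n) (l : literal n) : bool :=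
  s l.1 == l.2.

Definition sat_formula (n k m : nat) (s : assignment n) (F : formula n k m)
  : bool :=
  all (fun c : clause n k => has (sat_literal s) c) F.

Definition complement (n : nat) (s : assignment n) : assignment n :=
  [ffun x => ~~ s x].

Definition nae_sat (n k m : nat) (F : formula n k m) (s : assignment n)
  : bool :=
  sat_formula s F && sat_formula (complement s) F.

Local Open Scope ring_scope.

Definition uniform (R : realType) (T : finType) (A : pred T) (x : T) : R :=
  (A x)%:R / #|A|%:R.

Definition tv (R : realType) (T : finType) (mu nu : T -> R) : R :=
  2^-1 * \sum_(x : T) `|mu x - nu x|.

(* m independent uniform clauses: the uniform distribution on m-tuples of
   clauses without repeated variables. For n < k and m > 0 there is no such
   tuple, and every event has probability 0. *)
Definition Pr_Fk (R : realType) (n k m : nat) (E : pred (formula n k m)) : R :=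
  \sum_(F : formula n k m | E F)
    uniform R (@proper_formula n k m) F.

Local Close Scope ring_scope.

(* Randomized algorithms are programs of a unit-cost word RAM with words of
   O(log N) bits, N the input size, and a fair-coin instruction. *)

Inductive binop := Add | Sub | Mul | Div.

Inductive instr :=
| Const of nat & nat            (* r := v *)
| Op of binop & nat & nat & nat (* r := a op b *)
| Read of nat & nat             (* r := memory[a] *)
| Write of nat & nat            (* memory[a] := r *)
| Blt of nat & nat & nat        (* if a < b then goto l *)
| Coin of nat.                  (* r := fair random bit *)

Definition program := seq instr.

Record state := State {
  pc : nat;
  reg : nat -> nat;
  memory : nat -> nat
}.

Definition upd (f : nat -> nat) (a v : nat) : nat -> nat :=
  fun x => if x == a then v else f x.

(* Subtraction is truncated at 0 and division by 0 yields 0. *)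
Definition eval_op (o : binop) (a b : nat) : nat :=
  match o with
  | Add => a + b
  | Sub => a - b
  | Mul => a * b
  | Div => a %/ b
  end.

(* One step at word length w; arithmetic is modulo 2 ^ w. The argument b is
   the random bit of this step, discarded unless the instruction is [Coin].
   The machine has halted once pc lies outside the program. *)
Definition step (p : program) (w : nat) (s : state) (b : bool) : state :=
  let: State i r M := s in
  if onth p i is Some c then
    match c with
    | Const x v => State i.+1 (upd r x (v %% 2 ^ w)) M
    | Op o x y z =>
        State i.+1 (upd r x (eval_op o (r y) (r z) %% 2 ^ w)) M
    | Read x a => State i.+1 (upd r x (M (r a))) M
    | Write a x => State i.+1 r (upd M (r a) (r x))
    | Blt x y l => State (if r x < r y then l else i.+1) r M
    | Coin x => State i.+1 (upd r x (b %% 2 ^ w)) M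
    end
  else s.

(* Runs for [size bs] steps, the i-th step using the i-th bit of bs. *)
Definition run (p : program) (w : nat) (s : state) (bs : seq bool) : state :=
  foldl (step p w) s bs.

Definition halted (p : program) (s : state) : bool := size p <= pc s.

Definition encode_literal (n : nat) (l : literal n) : nat := (l.1).*2 + l.2.

(* The input is stored as n, m, followed by the m * k literals. *)
Definition input (n k m : nat) (F : formula n k m) : seq nat :=
  n :: m :: [seq encode_literal l | l <- flatten [seq tval c | c <- F]].

Definition init (n k m : nat) (F : formula n k m) : state :=
  State 0 (fun _ => 0) (nth 0 (input F)).

(* Word length: c times the logarithm of a bound that exceeds every address
   and every value occurring in the input. *)
Definition word_length (c n k m : nat) : nat :=
  c * up_log 2 (n.*2 + m * k + 2).

Definition output (n : nat) (s : state) : assignment n :=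
  [ffun i : 'I_n => memory s i != 0].

Definition exec (p : program) (c n k m : nat) (F : formula n k m)
    (bs : seq bool) : state :=
  run p (word_length c n k m) (init F) bs.

(* The coin flips of T n steps are uniform on a finite set, so halting with
   probability 1 amounts to halting for every outcome. *)
Definition runs_in_time (p : program) (c k : nat) (T : nat -> nat) : Prop :=
  forall (n m : nat) (F : formula n k m) (bs : (T n).-tuple bool),
    halted p (exec p c F bs).

Local Open Scope ring_scope.

(* Law of the output after t steps. A halted state is stationary, so this does
   not depend on t once all runs of length t have halted. *)
Definition output_dist (R : realType) (p : program) (c t n k m : nat)
    (F : formula n k m) (s : assignment n) : R :=
  #|[set bs : t.-tuple bool | output n (exec p c F bs) == s]|%:R / 2 ^+ t.

(* mu is defined only if F has an NAE-satisfying assignment. *)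
Definition samples_within (R : realType) (p : program) (c t n k m : nat)
    (err : R) (F : formula n k m) : bool :=
  [exists s : assignment n, nae_sat F s] &&
  (tv (@output_dist R p c t n k m F) (uniform R (nae_sat F)) <= err).

(* Main.v *)
Require Import Defs.
From HB Require Import structures.
From mathcomp Require Import all_boot all_order all_algebra fingroup perm.
From mathcomp Require Import all_classical all_reals all_analysis.
From mathcomp Require Import zify ring lra.

Set Implicit Arguments.
Unset Strict Implicit.
Unset Printing Implicit Defensive.

Import Order.TTheory GRing.Theory Num.Theory.
Import numFieldNormedType.Exports.

(** The algorithm activates the clauses one after the other while it maintains
an almost uniform NAE-solution of the active clauses. To activate a block [B]
it rerandomises, as long as [B] is violated, the variables of [B]: the variable
[x] is flipped, on a fair coin, together with the cluster of variables that is
forced to follow it through the unique minority literals of the active clauses.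
Flipping a cluster is an involution of the NAE-solutions, so the uniform
distribution is preserved exactly; an error arises only if the cluster does not
close up within [O(log n)] rounds, or returns to [B].

Such an event produces a list of distinct clauses, each attached to the previous
ones, and a union bound over index sequences gives its probability in the
planted model, where the branching ratio of the clusters is
[d (k - 1) / (2 ^ (k - 1) - 1) < 1 - delta]. A clause on no short cycle forms a
block of its own and its cluster can return only through a path of length
[r = Theta (log n)], which costs [(1 - delta) ^ r]. The clauses on short cycles
are few, their components are cycles unless two short cycles meet, and they are
activated last, one component at a time, with [sqrt n] attempts.

Planted bounds transfer to the uniform model because the number [Z] of
NAE-solutions is rarely much smaller than its mean: exposing the clauses in
order, a negative moment of [Z / E Z] stays bounded as long as the overlap of
two random solutions is of order [n ^ (-1/2)], which an exponential second
moment guarantees. Finally the algorithm is written in a small structured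
language that is compiled to the word RAM, with a static cost bound. *)

(** A block is activated against the solutions of the clauses already active, while the planted
    model speaks of solutions of the whole formula. To reconcile the two, every choice of the
    schedule (short cycles, components, order, active set) is a function of the variables of the
    clauses alone. The signs of the inactive clauses then stay independent fair bits, and averaging
    over them turns a solution of the whole formula into one of the active clauses, at a fixed price
    per clause. A bounded second moment of [Z] gives a lower bound on [Z] with positive probability
    only; for [1 - o(1)] a negative moment is used. It is endangered only by a clause that removes
    almost all solutions, which forces the variables of the clause to be pairwise strongly
    correlated. For three or more variables this has probability of order [n ^ (-3/2)], summable
    over linearly many clauses; the bounds on [d] rule out [k = 2]. The number [55] leaves slack:
    the search radius is tuned so that the contraction by [1 - delta] yields the exponent
    [delta / (52 * ln (d * k))], and the gap absorbs logarithms and the loss [n ^ ep] of the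
    transfer. *)

Module Explore.

(** * Search in the hypergraph of clauses, walks and short cycles *)

Section Exploration.
Variables (n m : nat) (V : 'I_m -> {set 'I_n}).
Implicit Types (a : 'I_m -> 'I_n -> bool) (U S : {set 'I_n}).

(** [a e y] decides whether the clause [e] fires once [y] is reached; a clause that fires
    contributes all its variables. The relation [pl] fires through any variable, the later [mn] only
    through the minority variable. *)
Definition grow a S : {set 'I_n} :=
  S :|: \bigcup_(e | [exists y in S, a e y]) V e.
Definition reach a U t := iter t (grow a) U.

Lemma growP a S y :
  reflect (y \in S \/ exists e u, [/\ u \in S, a e u & y \in V e])
          (y \in grow a S).
Proof.
rewrite inE; apply: (iffP orP) => -[yS|]; [by left| |by left|].
  by case/bigcupP => e /existsP[u /andP[uS aeu]] yV; right; exists e, u.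
case=> e [u [uS aeu yV]]; right; apply/bigcupP; exists e => //.
by apply/existsP; exists u; rewrite uS.
Qed.

Lemma reachS a U t : reach a U t.+1 = grow a (reach a U t).
Proof. by []. Qed.

Lemma reachD a U s t : reach a U (s + t) = reach a (reach a U s) t.
Proof. by rewrite /reach addnC iterD. Qed.

Lemma reach_leq a U s t : s <= t -> reach a U s \subset reach a U t.
Proof.
elim: t => [|t IH]; first by rewrite leqn0 => /eqP->.
rewrite leq_eqVlt => /orP[/eqP-> //|/IH /fintype.subset_trans]; apply.
by apply/fintype.subsetP => y yS; apply/growP; left.
Qed.

Lemma reach_sub a U t : U \subset reach a U t.
Proof. exact: (@reach_leq a U 0). Qed.

Lemma reach_mono a U U' t : U \subset U' -> reach a U t \subset reach a U' t.
Proof.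
move=> /fintype.subsetP UU'; elim: t => [|t /fintype.subsetP IH].
  exact/fintype.subsetP.
apply/fintype.subsetP => y /growP[/IH yS|[e [u [/IH uS aeu yV]]]].
  by apply/growP; left.
by apply/growP; right; exists e, u.
Qed.

(** A walk is a list of pairs of a clause and the variable through which it is left. The variable of
    entry is the preceding exit, or [u] for the first clause. *)
Fixpoint chain a u (s : seq ('I_m * 'I_n)) :=
  if s is (e, v) :: s' then [&& a e u, v \in V e, v != u & chain a v s']
  else true.

Definition target (u : 'I_n) (s : seq ('I_m * 'I_n)) := last u (unzip2 s).

Lemma chain_rcons a u s e v :
  chain a u (rcons s (e, v)) =
  [&& chain a u s, a e (target u s), v \in V e & v != target u s].
Proof.
elim: s u => [|[e' v'] s IH] u /=; first by rewrite andbT.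
by rewrite IH -!andbA.
Qed.

Lemma target_rcons u s e v : target u (rcons s (e, v)) = v.
Proof. by rewrite /target /unzip2 map_rcons last_rcons. Qed.

Lemma chain_cat a u s t :
  chain a u (s ++ t) = chain a u s && chain a (target u s) t.
Proof. by elim: s u => [|[e v] s IH] u //=; rewrite IH -!andbA. Qed.

Lemma target_cat u s t : target u (s ++ t) = target (target u s) t.
Proof. by rewrite /target /unzip2 map_cat last_cat. Qed.

Lemma chain_reach a U u s :
  chain a u s -> u \in U -> target u s \in reach a U (size s).
Proof.
elim/last_ind: s => [//|s [e v] IH]; rewrite chain_rcons size_rcons.
case/and4P => cs ae vV _ uU; rewrite target_rcons.
by apply/growP; right; exists e, (target u s); split=> //; apply: IH.
Qed.

Lemma chain_act a u s e : chain a u s -> e \in unzip1 s ->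
  exists2 y, a e y & y \in u :: unzip2 s.
Proof.
elim: s u => [//|[e' v] s IH] u /= /and4P[ae vV vu cs].
rewrite inE => /orP[/eqP->|/(IH _ cs)[y aey ys]]; first by exists u => //; rewrite inE eqxx.
by exists y => //; rewrite inE ys orbT.
Qed.

(** The last clause fires from a variable reached only one stage earlier; had an older variable
    fired it, [y] would have been reached before. It therefore differs from the clauses of the
    shorter chain, which fire from older variables. This freshness is what permits a union bound
    over distinct clauses. *)
Lemma chain_stage a U t y :
  y \in reach a U t.+1 -> y \notin reach a U t ->
  exists u s, [/\ u \in U, chain a u s, target u s = y, size s = t.+1 &
    uniq (unzip1 s) /\
    {in unzip1 s, forall e, [exists z in reach a U t, a e z]}].
Proof.
elim: t y => [|t IH] y.
  rewrite reachS => /growP[yS /negP //|[e [u [uS aeu yV]]] yN].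
  exists u, [:: (e, y)]; split=> //=.
    by rewrite aeu yV andbT /=; apply: contraNneq yN => ->.
  split=> // g; rewrite inE => /eqP->; apply/existsP; exists u; by rewrite uS.
rewrite reachS => /growP[yS /negP //|[e [u [uS aeu yV]]] yN].
have uN : u \notin reach a U t.
  apply: contra yN => uS'; rewrite reachS; apply/growP; right.
  by exists e, u.
have [u0 [s [u0U cs tgt sz [us act]]]] := IH u uS uN.
have eN : ~~ [exists z in reach a U t, a e z].
  apply/existsP => -[z /andP[zS aez]]; move/negP: yN; apply.
  by rewrite reachS; apply/growP; right; exists e, z.
exists u0, (rcons s (e, y)); split=> //.
- rewrite chain_rcons cs tgt aeu yV /=.
  by apply: contraNneq yN => ->.
- by rewrite target_rcons.
- by rewrite size_rcons sz.
rewrite /unzip1 map_rcons rcons_uniq us andbT /=; split.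
  by apply/negP => /act; rewrite (negbTE eN).
move=> g; rewrite mem_rcons inE => /orP[/eqP->|/act /existsP[z /andP[zS agz]]].
  by apply/existsP; exists u; rewrite uS.
apply/existsP; exists z; rewrite agz andbT.
by apply: (fintype.subsetP (reach_leq _ _ (leqnSn t))).
Qed.

Lemma reach_chain a U t y : y \in reach a U t ->
  exists u s, [/\ u \in U, chain a u s, target u s = y, size s <= t &
    uniq (unzip1 s) /\
    {in unzip1 s, forall e, V e \subset reach a U t}].
Proof.
elim: t => [|t IH] yS; first by exists y, [::].
have [yT|yT] := boolP (y \in reach a U t).
  have [u [s [uU cs tg sz [us act]]]] := IH yT.
  exists u, s; split=> //; first exact: leqW.
  by split=> // e /act /fintype.subset_trans; apply; apply: reach_leq.
have [u [s [uU cs tg sz [us act]]]] := chain_stage yS yT.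
exists u, s; rewrite sz; split=> //; split=> // e /act /existsP[z /andP[zS az]].
apply/fintype.subsetP => v vV; rewrite reachS; apply/growP; right.
by exists e, z.
Qed.

Definition pl (K : {set 'I_m}) e y := (e \in K) && (y \in V e).

Lemma pl_sym K u v t :
  v \in reach (pl K) [set u] t -> u \in reach (pl K) [set v] t.
Proof.
elim: t v => [|t IH] v; first by rewrite !inE eq_sym.
rewrite reachS => /growP[/IH uS|[e [z [zS /andP[eK zV] vV]]]].
  by apply: (fintype.subsetP (reach_leq _ _ (leqnSn t))).
rewrite -add1n reachD.
have zv : [set z] \subset reach (pl K) [set v] 1.
  rewrite finset.sub1set; apply/growP; right; exists e, v.
  by rewrite inE eqxx /pl eK vV.
exact: (fintype.subsetP (reach_mono _ _ zv)) (IH _ zS).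
Qed.

Lemma pl_trans K u v w s t : v \in reach (pl K) [set u] s ->
  w \in reach (pl K) [set v] t -> w \in reach (pl K) [set u] (s + t).
Proof.
move=> vS; rewrite reachD; apply: (fintype.subsetP (reach_mono _ _ _)).
by rewrite finset.sub1set.
Qed.

Lemma pl_step (K : {set 'I_m}) e u v : e \in K -> u \in V e -> v \in V e ->
  v \in reach (pl K) [set u] 1.
Proof.
move=> eK uV vV; apply/growP; right; exists e, u.
by rewrite inE eqxx /pl eK uV.
Qed.

Lemma pl_reachW K u v s t : s <= t ->
  v \in reach (pl K) [set u] s -> v \in reach (pl K) [set u] t.
Proof. by move=> st; apply: (fintype.subsetP (reach_leq _ _ st)). Qed.

Lemma chain_sub a a' u s : (forall e y, e \in unzip1 s -> a e y -> a' e y) ->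
  chain a u s -> chain a' u s.
Proof.
elim: s u => [//|[e v] s IH] u aa' /= /and4P[ae -> -> cs].
rewrite (aa' e u) ?inE ?eqxx //=; apply: IH cs => g y gs.
by apply: aa'; rewrite inE gs orbT.
Qed.

(** Two variables of [e] are joined without [e], so that [e] closes a cycle of at most [r + 1]
    clauses. Only the variables of the clauses enter, not their signs. *)
Definition shortcyc r : {set 'I_m} :=
  [set e | [exists x in V e, exists y in V e,
    (x != y) && (y \in reach (pl [set~ e]) [set x] r)]].

Lemma shortcycP r e : reflect
  (exists x y, [/\ x \in V e, y \in V e, x != y &
     y \in reach (pl [set~ e]) [set x] r]) (e \in shortcyc r).
Proof.
rewrite inE; apply: (iffP existsP) => [[x /andP[xV /existsP[y]]]|].
  by case/andP => yV /andP[xy yS]; exists x, y.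
case=> x [y [xV yV xy yS]]; exists x; rewrite xV; apply/existsP; exists y.
by rewrite yV xy.
Qed.

(** This is a connected component as soon as the ball of radius [R] has stopped growing, which is
    the case if short cycles do not meet. *)
Definition comp r R e : {set 'I_m} :=
  [set g in shortcyc r | ~~ [disjoint V g & reach (pl (shortcyc r)) (V e) R]].

End Exploration.
End Explore.

(** * Ways in which a new clause attaches to a list of clauses *)

Module Steps.
Import Explore.
Section Steps.
Variables (K : eqType) (n : nat) (V : K -> {set 'I_n}) (um : K -> 'I_n -> bool).
Implicit Types (p : seq K) (c : K).

Definition Vs p : {set 'I_n} := \bigcup_(c <- p) V c.
Definition lastV p : {set 'I_n} := if p is c :: p' then V (last c p') else finset.set0.
Definition lastum p (y : 'I_n) : bool :=
  if p is c :: p' then um (last c p') y else false.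

Definition step_pred := seq K -> K -> bool.
(* How a new clause [c] attaches to the clauses [p] found so far: [sF0], [sF]
   through its minority variable, which then propagates a flip; [sB0], [sB] through
   another variable, so that [c] propagates towards [p]; [sN0], [sP] through any
   variable; [sT] through two variables, which closes the configuration. The suffix
   0 and [sT] refer to all of [p], the others to its last clause. *)
Definition sF0 : step_pred := fun p c => [exists y in Vs p, um c y].
Definition sF : step_pred := fun p c =>
  [exists y in lastV p, um c y && ~~ lastum p y] && [exists z, lastum p z].
Definition sN0 : step_pred := fun p c => [exists y in Vs p, y \in V c].
Definition sP : step_pred := fun p c => [exists y in lastV p, y \in V c].
Definition sB0 : step_pred := fun p c =>
  [exists z in lastV p, [&& z \in V c, ~~ um c z & [exists y, um c y]]].
Definition sB : step_pred := fun p c =>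
  [exists z, [&& lastum p z, z \in V c, ~~ um c z & [exists y, um c y]]].
Definition sT : step_pred := fun p c =>
  [exists y in Vs p, exists z in Vs p, [&& y != z, y \in V c & z \in V c]].

Definition fw a : seq step_pred := if a is a'.+1 then sF0 :: nseq a' sF else [::].
Definition bw b : seq step_pred := if b is b'.+1 then sB0 :: nseq b' sB else [::].
(** [a] clauses carry the flip away from the block. With [None] the next clause closes the
    configuration. With [Some b] a clause follows on which nothing is imposed about minorities, then
    [b] clauses that propagate towards it and a closing one: two branches of the cluster meet in one
    clause. *)
Definition conf a (ob : option nat) : seq step_pred :=
  if ob is Some b then
    (if a is 0 then [:: sN0] else rcons (fw a) sP) ++ rcons (bw b) sT
  else rcons (fw a) sT.
Definition plainret l : seq step_pred :=
  if l is l'.+2 then sN0 :: rcons (nseq l' sP) sT else [:: sT].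
(** Up to a bounded number, the steps counted here carry the branching ratio below one; the junction
    and the closing clause do not. *)
Definition confcost a (ob : option nat) := a + odflt 0 ob.

Lemma in_Vs p c y : c \in p -> y \in V c -> y \in Vs p.
Proof.
move=> cp yc; rewrite /Vs (big_rem c) //=.
by rewrite inE yc.
Qed.

Lemma VsP p y : reflect (exists2 c, c \in p & y \in V c) (y \in Vs p).
Proof.
apply: (iffP idP) => [|[c]]; last exact: in_Vs.
rewrite /Vs; elim: p => [|c p IH]; first by rewrite big_nil inE.
rewrite big_cons inE => /orP[yc|/IH[c' c'p yc']].
  by exists c => //; rewrite inE eqxx.
by exists c' => //; rewrite inE c'p orbT.
Qed.

Lemma Vs_sub p p' : {subset p <= p'} -> Vs p \subset Vs p'.
Proof.
by move=> s; apply/fintype.subsetP => y /VsP[c /s cp yc]; apply/VsP; exists c.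
Qed.

Lemma lastV_Vs p : lastV p \subset Vs p.
Proof.
case: p => [|c p]; first by rewrite /lastV; apply/fintype.subsetP => y; rewrite inE.
by apply/fintype.subsetP => y yl; apply/VsP; exists (last c p) => //; apply: mem_last.
Qed.

Lemma lastV_rcons p c : lastV (rcons p c) = V c.
Proof. by case: p => //= c' p; rewrite last_rcons. Qed.

Lemma lastum_rcons p c y : lastum (rcons p c) y = um c y.
Proof. by case: p => //= c' p; rewrite last_rcons. Qed.

Lemma Vs_rcons p c y : (y \in Vs (rcons p c)) = (y \in Vs p) || (y \in V c).
Proof. by rewrite /Vs -cats1 big_cat big_seq1 inE. Qed.

Fixpoint occ (As : seq step_pred) p (s : seq K) : bool :=
  match As, s with
  | [::], [::] => true
  | A :: As', c :: s' => [&& c \notin p, A p c & occ As' (rcons p c) s']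
  | _, _ => false
  end.

Lemma occ_size As p s : occ As p s -> size s = size As.
Proof.
elim: As p s => [|A As IH] p [|c s] //= /and3P[_ _ /IH ->] //.
Qed.

Lemma occ_cat As Bs p s t : size s = size As ->
  occ (As ++ Bs) p (s ++ t) = occ As p s && occ Bs (p ++ s) t.
Proof.
elim: As p s => [|A As IH] p [|c s] //=; first by rewrite cats0.
by move=> [sz]; rewrite IH // cat_rcons -!andbA.
Qed.

Lemma occ_catE As Bs p s : occ (As ++ Bs) p s ->
  exists s1 s2, [/\ s = s1 ++ s2, occ As p s1 & occ Bs (p ++ s1) s2].
Proof.
move=> o; exists (take (size As) s), (drop (size As) s).
have sz : size (take (size As) s) = size As.
  by rewrite size_take (occ_size o) size_cat; case: ltnP => //; lia.
by move: o; rewrite -{1}(cat_take_drop (size As) s) occ_cat // cat_take_drop => /andP[].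
Qed.

Lemma occ_rcons As B p s c : size s = size As ->
  occ (rcons As B) p (rcons s c) = [&& occ As p s, c \notin p ++ s & B (p ++ s) c].
Proof. by move=> sz; rewrite -!cats1 occ_cat //= andbT. Qed.

Definition simp (A B : step_pred) := forall p c, p != [::] -> A p c -> B p c.

Fixpoint alls (As : seq step_pred) : Prop :=
  if As is A :: As' then simp A sP /\ alls As' else True.

Lemma alls_cat As Bs : alls As -> alls Bs -> alls (As ++ Bs).
Proof. by elim: As => //= A As IH [? ?] ?; split=> //; apply: IH. Qed.

Lemma alls_nseq l A : simp A sP -> alls (nseq l A).
Proof. by move=> s; elim: l. Qed.

Lemma occ_alls As p s : p != [::] -> alls As ->
  occ As p s -> occ (nseq (size As) sP) p s.
Proof.
elim: As p s => [|A As IH] p [|c s] //= p0 [AP As_P] /and3P[-> Apc o].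
by have -> /= := AP _ _ p0 Apc; apply: IH o => //; case: (p).
Qed.

Lemma occ_plainret A As p s : p != [::] -> simp A sN0 -> alls As ->
  occ (A :: rcons As sT) p s -> occ (plainret (size As).+2) p s.
Proof.
case: s => [//|c s] p0 AN As_P /= /and3P[-> Apc].
have -> /= := AN _ _ p0 Apc.
rewrite -!cats1 => /occ_catE[s1 [s2 [-> o1 o2]]].
rewrite occ_cat ?(occ_size o1) ?size_nseq // o2 andbT.
by apply: occ_alls o1 => //; case: (p).
Qed.

Hypothesis um_V : forall c y, um c y -> y \in V c.

Lemma size_conf a ob :
  size (conf a ob) = if ob is Some b then a + b + 2 else a.+1.
Proof.
have sf x : size (fw x) = x by case: x => //= b'; rewrite size_nseq.
have sb x : size (bw x) = x by case: x => //= b'; rewrite size_nseq.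
case: ob => [b|] /=; last by rewrite size_rcons sf; lia.
rewrite size_cat size_rcons sb; case: a => [|a] /=; first by lia.
by rewrite size_rcons size_nseq; lia.
Qed.

(** Every step is weakened to a mere intersection. A configuration attached to a short cycle thereby
    becomes an ear of this cycle, whatever the minorities are. *)
Lemma conf_plain a ob p s : p != [::] -> occ (conf a ob) p s ->
  occ (plainret (size (conf a ob))) p s.
Proof.
move=> p0.
have F0N : simp sF0 sN0.
  move=> q c _ /existsP[y /andP[yp uy]]; apply/existsP; exists y.
  by rewrite yp um_V.
have FP : simp sF sP.
  move=> q c _ /andP[/existsP[y /and3P[yp uy _]] _]; apply/existsP; exists y.
  by rewrite yp um_V.
have B0P : simp sB0 sP.
  move=> q c _ /existsP[y /and3P[yp uy _]]; apply/existsP; exists y.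
  by rewrite yp uy.
have BP : simp sB sP.
  move=> q c q0 /existsP[y /and3P[yp uy _]]; apply/existsP; exists y.
  by rewrite uy andbT; case: (q) q0 yp => //= c' p' _; apply: um_V.
have bwP b : alls (bw b) by case: b => //= b; split=> //; apply: alls_nseq.
rewrite size_conf; case: ob => [b|]; last first.
  case: a => [//|a] /= o.
  have := occ_plainret p0 F0N (alls_nseq a FP) o.
  by rewrite size_nseq.
have sb x : size (bw x) = x by case: x => //= b'; rewrite size_nseq.
case: a => [|a] /= o.
  have := @occ_plainret sN0 (bw b) _ _ p0 (fun _ _ _ => id) (bwP b) o.
  by rewrite sb addn2.
have := @occ_plainret sF0 (rcons (nseq a sF) sP ++ bw b) p s p0 F0N.
rewrite rcons_cat size_cat sb size_rcons size_nseq addSn addn2; apply=> //.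
apply: alls_cat => //; rewrite -cats1; apply: alls_cat; first exact: alls_nseq.
by split=> // ? ? _.
Qed.

End Steps.
End Steps.

(** * From a failed switch to a configuration of clauses *)

Module SwitchConf.
Import Explore Steps.
Section SwitchToSteps.
Variables (n m : nat) (V : 'I_m -> {set 'I_n}) (um : 'I_m -> 'I_n -> bool).
Hypothesis um_V : forall e y, um e y -> y \in V e.
Hypothesis um_inj : forall e y z, um e y -> um e z -> y = z.
Implicit Types (a : 'I_m -> 'I_n -> bool) (p : seq 'I_m).

Definition avoids (p q : seq 'I_m) := {in q, forall e, e \notin p}.

Lemma target_Vs a p u s : chain V a u s -> u \in Vs V p ->
  target u s \in Vs V (p ++ unzip1 s).
Proof.
case/lastP: s => [|s [e v]]; first by rewrite cats0.
rewrite chain_rcons target_rcons => /and4P[_ _ vV _] _.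
by apply: (in_Vs (c := e)) => //; rewrite mem_cat /unzip1 map_rcons mem_rcons inE eqxx orbT.
Qed.

Lemma avoids_cons p e (s : seq 'I_m) : uniq (e :: s) -> avoids p (e :: s) ->
  e \notin p /\ avoids (rcons p e) s.
Proof.
move=> /= /andP[es us] av; split; first by apply: av; rewrite inE eqxx.
move=> g gs; rewrite mem_rcons inE negb_or (av g) ?inE ?gs ?orbT // andbT.
by apply: contraNneq es => <-.
Qed.

Lemma chain_notum a e u v (s : seq ('I_m * 'I_n)) :
  (forall e y, a e y -> um e y) -> a e u -> v != u -> ~~ um e v.
Proof. by move=> aum /aum ue vu; apply: contraNN vu => /(um_inj ue) ->. Qed.

(** A clause is entered through its only minority variable and left through another one, so the next
    clause meets it outside the minority variable. This leaves [k - 1] instead of [k] positions in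
    the branching ratio. *)
Lemma occ_sF a p v s : (forall e y, a e y -> um e y) ->
  chain V a v s -> uniq (unzip1 s) -> avoids p (unzip1 s) ->
  v \in lastV V p -> ~~ lastum um p v -> [exists z, lastum um p z] ->
  occ (nseq (size s) (sF V um)) p (unzip1 s).
Proof.
move=> aum; elim: s p v => [//|[e w] s IH] p v /= /and4P[ae wV wv cs] us av vl vn vz.
have [ep av'] := avoids_cons us av; rewrite ep /=; apply/andP; split.
  by apply/andP; split=> //; apply/existsP; exists v; rewrite vl vn aum.
apply: (IH _ w) => //; first by case/andP: us.
- by rewrite lastV_rcons.
- by rewrite lastum_rcons (chain_notum s aum ae).
- by apply/existsP; exists v; rewrite lastum_rcons aum.
Qed.

Lemma occ_fw a p u s : (forall e y, a e y -> um e y) ->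
  chain V a u s -> uniq (unzip1 s) -> avoids p (unzip1 s) ->
  u \in Vs V p -> occ (fw V um (size s)) p (unzip1 s).
Proof.
move=> aum; case: s => [//|[e w] s] /= /and4P[ae wV wv cs] us av uV.
have [ep av'] := avoids_cons us av; rewrite ep /=; apply/andP; split.
  by apply/existsP; exists u; rewrite uV aum.
apply: (occ_sF (v := w) aum cs) => //; first by case/andP: us.
- by rewrite lastV_rcons.
- by rewrite lastum_rcons (chain_notum s aum ae).
- by apply/existsP; exists u; rewrite lastum_rcons aum.
Qed.

Lemma occ_sP a p v s : (forall e y, a e y -> y \in V e) ->
  chain V a v s -> uniq (unzip1 s) -> avoids p (unzip1 s) ->
  v \in lastV V p -> occ (nseq (size s) (sP V)) p (unzip1 s).
Proof.
move=> aV; elim: s p v => [//|[e w] s IH] p v /= /and4P[ae wV wv cs] us av vl.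
have [ep av'] := avoids_cons us av; rewrite ep /=; apply/andP; split.
  by apply/existsP; exists v; rewrite vl aV.
by apply: (IH _ w) => //; [case/andP: us|rewrite lastV_rcons].
Qed.

Lemma unzip1_rcons (s : seq ('I_m * 'I_n)) e v :
  unzip1 (rcons s (e, v)) = rcons (unzip1 s) e.
Proof. by rewrite /unzip1 map_rcons. Qed.

Lemma uniq_avoids_rcons p (s : seq 'I_m) e : uniq (rcons s e) -> avoids p (rcons s e) ->
  [/\ uniq s, e \notin p, avoids p s & avoids (rcons p e) s].
Proof.
rewrite rcons_uniq => /andP[es us] av; split=> //.
- by apply: av; rewrite mem_rcons inE eqxx.
- by move=> g gs; apply: av; rewrite mem_rcons inE gs orbT.
move=> g gs; rewrite mem_rcons inE negb_or (av g) ?mem_rcons ?inE ?gs ?orbT // andbT.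
by apply: contraNneq es => <-.
Qed.

(** The walk is read from its end: each clause is attached through the variable by which the walk
    leaves it, which is the minority variable of the clause found just before and not its own. The
    first clause of the walk starts at [w], already known, and so closes the configuration. *)
Lemma occ_sB a p w s : (forall e y, a e y -> um e y) ->
  chain V a w s -> uniq (unzip1 s) -> avoids p (unzip1 s) ->
  w \in Vs V p -> p != [::] -> lastum um p (target w s) -> 0 < size s ->
  occ (rcons (nseq (size s).-1 (sB V um)) (sT V)) p (rev (unzip1 s)).
Proof.
move=> aum; elim/last_ind: s p => [//|s [e v] IH] p.
rewrite chain_rcons target_rcons unzip1_rcons size_rcons /=.
case/and4P => cs ae vV vt us av wV p0 lu _.
have [us' ep av1 av2] := uniq_avoids_rcons us av.
have vp : v \in Vs V p.
  apply: (fintype.subsetP (lastV_Vs V p)); case: (p) p0 lu => //= c q _; exact: um_V.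
rewrite rev_rcons; case/lastP: s => [|s [g z]] in cs ae vt us us' av av1 av2 IH *.
  rewrite /rev /= ep /= andbT; apply/existsP; exists v; rewrite vp; apply/existsP; exists w.
  by rewrite wV vV vt um_V // aum.
move: (ae); rewrite size_rcons target_rcons /= ep /= => aez; apply/andP; split.
  apply/existsP; exists v; rewrite lu vV (chain_notum s aum ae vt) /=.
  by apply/existsP; exists z; apply: aum.
have := IH (rcons p e) cs us' av2; rewrite size_rcons /=; apply=> //.
- by rewrite Vs_rcons wV.
- by case: (p).
- by rewrite target_rcons lastum_rcons aum.
Qed.

Lemma occ_bw a p w s : (forall e y, a e y -> um e y) ->
  chain V a w s -> uniq (unzip1 s) -> avoids p (unzip1 s) ->
  w \in Vs V p -> target w s \in lastV V p -> 0 < size s ->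
  occ (rcons (bw V um (size s).-1) (sT V)) p (rev (unzip1 s)).
Proof.
move=> aum; case/lastP: s => [//|s [e v]].
rewrite chain_rcons target_rcons unzip1_rcons size_rcons /=.
case/and4P => cs ae vV vt us av wV vl _.
have [us' ep av1 av2] := uniq_avoids_rcons us av.
have vp := fintype.subsetP (lastV_Vs V p) _ vl.
rewrite rev_rcons; case/lastP: s => [|s [g z]] in cs ae vt us us' av av1 av2 *.
  rewrite /rev /= ep /= andbT; apply/existsP; exists v; rewrite vp; apply/existsP; exists w.
  by rewrite wV vV vt um_V // aum.
move: (ae); rewrite size_rcons target_rcons /= ep /= => aez; apply/andP; split.
  apply/existsP; exists v; rewrite vl vV (chain_notum s aum ae vt) /=.
  by apply/existsP; exists z; apply: aum.
have := @occ_sB a (rcons p e) w (rcons s (g, z)) aum cs us' av2.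
rewrite size_rcons /=; apply=> //.
- by rewrite Vs_rcons wV.
- by case: (p).
- by rewrite target_rcons lastum_rcons aum.
Qed.

(** Beyond the last visit every clause is left through a variable outside [W], hence is none of the
    clauses that span [W]. *)
Lemma last_visit (W : {set 'I_n}) u (s : seq ('I_m * 'I_n)) : u \in W ->
  exists s1 s2, [/\ s = s1 ++ s2, target u s1 \in W &
                  {in unzip2 s2, forall v, v \notin W}].
Proof.
move=> uW; elim/last_ind: s => [|s [e v] [s1 [s2 [-> t1 n2]]]].
  by exists [::], [::].
have [vW|vW] := boolP (v \in W).
  by exists (rcons (s1 ++ s2) (e, v)), [::]; rewrite cats0 target_rcons.
exists s1, (rcons s2 (e, v)); rewrite rcons_cat; split=> // z.
rewrite /unzip2 map_rcons mem_rcons inE => /orP[/eqP-> //|]; exact: n2.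
Qed.

Definition mn (A : {set 'I_m}) e y := (e \in A) && um e y.
(** A clause inside [S] is complemented by the flip; one that meets [S] in a single variable, not
    its minority, keeps both truth values. The second alternative includes clauses disjoint from
    [S]. *)
Definition clause_ok (S : {set 'I_n}) e := (V e \subset S) ||
  [forall y in V e :&: S, ~~ um e y && [forall z in V e :&: S, z == y]].
Definition switchable (A : {set 'I_m}) S := [forall e in A, clause_ok S e].
Definition cluster A R x := reach V (mn A) [set x] R.

Lemma chain_exit a u s e : chain V a u s -> e \in unzip1 s ->
  exists2 v, v \in V e & v \in unzip2 s.
Proof.
elim: s u => [//|[e' v] s IH] u /= /and4P[_ vV _ cs].
rewrite inE => /orP[/eqP->|/(IH _ cs)[y ? ys]].
  by exists v => //; rewrite inE eqxx.
by exists y => //; rewrite inE ys orbT.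
Qed.

Lemma chain_cons_reach (K : {set 'I_m}) w u s e : chain V (pl V K) u s -> e \in unzip1 s ->
  w \in V e -> target u s \in reach V (pl V K) [set w] (size s).
Proof.
elim: s u => [//|[e' v] s IH] u /= /and4P[ae vV _ cs].
rewrite inE => /orP[/eqP->|es] wV; last first.
  exact: (pl_reachW (leqnSn _) (IH _ cs es wV)).
change (target v s \in reach V (pl V K) [set w] (1 + size s)); apply: (@pl_trans _ _ _ _ w v).
  by case/andP: ae => eK _; apply: (pl_step eK).
by apply: (chain_reach cs); rewrite inE.
Qed.

(** A switch fails in three ways: the cluster returns to [X]; a clause has its minority variable in
    [S] without lying in [S], so the cluster is still growing; or a clause [N] meets [S] in two
    variables, reached along two branches. If the block is one clause and all clauses around are off
    short cycles, the clauses found close a cycle through [e] or through [N], which bounds the cost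
    below by [r]. *)
Lemma switch_conf r R (A : {set 'I_m}) x p (X : {set 'I_n}) :
  avoids p (enum A) -> x \in X -> X \subset Vs V p ->
  let S := cluster A R x in
  ~~ (switchable A S && (S :&: X == [set x])) ->
  (exists s, occ (fw V um R.+1) p s) \/
  exists l ob s, [/\ l <= R, odflt 0 ob <= R, occ (conf V um l ob) p s &
    (exists e, [/\ p = [:: e], X = V e, e \notin shortcyc V r &
                 {in A, forall g, g \notin shortcyc V r}]) ->
    r <= confcost l ob].
Proof.
move=> avA xX /fintype.subsetP XV S bad.
have avP e : e \in A -> e \notin p by move=> eA; apply: avA; rewrite mem_enum.
have xV := XV _ xX.
have mum e y : mn A e y -> um e y by case/andP.
have mnA u s : chain V (mn A) u s -> {in unzip1 s, forall e, e \in A}.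
  by move=> cs e /(chain_act cs)[y /andP[]].
have mav u s : chain V (mn A) u s -> avoids p (unzip1 s).
  by move=> cs e /(mnA _ _ cs) /avP.
have mpl (N : 'I_m) u s : chain V (mn A) u s -> N \notin unzip1 s ->
    chain V (pl V [set~ N]) u s.
  move=> cs Ns; apply: chain_sub cs => e y es /mum ue.
  by rewrite /pl um_V // andbT !inE; apply: contraNneq Ns => <-.
have xS : x \in S by apply: (fintype.subsetP (reach_sub _ _ _ _)); rewrite inE.
have [hit|nohit] := boolP [exists y in S :&: X, y != x].
  case/existsP: hit => y /andP[]; rewrite inE => /andP[yS yX] yx; right.
  have [u [s [/set1P-> cs tg sz [us _]]]] := reach_chain yS.
  case/lastP: s => [|s [e v]] in cs tg sz us *; first by move: yx; rewrite -tg eqxx.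
  exists (size s), None, (rcons (unzip1 s) e).
  move: (cs); rewrite chain_rcons => /and4P[cs' ae vV vt].
  move: tg; rewrite target_rcons => ?; subst v.
  rewrite unzip1_rcons in us; have av := mav _ _ cs; rewrite unzip1_rcons in av.
  have [us' ep av1 _] := uniq_avoids_rcons us av.
  rewrite size_rcons in sz; split=> //; first exact: ltnW.
    rewrite /conf occ_rcons; last by case: (s) => //= ? ?; rewrite /unzip1 size_map size_nseq.
    rewrite (occ_fw mum cs') //= mem_cat (negbTE ep) /=.
    rewrite rcons_uniq in us; case/andP: us => -> _ /=.
    apply/existsP; exists (target x s); rewrite (target_Vs cs') //=.
    apply/existsP; exists y; rewrite eq_sym vt vV um_V ?(mum _ _ ae) // !andbT.
    by apply: (fintype.subsetP (Vs_sub V _)) (XV _ yX) => z zp; rewrite mem_cat zp.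
  case=> e0 [p0 XE e0N _]; rewrite /confcost addn0 leqNgt; apply: contra e0N => sr.
  apply/shortcycP; exists x, y; rewrite -XE eq_sym; split=> //.
  rewrite -(target_rcons x s e y); apply: (pl_reachW (s := (size s).+1)) => //.
  rewrite -(size_rcons s (e, y)); apply: (chain_reach (a := pl V [set~ e0])); last by rewrite inE.
  by apply: mpl => //; apply/negP => /(mnA _ _ cs)/avP; rewrite p0 inE eqxx.
have SX : S :&: X = [set x].
  apply/setP => y; rewrite !inE; apply/idP/eqP => [yS|->]; last by rewrite xS.
  apply/eqP; apply: contraNT nohit => yx; apply/existsP; exists y.
  by rewrite !inE yS.
move: bad; rewrite SX eqxx andbT => /forallPn[N]; rewrite negb_imply => /andP[NA].
rewrite negb_or => /andP[NS /forallPn[y]]; rewrite negb_imply inE negb_and negbK.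
(* If [y] is the minority variable of [N], one more round makes [N] fire and brings a variable
   outside [S]; this gives a chain of exactly [R + 1] clauses. *)
case/andP => /andP[yN yS] /orP[uy|/forallPn[z]].
  left; have /subsetPn[w wN wS] := NS.
  have wS' : w \in reach V (mn A) [set x] R.+1.
    by rewrite reachS; apply/growP; right; exists N, y; rewrite /mn NA uy.
  have [u [s [/set1P-> cs tg sz [us _]]]] := chain_stage wS' wS.
  exists (unzip1 s); rewrite -sz; apply: (occ_fw mum cs) => //; exact: mav cs.
rewrite negb_imply inE => /andP[/andP[zN zS] zy]; right.
have [u [s [/set1P-> cs tgs szs [us sS]]]] := reach_chain yS.
have [u' [t [/set1P-> ct tgt szt [ut tS]]]] := reach_chain zS.
have Ns : N \notin unzip1 s by apply: contraNN NS => /sS.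
have Nt : N \notin unzip1 t by apply: contraNN NS => /tS.
have Np := avP _ NA.
set p1 := p ++ unzip1 s.
have yV : y \in Vs V p1 by rewrite -tgs; apply: target_Vs cs _.
have xV1 : x \in Vs V p1.
  by apply: (fintype.subsetP (Vs_sub V _)) xV => e ep; rewrite mem_cat ep.
(* The second branch is cut after its last visit to [p] and the first branch. The rest [t2] consists
   of new clauses and will be read backwards from [N]. *)
have [t1 [t2 [tE wV wN]]] := @last_visit (Vs V p1) x t xV1.
move: ct; rewrite tE chain_cat => /andP[ct1 ct2].
set w := target x t1 in wV ct2.
have tw : target w t2 = z by rewrite -tgt tE target_cat.
have occs := occ_fw mum cs us (mav _ _ cs) xV.
have sfw : size (unzip1 s) = size (fw V um (size s)).
  by case: (s) => //= ? ?; rewrite size_nseq size_map.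
(* [y] and [z] are joined through [w] without [N] in at most [size s + size t2] rounds; were this at
   most [r], then [N] would lie on a short cycle. *)
have len : (exists e, [/\ p = [:: e], X = V e, e \notin shortcyc V r &
    {in A, forall g, g \notin shortcyc V r}]) -> r < size s + size t2.
  case=> e0 [p0 XE e0N GA]; rewrite ltnNge; apply: contra (GA _ NA) => le.
  have wS : w \in S.
    apply: (fintype.subsetP (reach_leq _ _ _ _)) (chain_reach ct1 (set11 x)).
    by apply: leq_trans szt; rewrite tE size_cat leq_addr.
  have cs' := mpl _ _ _ cs Ns.
  have wy : y \in reach V (pl V [set~ N]) [set w] (size s).
    move: wV; rewrite /p1 => /VsP[e]; rewrite mem_cat p0 inE => /orP[/eqP-> we|es we].
      have -> : w = x by apply/set1P; rewrite -SX inE wS XE.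
      by rewrite -tgs; apply: (chain_reach cs'); rewrite inE.
    by rewrite -tgs; apply: (chain_cons_reach cs' es we).
  have Nt2 : N \notin unzip1 t2.
    by apply: contra Nt => Nt2; rewrite tE /unzip1 map_cat mem_cat Nt2 orbT.
  have wz : z \in reach V (pl V [set~ N]) [set w] (size t2).
    by rewrite -tw; apply: (chain_reach (mpl _ _ _ ct2 Nt2)); rewrite inE.
  apply/shortcycP; exists y, z; split=> //; first by rewrite eq_sym.
  exact: pl_reachW le (pl_trans (pl_sym wy) wz).
(* If [t2] is empty, [z] itself is explored already and [N] alone closes the configuration. *)
have [t20|t2n0] := posnP (size t2).
  exists (size s), None, (rcons (unzip1 s) N); split=> //.
    rewrite /conf occ_rcons // occs mem_cat negb_or Np Ns /=.
    apply/existsP; exists y; rewrite yV; apply/existsP; exists z.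
    rewrite eq_sym zy yN zN !andbT /=; move: wV; rewrite -tw.
    by case: (t2) t20.
  by move/len; rewrite t20 /confcost /= => /ltnW; rewrite addn0.
exists (size s), (Some (size t2).-1), (rcons (unzip1 s) N ++ rev (unzip1 t2)).
have ut2 : uniq (unzip1 t2).
  by move: ut; rewrite tE /unzip1 map_cat cat_uniq => /and3P[].
split=> //.
- apply: leq_trans (leq_pred _) _; apply: leq_trans szt.
  by rewrite tE size_cat leq_addl.
- have av2 : avoids (rcons p1 N) (unzip1 t2).
    move=> e et; rewrite mem_rcons inE negb_or; apply/andP; split.
      by apply: contraNneq Nt => <-; rewrite tE /unzip1 map_cat mem_cat et orbT.
    have [v ve vt] := chain_exit ct2 et.
    by apply: contraNN (wN _ vt) => ep; apply: in_Vs ve.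
  have ob := occ_bw mum ct2 ut2 av2.
  rewrite /conf; case: (posnP (size s)) => [s0|sn0].
    have s0' : s = [::] by case: (s) s0.
    rewrite s0 s0' /= Np /=; apply/andP; split.
      apply/existsP; exists y; rewrite yN andbT.
      by move: yV; rewrite /p1 s0' cats0.
    have := ob; rewrite /p1 s0' cats0 tw lastV_rcons Vs_rcons; apply=> //.
    by move: wV; rewrite /p1 s0' cats0 => ->.
  rewrite (_ : (if size s is 0 then _ else _) = rcons (fw V um (size s)) (sP V)); last first.
    by case: (size s) sn0.
  rewrite occ_cat ?size_rcons ?sfw // occ_rcons // occs mem_cat negb_or Np Ns /=.
  apply/andP; split.
    apply/existsP; exists y; rewrite yN andbT.
    case/lastP: s sn0 cs tgs {us szs sS Ns p1 yV xV1 wV wN occs sfw len av2 ob} => [//|s [e v]] _.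
    rewrite chain_rcons target_rcons unzip1_rcons => /and4P[_ _ vV _] <-.
    by rewrite -rcons_cat lastV_rcons.
  rewrite -rcons_cat; apply: ob => //; first by rewrite Vs_rcons wV.
  by rewrite tw lastV_rcons.
- by move/len => lt; rewrite /confcost /= -ltnS -addnS prednK.
Qed.

End SwitchToSteps.
End SwitchConf.

(** * Short cycles and their components *)

Module ShortCycle.
Import Explore Steps SwitchConf.
Section ShortCycles.
Variables (n m : nat) (V : 'I_m -> {set 'I_n}) (r : nat).
Let G := shortcyc V r.

Definition cyc_steps l : seq (step_pred 'I_m) := rcons (nseq l (sP V)) (sT V).

(** A short cycle through [e] with an ear, that is, two independent cycles. Each of the two [sT]
    steps costs a factor [1 / n] while only [e] is chosen freely, so this is unlikely. *)
Definition bicyclic e := exists l Q j s,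
  [/\ l < r, j <= r, occ (cyc_steps l) [:: e] Q &
      occ (plainret V j.+1) (e :: Q) s].

Lemma shortcyc_sym e x y : x \in V e -> y \in V e -> x != y ->
  y \in reach V (pl V [set~ e]) [set x] r ->
  exists s, [/\ chain V (pl V [set~ e]) x s, target x s = y, 0 < size s <= r,
    uniq (unzip1 s) & {in unzip1 s, forall g, g != e}].
Proof.
move=> xV yV xy yS.
have [u [s [/set1P-> cs tg sz [us _]]]] := reach_chain yS.
exists s; split=> //.
  by rewrite sz andbT; case: (s) tg => // tg; move: xy; rewrite -tg eqxx.
by move=> g /(chain_act cs)[z /andP[]]; rewrite !inE.
Qed.

(** The walk is followed up to its first return to the explored variables. Before that, each
    variable passed belongs to no explored clause but the last, so the next clause cannot be an old
    one. *)
Lemma occ_return p v t : v \in lastV V p ->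
  {in p, forall c, c != last c p -> v \notin V c} ->
  chain V (fun e y => y \in V e) v t -> uniq (unzip1 t) ->
  {in unzip1 t, forall g, g != last g p} ->
  0 < size t -> target v t \in Vs V p ->
  exists j s, j < size t /\ occ (rcons (nseq j (sP V)) (sT V)) p s.
Proof.
elim: t p v => [//|[d w] t IH] p v vl vo /= /and4P[vd wd wv ct] /andP[dt ut] tl _ tg.
have p0 : p != [::] by case: (p) vl; rewrite //= inE.
have dp : d \notin p.
  apply/negP => dp; move/negP: (vo _ dp (tl d (mem_head _ _))); by rewrite vd.
have vp := fintype.subsetP (lastV_Vs V p) _ vl.
have [wp|wp] := boolP (w \in Vs V p).
  exists 0, [:: d]; rewrite /= dp /= andbT; split=> //.
  by apply/existsP; exists v; rewrite vp; apply/existsP; exists w; rewrite wp eq_sym wv vd.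
have [j [s [jt os]]] : exists j s, j < size t /\ occ (rcons (nseq j (sP V)) (sT V)) (rcons p d) s.
  apply: (IH (rcons p d) w) => //.
  - by rewrite lastV_rcons.
  - move=> c; rewrite last_rcons mem_rcons inE => /orP[/eqP-> /eqP //|cp _].
    by apply: contraNN wp; apply: in_Vs.
  - by move=> g gt; rewrite last_rcons; apply: contraNneq dt => <-.
  - by case: (t) tg => // tg; move: wp; rewrite tg.
  - by apply: (fintype.subsetP (Vs_sub V _)) tg => c cp; rewrite mem_rcons inE cp orbT.
exists j.+1, (d :: s); split=> //=; rewrite dp os andbT /=.
by apply/existsP; exists v; rewrite vl vd.
Qed.

(** Without an ear the cycle is isolated: another clause on a short cycle that met it would touch it
    twice or return to it along its own cycle. The last property, that a set closed under growth and
    containing one clause of the cycle reaches back to [e], makes membership in a component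
    symmetric. *)
Lemma cycle_of_shortcyc e : e \in G -> ~ bicyclic e ->
  exists l Q, [/\ l < r, occ (cyc_steps l) [:: e] Q, {subset e :: Q <= G},
    forall g, g \in G -> ~~ [disjoint V g & Vs V (e :: Q)] -> g \in e :: Q &
    forall U g, grow V (pl V G) U \subset U -> g \in e :: Q ->
      V g \subset U -> ~~ [disjoint V e & U]].
Proof.
move=> eG nb; have [x [y [xV yV xy yS]]] := shortcycP _ _ _ eG.
have [s [cs tg /andP[s0 sr] us se]] := shortcyc_sym xV yV xy yS.
set Q := unzip1 s; have eQ : e \notin Q by apply/negP => /se; rewrite eqxx.
have occQ : occ (cyc_steps (size s).-1) [:: e] Q.
  rewrite /Q; case/lastP: s cs tg us se s0 {sr eQ Q} => [//|s [g v]].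
  rewrite chain_rcons target_rcons unzip1_rcons size_rcons /=.
  case/and4P => cs ag vg vt vy us se _; subst v.
  have av : avoids [:: e] (rcons (unzip1 s) g).
    by move=> c cs'; rewrite inE; apply: se.
  have [us' ge av1 _] := uniq_avoids_rcons us av.
  rewrite /cyc_steps occ_rcons ?size_nseq ?size_map //.
  rewrite (@occ_sP _ _ V (pl V [set~ e]) [:: e] x) //; last by move=> ? ? /andP[].
  rewrite mem_cat (negbTE ge) /=; move: us; rewrite rcons_uniq => /andP[-> _] /=.
  apply/existsP; exists (target x s).
  rewrite (@target_Vs _ _ V (pl V [set~ e]) [:: e]) //=; last first.
    by apply: (in_Vs (c := e)); rewrite ?inE.
  apply/existsP; exists y; rewrite eq_sym vt vg andbT; case/andP: ag => _ ->.
  by rewrite !andbT; apply: (in_Vs (c := e)); rewrite ?mem_head.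
(* Seen from another clause [g] of the cycle, the remaining clauses, [e] included, still join two
   variables of [g] within [r] rounds. *)
have QG : {subset e :: Q <= G}.
  move=> g; rewrite inE => /orP[/eqP-> //|gQ].
  have ge := se _ gQ.
  have /(nthP g)[i] := gQ; rewrite size_map => i_lt.
  rewrite (nth_map (g, x)) // => gi.
  move: cs us tg; rewrite -(cat_take_drop i s) (drop_nth (g, x)) //.
  case gv : (nth (g, x) s i) => [g' v]; rewrite gv /= in gi; subst g'.
  set p1 := take i s; set p2 := drop i.+1 s.
  rewrite chain_cat target_cat /= => /andP[c1 /and4P[/andP[_ ug] vg vu c2]].
  rewrite /unzip1 map_cat cat_uniq /= => /and3P[_ /norP[gp1 _] /andP[gp2 _]] tg.
  have sz : size p1 + 1 + size p2 <= r.
    apply: leq_trans sr; rewrite -(cat_take_drop i s) (drop_nth (g, x)) // size_cat /=.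
    by rewrite -addnA add1n.
  have toG z t : chain V (pl V [set~ e]) z t -> g \notin unzip1 t ->
      target z t \in reach V (pl V [set~ g]) [set z] (size t).
    move=> ct gt; apply: (chain_reach (a := pl V [set~ g])); last by rewrite inE.
    apply: chain_sub ct => c w ct /andP[_ wc]; rewrite /pl wc andbT !inE.
    by apply: contraNneq gt => <-.
  apply/shortcycP; exists (target x p1), v; split=> //; first by rewrite eq_sym.
  apply: pl_reachW sz _; apply: (pl_trans (v := y)); last first.
    by rewrite -tg; apply: pl_sym; apply: toG.
  apply: (pl_trans (v := x)); first by apply: pl_sym; apply: toG.
  by apply: (pl_step (e := e)) => //; rewrite !inE eq_sym.
exists (size s).-1, Q; split=> //; first by rewrite prednK.
- move=> g gG; rewrite -setI_eq0 => /set0Pn[u]; rewrite inE => /andP[ug uQ].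
  apply/negPn/negP => gQ; apply: nb.
  have [x1 [y1 [x1g y1g xy1 y1S x1u]]] : exists x1 y1, [/\ x1 \in V g, y1 \in V g, x1 != y1,
      y1 \in reach V (pl V [set~ g]) [set x1] r & x1 != u].
    have [x1 [y1 [x1g y1g xy1 y1S]]] := shortcycP _ _ _ gG.
    have [x1u|x1u] := eqVneq x1 u; last by exists x1, y1.
    exists y1, x1; split=> //; [by rewrite eq_sym|exact: pl_sym|by rewrite -x1u eq_sym].
  have [t [ct tgt /andP[t0 tr] ut tne]] := shortcyc_sym x1g y1g xy1 y1S.
  have sN : sN0 V (e :: Q) g by apply/existsP; exists u; rewrite uQ.
  have [x1Q|x1Q] := boolP (x1 \in Vs V (e :: Q)).
    exists (size s).-1, Q, 0, [:: g]; split=> //; first by rewrite prednK.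
    rewrite /= gQ andbT /=; apply/existsP; exists x1; rewrite x1Q.
    by apply/existsP; exists u; rewrite uQ x1u x1g.
  have [j [s' [jt os]]] : exists j s, j < size t /\
      occ (rcons (nseq j (sP V)) (sT V)) (rcons (e :: Q) g) s.
    apply: (@occ_return _ x1) => //.
    - by rewrite lastV_rcons.
    - move=> c; rewrite last_rcons mem_rcons inE => /orP[/eqP-> /eqP //|cQ _].
      by apply: contraNN x1Q; apply: in_Vs.
    - by apply: chain_sub ct => c w _ /andP[].
    - by move=> c /tne; rewrite last_rcons.
    - rewrite tgt; apply: (in_Vs (c := g)) => //.
      by rewrite mem_rcons inE eqxx.
  exists (size s).-1, Q, j.+1, (g :: s'); split=> //; first by rewrite prednK.
    exact: leq_trans jt tr.
  by move: os; rewrite /= gQ sN.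
- move=> U g Ucl gQ gU.
  have Ustep c z : c \in e :: Q -> z \in V c -> z \in U -> V c \subset U.
    move=> cQ zc zU; apply/fintype.subsetP => w wc; apply: (fintype.subsetP Ucl).
    by apply/growP; right; exists c, z; rewrite /pl zc QG.
  suff xU : x \in U by rewrite -setI_eq0; apply/set0Pn; exists x; rewrite inE xV.
  move: gQ; rewrite inE => /orP[/eqP ge|gQ].
    by apply: (fintype.subsetP gU); rewrite ge.
  have /(nthP g)[i] := gQ; rewrite size_map => i_lt.
  rewrite (nth_map (g, x)) // => gi.
  have sQ c : c \in unzip1 (take i s) -> c \in Q.
    by rewrite /unzip1 map_take => /mem_take.
  move: cs; rewrite -{1}(cat_take_drop i s) (drop_nth (g, x)) // chain_cat.
  case gv : (nth (g, x) s i) => [g' v]; rewrite gv /= in gi; subst g'.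
  move=> /= /andP[c1 /and4P[/andP[_ ug] _ _ _]].
  have : target x (take i s) \in U by apply: (fintype.subsetP gU).
  elim/last_ind: (take i s) c1 sQ => [//|p [c z] IH].
  rewrite chain_rcons target_rcons => /and4P[c1 /andP[_ tc] zc _] pQ zU.
  apply: IH => //; first by move=> c' c'p; apply: pQ; rewrite unzip1_rcons mem_rcons inE c'p orbT.
  have cQ : c \in e :: Q.
    by rewrite inE pQ ?orbT // unzip1_rcons mem_rcons mem_head.
  by apply: (fintype.subsetP (Ustep c z cQ zc zU)).
Qed.

(** As short cycles do not meet, a component stays inside one cycle. A search of [R > r] rounds
    outlasts the clauses of the cycle and has stopped growing, which makes different components
    disjoint. *)
Lemma comp_cycle R e : r < R -> (forall e', ~ bicyclic e') -> e \in G ->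
  exists l Q, [/\ l < r, occ (cyc_steps l) [:: e] Q,
    {subset comp V r R e <= e :: Q}, {subset e :: Q <= G} &
    forall e0, e0 \in G -> e \notin comp V r R e0 ->
      {in e :: Q, forall g, g \notin comp V r R e0}].
Proof.
move=> rR nb eG; have [l [Q [lr oQ QG cl co]]] := cycle_of_shortcyc eG (nb e).
exists l, Q.
have inside e0 l0 Q0 : l0 < r -> occ (cyc_steps l0) [:: e0] Q0 ->
    (forall g, g \in G -> ~~ [disjoint V g & Vs V (e0 :: Q0)] -> g \in e0 :: Q0) ->
    forall t, reach V (pl V G) (V e0) t \subset Vs V (e0 :: Q0).
  move=> l0r o0 cl0; elim=> [|t IH].
    by apply/fintype.subsetP => y ye; apply: (in_Vs (c := e0)); rewrite ?mem_head.
  apply/fintype.subsetP => y; rewrite reachS => /growP[/(fintype.subsetP IH) //|].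
  case=> g [u [uS /andP[gG ug] yg]]; apply: (in_Vs (c := g)) => //.
  apply: cl0 => //; rewrite -setI_eq0; apply/set0Pn; exists u.
  by rewrite inE ug (fintype.subsetP IH).
split=> //.
  move=> g; rewrite inE => /andP[gG]; rewrite -setI_eq0 => /set0Pn[u].
  rewrite inE => /andP[ug uS]; apply: (cl g) => //; rewrite -setI_eq0; apply/set0Pn.
  by exists u; rewrite inE ug (fintype.subsetP (inside _ _ _ lr oQ cl R)).
move=> e0 e0G ec g gQ; apply: contra ec; rewrite inE => /andP[gG].
rewrite -setI_eq0 => /set0Pn[u]; rewrite inE => /andP[ug uS].
have [l0 [Q0 [l0r o0 Q0G cl0 _]]] := cycle_of_shortcyc e0G (nb e0).
have szQ0 : size (e0 :: Q0) <= r.+1.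
  by rewrite /= (occ_size o0) size_rcons size_nseq.
(* One more round would exhibit [R + 1] distinct clauses within a cycle of at most [r + 1]
   clauses. *)
have closed : grow V (pl V G) (reach V (pl V G) (V e0) R) \subset reach V (pl V G) (V e0) R.
  apply/fintype.subsetP => w wS; apply/negPn/negP => wN.
  have [z [s [_ cs _ sz [us act]]]] := chain_stage (wS : w \in reach _ _ _ R.+1) wN.
  have sub : {subset unzip1 s <= e0 :: Q0}.
    move=> c /act /existsP[v /andP[vS /andP[cG vc]]]; apply: (cl0 c) => //.
    rewrite -setI_eq0; apply/set0Pn; exists v.
    by rewrite inE vc (fintype.subsetP (inside _ _ _ l0r o0 cl0 R)).
  have := uniq_leq_size us sub; rewrite size_map sz => le.
  by move: (leq_trans le szQ0); rewrite ltnS leqNgt rR.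
rewrite inE eG /=; apply: (co _ g) => //.
apply/fintype.subsetP => w wg; apply: (fintype.subsetP closed).
by apply/growP; right; exists g, u; rewrite /pl gG ug.
Qed.

End ShortCycles.
End ShortCycle.

(** * First moment bound for configurations of independent clauses *)

Module OccProb.
Import Explore Steps SwitchConf ShortCycle.
Local Open Scope ring_scope.

Lemma big_tuple_rcons (R : nmodType) (T : finType) z (f : seq T -> R) :
  \sum_(t : z.+1.-tuple T) f t = \sum_(s : z.-tuple T) \sum_e f (rcons s e).
Proof.
rewrite (pair_bigA _ (fun (s : z.-tuple T) e => f (rcons s e))) /=.
rewrite (reindex (fun q : z.-tuple T * T => [tuple of rcons q.1 q.2])) //=.
exists (fun t : z.+1.-tuple T =>
  ([tuple of belast (thead t) (behead t)], last (thead t) (behead t))) => [[s e] _|t _].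
  have E : rcons (belast (thead [tuple of rcons s e]) (behead [tuple of rcons s e]))
      (last (thead [tuple of rcons s e]) (behead [tuple of rcons s e])) = rcons s e.
    by rewrite -lastI -[RHS]/(val [tuple of rcons s e]) [in RHS](tuple_eta [tuple of rcons s e]).
  move/eqP: E; rewrite eqseq_rcons => /andP[/eqP E1 /eqP E2].
  by congr pair => //; apply: val_inj.
by apply: val_inj; rewrite /= -lastI [in RHS](tuple_eta t).
Qed.

Section ProductMeasure.
Variables (R : realType) (K : finType) (C : pred K) (m : nat).
Implicit Types (F : m.-tuple K) (A : step_pred K).

Definition upd_tuple F (e : 'I_m) c : m.-tuple K :=
  [tuple if i == e then c else tnth F i | i < m].

Lemma tnth_upd F e c i : tnth (upd_tuple F e c) i = if i == e then c else tnth F i.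
Proof. by rewrite tnth_mktuple. Qed.

Lemma upd_upd F e c c' : upd_tuple (upd_tuple F e c) e c' = upd_tuple F e c'.
Proof. by apply: eq_from_tnth => i; rewrite !tnth_upd; case: eqP. Qed.

Lemma upd_same F e : upd_tuple F e (tnth F e) = F.
Proof. by apply: eq_from_tnth => i; rewrite !tnth_upd; case: eqP => // ->. Qed.

Lemma all_upd F e c : all C F -> C c -> all C (upd_tuple F e c).
Proof.
move=> CF Cc; apply/all_tnthP => i; rewrite tnth_upd; case: eqP => // _.
exact: (all_tnthP CF).
Qed.

Definition cnt (P : pred (m.-tuple K)) : R :=
  \sum_(F : m.-tuple K | all C F) (P F)%:R.

Lemma cnt_ge0 P : 0 <= cnt P.
Proof. by apply: sumr_ge0 => F _; rewrite ler0n. Qed.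

Lemma cnt_sub (P Q : pred (m.-tuple K)) :
  (forall F, all C F -> P F -> Q F) -> cnt P <= cnt Q.
Proof.
move=> PQ; apply: ler_sum => F CF; rewrite ler_nat.
by case: (boolP (P F)) => // /(PQ F CF) ->.
Qed.

(** Exchanging the clause at [e] with a fresh one is an involution of the pairs, so the clause at
    [e] may be treated as independent of the others. *)
Lemma swap_coord (e : 'I_m) (f : m.-tuple K -> K -> R) :
  \sum_(F : m.-tuple K | all C F) \sum_(c | C c) f F c =
  \sum_(F : m.-tuple K | all C F) \sum_(c | C c) f (upd_tuple F e c) (tnth F e).
Proof.
rewrite (pair_big (fun F : m.-tuple K => all C F) C) /=.
rewrite (pair_big (fun F : m.-tuple K => all C F) C
  (fun F c => f (upd_tuple F e c) (tnth F e))) /=.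
pose h (p : m.-tuple K * K) := (upd_tuple p.1 e p.2, tnth p.1 e).
have hK : involutive h.
  by case=> F c; rewrite /h /= upd_upd upd_same tnth_upd eqxx.
rewrite (reindex_inj (inv_inj hK)); apply: eq_bigl => -[F c].
rewrite -[LHS]/(all C (upd_tuple F e c) && C (tnth F e)) -[RHS]/(all C F && C c).
apply/andP/andP => -[CF Cc].
  split; last by move: (all_tnthP CF e); rewrite tnth_upd eqxx.
  by rewrite -(upd_same F e) -(upd_upd F e c); apply: all_upd.
by split; [apply: all_upd|apply: (all_tnthP CF)].
Qed.

Lemma resample (e : 'I_m) (P : pred (m.-tuple K)) (B : m.-tuple K -> pred K) (al : R) :
  (forall F c, P (upd_tuple F e c) = P F) ->
  (forall F c, B (upd_tuple F e c) =1 B F) ->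
  (forall F, \sum_(c | C c) (B F c)%:R <= al * #|C|%:R) ->
  cnt (fun F => P F && B F (tnth F e)) <= al * cnt P.
Proof.
move=> Pu Bu Bal.
have [C0|C0] := posnP #|C|.
  have noF F : all C F = false.
    apply/negbTE/negP => /all_tnthP/(_ e) Ce; move/eqP: C0.
    by apply/negP; rewrite -lt0n; apply/card_gt0P; exists (tnth F e).
  by rewrite /cnt !big_pred0 ?mulr0.
have C0' : 0 < #|C|%:R :> R by rewrite ltr0n.
rewrite -(ler_pM2r C0') /cnt mulr_suml.
under eq_bigr => F CF do rewrite mulr_natr -sumr_const.
rewrite (swap_coord e) -mulrA mulrCA mulr_suml.
apply: ler_sum => F CF.
under eq_bigr => c _ do rewrite Pu Bu tnth_upd eqxx.
case: (P F) => /=; last by rewrite big1_eq mul0r.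
rewrite mul1r; exact: Bal.
Qed.

(** Distinctness concerns indices, attachment concerns the clauses at these indices; two indices may
    carry the same clause. *)
Fixpoint occF (As : seq (step_pred K)) F (p s : seq 'I_m) : bool :=
  match As, s with
  | [::], [::] => true
  | A :: As', e :: s' => [&& e \notin p, A (map (tnth F) p) (tnth F e) &
                            occF As' F (rcons p e) s']
  | _, _ => false
  end.

Lemma occF_size As F p s : occF As F p s -> size s = size As.
Proof. by elim: As p s => [|A As IH] p [|c s] //= /and3P[_ _ /IH ->]. Qed.

Lemma occF_cat As Bs F p s t : size s = size As ->
  occF (As ++ Bs) F p (s ++ t) = occF As F p s && occF Bs F (p ++ s) t.
Proof.
elim: As p s => [|A As IH] p [|c s] //=; first by rewrite cats0.
by move=> [sz]; rewrite IH // cat_rcons -!andbA.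
Qed.

Lemma occF_rcons As B F p s e : size s = size As ->
  occF (rcons As B) F p (rcons s e) =
  [&& occF As F p s, e \notin p ++ s & B (map (tnth F) (p ++ s)) (tnth F e)].
Proof. by move=> sz; rewrite -!cats1 occF_cat //= andbT. Qed.

Lemma occF_upd As F p s e c : e \notin p ++ s ->
  occF As (upd_tuple F e c) p s = occF As F p s.
Proof.
elim: As p s => [|A As IH] p [|g s] //= eN.
rewrite IH ?cat_rcons // tnth_upd; congr [&& _, A _ _ & _].
  apply/eq_in_map => i ip; rewrite tnth_upd; case: eqP => // ie.
  by move: eN; rewrite -ie mem_cat ip.
by case: eqP => // ge; move: eN; rewrite -ge mem_cat mem_head orbT.
Qed.

(** [z] counts the clauses found so far: the bound on a step may depend on how many they are, not on
    which. *)
Fixpoint bounded_by (z : nat) (As : seq (step_pred K)) (als : seq R) : Prop :=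
  match As, als with
  | [::], [::] => True
  | A :: As', al :: als' =>
      [/\ 0 <= al,
         forall q, size q = z -> \sum_(c | C c) (A q c)%:R <= al * #|C|%:R &
         bounded_by z.+1 As' als']
  | _, _ => False
  end.

Lemma bounded_cat z As Bs als bls : bounded_by z As als ->
  bounded_by (z + size As) Bs bls -> bounded_by z (As ++ Bs) (als ++ bls).
Proof.
elim: As als z => [|A As IH] [|al als] z //=; first by rewrite addn0.
by rewrite -addSnnS => -[? ? ?] ?; split=> //; apply: IH.
Qed.

Lemma bounded_size z As als : bounded_by z As als -> size As = size als.
Proof. by elim: As als z => [|A As IH] [|al als] z //= [_ _ /IH ->]. Qed.

Definition occ_count z As p : R :=
  \sum_(s : z.-tuple 'I_m) cnt (fun F => occF As F p s).

(** There are [m] candidates for the new index. An index used before contributes nothing, and the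
    clause at any other index is independent of the earlier steps. *)
Lemma occ_count_rcons As (B : step_pred K) (p : seq 'I_m) (al : R) : uniq p -> 0 <= al ->
  (forall q, size q = (size p + size As)%N ->
     \sum_(c | C c) (B q c)%:R <= al * #|C|%:R) ->
  occ_count (size As).+1 (rcons As B) p <= m%:R * al * occ_count (size As) As p.
Proof.
move=> up al0 Bal.
rewrite {1}/occ_count (big_tuple_rcons _ (fun s : seq 'I_m => cnt (fun F => occF (rcons As B) F p s))).
rewrite /occ_count mulr_sumr; apply: ler_sum => s _.
have step e : cnt (fun F => occF (rcons As B) F p (rcons s e)) <=
    al * cnt (fun F => occF As F p s).
  have [ein|eN] := boolP (e \in p ++ s).
    have -> : cnt (fun F => occF (rcons As B) F p (rcons s e)) = 0.
      by apply: big1 => F _; rewrite occF_rcons ?size_tuple // ein /= andbF.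
    by apply: mulr_ge0 => //; apply: cnt_ge0.
  apply: le_trans (@resample e (fun F => occF As F p s)
     (fun F c => B (map (tnth F) (p ++ s)) c) al _ _ _).
  - apply: cnt_sub => F _; rewrite occF_rcons ?size_tuple // => /and3P[-> _ ->] //.
  - by move=> F c; apply: occF_upd.
  - move=> F c x; congr (B _ x); apply/eq_in_map => i ip; rewrite tnth_upd.
    by case: eqP => // ie; move: eN; rewrite -ie ip.
  by move=> F; apply: Bal; rewrite size_map size_cat size_tuple.
apply: le_trans (ler_sum _ (fun e _ => step e)) _.
by rewrite sumr_const card_ord -mulrA mulr_natl.
Qed.

Lemma occ_count_le As als p : uniq p -> bounded_by (size p) As als ->
  occ_count (size As) As p <= \prod_(al <- als) (m%:R * al) * cnt xpredT.
Proof.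
move=> up; elim/last_ind: As als => [|As B IH] als b.
  case: als b => // _; rewrite big_nil mul1r /occ_count.
  rewrite (big_pred1 [tuple]) => [|s]; last by rewrite [s]tuple0 /= eqxx.
  exact: cnt_sub.
case/lastP: als b => [|als al] b; first by move/bounded_size: b; rewrite size_rcons.
have [bA al0 bB] : [/\ bounded_by (size p) As als, 0 <= al &
    forall q, size q = (size p + size As)%N -> \sum_(c | C c) (B q c)%:R <= al * #|C|%:R].
  move: b {IH}; elim: As als (size p) => [|A As IH] [|a als] z /=.
  - by rewrite addn0 => -[? ? _].
  - by case=> _ _; case: (als).
  - by case=> _ _; case: (As).
  by rewrite -addSnnS => -[? ? /IH[? ? ?]].
rewrite size_rcons; apply: le_trans (occ_count_rcons up al0 bB) _.
rewrite -cats1 big_cat big_seq1 /= [X in _ <= X * _]mulrC -[leRHS]mulrA.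
by apply: ler_wpM2l (IH _ bA); apply: mulr_ge0.
Qed.

Lemma occ_prob As als p : uniq p -> bounded_by (size p) As als ->
  cnt (fun F => [exists s : (size As).-tuple 'I_m, occF As F p s]) <=
  \prod_(al <- als) (m%:R * al) * cnt xpredT.
Proof.
move=> up b; apply: le_trans (occ_count_le up b).
rewrite /occ_count /cnt exchange_big /=; apply: ler_sum => F _.
case: existsP => [[s os]|_]; last by apply: sumr_ge0.
by rewrite (bigD1 s) //= os lerDl; apply: sumr_ge0.
Qed.

End ProductMeasure.
End OccProb.

(** * Counting clauses satisfied by a planted assignment *)

Module ClauseCount.
Import Explore Steps SwitchConf ShortCycle OccProb.
Local Open Scope ring_scope.

Section Clauses.
Variables (n k : nat).
Implicit Types (s : assignment n) (c : clause n k).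

Definition clx c : {ffun 'I_k -> 'I_n} := [ffun j => (tnth c j).1].
Definition clv s c : {ffun 'I_k -> bool} := [ffun j => sat_literal s (tnth c j)].
(** For fixed [s] a clause amounts to its variables together with the truth values of its literals.
    Under the planted law the two are independent, and sums over clauses become products. *)
Definition mkc s (v : {ffun 'I_k -> 'I_n}) (b : {ffun 'I_k -> bool}) : clause n k :=
  [tuple (v j, b j == s (v j)) | j < k].

Lemma mkcK s v b : (clx (mkc s v b), clv s (mkc s v b)) = (v, b).
Proof.
congr pair; apply/ffunP => j; rewrite ffunE tnth_mktuple //= /sat_literal /=.
by case: (b j); case: (s (v j)).
Qed.

Lemma mkcKV s c : mkc s (clx c) (clv s c) = c.
Proof.
apply: eq_from_tnth => j; rewrite tnth_mktuple !ffunE /sat_literal.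
by case: (tnth c j) => x b /=; case: b; case: (s x).
Qed.

Definition nonconst (b : {ffun 'I_k -> bool}) : bool := [exists i, exists j, b i != b j].
Definition naec s c := nonconst (clv s c).
Definition okc s c := proper_clause c && naec s c.
Definition Vc c : {set 'I_n} := [set clx c j | j : 'I_k].
(** For [k = 2] both positions of a nonconstant pattern qualify; from [k = 3] on there is at most
    one such position. *)
Definition minor (b : {ffun 'I_k -> bool}) j := [forall i, (i != j) ==> (b i != b j)].
Definition umc s c y := [exists j, (clx c j == y) && minor (clv s c) j].

Lemma properE c : proper_clause c = injectiveb (clx c).
Proof.
rewrite /proper_clause /injectiveb /dinjectiveb; congr uniq.
have -> : [seq l.1 | l <- c] = [seq (tnth c j).1 | j <- enum 'I_k].
  by rewrite -[in LHS](map_tnth_enum c) -map_comp.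
by apply: eq_map => j; rewrite ffunE.
Qed.

Lemma naecE s c : naec s c =
  has (sat_literal s) c && has (sat_literal (complement s)) c.
Proof.
have neg l : sat_literal (complement s) l = ~~ sat_literal s l.
  by rewrite /sat_literal /complement ffunE; case: (s _); case: l.2.
apply/idP/andP => [/existsP[i /existsP[j]]|[/hasP[l lc sl] /hasP[l' l'c]]].
  rewrite !ffunE => ne; split; apply/hasP.
    case E: (sat_literal s (tnth c i)); first by exists (tnth c i) => //; apply: mem_tnth.
    exists (tnth c j); first exact: mem_tnth.
    by move: ne; rewrite E; case: sat_literal.
  case E: (sat_literal s (tnth c i)); last first.
    by exists (tnth c i); rewrite ?neg ?E ?mem_tnth.
  exists (tnth c j); first exact: mem_tnth.
  by move: ne; rewrite neg E; case: sat_literal.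
rewrite neg.
have [i li] := tnthP _ _ lc; have [j lj] := tnthP _ _ l'c.
rewrite li in sl; rewrite lj => nl.
apply/existsP; exists i; apply/existsP; exists j.
by rewrite !ffunE sl (negbTE nl).
Qed.

Lemma nae_satE m (F : formula n k m) s : nae_sat F s = all (naec s) F.
Proof.
rewrite /nae_sat /sat_formula -all_predI; apply: eq_all => c /=.
by rewrite naecE.
Qed.

Lemma umc_V s c y : umc s c y -> y \in Vc c.
Proof. by case/existsP => j /andP[/eqP<- _]; apply: imset_f. Qed.

Lemma umc_inj s c y z : (2 < k)%N -> umc s c y -> umc s c z -> y = z.
Proof.
move=> k3 /existsP[i /andP[/eqP<- /forallP mi]] /existsP[j /andP[/eqP<- /forallP mj]].
have [-> //|ij] := eqVneq i j; exfalso.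
have [l /andP[li lj]] : exists l : 'I_k, (l != i) && (l != j).
  apply/existsP; apply: contraT => /existsPn H.
  suff : (#|'I_k| <= #|[set i; j]|)%N by rewrite card_ord cards2 ij leqNgt k3.
  apply: subset_leq_card; apply/fintype.subsetP => l _; rewrite !inE.
  by have := H l; rewrite negb_and !negbK.
have ji : j != i by rewrite eq_sym.
move: (implyP (mi l) li) (implyP (mj l) lj) (implyP (mi j) ji).
by case: (clv s c l); case: (clv s c i); case: (clv s c j).
Qed.

Lemma card_Vc c : (#|Vc c| <= k)%N.
Proof. by apply: leq_trans (leq_imset_card _ _) _; rewrite card_ord. Qed.

Section Sums.
Variable R : realType.

Lemma sum_clause s (f : {ffun 'I_k -> 'I_n} -> {ffun 'I_k -> bool} -> R) :
  \sum_c f (clx c) (clv s c) = \sum_v \sum_b f v b.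
Proof.
rewrite pair_bigA /=.
rewrite [RHS](reindex (fun c => (clx c, clv s c))) //=.
exists (fun p => mkc s p.1 p.2) => [c _|[v b] _]; [exact: mkcKV|exact: mkcK].
Qed.

Definition Nv : R := \sum_(v : {ffun 'I_k -> 'I_n} | injectiveb v) 1.
Definition Nb : R := \sum_(b : {ffun 'I_k -> bool} | nonconst b) 1.

Lemma sum_okc s (P : {ffun 'I_k -> 'I_n} -> {ffun 'I_k -> bool} -> bool) :
  \sum_(c | okc s c) (P (clx c) (clv s c))%:R =
  \sum_(v : {ffun 'I_k -> 'I_n} | injectiveb v)
    \sum_(b : {ffun 'I_k -> bool} | nonconst b) (P v b)%:R :> R.
Proof.
rewrite big_mkcond /=.
pose f (v : {ffun 'I_k -> 'I_n}) b : R := if injectiveb v && nonconst b then (P v b)%:R else 0.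
rewrite (eq_bigr (fun c => f (clx c) (clv s c))); last first.
  by move=> c _; rewrite /f /okc properE.
rewrite sum_clause [RHS]big_mkcond /=; apply: eq_bigr => v _.
case: ifP => iv; last by rewrite big1 // => b _; rewrite /f iv.
by rewrite [RHS]big_mkcond /=; apply: eq_bigr => b _; rewrite /f iv.
Qed.

Lemma card_okc s : #|okc s|%:R = Nv * Nb.
Proof.
rewrite -sum1_card natr_sum.
rewrite (eq_bigr (fun c => (true : bool)%:R)) //.
rewrite (sum_okc s (fun _ _ => true)) /Nv mulr_suml; apply: eq_bigr => v _.
by rewrite mul1r.
Qed.

Lemma Nv_ge0 : 0 <= Nv. Proof. exact: sumr_ge0. Qed.
Lemma Nb_ge0 : 0 <= Nb. Proof. exact: sumr_ge0. Qed.

Lemma union_okc s (T : finType) (D : pred T) (P : clause n k -> bool)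
    (Q : T -> {ffun 'I_k -> 'I_n} -> bool) (S : T -> {ffun 'I_k -> bool} -> bool) :
  (forall c, okc s c -> P c -> exists2 t, D t & Q t (clx c) && S t (clv s c)) ->
  \sum_(c | okc s c) (P c)%:R <=
  \sum_(t | D t) (\sum_(v : {ffun 'I_k -> 'I_n} | injectiveb v) (Q t v)%:R) *
             (\sum_(b : {ffun 'I_k -> bool} | nonconst b) (S t b)%:R) :> R.
Proof.
move=> PQ.
apply: (@le_trans _ _ (\sum_(c | okc s c) \sum_(t | D t) (Q t (clx c) && S t (clv s c))%:R)).
  apply: ler_sum => c oc; case: (boolP (P c)) => [/(PQ c oc)[t Dt QS]|_].
    by rewrite (bigD1 t) //= QS lerDl; apply: sumr_ge0.
  exact: sumr_ge0.
rewrite exchange_big /=; apply: ler_sum => t _.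
rewrite (sum_okc s (fun v b => Q t v && S t b)) mulr_suml; apply: ler_sum => v _.
by rewrite mulr_sumr; apply: ler_sum => b _; case: (Q t v); case: (S t b); rewrite ?mulr0 ?mul0r ?mul1r.
Qed.

Lemma inj_perm (pi : {perm 'I_n}) (f : {ffun 'I_k -> 'I_n} -> R) :
  \sum_(v : {ffun 'I_k -> 'I_n} | injectiveb v) f v =
  \sum_(v : {ffun 'I_k -> 'I_n} | injectiveb v) f [ffun j => pi (v j)].
Proof.
rewrite (reindex (fun v : {ffun 'I_k -> 'I_n} => [ffun j => pi (v j)])) /=; last first.
  exists (fun v : {ffun 'I_k -> 'I_n} => [ffun j => (pi^-1)%g (v j)]) => v _;
    by apply/ffunP => j; rewrite !ffunE ?permK ?permKV.
apply: eq_bigl => v; apply/injectiveP/injectiveP => iv i j; last by rewrite !ffunE => /perm_inj /iv.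
by move=> vij; apply: iv; rewrite !ffunE vij.
Qed.

(** Transpositions of the variables act on injective tuples, so all values at position [i] are
    equally likely. *)
Lemma inj_pos i (U : {set 'I_n}) :
  n%:R * (\sum_(v : {ffun 'I_k -> 'I_n} | injectiveb v) (v i \in U)%:R) = #|U|%:R * Nv.
Proof.
have one y z : \sum_(v : {ffun 'I_k -> 'I_n} | injectiveb v) (v i == y)%:R =
    \sum_(v : {ffun 'I_k -> 'I_n} | injectiveb v) (v i == z)%:R :> R.
  rewrite [RHS](inj_perm (tperm y z)); apply: eq_bigr => v _; rewrite ffunE.
  by rewrite -{2}[z](tpermL y) (inj_eq perm_inj).
have each y : n%:R * (\sum_(v : {ffun 'I_k -> 'I_n} | injectiveb v) (v i == y)%:R) = Nv.
  transitivity (\sum_(z < n) \sum_(v : {ffun 'I_k -> 'I_n} | injectiveb v) (v i == z)%:R : R).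
    rewrite [RHS](eq_bigr _ (fun z _ => one z y)) sumr_const card_ord mulr_natl //.
  rewrite exchange_big /=; apply: eq_bigr => v _.
  by rewrite (bigD1 (v i)) //= eqxx big1 ?addr0 // => z /negbTE; rewrite eq_sym => ->.
transitivity (\sum_(y in U) n%:R * (\sum_(v : {ffun 'I_k -> 'I_n} | injectiveb v) (v i == y)%:R) : R).
  rewrite -[RHS]mulr_sumr [in RHS]exchange_big /=; congr (_ * _); apply: eq_bigr => v _.
  have [vU|vU] := boolP (v i \in U).
    by rewrite (bigD1 (v i)) //= eqxx big1 ?addr0 // => z /andP[_ /negbTE]; rewrite eq_sym => ->.
  by rewrite big1 // => y yU; case: eqP => // vy; rewrite -vy (negbTE vU) in yU.
by rewrite (eq_bigr _ (fun y _ => each y)) sumr_const mulr_natl.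
Qed.

(** By symmetry all ordered pairs of distinct variables are equally likely at [i] and [j]. The
    inequality comes from admitting equal elements of [U] and [W] on the right. *)
Lemma inj_pos2 i j (U W : {set 'I_n}) : i != j ->
  n%:R * (n%:R - 1) * (\sum_(v : {ffun 'I_k -> 'I_n} | injectiveb v) ((v i \in U) && (v j \in W))%:R)
  <= #|U|%:R * #|W|%:R * Nv.
Proof.
move=> ij.
pose N y z : R := \sum_(v : {ffun 'I_k -> 'I_n} | injectiveb v) ((v i == y) && (v j == z))%:R.
have symN y z y' z' : y != z -> y' != z' -> N y z = N y' z'.
  move=> yz yz'; pose a := tperm y y' z.
  have ay' : a != y' by rewrite -(tpermL y y') (inj_eq perm_inj) eq_sym.
  pose pi := (tperm y y' * tperm a z')%g.
  have Ey : pi y = y' by rewrite permM tpermL tpermD // eq_sym.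
  have Ez : pi z = z' by rewrite permM -/a tpermL.
  have E1 w : (pi w == y') = (w == y) by rewrite -Ey (inj_eq perm_inj).
  have E2 w : (pi w == z') = (w == z) by rewrite -Ez (inj_eq perm_inj).
  by rewrite /N [RHS](inj_perm pi); apply: eq_bigr => v _; rewrite !ffunE E1 E2.
have each y z : y != z -> n%:R * (n%:R - 1) * N y z = Nv.
  move=> yz.
  transitivity (\sum_(y' < n) \sum_(z' < n | z' != y') N y' z').
    rewrite (eq_bigr (fun _ => (n%:R - 1) * N y z)); last first.
      move=> y' _; rewrite (eq_bigr (fun _ => N y z)); last first.
        by move=> z' zy; apply: symN => //; rewrite eq_sym.
      rewrite sumr_const -[LHS]mulr_natl; congr (_ * _).
      have n0 : (0 < n)%N by apply: leq_ltn_trans (ltn_ord y').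
      by rewrite (eq_card (B := predC1 y')) // cardC1 card_ord -subn1 natrB.
    by rewrite sumr_const card_ord -[RHS]mulr_natl mulrA.
  rewrite (eq_bigr (fun y' => \sum_(v : {ffun 'I_k -> 'I_n} | injectiveb v) (v i == y')%:R)).
    rewrite exchange_big /=; apply: eq_bigr => v _.
    by rewrite (bigD1 (v i)) //= eqxx big1 ?addr0 // => w /negbTE; rewrite eq_sym => ->.
  move=> y' _; rewrite /N exchange_big /=; apply: eq_bigr => v /injectiveP iv.
  case: eqP => [vi|_] /=; last by rewrite big1.
  rewrite (bigD1 (v j)) /=; last first.
    by rewrite -vi; apply: contraNneq ij => /iv ->.
  by rewrite eqxx big1 ?addr0 // => w /andP[_ /negbTE]; rewrite eq_sym => ->.
apply: (@le_trans _ _ (\sum_(y in U) \sum_(z in W | z != y) n%:R * (n%:R - 1) * N y z)).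
  rewrite (eq_bigr (fun y => n%:R * (n%:R - 1) * \sum_(z in W | z != y) N y z)); last first.
    by move=> y _; rewrite mulr_sumr.
  rewrite -mulr_sumr; case: (posnP n) => [n0|n0].
    rewrite (_ : n%:R = 0 :> R); first by rewrite !mul0r.
    by rewrite n0.
  apply: ler_wpM2l; first by apply: mulr_ge0 => //; rewrite subr_ge0 ler1n.
  rewrite (eq_bigr (fun y => \sum_(v : {ffun 'I_k -> 'I_n} | injectiveb v)
     \sum_(z in W | z != y) ((v i == y) && (v j == z))%:R)); last first.
    by move=> y _; rewrite exchange_big.
  rewrite exchange_big /=; apply: ler_sum => v /injectiveP iv.
  case: andP => [[vU vW]|_]; last by apply: sumr_ge0 => y _; apply: sumr_ge0.
  have vv : v j != v i by apply: contraNneq ij => /iv ->.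
  rewrite (bigD1 (v i)) //= (bigD1 (v j)) ?vW //= !eqxx /= -addrA lerDl.
  by apply: addr_ge0; do ?[apply: sumr_ge0 => ? _].
rewrite (eq_bigr (fun y => #|[pred z in W | z != y]|%:R * Nv)); last first.
  move=> y _; rewrite (eq_bigr (fun _ => Nv)); last first.
    by move=> z /andP[_ zy]; apply: each; rewrite eq_sym.
  by rewrite sumr_const -[LHS]mulr_natl.
rewrite -mulrA [leRHS]mulr_natl -sumr_const; apply: ler_sum => y _.
apply: ler_wpM2r; first exact: Nv_ge0.
by rewrite ler_nat; apply: subset_leq_card; apply/fintype.subsetP => z; rewrite !inE => /andP[].
Qed.

Lemma minor_count j :
  \sum_(b : {ffun 'I_k -> bool} | nonconst b) (minor b j)%:R <= 2 :> R.
Proof.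
apply: (@le_trans _ _ (\sum_(b : {ffun 'I_k -> bool}) \sum_(x : bool)
    (b == [ffun i => if i == j then x else ~~ x])%:R)).
  rewrite big_mkcond /=; apply: ler_sum => b _; case: ifP => _; last exact: sumr_ge0.
  case: (boolP (minor b j)) => [/forallP mb|_]; last exact: sumr_ge0.
  rewrite (bigD1 (b j)) //= (_ : b == _); first by rewrite lerDl; apply: sumr_ge0.
  apply/eqP/ffunP => i; rewrite ffunE; case: eqP => [-> //|/eqP ij].
  by move/implyP: (mb i) => /(_ ij); case: (b i); case: (b j).
rewrite exchange_big /= (eq_bigr (fun _ => 1)); first by rewrite sumr_const card_bool.
move=> x _; rewrite (bigD1 [ffun i => if i == j then x else ~~ x]) //= eqxx.
by rewrite big1 ?addr0 // => b /negbTE ->.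
Qed.

Lemma Nb_E : (2 <= k)%N -> Nb = 2 * (2 ^+ k.-1 - 1).
Proof.
move=> k2; have k0 : (0 < k)%N by apply: leq_trans k2.
have tot : \sum_(b : {ffun 'I_k -> bool}) 1 = 2 ^+ k :> R.
  by rewrite sumr_const card_ffun card_bool card_ord natrX.
have cst : \sum_(b : {ffun 'I_k -> bool} | ~~ nonconst b) 1 = 2 :> R.
  rewrite (eq_bigl (mem [set [ffun=> true]; [ffun=> false]])).
    rewrite sumr_const cards2 (_ : [ffun=> true] != [ffun=> false]) //.
    by apply/eqP => /ffunP/(_ (Ordinal k0)); rewrite !ffunE.
  move=> b; rewrite !inE; apply/idP/idP.
    move=> /existsPn nb; have cb i : b i = b (Ordinal k0).
      by apply/eqP; apply: contraNT (nb i) => ne; apply/existsP; exists (Ordinal k0).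
    by case E: (b (Ordinal k0)); apply/orP; [left|right]; apply/eqP/ffunP => i; rewrite ffunE cb.
  by case/orP => /eqP->; apply/existsPn => i; apply/existsPn => j; rewrite !ffunE.
have : Nb + 2 = 2 ^+ k by rewrite -tot -cst [RHS](bigID nonconst).
by rewrite -[in 2 ^+ k](prednK k0) exprS => ?; lra.
Qed.

End Sums.
End Clauses.
End ClauseCount.

(** * Weights of attachment steps and of configurations *)

Module Weights.
Import Explore Steps SwitchConf ShortCycle OccProb ClauseCount.
Local Open Scope ring_scope.

Lemma ler_of_eq (R : numDomainType) (x y : R) : x = y -> x <= y.
Proof. by move->. Qed.

Section StepBounds.
Variables (R : realType) (n k m : nat) (s : assignment n).
Hypotheses (n2 : (2 <= n)%N) (k3 : (3 <= k)%N).
Let C : pred (clause n k) := okc s.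
Let V := @Vc n k.
Let um := @umc n k s.
Let kap : R := (2 ^+ k.-1 - 1)^-1.
Let N : R := n%:R.

Lemma n_gt0 : 0 < N. Proof. by rewrite ltr0n; apply: leq_trans n2. Qed.
Lemma n1_gt0 : 0 < N - 1. Proof. by rewrite subr_gt0 ltr1n. Qed.

Lemma b_touch (A : pred (clause n k)) (U : {set 'I_n}) (u : nat) : (#|U| <= u)%N ->
  (forall c, A c -> exists2 y, y \in U & y \in V c) ->
  \sum_(c | C c) (A c)%:R <= k%:R * u%:R / N * #|C|%:R.
Proof.
move=> Uu AU; apply: le_trans (@union_okc _ _ R s 'I_k xpredT A
   (fun i v => v i \in U) (fun _ _ => true) _) _.
  by move=> c _ /AU[y yU /imsetP[j _ yj]]; exists j; rewrite // -yj yU.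
rewrite card_okc; apply: (@le_trans _ _ (\sum_(i < k) u%:R / N * Nv n k R * Nb k R)).
  apply: ler_sum => i _; apply: ler_wpM2r; first exact: Nb_ge0.
  rewrite mulrAC -[leLHS](mulKf (lt0r_neq0 n_gt0)) inj_pos mulrC.
  apply: ler_wpM2r; first by rewrite invr_ge0 ltW ?n_gt0.
  by apply: ler_wpM2r; [exact: Nv_ge0|rewrite ler_nat].
by rewrite sumr_const card_ord -[leLHS]mulr_natl !mulrA.
Qed.

(** At most two of the [2 * (2 ^ (k - 1) - 1)] nonconstant patterns make [j] the minority. *)
Lemma minor_kap j :
  \sum_(b : {ffun 'I_k -> bool} | nonconst b) (minor b j)%:R <= kap * Nb k R.
Proof.
have k2 : (2 <= k)%N by apply: ltnW.
rewrite Nb_E // mulrCA mulVf ?mulr1; first exact: minor_count.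
by rewrite subr_eq0 -natrX (eqr_nat R _ 1) -(expn0 2) eqn_exp2l //; case: (k) k2 => [|[]].
Qed.

Lemma kap_ge0 : 0 <= kap.
Proof. by rewrite invr_ge0 subr_ge0 -natrX (ler_nat R 1) expn_gt0. Qed.

Lemma b_um (A : pred (clause n k)) (U : {set 'I_n}) u : (#|U| <= u)%N ->
  (forall c, A c -> exists2 y, y \in U & um c y) ->
  \sum_(c | C c) (A c)%:R <= k%:R * u%:R * kap / N * #|C|%:R.
Proof.
move=> Uu AU; apply: le_trans (@union_okc _ _ R s 'I_k xpredT A
   (fun i v => v i \in U) (fun j b => minor b j) _) _.
  by move=> c _ /AU[y yU /existsP[j /andP[/eqP yj mj]]]; exists j; rewrite // yj yU.
rewrite card_okc; apply: (@le_trans _ _ (\sum_(i < k) (u%:R / N * Nv n k R) * (kap * Nb k R))).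
  apply: ler_sum => i _; apply: ler_pM; do ?[exact: sumr_ge0]; last exact: minor_kap.
  rewrite mulrAC -[leLHS](mulKf (lt0r_neq0 n_gt0)) inj_pos mulrC.
  apply: ler_wpM2r; first by rewrite invr_ge0 ltW ?n_gt0.
  by apply: ler_wpM2r; [exact: Nv_ge0|rewrite ler_nat].
by rewrite sumr_const card_ord -[leLHS]mulr_natl; apply: ler_of_eq; ring.
Qed.

Lemma card_pairs : #|[pred p : 'I_k * 'I_k | p.1 != p.2]|%:R = k%:R * (k%:R - 1) :> R.
Proof.
have k0 : (0 < k)%N by apply: leq_trans k3.
rewrite -sum1_card natr_sum (eq_bigl (fun p : 'I_k * 'I_k => xpredT p.1 && (p.1 != p.2))) //.
rewrite -(pair_big_dep xpredT (fun i j : 'I_k => i != j) (fun _ _ => 1%:R)) /=.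
rewrite (eq_bigr (fun _ => k%:R - 1)) ?sumr_const ?card_ord ?mulr_natl // => i _.
rewrite sumr_const (eq_card (B := predC1 i)) => [|j]; last by rewrite !inE eq_sym.
by rewrite cardC1 card_ord -subn1 natrB.
Qed.

Lemma b_um2 (A : pred (clause n k)) (U : {set 'I_n}) u : (#|U| <= u)%N ->
  (forall c, A c -> exists2 z, z \in U & [&& z \in V c, ~~ um c z & [exists y, um c y]]) ->
  \sum_(c | C c) (A c)%:R <= k%:R * (k%:R - 1) * u%:R * kap / N * #|C|%:R.
Proof.
move=> Uu AU; apply: le_trans (@union_okc _ _ R s ('I_k * 'I_k)%type
   [pred p | p.1 != p.2] A
   (fun p v => v p.1 \in U) (fun p b => minor b p.2) _) _.
  move=> c _ /AU[z zU /and3P[/imsetP[i _ zi] nz /existsP[y /existsP[j /andP[yj mj]]]]].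
  exists (i, j) => /=; last by rewrite -zi zU.
  apply: contraNneq nz => ij; apply/existsP; exists j.
  by rewrite mj andbT zi ij.
rewrite card_okc; apply: (@le_trans _ _ (\sum_(p | [pred p : 'I_k * 'I_k | p.1 != p.2] p)
    (u%:R / N * Nv n k R) * (kap * Nb k R))).
  apply: ler_sum => p _; apply: ler_pM; do ?[exact: sumr_ge0]; last exact: minor_kap.
  rewrite mulrAC -[leLHS](mulKf (lt0r_neq0 n_gt0)) inj_pos mulrC.
  apply: ler_wpM2r; first by rewrite invr_ge0 ltW ?n_gt0.
  by apply: ler_wpM2r; [exact: Nv_ge0|rewrite ler_nat].
by rewrite sumr_const -[leLHS]mulr_natl card_pairs; apply: ler_of_eq; ring.
Qed.

Lemma b_two (A : pred (clause n k)) (U : {set 'I_n}) u : (#|U| <= u)%N ->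
  (forall c, A c -> exists y z, [/\ y \in U, z \in U & [&& y != z, y \in V c & z \in V c]]) ->
  \sum_(c | C c) (A c)%:R <=
  k%:R * (k%:R - 1) * u%:R ^+ 2 / (N * (N - 1)) * #|C|%:R.
Proof.
move=> Uu AU; apply: le_trans (@union_okc _ _ R s ('I_k * 'I_k)%type
   [pred p | p.1 != p.2] A
   (fun p v => (v p.1 \in U) && (v p.2 \in U)) (fun p b => true) _) _.
  move=> c _ /AU[y [z [yU zU /and3P[yz /imsetP[i _ yi] /imsetP[j _ zj]]]]].
  exists (i, j) => /=; last by rewrite -yi -zj yU zU.
  by apply: contraNneq yz => ij; rewrite yi zj ij.
have NN : 0 < N * (N - 1) by rewrite mulr_gt0 ?n_gt0 ?n1_gt0.
rewrite card_okc; apply: (@le_trans _ _ (\sum_(p | [pred p : 'I_k * 'I_k | p.1 != p.2] p)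
    (u%:R ^+ 2 / (N * (N - 1)) * Nv n k R) * Nb k R)).
  apply: ler_sum => p pne; apply: ler_wpM2r; first exact: Nb_ge0.
  rewrite mulrAC ler_pdivlMr // mulrC.
  apply: le_trans (inj_pos2 R U U pne) _; apply: ler_wpM2r; first exact: Nv_ge0.
  by rewrite expr2; apply: ler_pM; rewrite ?ler_nat.
by rewrite sumr_const -[leLHS]mulr_natl card_pairs; apply: ler_of_eq; ring.
Qed.

Lemma card_Vs (q : seq (clause n k)) : (#|Vs V q| <= k * size q)%N.
Proof.
elim: q => [|c q IH]; first by rewrite /Vs big_nil cards0.
rewrite /Vs big_cons; apply: leq_trans (leq_card_setU _ _) _.
by rewrite mulnS; apply: leq_add; [exact: card_Vc|exact: IH].
Qed.

Lemma card_lastV (q : seq (clause n k)) : (#|lastV V q| <= k)%N.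
Proof. by case: q => [|c q]; [rewrite cards0|exact: card_Vc]. Qed.

(** Times [m], these bound the expected number of clauses that attach to [z] clauses ([x0], [xT]) or
    to one clause ([x1], [xl]). For [m = d n / k] the product [m * xl] is the branching ratio
    [d (k - 1) / (2 ^ (k - 1) - 1)], and [xT] has an additional factor [1 / n]. *)
Definition x0 z : R := k%:R * (k * z)%:R / N.
Definition x1 : R := k%:R * k%:R / N.
Definition xl : R := k%:R * (k%:R - 1) * kap / N.
Definition xT z : R := k%:R * (k%:R - 1) * (k * z)%:R ^+ 2 / (N * (N - 1)).

Lemma k1_ge0 : 0 <= k%:R - 1 :> R.
Proof. by rewrite subr_ge0 (ler_nat R 1); apply: leq_trans k3. Qed.
Lemma x0_ge0 z : 0 <= x0 z. Proof. by rewrite /x0 !mulr_ge0 ?invr_ge0 ?ler0n. Qed.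
Lemma x1_ge0 : 0 <= x1. Proof. by rewrite /x1 !mulr_ge0 ?invr_ge0 ?ler0n. Qed.
Lemma xl_ge0 : 0 <= xl.
Proof. by rewrite /xl !mulr_ge0 ?kap_ge0 ?k1_ge0 ?ler0n // invr_ge0 ler0n. Qed.
Lemma xT_ge0 z : 0 <= xT z.
Proof.
by rewrite /xT !mulr_ge0 ?invr_ge0 ?mulr_ge0 ?ler0n ?k1_ge0 ?exprn_ge0 ?ler0n // ltW ?n1_gt0.
Qed.

Lemma bd1 z (A : step_pred (clause n k)) (al : R) : 0 <= al ->
  (forall q, size q = z -> \sum_(c | C c) (A q c)%:R <= al * #|C|%:R) ->
  bounded_by C z [:: A] [:: al].
Proof. by []. Qed.

Lemma bd_nseq z (A : step_pred (clause n k)) (al : R) l : 0 <= al ->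
  (forall q, \sum_(c | C c) (A q c)%:R <= al * #|C|%:R) ->
  bounded_by C z (nseq l A) (nseq l al).
Proof. by move=> al0 b; elim: l z => //= l IH z; split. Qed.

Lemma bd_sF q : \sum_(c | C c) (sF V um q c)%:R <= xl * #|C|%:R.
Proof.
(* If the last clause has no minority variable, the step is impossible; if it has one, only [k - 1]
   of its variables can carry the step. *)
have [/existsP[w uw]|nw] := boolP [exists w, lastum um q w]; last first.
  rewrite big1; first by rewrite mulr_ge0 ?xl_ge0.
  by move=> c _; rewrite /sF (negbTE nw) andbF.
have -> : xl = k%:R * (k.-1)%:R * kap / N.
  by rewrite /xl -subn1 natrB //; apply: leq_trans k3.
apply: (@b_um _ (lastV V q :\ w)); last first.
  move=> c /andP[/existsP[y /and3P[yl uy nu]] _]; exists y => //.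
  by rewrite !inE yl andbT; apply: contraNneq nu => ->.
have wl : w \in lastV V q by case: (q) uw => //= c q'; apply: umc_V.
rewrite -ltnS prednK; last by apply: leq_trans k3.
by have := card_lastV q; rewrite (cardsD1 w) wl add1n.
Qed.

Lemma bd_sB q : \sum_(c | C c) (sB V um q c)%:R <= xl * #|C|%:R.
Proof.
have -> : xl = k%:R * (k%:R - 1) * 1%:R * kap / N by rewrite /xl mulr1.
apply: (@b_um2 _ [set z | lastum um q z]).
  apply/card_le1_eqP => y z; rewrite !inE; case: (q) => //= c q' uy uz.
  exact: umc_inj k3 uz uy.
by move=> c /existsP[z /andP[lz H]]; exists z; rewrite ?inE.
Qed.

Lemma bd_last q (A : pred (clause n k)) : (forall c, A c -> exists2 y, y \in lastV V q & y \in V c) ->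
  \sum_(c | C c) (A c)%:R <= x1 * #|C|%:R.
Proof. by apply: b_touch; apply: card_lastV. Qed.

Lemma bd_sP q : \sum_(c | C c) (sP V q c)%:R <= x1 * #|C|%:R.
Proof. by apply: (bd_last (q := q)) => c /existsP[y /andP[]]; exists y. Qed.

Lemma bd_sB0 q : \sum_(c | C c) (sB0 V um q c)%:R <= x1 * #|C|%:R.
Proof. by apply: (bd_last (q := q)) => c /existsP[y /and3P[? ? _]]; exists y. Qed.

Lemma bd_Vs q z (A : pred (clause n k)) : size q = z -> (forall c, A c -> exists2 y, y \in Vs V q & y \in V c) ->
  \sum_(c | C c) (A c)%:R <= x0 z * #|C|%:R.
Proof. by move=> <-; apply: b_touch; apply: card_Vs. Qed.

Lemma bd_sN0 q z : size q = z -> \sum_(c | C c) (sN0 V q c)%:R <= x0 z * #|C|%:R.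
Proof. by move/bd_Vs; apply=> c /existsP[y /andP[]]; exists y. Qed.

Lemma bd_sF0 q z : size q = z -> \sum_(c | C c) (sF0 V um q c)%:R <= x0 z * #|C|%:R.
Proof. by move/bd_Vs; apply=> c /existsP[y /andP[yq uy]]; exists y => //; exact: umc_V uy. Qed.

Lemma bd_sT q z : size q = z -> \sum_(c | C c) (sT V q c)%:R <= xT z * #|C|%:R.
Proof.
move=> <-; apply: (@b_two _ (Vs V q)); first exact: card_Vs.
by move=> c /existsP[y /andP[yq /existsP[w /andP[wq H]]]]; exists y, w.
Qed.

Definition fwa z a := if a is a'.+1 then x0 z :: nseq a' xl else [::].
Definition bwa b := if b is b'.+1 then x1 :: nseq b' xl else [::].
Definition confa z a (ob : option nat) :=
  if ob is Some b then
    (if a is 0 then [:: x0 z] else fwa z a ++ [:: x1]) ++ (bwa b ++ [:: xT (z + a + b + 1)])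
  else fwa z a ++ [:: xT (z + a)].
Definition cyca z l := nseq l x1 ++ [:: xT (z + l)].
Definition preta z l :=
  if l is l'.+2 then x0 z :: nseq l' x1 ++ [:: xT (z + l'.+1)] else [:: xT z].

Lemma bd_fw z a : bounded_by C z (fw V um a) (fwa z a).
Proof.
case: a => [//|a] /=; split; [exact: x0_ge0|by move=> q; apply: bd_sF0|].
exact: bd_nseq xl_ge0 bd_sF.
Qed.

Lemma bd_bw z b : bounded_by C z (bw V um b) (bwa b).
Proof.
case: b => [//|b] /=; split; [exact: x1_ge0|by move=> q _; apply: bd_sB0|].
exact: bd_nseq xl_ge0 bd_sB.
Qed.

Lemma bd_T z : bounded_by C z [:: sT V] [:: xT z].
Proof. by apply: bd1; [exact: xT_ge0|move=> q; apply: bd_sT]. Qed.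

Lemma size_fw a : size (fw V um a) = a.
Proof. by case: a => //= a; rewrite size_nseq. Qed.
Lemma size_bw b : size (bw V um b) = b.
Proof. by case: b => //= a; rewrite size_nseq. Qed.

Lemma bd_conf z a ob : bounded_by C z (conf V um a ob) (confa z a ob).
Proof.
case: ob => [b|] /=; rewrite -!cats1.
  apply: bounded_cat.
    case: a => [|a]; first by apply: bd1; [exact: x0_ge0|move=> q; apply: bd_sN0].
    apply: (bounded_cat (bd_fw z a.+1)); apply: bd1; first exact: x1_ge0.
    by move=> q _; apply: bd_sP.
  apply: bounded_cat; first exact: bd_bw.
  set z' := (_ + _ + _)%N; have -> : z' = (z + a + b + 1)%N; last exact: bd_T.
  rewrite {}/z' size_bw; case: a => [|a] /=; first by lia.
  by rewrite size_cat /= size_nseq; lia.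
by apply: bounded_cat; [exact: bd_fw|rewrite size_fw; exact: bd_T].
Qed.

Lemma bd_cyc z l : bounded_by C z (rcons (nseq l (sP V)) (sT V)) (cyca z l).
Proof.
rewrite -cats1; apply: bounded_cat; first exact: bd_nseq x1_ge0 bd_sP.
by rewrite size_nseq; apply: bd_T.
Qed.

Lemma bd_pret z l : bounded_by C z (plainret V l) (preta z l).
Proof.
case: l => [|[|l]] /=; [exact: bd_T|exact: bd_T|split].
- exact: x0_ge0.
- by move=> q; apply: bd_sN0.
by have := bd_cyc z.+1 l; rewrite /cyca addSnnS.
Qed.

Section Weights.
Variables (D lam : R).
Hypotheses (D1 : 1 <= D) (DE : m%:R * x1 <= D) (lam0 : 0 < lam) (lam1 : lam <= 1)
  (lamE : m%:R * xl <= lam).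

Let w (als : seq R) := \prod_(al <- als) (m%:R * al).

Lemma w_cat a b : w (a ++ b) = w a * w b. Proof. exact: big_cat. Qed.
Lemma w_cons a b : w (a :: b) = m%:R * a * w b. Proof. exact: big_cons. Qed.
Lemma w1 a : w [:: a] = m%:R * a. Proof. exact: big_seq1. Qed.
Lemma w_nseq l a : w (nseq l a) = (m%:R * a) ^+ l.
Proof. by elim: l => [|l IH]; rewrite /= ?w_cons ?IH ?exprS // /w big_nil. Qed.

Lemma mx1_ge0 : 0 <= m%:R * x1. Proof. by rewrite mulr_ge0 ?ler0n ?x1_ge0. Qed.
Lemma mxl_ge0 : 0 <= m%:R * xl. Proof. by rewrite mulr_ge0 ?ler0n ?xl_ge0. Qed.
Lemma mx0_ge0 z : 0 <= m%:R * x0 z. Proof. by rewrite mulr_ge0 ?ler0n ?x0_ge0. Qed.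
Lemma mxT_ge0 z : 0 <= m%:R * xT z. Proof. by rewrite mulr_ge0 ?ler0n ?xT_ge0. Qed.

Lemma mx0 z Z : (z <= Z)%N -> m%:R * x0 z <= D * Z%:R.
Proof.
move=> zZ; rewrite (_ : m%:R * x0 z = (m%:R * x1) * z%:R); last by rewrite /x0 /x1 natrM; ring.
by apply: ler_pM; rewrite ?ler_nat ?mx1_ge0 ?ler0n.
Qed.

Definition wT (Z : nat) : R := D * (2 * k%:R ^+ 2 * Z%:R ^+ 2) / N.

Lemma mxT z Z : (z <= Z)%N -> m%:R * xT z <= wT Z.
Proof.
move=> zZ; have N1 := n1_gt0; have N0 := n_gt0.
rewrite (_ : m%:R * xT z = (m%:R * x1) * ((k%:R - 1) * k%:R * z%:R ^+ 2 / (N - 1))).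
  rewrite /wT -[leRHS]mulrA; apply: ler_pM => //; first exact: mx1_ge0.
    by rewrite !mulr_ge0 ?invr_ge0 ?k1_ge0 ?exprn_ge0 // ltW.
  rewrite ler_pdivrMr // [leRHS]mulrAC ler_pdivlMr //.
  have N2 : 2 <= N by rewrite (ler_nat R 2).
  have h1 : (k%:R - 1) * k%:R * z%:R ^+ 2 <= k%:R ^+ 2 * Z%:R ^+ 2 :> R.
    apply: ler_pM; rewrite ?mulr_ge0 ?k1_ge0 ?exprn_ge0 //.
      by rewrite expr2; apply: ler_wpM2r => //; rewrite gerBl.
    by rewrite lerXn2r ?nnegrE ?ler_nat.
  have h0 : 0 <= k%:R ^+ 2 * Z%:R ^+ 2 :> R by rewrite mulr_ge0 ?exprn_ge0.
  by nra.
rewrite /xT /x1 natrM; field.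
by rewrite (lt0r_neq0 N1) (lt0r_neq0 N0).
Qed.

Lemma D0 : 0 < D. Proof. exact: lt_le_trans D1. Qed.

Lemma wT_ge0 Z : 0 <= wT Z.
Proof.
apply: mulr_ge0; last by rewrite invr_ge0 ltW ?n_gt0.
by apply: mulr_ge0; [exact: ltW D0|rewrite -!natrX -!natrM ler0n].
Qed.

(** The first step attaches to any of up to [Z] clauses and does not contract; the division by [lam]
    allows the full power [lam ^ a] to be kept. *)
Lemma w_fw z Z a : (z <= Z)%N -> (0 < Z)%N -> 0 <= w (fwa z a) <= D * Z%:R / lam * lam ^+ a.
Proof.
move=> zZ Z0; case: a => [|a].
  rewrite /w big_nil ler01 /= expr0 mulr1 ler_pdivlMr // mul1r.
  apply: le_trans lam1 _; rewrite -[leLHS]mul1r; apply: ler_pM => //.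
  by rewrite (ler_nat R 1).
rewrite /= w_cons w_nseq; apply/andP; split.
  by rewrite mulr_ge0 ?mx0_ge0 ?exprn_ge0 ?mxl_ge0.
rewrite exprS mulrA divfK ?lt0r_neq0 //; apply: ler_pM; rewrite ?mx0_ge0 ?exprn_ge0 ?mxl_ge0 //.
  exact: mx0.
by rewrite lerXn2r ?nnegrE ?mxl_ge0 // ltW.
Qed.

Lemma w_bw b : 0 <= w (bwa b) <= D / lam * lam ^+ b.
Proof.
case: b => [|b].
  rewrite /w big_nil ler01 /= expr0 mulr1 ler_pdivlMr // mul1r.
  exact: le_trans lam1 _.
rewrite /= w_cons w_nseq; apply/andP; split.
  by rewrite mulr_ge0 ?mx1_ge0 ?exprn_ge0 ?mxl_ge0.
rewrite exprS mulrA divfK ?lt0r_neq0 //; apply: ler_pM; rewrite ?mx1_ge0 ?exprn_ge0 ?mxl_ge0 //.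
by rewrite lerXn2r ?nnegrE ?mxl_ge0 // ltW.
Qed.

Lemma w_ge0 z As als : bounded_by C z As als -> 0 <= w als.
Proof.
elim: als As z => [|al als IH] [|A As] z //=; first by rewrite /w big_nil.
by case=> al0 _ /IH wals; rewrite w_cons !mulr_ge0.
Qed.

(** Three steps need not contract: the first one, the junction and the start of the backward branch.
    They account for [D ^ 3]. Since the first step of either branch is counted as if it contracted,
    two factors [lam] have to be divided out. *)
Lemma w_conf z Z a ob : (z + a + odflt 0 ob + 1 <= Z)%N ->
  w (confa z a ob) <= D ^+ 3 * Z%:R ^+ 2 / lam ^+ 2 * lam ^+ confcost a ob * wT Z.
Proof.
move=> zZ; have Z0 : (0 < Z)%N by apply: leq_trans zZ; rewrite addn1.
have zZ' : (z <= Z)%N by apply: leq_trans zZ; rewrite -!addnA leq_addr.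
have zZ1 : (z + a <= Z)%N by apply: leq_trans zZ; rewrite -addnA leq_addr.
have Z1 : 1 <= Z%:R :> R by rewrite (ler_nat R 1).
have wT0 := wT_ge0 Z.
have [f0 f1] := andP (w_fw a zZ' Z0).
have lV : 1 <= lam^-1 by rewrite invf_ge1.
have DZ : 1 <= D * Z%:R by rewrite -[leLHS]mul1r; apply: ler_pM.
have D0' := ltW D0; have Zn : 0 <= Z%:R :> R by rewrite ler0n.
have lV0 : 0 <= lam^-1 by rewrite invr_ge0 ltW.
have p1 : 0 <= D * Z%:R / lam := mulr_ge0 (mulr_ge0 D0' Zn) lV0.
have DL : 1 <= D / lam by rewrite -[leLHS]mul1r; apply: ler_pM.
case: ob zZ => [b|] zZ; rewrite /confcost /=; last first.
  rewrite addn0 w_cat w1; apply: ler_pM => //; [exact: mxT_ge0| |exact: mxT].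
  apply: le_trans f1 _; apply: ler_wpM2r; first by rewrite exprn_ge0 // ltW.
  rewrite !exprS !expr0 !mulr1 invfM.
  have -> : D * (D * D) * (Z%:R * Z%:R) * (lam^-1 * lam^-1) =
     (D * Z%:R / lam) * ((D * Z%:R) * (D / lam)) by ring.
  rewrite ler_peMr //.
  by rewrite -[leLHS]mul1r; apply: ler_pM.
have [b0 b1] := andP (w_bw b).
rewrite !w_cat !w1 mulrA; apply: ler_pM => //.
- apply: mulr_ge0 => //; case: (a) => [|a']; first by rewrite w1 mx0_ge0.
  by rewrite w_cat w1 mulr_ge0 ?mx1_ge0 //; case/andP: (w_fw a'.+1 zZ' Z0).
- exact: mxT_ge0.
- have -> : D ^+ 3 * Z%:R ^+ 2 / lam ^+ 2 * lam ^+ (a + b) =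
     (D * Z%:R / lam * lam ^+ a * (D * Z%:R)) * (D / lam * lam ^+ b).
    by rewrite exprD !exprS !expr0 !mulr1 invfM; ring.
  apply: ler_pM => //.
    case: (a) => [|a']; first by rewrite w1 mx0_ge0.
    by rewrite w_cat w1 mulr_ge0 ?mx1_ge0 //; case/andP: (w_fw a'.+1 zZ' Z0).
  case: (a) f0 f1 => [|a'] f0 f1.
    rewrite w1; apply: le_trans (mx0 zZ') _; rewrite expr0 mulr1 ler_peMl //.
      exact: mulr_ge0.
    by rewrite -[leLHS]mul1r; apply: ler_pM.
  rewrite w_cat w1; apply: ler_pM => //; first exact: mx1_ge0.
  by apply: le_trans DE _; rewrite ler_peMr // ltW ?D0.
- exact: mxT.
Qed.

Lemma w_cyc z Z l : (z + l <= Z)%N -> 0 <= w (cyca z l) <= D ^+ l * wT Z.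
Proof.
move=> zZ; rewrite w_cat w1 w_nseq; apply/andP; split.
  by rewrite mulr_ge0 ?exprn_ge0 ?mx1_ge0 ?mxT_ge0.
apply: ler_pM; rewrite ?exprn_ge0 ?mx1_ge0 ?mxT_ge0 //; last exact: mxT.
by rewrite lerXn2r ?nnegrE ?mx1_ge0 // ltW ?D0.
Qed.

Lemma w_pret z Z l : (z + l <= Z)%N -> (0 < Z)%N ->
  0 <= w (preta z l) <= D * Z%:R * D ^+ l * wT Z.
Proof.
move=> zZ Z0; have zZ' : (z <= Z)%N by apply: leq_trans zZ; rewrite leq_addr.
have wT0 := wT_ge0 Z.
have Z1 : 1 <= Z%:R :> R by rewrite (ler_nat R 1).
have DZ : 1 <= D * Z%:R by rewrite -[leLHS]mul1r; apply: ler_pM.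
have De e : 1 <= D ^+ e by rewrite exprn_ege1.
have small : 0 <= w [:: xT z] <= D * Z%:R * D ^+ l * wT Z.
  rewrite w1 mxT_ge0 //=; apply: le_trans (mxT zZ') _.
  by rewrite ler_peMl // -[leLHS]mul1r; apply: ler_pM.
case: l zZ small => [|[|l]] zZ small //=.
have yy : 0 <= (m%:R * x1) ^+ l * (m%:R * xT (z + l.+1)).
  by rewrite mulr_ge0 ?exprn_ge0 ?mx1_ge0 ?mxT_ge0.
rewrite w_cons w_cat w1 w_nseq; apply/andP; split; first by rewrite mulr_ge0 ?mx0_ge0.
rewrite -[leRHS]mulrA; apply: ler_pM; rewrite ?mx0_ge0 //.
  exact: mx0.
apply: ler_pM; rewrite ?exprn_ge0 ?mx1_ge0 ?mxT_ge0 //; last by apply: mxT; apply: leq_trans zZ; rewrite leq_add2l.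
apply: (@le_trans _ _ (D ^+ l)); first by rewrite lerXn2r ?nnegrE ?mx1_ge0 // ltW ?D0.
by rewrite ler_weXn2l // -addn2 leq_addr.
Qed.

End Weights.
End StepBounds.
End Weights.

(** * Rerandomisation of the signs of a clause *)

Module Resign.
Import Explore Steps SwitchConf ShortCycle OccProb ClauseCount.
Local Open Scope ring_scope.

Section Resign.
Variables (R : realType) (n k m : nat).
Hypothesis k2 : (2 <= k)%N.
Implicit Types (s : assignment n) (c : clause n k) (F : formula n k m) (xi : {ffun 'I_k -> bool}).

Definition flipc c xi : clause n k :=
  [tuple ((tnth c j).1, (tnth c j).2 (+) xi j) | j < k].

Lemma clx_flip c xi : clx (flipc c xi) = clx c.
Proof. by apply/ffunP => j; rewrite !ffunE tnth_mktuple. Qed.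

Lemma clv_flip s c xi j : clv s (flipc c xi) j = clv s c j (+) xi j.
Proof.
rewrite !ffunE tnth_mktuple /sat_literal /=.
by case: (s _); case: (tnth c j).2; case: (xi j).
Qed.

Lemma flipcK c xi : flipc (flipc c xi) xi = c.
Proof.
apply: eq_from_tnth => j; rewrite !tnth_mktuple /= -addbA addbb addbF.
by case: (tnth c j).
Qed.

(** The probability that a clause with uniform signs is NAE-satisfied by a fixed assignment,
    [1 - 2 ^ (1 - k)]. *)
Definition rho : R := Nb k R / 2 ^+ k.

Lemma sum_flip s c : \sum_xi (naec s (flipc c xi))%:R = Nb k R.
Proof.
rewrite /Nb [RHS]big_mkcond /=.
have inj : injective (fun xi => [ffun j => clv s c j (+) xi j] : {ffun 'I_k -> bool}).
  move=> x y /ffunP E; apply/ffunP => j; have := E j; rewrite !ffunE.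
  by apply: addbI.
rewrite [RHS](reindex_inj inj) /=; apply: eq_bigr => xi _.
rewrite /naec (_ : clv s (flipc c xi) = [ffun j => clv s c j (+) xi j]).
  by case: nonconst.
by apply/ffunP => j; rewrite clv_flip [RHS]ffunE.
Qed.

Definition resign F e xi : formula n k m := upd_tuple F e (flipc (tnth F e) xi).

Lemma resignK F e xi : resign (resign F e xi) e xi = F.
Proof.
apply: eq_from_tnth => i; rewrite !tnth_upd eqxx.
by case: eqP => // ->; rewrite flipcK.
Qed.

Lemma proper_resign F e xi : proper_formula (resign F e xi) = proper_formula F.
Proof.
suff imp G : proper_formula G -> proper_formula (resign G e xi).
  by apply/idP/idP => [/imp|/imp //]; rewrite resignK.
move=> pG; apply: all_upd => //.
by have := all_tnthP pG e; rewrite !properE clx_flip.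
Qed.

Lemma resign_avg s (e : 'I_m) (h : formula n k m -> R) :
  (forall F xi, h (resign F e xi) = h F) ->
  \sum_(F | proper_formula F) (naec s (tnth F e))%:R * h F =
  rho * \sum_(F | proper_formula F) h F.
Proof.
move=> hr.
have one xi : \sum_(F | proper_formula F) (naec s (tnth F e))%:R * h F =
    \sum_(F | proper_formula F) (naec s (flipc (tnth F e) xi))%:R * h F.
  pose f F := resign F e xi; have fK : involutive f by move=> F; apply: resignK.
  rewrite [LHS](reindex_inj (inv_inj fK)) /=.
  rewrite (eq_bigl (fun F => proper_formula F)) => [|F]; last by rewrite proper_resign.
  by apply: eq_bigr => F _; rewrite hr /resign tnth_upd eqxx.
have p2 : (2 ^+ k : R) != 0 by rewrite expf_neq0.
apply: (mulfI p2); rewrite /rho mulrA mulrCA divff // mulr1.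
have -> : 2 ^+ k = \sum_(xi : {ffun 'I_k -> bool}) 1 :> R.
  by rewrite sumr_const card_ffun card_bool card_ord natrX.
rewrite mulr_suml (eq_bigr _ (fun xi _ => mul1r _)) (eq_bigr _ (fun xi _ => one xi)).
rewrite exchange_big /= mulr_sumr; apply: eq_bigr => F _.
by rewrite -mulr_suml sum_flip.
Qed.

Definition nae_on (K : {set 'I_m}) F s := [forall e in K, naec s (tnth F e)].

(** [K] sees no signs, and [g] only those of the clauses in [K F]. Given all this, every other
    clause is satisfied by [s] with probability [rho], independently. *)
Lemma resign_sum s (K : formula n k m -> {set 'I_m}) (g : formula n k m -> R) :
  (forall F e xi, K (resign F e xi) = K F) ->
  (forall F e xi, e \notin K F -> g (resign F e xi) = g F) ->
  \sum_(F | proper_formula F) (nae_sat F s)%:R * g F =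
  \sum_(F | proper_formula F) (nae_on (K F) F s)%:R * rho ^+ (m - #|K F|) * g F.
Proof.
move=> Kr gr.
(* Interpolation: for the clauses of [l] outside [K F] the indicator is replaced by its average
   [rho], one clause at a time. *)
pose t (l : seq 'I_m) F : R :=
  \prod_(e < m) (if (e \in K F) || (e \notin l) then (naec s (tnth F e))%:R else rho).
pose t' e (l : seq 'I_m) F : R :=
  \prod_(i < m | i != e) (if (i \in K F) || (i \notin l) then (naec s (tnth F i))%:R else rho).
have step l : uniq l -> \sum_(F | proper_formula F) t l F * g F =
    \sum_(F | proper_formula F) t [::] F * g F.
  elim: l => [//|e l IH] /= /andP[el /IH <-].
  have t'E F : t' e (e :: l) F = t' e l F.
    by apply: eq_bigr => i ie; rewrite inE (negbTE ie).
  pose h F := (e \notin K F)%:R * (t' e l F * g F).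
  have hr F xi : h (resign F e xi) = h F.
    rewrite /h Kr; case: (boolP (e \in K F)) => eK; first by rewrite !mul0r.
    rewrite gr //; congr (_ * (_ * _)); apply: eq_bigr => i ie.
    by rewrite Kr tnth_upd (negbTE ie).
  rewrite (eq_bigr (fun F => (e \in K F)%:R * (naec s (tnth F e))%:R * t' e l F * g F + rho * h F)).
    rewrite big_split /= -mulr_sumr -(resign_avg s hr) -big_split /=.
    apply: eq_bigr => F _; rewrite /t (bigD1 e) //= el orbT -/(t' e l F) /h.
    by case: (e \in K F); rewrite /=; ring.
  move=> F _; rewrite /t (bigD1 e) //= -/(t' e (e :: l) F) t'E inE eqxx /= orbF /h.
  by case: (e \in K F); rewrite /=; ring.
transitivity (\sum_(F | proper_formula F) t [::] F * g F).
  apply: eq_bigr => F _; congr (_ * _).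
  rewrite nae_satE /t (eq_bigr (fun e => (naec s (tnth F e))%:R)); last first.
    by move=> e _; rewrite orbT.
  case: (boolP (all _ F)) => [/all_tnthP H|].
    by rewrite big1 // => e _; rewrite H.
  rewrite -has_predC => /hasP[c /tnthP[e ->] /= /negbTE H].
  by rewrite (bigD1 e) //= H mul0r.
rewrite -(step (enum 'I_m)) ?enum_uniq //; apply: eq_bigr => F _; congr (_ * _).
rewrite /t (bigID (fun e => e \in K F)) /=; congr (_ * _).
  rewrite (eq_bigr (fun e => (naec s (tnth F e))%:R)); last by move=> e ->.
  case: (boolP (nae_on _ _ _)) => [/forallP H|/forallPn[e]].
    by rewrite big1 // => e eK; move/implyP: (H e) => ->.
  by rewrite negb_imply => /andP[eK /negbTE H]; rewrite (bigD1 e) //= H mul0r.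
rewrite (eq_bigr (fun _ => rho)); last by move=> e /negbTE ->; rewrite mem_enum.
rewrite prodr_const; congr (_ ^+ _).
have E : (#|K F| + #|~: K F| = m)%N by rewrite cardsC card_ord.
have le : (#|K F| <= m)%N by have := max_card (mem (K F)); rewrite card_ord.
transitivity #|~: K F|; first by apply: eq_card => e; rewrite !inE.
by apply/eqP; rewrite -(eqn_add2l #|K F|) E subnKC.
Qed.

End Resign.
End Resign.

(** * Coin-tossing trees and the rerandomisation of one block *)

Module CoinTree.
Import Explore Steps SwitchConf ShortCycle OccProb ClauseCount Weights Resign.
Local Open Scope ring_scope.

(** A randomised computation is the binary tree of its coin tosses; a leaf has weight one half per
    toss on its branch. This model is shared by the abstract algorithm and by the semantics of the
    program. *)
Inductive rtree (A : Type) := Ret of A | Flp of rtree A & rtree A.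

Fixpoint bind (A B : Type) (t : rtree A) (f : A -> rtree B) : rtree B :=
  match t with Ret a => f a | Flp t0 t1 => Flp (bind t0 f) (bind t1 f) end.

Section Expectation.
Variable R : realType.

Fixpoint Ex (A : Type) (f : A -> R) (t : rtree A) : R :=
  match t with Ret a => f a | Flp t0 t1 => (Ex f t0 + Ex f t1) / 2 end.

Lemma Ex_bind (A B : Type) (f : B -> R) (t : rtree A) (g : A -> rtree B) :
  Ex f (bind t g) = Ex (fun a => Ex f (g a)) t.
Proof. by elim: t => //= t0 -> t1 ->. Qed.

Lemma Ex_ge0 (A : Type) (f : A -> R) t : (forall a, 0 <= f a) -> 0 <= Ex f t.
Proof. by move=> f0; elim: t => //= t0 h0 t1 h1; rewrite divr_ge0 ?addr_ge0. Qed.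

Lemma Ex_cst (A : Type) c (t : rtree A) : Ex (fun _ => c) t = c.
Proof. by elim: t => //= t0 -> t1 ->; field. Qed.

Lemma Ex_sum (A : Type) (I : finType) (f : I -> A -> R) t :
  Ex (fun a => \sum_i f i a) t = \sum_i Ex (f i) t.
Proof.
elim: t => //= t0 -> t1 ->; rewrite -big_split /= mulr_suml.
by [].
Qed.

Lemma ExM (A : Type) c (f : A -> R) t : Ex (fun a => c * f a) t = c * Ex f t.
Proof. by elim: t => //= t0 -> t1 ->; rewrite -mulrDr mulrA. Qed.

Lemma eq_Ex (A : Type) (f g : A -> R) t : f =1 g -> Ex f t = Ex g t.
Proof. by move=> fg; elim: t => //= t0 -> t1 ->. Qed.

Section Laws.
Variable T : finType.
Implicit Types (nu mu : T -> R) (K : T -> rtree T).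

Definition law (t : rtree T) (a : T) : R := Ex (fun b => (b == a)%:R) t.
Definition push nu K (a : T) : R := \sum_b nu b * law (K b) a.
Definition l1 nu mu : R := \sum_a `|nu a - mu a|.

Lemma law_ge0 t a : 0 <= law t a. Proof. exact: Ex_ge0. Qed.

Lemma sum_law t : \sum_a law t a = 1.
Proof.
rewrite -Ex_sum -[RHS](Ex_cst 1 t); apply: eq_Ex => b.
by rewrite (bigD1 b) //= eqxx big1 ?addr0 // => a /negbTE; rewrite eq_sym => ->.
Qed.

Lemma Ex_law (f : T -> R) t : Ex f t = \sum_a law t a * f a.
Proof.
transitivity (Ex (fun b => \sum_a f a * (b == a)%:R) t).
  apply: eq_Ex => b; rewrite (bigD1 b) //= eqxx mulr1 big1 ?addr0 // => a.
  by move/negbTE; rewrite eq_sym => ->; rewrite mulr0.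
by rewrite Ex_sum; apply: eq_bigr => a _; rewrite ExM mulrC.
Qed.

Lemma law_bind (t : rtree T) K a : law (bind t K) a = \sum_b law t b * law (K b) a.
Proof. by rewrite /law Ex_bind Ex_law. Qed.

Lemma push_bind nu K K' a :
  push nu (fun s => bind (K s) K') a = push (push nu K) K' a.
Proof.
rewrite /push; under eq_bigr => b _ do rewrite law_bind mulr_sumr.
rewrite exchange_big /=; apply: eq_bigr => c _; rewrite mulr_suml.
by apply: eq_bigr => b _; rewrite mulrA.
Qed.

Lemma push_l1 nu mu K : l1 (push nu K) (push mu K) <= l1 nu mu.
Proof.
apply: (@le_trans _ _ (\sum_a \sum_b `|nu b - mu b| * law (K b) a)).
  apply: ler_sum => a _; rewrite /push -sumrB.
  apply: le_trans (ler_norm_sum _ _ _) _; apply: ler_sum => b _.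
  by rewrite -mulrBl normrM (ger0_norm (law_ge0 _ _)).
rewrite exchange_big /=; apply: ler_sum => b _.
by rewrite -mulr_sumr sum_law mulr1.
Qed.

Lemma l1_triangle nu mu xi : l1 nu xi <= l1 nu mu + l1 mu xi.
Proof. by rewrite -big_split /=; apply: ler_sum => a _; apply: ler_distD. Qed.

Lemma l1_ge0 nu mu : 0 <= l1 nu mu. Proof. exact: sumr_ge0. Qed.

Lemma eq_l1 nu nu' mu mu' : nu =1 nu' -> mu =1 mu' -> l1 nu mu = l1 nu' mu'.
Proof. by move=> h g; apply: eq_bigr => a _; rewrite h g. Qed.

Lemma pushZ c nu K a : push (fun s => c * nu s) K a = c * push nu K a.
Proof. by rewrite /push mulr_sumr; apply: eq_bigr => b _; rewrite mulrA. Qed.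

Lemma push_Ret nu a : push nu (fun s => Ret s) a = nu a.
Proof.
rewrite /push (bigD1 a) //= /law /= eqxx mulr1 big1 ?addr0 // => b /negbTE ->.
by rewrite mulr0.
Qed.

Lemma sum_push nu K : \sum_a push nu K a = \sum_a nu a.
Proof.
rewrite /push exchange_big /=; apply: eq_bigr => b _.
by rewrite -mulr_sumr sum_law mulr1.
Qed.

End Laws.

Section Block.
Variable n : nat.
Let T := assignment n.
Implicit Types (s t : T) (g : T -> R).
Variables (S : pred T) (sw : 'I_n -> T -> T) (bad : 'I_n -> pred T) (W : {set 'I_n}).

Definition flip1 (x : 'I_n) s : T := [ffun y => s y (+) (y == x)].

(** An abstract switch: an involution of [S] that acts on [W] like the flip of [x], unless the
    assignment is in [bad x]. *)
Hypothesis swS : forall x s, S s -> S (sw x s).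
Hypothesis swK : forall x s, S s -> sw x (sw x s) = s.
Hypothesis swW : forall x s, x \in W -> S s -> ~~ bad x s ->
  {in W, forall y, sw x s y = flip1 x s y}.

Definition flipK x s : rtree T := Flp (Ret s) (Ret (sw x s)).
Fixpoint tryX (X : seq 'I_n) s : rtree T :=
  if X is x :: X' then bind (flipK x s) (tryX X') else Ret s.
Definition roundK (v : pred T) X s : rtree T := if v s then tryX X s else Ret s.
Fixpoint blockK (v : pred T) X N s : rtree T :=
  if N is N'.+1 then bind (blockK v X N' s) (roundK v X) else Ret s.

Definition depW g := forall s t, {in W, forall y, s y = t y} -> g s = g t.
Definition avg x g s : R := (g s + g (flip1 x s)) / 2.
Fixpoint avgX (X : seq 'I_n) g : T -> R :=
  if X is x :: X' then avgX X' (avg x g) else g.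

Lemma flip1K x : involutive (flip1 x).
Proof. by move=> s; apply/ffunP => y; rewrite !ffunE -addbA addbb addbF. Qed.

Lemma flip1C x y s : flip1 x (flip1 y s) = flip1 y (flip1 x s).
Proof. by apply/ffunP => z; rewrite !ffunE -!addbA (addbC (z == x)). Qed.

Lemma dep_avg x g : depW g -> depW (avg x g).
Proof.
move=> dg s t st; rewrite /avg (dg s t st) (dg (flip1 x s) (flip1 x t)) //.
by move=> y yW; rewrite !ffunE st.
Qed.

Lemma dep_avgX X g : depW g -> depW (avgX X g).
Proof. by elim: X g => //= x X IH g /(dep_avg x) /IH. Qed.

Lemma avg_inv x y g s : (forall t, g (flip1 y t) = g t) -> avg x g (flip1 y s) = avg x g s.
Proof. by move=> gy; rewrite /avg gy flip1C gy. Qed.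

Lemma avgX_keep X y g : (forall t, g (flip1 y t) = g t) ->
  forall s, avgX X g (flip1 y s) = avgX X g s.
Proof. by elim: X g => //= x X IH g gy; apply: IH => t; apply: avg_inv. Qed.

Lemma avgX_inv X g y s : y \in X -> avgX X g (flip1 y s) = avgX X g s.
Proof.
elim: X g => //= x X IH g; rewrite inE => /orP[/eqP->|yX]; last exact: IH.
by apply: avgX_keep => t; rewrite /avg flip1K addrC.
Qed.

Lemma sum_avg x g : \sum_s avg x g s = \sum_s g s.
Proof.
have E : \sum_s g (flip1 x s) = \sum_s g s.
  by rewrite [RHS](reindex_inj (inv_inj (flip1K x))).
rewrite /avg -mulr_suml big_split /= E.
by rewrite -mulr2n -[_ *+ 2]mulr_natr mulfK.
Qed.

Lemma sum_avgX X g : \sum_s avgX X g s = \sum_s g s.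
Proof. by elim: X g => //= x X IH g; rewrite IH sum_avg. Qed.

Lemma avgX_const X g s : W = [set x in X] -> depW g ->
  avgX X g s = (\sum_t g t) / 2 ^+ n.
Proof.
move=> WX dg; set h := avgX X g.
have cst t : h t = h s.
  pose u (L : seq 'I_n) : T := [ffun y => if y \in L then s y else t y].
  have uL L : {subset L <= X} -> h (u L) = h t.
    elim: L => [|x L IH] LX.
      by congr h; apply/ffunP => y; rewrite ffunE.
    rewrite -IH; last by move=> y yL; apply: LX; rewrite inE yL orbT.
    have [E|E] : u (x :: L) = u L \/ u (x :: L) = flip1 x (u L).
      case: (eqVneq (s x) (u L x)) => ne; [left|right]; apply/ffunP => y; rewrite !ffunE inE.
        by case: eqP => [->|_] //=; rewrite {1}ne ffunE.
      case: eqP => [->|_] /=; last by rewrite addbF.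
      by move: ne; rewrite !ffunE; case: (s x); case: (if _ then _ else _).
    - by rewrite E.
    - by rewrite E /h avgX_inv // LX // mem_head.
  rewrite -(uL X) //; apply: dep_avgX => // y; rewrite WX inE => yX.
  by rewrite ffunE yX.
rewrite -(sum_avgX X g) (eq_bigr (fun _ => h s)) // sumr_const.
rewrite card_ffun card_bool card_ord -[_ *+ _]mulr_natr natrX mulfK //.
Qed.

Definition on g s : R := (S s)%:R * g s.
Definition nbad x : R := \sum_(s | S s) (bad x s)%:R.

(** As [sw x] is an involution of [S], the density [g] on [S] becomes exactly the average of [g s]
    and [g (sw x s)]. This differs from [avg x g] only where the switch is bad, and there by at most
    [M]. *)
Lemma flip_step x g M : x \in W -> (forall s, 0 <= g s <= M) -> depW g ->
  l1 (push (on g) (flipK x)) (on (avg x g)) <= M * nbad x.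
Proof.
move=> xW gM dg.
have pE a : push (on g) (flipK x) a = on (fun s => (g s + g (sw x s)) / 2) a.
  rewrite /push /law /=.
  have -> : \sum_b on g b * (((b == a)%:R + (sw x b == a)%:R) / 2) =
     (on g a + \sum_b on g b * (sw x b == a)%:R) / 2.
    rewrite -[in on g a](push_Ret (on g) a) /push /law /= -big_split /= mulr_suml.
    by apply: eq_bigr => b _; ring.
  rewrite /on; case: (boolP (S a)) => Sa.
    rewrite (bigD1 (sw x a)) //= swK // eqxx swS // big1 ?addr0 ?mulr1 ?mul1r // => b ba.
    case: (boolP (S b)) => Sb; last by rewrite !mul0r.
    by case: eqP => [E|_]; rewrite ?mulr0 //; rewrite -E swK ?eqxx in ba.
  rewrite mul0r big1 ?addr0 ?mul0r // => b _; case: (boolP (S b)) => Sb; last by rewrite !mul0r.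
  by case: eqP => [E|_]; rewrite ?mulr0 //; rewrite -E swS in Sa.
rewrite (eq_l1 pE (fun _ => erefl)) /l1 /nbad mulr_sumr [leRHS]big_mkcond /=.
apply: ler_sum => s _; rewrite /on /avg; case: (boolP (S s)) => Ss; last first.
  by rewrite !mul0r subrr normr0.
rewrite !mul1r; case: (boolP (bad x s)) => bx; last first.
  by rewrite (dg _ _ (swW xW Ss bx)) subrr normr0 mulr0.
have /andP[h1 h2] := gM (sw x s); have /andP[h3 h4] := gM (flip1 x s).
rewrite mulr1 -mulrBl opprD addrACA subrr add0r normrM normfV (ger0_norm (_ : 0 <= 2)) //.
rewrite ler_pdivrMr //; have : `|g (sw x s) - g (flip1 x s)| <= M.
  by rewrite ler_norml; apply/andP; split; lra.
by lra.
Qed.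

Lemma avg_bd x g M : (forall s, 0 <= g s <= M) -> forall s, 0 <= avg x g s <= M.
Proof.
move=> gM s; have /andP[h1 h2] := gM s; have /andP[h3 h4] := gM (flip1 x s).
by rewrite /avg; apply/andP; split; lra.
Qed.

Lemma try_step X g M : {subset X <= W} -> (forall s, 0 <= g s <= M) -> depW g ->
  l1 (push (on g) (tryX X)) (on (avgX X g)) <= M * \sum_(x <- X) nbad x.
Proof.
elim: X g => [|x X IH] g XW gM dg /=.
  rewrite big_nil mulr0 (eq_l1 (push_Ret (on g)) (fun _ => erefl)).
  by rewrite /l1 big1 // => a _; rewrite subrr normr0.
rewrite big_cons mulrDr.
rewrite (eq_l1 (push_bind (on g) (flipK x) (tryX X)) (fun _ => erefl)).
apply: le_trans (l1_triangle _ (push (on (avg x g)) (tryX X)) _) _; apply: lerD.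
  by apply: le_trans (push_l1 _ _ _) _; apply: flip_step => //; apply: XW; rewrite mem_head.
apply: IH; [by move=> y yX; apply: XW; rewrite inE yX orbT|exact: avg_bd|exact: dep_avg].
Qed.

Variables (v : pred T) (X : seq 'I_n).
Hypothesis WX : W = [set x in X].
Hypothesis depv : forall s t, {in W, forall y, s y = t y} -> v s = v t.

Let Zs : R := #|S|%:R.
Let miss : R := (\sum_s (v s)%:R) / 2 ^+ n.
Definition block_err (N : nat) : R := N%:R * ((\sum_(x <- X) nbad x) / #|S|%:R).

Lemma miss_bd : 0 <= miss <= 1.
Proof.
apply/andP; split; first by rewrite /miss divr_ge0 ?exprn_ge0 ?sumr_ge0.
rewrite /miss ler_pdivrMr ?exprn_gt0 // mul1r.
have -> : 2 ^+ n = \sum_(s : T) 1 :> R.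
  by rewrite sumr_const card_ffun card_bool card_ord natrX.
by apply: ler_sum => s _; case: (v s).
Qed.

Lemma sumS : \sum_s (S s)%:R = Zs.
Proof.
rewrite /Zs -sum1_card natr_sum [RHS]big_mkcond /=; apply: eq_bigr => s _.
by rewrite unfold_in; case: (S s).
Qed.

(** Up to the error, the density stays constant on the violated elements of [S] and constant on the
    others: a round spreads the violated part uniformly over [S]. Since [a * Zs <= 1], a round costs
    the same error whatever its number. *)
Lemma block_iter N : 0 < Zs -> exists b : R,
  l1 (push (uniform R S) (blockK v X N))
     (fun s => (S s)%:R * (if v s then miss ^+ N / Zs else b)) <= block_err N.
Proof.
move=> Z0; have /andP[f0 f1] := miss_bd.
elim: N => [|N [b IH]].
  exists Zs^-1; rewrite /block_err mul0r expr0 mul1r.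
  rewrite (eq_l1 (push_Ret _) (fun _ => erefl)) /l1 big1 // => s _.
  by rewrite /uniform if_same subrr normr0.
set a := miss ^+ N / Zs in IH.
have a0 : 0 <= a by rewrite divr_ge0 ?exprn_ge0 // ltW.
have aZ : a * Zs <= 1 by rewrite divfK ?lt0r_neq0 // exprn_ile1.
exists (b + miss * a); rewrite /=.
rewrite (eq_l1 (push_bind _ (blockK v X N) (roundK v X)) (fun _ => erefl)).
apply: le_trans (l1_triangle _ (push (fun s => (S s)%:R * (if v s then a else b)) (roundK v X)) _) _.
have -> : block_err N.+1 = block_err N + (\sum_(x <- X) nbad x) / Zs.
  by rewrite /block_err -addn1 natrD mulrDl mul1r.
apply: lerD; first by apply: le_trans (push_l1 _ _ _) IH.
pose gv s : R := (v s)%:R.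
have gv01 s : 0 <= gv s <= 1 by rewrite /gv; case: (v s); rewrite ?lexx ler01.
have dgv : depW gv by move=> s t st; rewrite /gv (depv st).
have pE c : push (fun s => (S s)%:R * (if v s then a else b)) (roundK v X) c =
    (S c)%:R * ((~~ v c)%:R * b) + a * push (on gv) (tryX X) c.
  have -> : (S c)%:R * ((~~ v c)%:R * b) =
      push (fun s => (S s)%:R * ((~~ v s)%:R * b)) (fun s => Ret s) c by rewrite push_Ret.
  rewrite -pushZ.
  rewrite /push -big_split /=; apply: eq_bigr => s _; rewrite /on /gv /roundK.
  by case: (v s) => /=; ring.
rewrite (eq_l1 pE (fun _ => erefl)).
have XW : {subset X <= W} by move=> x xX; rewrite WX inE.
have := try_step XW gv01 dgv; rewrite mul1r => ts.
apply: (@le_trans _ _ (a * l1 (push (on gv) (tryX X)) (on (avgX X gv)))).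
  rewrite /l1 mulr_sumr; apply: ler_sum => s _.
  have nm (y : R) : a * `|y| = `|a * y| by rewrite normrM (ger0_norm a0).
  rewrite nm; apply: ler_of_eq; congr (`|_|).
  rewrite /on (avgX_const _ WX dgv) -/miss exprS -mulrA -/a.
  by case: (v s) => /=; ring.
rewrite ler_pdivlMr // mulrAC -[leRHS]mul1r.
by apply: ler_pM => //; rewrite ?l1_ge0 // mulr_ge0 // ltW.
Qed.

(** The constant [b] left open by [block_iter] is recovered, up to the error, from the conservation
    of total mass. Both error terms are then counted twice, which the factor one half in [tv]
    compensates. *)
Lemma block_tv N : (exists s, S s && ~~ v s) ->
  tv (push (uniform R S) (blockK v X N)) (uniform R [pred s | S s && ~~ v s])
  <= block_err N + miss ^+ N.
Proof.
case=> s0 s0S; have Z0 : 0 < Zs.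
  by rewrite ltr0n; apply/card_gt0P; exists s0; case/andP: s0S.
have /andP[f0 f1] := miss_bd.
have [b IH] := block_iter N Z0; set e := block_err N in IH *.
set P := #|[pred s | S s && ~~ v s]|%:R : R.
have P0 : 0 < P by rewrite ltr0n; apply/card_gt0P; exists s0.
set a := miss ^+ N / Zs in IH.
have a0 : 0 <= a by rewrite divr_ge0 ?exprn_ge0 // ltW.
set Q := \sum_s ((S s && v s)%:R : R).
have Q0 : 0 <= Q by apply: sumr_ge0.
have QZ : Q <= Zs by rewrite -sumS; apply: ler_sum => s _; case: (S s); case: (v s).
have aQ : a * Q <= miss ^+ N.
  rewrite /a mulrAC ler_pdivrMr //; apply: ler_wpM2l => //; exact: exprn_ge0.
have sumP : \sum_s ((S s && ~~ v s)%:R : R) = P.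
  rewrite /P -sum1_card natr_sum [RHS]big_mkcond /=; apply: eq_bigr => s _.
  by rewrite unfold_in /=; case: (_ && _).
have mass : `|b * P + a * Q - 1| <= e.
  have -> : b * P + a * Q - 1 =
     \sum_s ((S s)%:R * (if v s then a else b) - push (uniform R S) (blockK v X N) s).
    rewrite sumrB sum_push; congr (_ - _).
      rewrite -sumP /Q !mulr_sumr -big_split /=; apply: eq_bigr => s _.
      by case: (S s); case: (v s) => /=; ring.
    by rewrite /uniform -mulr_suml sumS divff // lt0r_neq0.
  apply: le_trans (ler_norm_sum _ _ _) _; apply: le_trans IH.
  by apply: ler_sum => s _; rewrite distrC.
rewrite -[tv _ _]/(2^-1 * l1 _ _).
have := l1_triangle (push (uniform R S) (blockK v X N))
  (fun s => (S s)%:R * (if v s then a else b)) (uniform R [pred s | S s && ~~ v s]).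
have : l1 (fun s => (S s)%:R * (if v s then a else b)) (uniform R [pred s | S s && ~~ v s])
    <= a * Q + `|b * P - 1|.
  have -> : `|b * P - 1| = \sum_s (S s && ~~ v s)%:R * `|b - P^-1|.
    have nm (y : R) : P * `|y| = `|P * y| by rewrite normrM (ger0_norm (ltW P0)).
    by rewrite -mulr_suml sumP nm mulrBr divff ?lt0r_neq0 // mulrC.
  rewrite /Q mulr_sumr -big_split /=; apply: ler_sum => s _; rewrite /uniform /=.
  case: (S s); case: (v s) => /=; rewrite ?mul0r ?mul1r ?mulr0 ?mulr1 ?addr0 ?add0r ?subr0 ?oppr0 ?normr0 //.
  by rewrite ger0_norm.
have : `|b * P - 1| <= e + a * Q.
  have -> : b * P - 1 = (b * P + a * Q - 1) - a * Q by ring.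
  apply: le_trans (ler_normB _ _) _; rewrite [`|a * Q|]ger0_norm; last exact: mulr_ge0.
  by rewrite lerD2r.
move=> h1 h2 h3; move: IH aQ h1 h2 h3.
set L1 := l1 _ _; set L2 := l1 _ _; set L3 := l1 _ _; set B := `|_|.
by move=> *; lra.
Qed.

End Block.
End Expectation.
End CoinTree.

(** * Cluster flips as involutions, and the error of a schedule of blocks *)

Module Switching.
Import Explore Steps SwitchConf OccProb ClauseCount Resign CoinTree.
Local Open Scope ring_scope.

Lemma bindA (A B C : Type) (t : rtree A) (f : A -> rtree B) (g : B -> rtree C) :
  bind (bind t f) g = bind t (fun a => bind (f a) g).
Proof. by elim: t => //= t0 -> t1 ->. Qed.

Section Switch.
Variables (n k m : nat) (F : formula n k m).
Hypotheses (k3 : (2 < k)%N) (Fp : proper_formula F).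
Implicit Types (s : assignment n) (A : {set 'I_m}) (S : {set 'I_n}).

Definition VF (e : 'I_m) := Vc (tnth F e).
Definition umF s (e : 'I_m) := umc s (tnth F e).
Definition flipS S s : assignment n := [ffun y => s y (+) (y \in S)].
Definition clus A T x s := cluster VF (umF s) A T x.
Definition sw A T x s : assignment n :=
  if switchable VF (umF s) A (clus A T x s) then flipS (clus A T x s) s else s.
Definition badsw A T (W : {set 'I_n}) x s :=
  ~~ (switchable VF (umF s) A (clus A T x s) && (clus A T x s :&: W == [set x])).

Lemma proper_tnth e : proper_clause (tnth F e).
Proof. by move/all_tnthP: Fp; apply. Qed.

Lemma clx_inj e : injective (clx (tnth F e)).
Proof. by apply/injectiveP; rewrite -properE proper_tnth. Qed.

Lemma clx_V e j : clx (tnth F e) j \in VF e.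
Proof. by apply/imsetP; exists j. Qed.

Lemma clv_flipS S s e j :
  clv (flipS S s) (tnth F e) j = clv s (tnth F e) j (+) (clx (tnth F e) j \in S).
Proof.
rewrite !ffunE /sat_literal !ffunE; case: (s _); case: (_ \in S); by case: (tnth _ j).2.
Qed.

Lemma umF_pos s e j : umF s e (clx (tnth F e) j) = minor (clv s (tnth F e)) j.
Proof.
apply/existsP/idP => [[i /andP[/eqP /clx_inj -> //]]|h].
by exists j; rewrite eqxx.
Qed.

Lemma minor_nconst (b : {ffun 'I_k -> bool}) j : ~~ minor b j -> exists2 i, i != j & b i = b j.
Proof.
rewrite negb_forall => /existsP[i]; rewrite negb_imply negbK => /andP[ij /eqP]; by exists i.
Qed.

(** If one variable of the clause is flipped and it is not the minority, its old value survives at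
    another position and its new value occurred elsewhere before. So the clause stays satisfied and
    the variable is still not the minority. *)
Lemma switch_clause S s e : naec s (tnth F e) -> clause_ok VF (umF s) S e ->
  naec (flipS S s) (tnth F e) /\ {in S, forall y, umF (flipS S s) e y = umF s e y}.
Proof.
set b := clv s (tnth F e); set b' := clv (flipS S s) (tnth F e).
have bE j : b' j = b j (+) (clx (tnth F e) j \in S) by exact: clv_flipS.
move=> ns /orP[/fintype.subsetP VS|/forallP ok].
  have bN j : b' j = ~~ b j by rewrite bE VS ?clx_V // addbT.
  split.
    case/existsP: ns => i /existsP[j ij]; apply/existsP; exists i; apply/existsP; exists j.
    by rewrite -/b' !bN; move: ij; rewrite -/b; case: (b i); case: (b j).
  move=> y _; apply: eq_existsb => j; congr (_ && _); apply: eq_forallb => i.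
  by rewrite -/b' -/b !bN; case: (b i); case: (b j).
have ok1 j : clx (tnth F e) j \in S -> ~~ minor b j /\ forall i, clx (tnth F e) i \in S -> i = j.
  move=> jS; have /implyP := ok (clx (tnth F e) j); rewrite inE clx_V jS => /(_ isT) /andP[um1 /forallP al].
  split; first by rewrite -umF_pos.
  by move=> i iS; have /implyP := al (clx (tnth F e) i); rewrite inE clx_V iS => /(_ isT) /eqP /clx_inj.
have [/existsP[j jS]|/existsPn none] := boolP [exists j, clx (tnth F e) j \in S]; last first.
  have bb' : b' = b by apply/ffunP => j; rewrite bE (negbTE (none j)) addbF.
  split; first by rewrite /naec -/b' bb'.
  by move=> y _; rewrite /umF /umc -/b' -/b bb'.
have [nm uq] := ok1 j jS; have [i ij bij] := minor_nconst nm.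
have bj : b' j = ~~ b j by rewrite bE jS addbT.
have bo l : l != j -> b' l = b l.
  by move=> lj; rewrite bE; case: (boolP (_ \in S)) => [/uq /eqP|]; rewrite ?(negbTE lj) // addbF.
split.
  apply/existsP; exists i; apply/existsP; exists j; rewrite -/b' bj bo // bij.
  by case: (b j).
move=> y yS; apply: eq_existsb => l; case: eqP => //= yl.
have lj : l = j by apply: uq; rewrite yl.
rewrite lj -/b -/b' (negbTE nm); apply/negbTE/negP => /forallP mj.
have [x [xj bx]] : exists x, x != j /\ b x != b j.
  case/existsP: ns => u /existsP[v]; rewrite -/b => uv.
  case: (eqVneq (b u) (b j)) => [E|E].
    exists v; split; last by rewrite -E eq_sym.
    by apply: contraNneq uv => ->; rewrite E.
  by exists u; split=> //; apply: contraNneq E => ->.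
have := mj x; rewrite xj bj bo //=; by move: bx; case: (b x); case: (b j).
Qed.

(** The minority relations that steer the search survive inside the cluster, so the search from [x]
    finds the same cluster after the flip. Hence the switch is an involution. *)
Lemma switch_inv A T x s : nae_on A F s ->
  switchable VF (umF s) A (clus A T x s) ->
  let S := clus A T x s in
  [/\ nae_on A F (flipS S s), clus A T x (flipS S s) = S &
      switchable VF (umF (flipS S s)) A S].
Proof.
move=> /forallP ns /forallP sw S.
have key e : e \in A -> naec (flipS S s) (tnth F e) /\ {in S, forall y, umF (flipS S s) e y = umF s e y}.
  move=> eA; apply: switch_clause; first by have := ns e; rewrite eA.
  by have := sw e; rewrite eA.
have sub t : (t <= T)%N -> reach VF (mn (umF s) A) [set x] t \subset S by move=> tT; apply: reach_leq.
have rE t : (t <= T)%N -> reach VF (mn (umF (flipS S s)) A) [set x] t = reach VF (mn (umF s) A) [set x] t.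
  elim: t => [//|t IH] tT; rewrite !reachS IH ?(ltnW tT) //.
  have /fintype.subsetP sb := sub t (ltnW tT).
  rewrite /grow; congr (_ :|: _); apply: eq_bigl => e; apply: eq_existsb => y.
  case: (boolP (y \in reach _ _ _ _)) => //= yr; rewrite /mn.
  by case: (boolP (e \in A)) => //= eA; apply: (proj2 (key e eA)); apply: sb.
split.
- by apply/forallP => e; apply/implyP => eA; case: (key e eA).
- by rewrite /clus /cluster rE.
apply/forallP => e; apply/implyP => eA; have := sw e; rewrite eA /= -/S /clause_ok.
case/orP => [-> //|/forallP ok]; apply/orP; right; apply/forallP => y; apply/implyP => yS.
have := ok y; rewrite yS /= (proj2 (key e eA)) //.
by move: yS; rewrite inE => /andP[].
Qed.

Lemma swS A T x s : nae_on A F s -> nae_on A F (sw A T x s).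
Proof. by move=> ns; rewrite /sw; case: ifP => // h; case: (switch_inv ns h). Qed.

Lemma swK A T x s : nae_on A F s -> sw A T x (sw A T x s) = s.
Proof.
move=> ns; rewrite {2}/sw; case: ifP => h; last by rewrite /sw h.
have [_ cE sE] := switch_inv ns h; rewrite /sw cE sE.
by apply/ffunP => y; rewrite !ffunE addbK.
Qed.

Lemma swW A T (W : {set 'I_n}) x s : x \in W -> ~~ badsw A T W x s ->
  {in W, forall y, sw A T x s y = flip1 x s y}.
Proof.
move=> xW; rewrite negbK => /andP[h /eqP SW] y yW.
rewrite /sw h !ffunE; congr (_ (+) _).
by have /setP/(_ y) := SW; rewrite !inE yW andbT.
Qed.

Definition viol (B : seq 'I_m) s := has (fun e => ~~ naec s (tnth F e)) B.
Definition XB (B : seq 'I_m) : seq 'I_n := flatten [seq codom (clx (tnth F e)) | e <- B].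
Definition WB (B : seq 'I_m) : {set 'I_n} := [set x in XB B].
Definition blockF A T (B : seq 'I_m) N s := blockK (sw A T) (viol B) (XB B) N s.
Definition cov (sch : seq (seq 'I_m * nat)) : {set 'I_m} := [set e | has (fun q => e \in q.1) sch].

Fixpoint alg T A (sch : seq (seq 'I_m * nat)) s : rtree (assignment n) :=
  if sch is (B, N) :: sch' then
    bind (blockF A T B N s) (alg T (A :|: [set e in B]) sch') else Ret s.

Lemma naec_dep s (t : assignment n) e : {in VF e, forall y, s y = t y} -> naec s (tnth F e) = naec t (tnth F e).
Proof.
move=> st; rewrite /naec; congr nonconst; apply/ffunP => j; rewrite !ffunE /sat_literal.
by have := st (clx (tnth F e) j) (clx_V e j); rewrite ffunE => ->.
Qed.

Lemma WB_V B e : e \in B -> VF e \subset WB B.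
Proof.
move=> eB; apply/fintype.subsetP => y /imsetP[j _ ->]; rewrite inE; apply/flattenP.
by exists (codom (clx (tnth F e))); [apply: map_f|apply: codom_f].
Qed.

Lemma viol_dep B s (t : assignment n) : {in WB B, forall y, s y = t y} -> viol B s = viol B t.
Proof.
move=> st; apply: eq_in_has => e eB; congr (~~ _); apply: naec_dep => y yV; apply: st.
exact: (fintype.subsetP (WB_V eB)).
Qed.

Lemma nae_on_cup A B s : nae_on (A :|: [set e in B]) F s = nae_on A F s && ~~ viol B s.
Proof.
rewrite -all_predC; apply/forallP/andP => [h|[/forallP hA /allP hB] e].
  split; first by apply/forallP => e; apply/implyP => eA; have := h e; rewrite inE eA.
  by apply/allP => e eB /=; rewrite negbK; have := h e; rewrite !inE eB orbT.
rewrite !inE; apply/implyP => /orP[eA|eB]; first by have := hA e; rewrite eA.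
by have := hB e eB; rewrite /= negbK.
Qed.

Lemma alg_cat T A c1 c2 s : alg T A (c1 ++ c2) s = bind (alg T A c1 s) (alg T (A :|: cov c1) c2).
Proof.
elim: c1 A s => [|[B N] c1 IH] A s /=.
  by congr (alg T _ c2 s); apply/setP => e; rewrite !inE orbF.
rewrite bindA; congr bind; apply/funext => s'; rewrite IH; congr bind.
by congr (alg T _ c2); apply/setP => e; rewrite !inE orbA.
Qed.

Variable R : realType.
Definition missB (B : seq 'I_m) : R := (\sum_s (viol B s)%:R) / 2 ^+ n.
Definition errB A T B (N : nat) : R :=
  block_err R (nae_on A F) (badsw A T (WB B)) (XB B) N + missB B ^+ N.
Fixpoint err T A (sch : seq (seq 'I_m * nat)) : R :=
  if sch is (B, N) :: sch' then errB A T B N + err T (A :|: [set e in B]) sch' else 0.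

(** A block starts from the output of its predecessors instead of the exact uniform law. As a kernel
    does not increase the distance, the errors of the blocks add up. *)
Lemma alg_tv T A sch : (exists s, nae_sat F s) ->
  tv (push (uniform R (nae_on A F)) (alg T A sch)) (uniform R (nae_on (A :|: cov sch) F))
  <= err T A sch.
Proof.
case=> s0; rewrite nae_satE => /all_tnthP s0F.
elim: sch A => [|[B N] sch IH] A /=.
  rewrite -[tv _ _]/(2^-1 * l1 _ _) (eq_l1 (push_Ret _) (fun _ => erefl)).
  have -> : A :|: cov [::] = A by apply/setP => e; rewrite !inE orbF.
  by rewrite /l1 big1 ?mulr0 // => a _; rewrite subrr normr0.
rewrite -[tv _ _]/(2^-1 * l1 _ _).
rewrite (eq_l1 (push_bind _ (blockF A T B N) (alg T (A :|: [set e in B]) sch)) (fun _ => erefl)).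
have uE : uniform R [pred s | nae_on A F s && ~~ viol B s] = uniform R (nae_on (A :|: [set e in B]) F).
  apply/funext => s; rewrite /uniform /= nae_on_cup; congr (_ / _%:R); apply: eq_card => t.
  by rewrite inE /= -[RHS]/(nae_on _ F t) nae_on_cup.
have tvB : tv (push (uniform R (nae_on A F)) (blockF A T B N)) (uniform R (nae_on (A :|: [set e in B]) F))
    <= errB A T B N.
  rewrite -uE; apply: (@block_tv R n (nae_on A F) (sw A T) (badsw A T (WB B)) (WB B)).
  - by move=> x s; apply: swS.
  - by move=> x s; apply: swK.
  - by move=> x s xW _; apply: swW.
  - by [].
  - exact: viol_dep.
  exists s0; rewrite -nae_on_cup; apply/forallP => e; apply/implyP => _; exact: s0F.
have := IH (A :|: [set e in B]).
have -> : A :|: [set e in B] :|: cov sch = A :|: cov ((B, N) :: sch).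
  by apply/setP => e; rewrite !inE orbA.
move: tvB; rewrite -![tv _ _]/(2^-1 * l1 _ _) => h1 h2.
have h3 := push_l1 (push (uniform R (nae_on A F)) (blockF A T B N))
  (uniform R (nae_on (A :|: [set e in B]) F)) (alg T (A :|: [set e in B]) sch).
have h4 := l1_triangle (push (push (uniform R (nae_on A F)) (blockF A T B N)) (alg T (A :|: [set e in B]) sch))
  (push (uniform R (nae_on (A :|: [set e in B]) F)) (alg T (A :|: [set e in B]) sch))
  (uniform R (nae_on (A :|: cov ((B, N) :: sch)) F)).
move: h1 h2 h3 h4; set L1 := l1 _ _; set L2 := l1 _ _; set L3 := l1 _ _; set L4 := l1 _ _.
by move=> *; lra.
Qed.

End Switch.
End Switching.

(** * Elementary inequalities for exponentials and power sums *)

Module Moments.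
Local Open Scope ring_scope.

Lemma big_tuple_cons (R : nmodType) (T : finType) z (f : seq T -> R) :
  \sum_(t : z.+1.-tuple T) f t = \sum_e \sum_(s : z.-tuple T) f (e :: s).
Proof.
rewrite (pair_bigA _ (fun e (s : z.-tuple T) => f (e :: s))) /=.
rewrite (reindex (fun q : T * z.-tuple T => [tuple of q.1 :: q.2])) //=.
exists (fun t : z.+1.-tuple T => (thead t, [tuple of behead t])) => [[e s] _|t _].
  by congr pair; apply: val_inj.
by apply: val_inj; rewrite /= [in RHS](tuple_eta t).
Qed.

Lemma ler_of_eqA (R : numDomainType) (x y : R) : x = y -> x <= y.
Proof. by move->. Qed.

Section Analytic.
Variable R : realType.
Implicit Types (x y h : R).

Lemma expR_le_inv h : h < 1 -> expR h <= (1 - h)^-1.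
Proof.
move=> h1; have := expR_ge1Dx (- h).
rewrite -[expR h]invrK -expRN lef_pV2 ?posrE ?expR_gt0 //.
by rewrite subr_gt0.
Qed.

Lemma cosh_small h : `|h| <= 4^-1 -> expR h + expR (- h) <= 2 * expR ((11 / 10) * h ^+ 2).
Proof.
rewrite ler_norml => /andP[h1 h2].
have a1 := @expR_le_inv h; have a2 := @expR_le_inv (- h).
have h3 : h < 1 by lra.
have h4 : - h < 1 by lra.
have := a1 h3; have := a2 h4; rewrite opprK => b1 b2.
have c1 : 0 < 1 - h by lra.
have c2 : 0 < 1 + h by lra.
have e : (1 - h)^-1 + (1 + h)^-1 <= 2 * (1 + (11 / 10) * h ^+ 2).
  rewrite (_ : (1 - h)^-1 + (1 + h)^-1 = 2 / ((1 - h) * (1 + h))).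
    rewrite ler_pdivrMr ?mulr_gt0 //.
    have : 0 <= h ^+ 2 by rewrite sqr_ge0.
    have : h ^+ 2 <= 16^-1.
      by rewrite (_ : 16^-1 = 4^-1 * 4^-1) ?expr2; [nra|field].
    by move=> u1 u2; nra.
  by field; rewrite !lt0r_neq0.
have := expR_ge1Dx ((11 / 10) * h ^+ 2).
by move=> ?; lra.
Qed.

(** Doubling of the argument: if the bound holds at [y] with right side [2 * E], then the left side
    at [2 * y] is at most [4 * E ^ 2 - 2], and this is at most [2 * E ^ 4] because
    [(E ^ 2 - 1) ^ 2 >= 0]. *)
Lemma cosh_le h : expR h + expR (- h) <= 2 * expR ((11 / 10) * h ^+ 2).
Proof.
have main j : forall h, `|h| <= 2 ^+ j / 4 ->
    expR h + expR (- h) <= 2 * expR ((11 / 10) * h ^+ 2).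
  elim: j => [|j IH] x xb; first by apply: cosh_small; move: xb; rewrite expr0 mul1r.
  have hb : `|x / 2| <= 2 ^+ j / 4.
    rewrite normrM normfV (ger0_norm (_ : 0 <= 2)) // ler_pdivrMr //.
    by apply: le_trans xb _; rewrite exprS; lra.
  have := IH _ hb; set y := x / 2; have xE : x = y + y by rewrite /y; field.
  rewrite xE opprD !expRD => hy.
  have p1 := expR_gt0 y; have p2 := expR_gt0 (- y).
  have pm : expR y * expR (- y) = 1 by rewrite -expRD subrr expR0.
  set E := expR ((11 / 10) * y ^+ 2) in hy.
  have -> : expR (11 / 10 * (y + y) ^+ 2) = E ^+ 4.
    by rewrite /E -expRM_natl; congr expR; ring.
  have E1 : 1 <= E by rewrite -[leLHS]expR0 ler_expR mulr_ge0 ?sqr_ge0.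
  have s2 : (expR y + expR (- y)) ^+ 2 <= 4 * E ^+ 2.
    have -> : 4 * E ^+ 2 = (2 * E) ^+ 2 by ring.
    by rewrite lerXn2r ?nnegrE // ltW ?addr_gt0 ?mulr_gt0 // (lt_le_trans ltr01).
  have : 0 <= (E ^+ 2 - 1) ^+ 2 by rewrite sqr_ge0.
  have -> : (E ^+ 2 - 1) ^+ 2 = E ^+ 4 - 2 * E ^+ 2 + 1 by ring.
  move: s2; rewrite sqrrD pm; rewrite !expr2.
  by move=> u1 u2; lra.
pose j := `|Num.ceil (`|h| * 4)|%N.
apply: (main j); rewrite ler_pdivlMr //.
apply: le_trans (ceil_ge _) _; rewrite -natrX.
apply: (@le_trans _ _ j%:R).
  by rewrite /j natr_absz ler_int ler_norm.
by rewrite ler_nat; apply: ltnW; apply: ltn_expl.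
Qed.

Definition sgn (b : bool) : R := if b then 1 else -1.

(** Summing out one sign changes [a] into [a + 22 / 5 * a ^ 2], where [22 / 5] is four times the
    constant of [cosh_le]. The condition on [a] is chosen to survive this change when [j] drops by
    one, and each sign costs at most [expR K^-1]. *)
Lemma rademacher K j a : 0 < K -> 0 <= a -> a * (K + 22 / 5 * j%:R) <= 1 ->
  \sum_(t : j.-tuple bool) expR (a * (\sum_(b <- t) sgn b) ^+ 2) <=
  2 ^+ j * expR (j%:R / K).
Proof.
move=> K0; elim: j a => [|j IH] a a0 aK.
  rewrite (big_pred1 [tuple]) => [|t]; last by rewrite [t]tuple0 /= eqxx.
  by rewrite big_nil expr0n /= mulr0 mul0r expr0 mul1r.
rewrite (big_tuple_cons _ (fun t => expR (a * (\sum_(b <- t) sgn b) ^+ 2))) exchange_big /=.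
have aK' : a <= K^-1.
  rewrite -[leRHS]mul1r ler_pdivlMr //; apply: le_trans aK; apply: ler_wpM2l => //.
  by rewrite lerDl mulr_ge0.
pose a' := a * (1 + 22 / 5 * a).
have a'0 : 0 <= a' by rewrite mulr_ge0 // addr_ge0 ?mulr_ge0.
have step (t : j.-tuple bool) : \sum_e expR (a * (\sum_(b <- e :: t) sgn b) ^+ 2) <=
    2 * expR a * expR (a' * (\sum_(b <- t) sgn b) ^+ 2).
  rewrite big_bool /= !big_cons /=; set S := \sum_(b <- t) _.
  have -> : a * (1 + S) ^+ 2 = (a + a * S ^+ 2) + 2 * a * S by ring.
  have -> : a * (-1 + S) ^+ 2 = (a + a * S ^+ 2) + - (2 * a * S) by ring.
  rewrite !expRD -mulrDr; apply: le_trans (ler_wpM2l _ (cosh_le _)) _.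
    by rewrite mulr_ge0 ?expR_ge0.
  rewrite [leLHS](_ : _ = 2 * (expR a * (expR (a * S ^+ 2) * expR (11 / 10 * (2 * a * S) ^+ 2)))).
    rewrite -!expRD -[leRHS]mulrA -expRD; apply: ler_wpM2l => //; rewrite ler_expR /a'.
    by apply: ler_of_eqA; field.
  by ring.
apply: le_trans (ler_sum _ (fun t _ => step t)) _; rewrite -mulr_sumr.
apply: le_trans (ler_wpM2l _ (IH a' a'0 _)) _.
- by rewrite mulr_ge0 ?expR_ge0.
- have j0 : 0 <= j%:R :> R by rewrite ler0n.
  move: aK; rewrite -[in j.+1%:R]addn1 natrD /a' => aK.
  have X0 : 0 <= K + 22 / 5 * j%:R by rewrite addr_ge0 ?mulr_ge0 // ltW.
  by nra.
have -> : j.+1%:R / K = j%:R / K + K^-1 :> R by rewrite -addn1 natrD mulrDl div1r.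
rewrite exprS expRD.
have := expR_ge0 (j%:R / K : R); have := exprn_ge0 j (ler0n R 2).
have : expR a <= expR K^-1 by rewrite ler_expR.
have := expR_gt0 a.
move=> q1 q2 q3 q4.
rewrite [leLHS](_ : _ = (2 * 2 ^+ j * expR (j%:R / K)) * expR a); last by ring.
rewrite [leRHS](_ : _ = (2 * 2 ^+ j * expR (j%:R / K)) * expR K^-1); last by ring.
by apply: ler_wpM2l; rewrite ?mulr_ge0.
Qed.

Lemma g_low k x y : 0 <= x -> 0 <= y -> x + y = 1 ->
  1 <= 2 ^+ k * (x ^+ k.+1 + y ^+ k.+1).
Proof.
move=> x0 y0 xy; elim: k => [|k IH]; first by rewrite expr0 mul1r !expr1 xy.
have h : x ^+ k.+1 + y ^+ k.+1 <= 2 * (x ^+ k.+2 + y ^+ k.+2).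
  have m : 0 <= (x ^+ k.+1 - y ^+ k.+1) * (x - y).
    case: (leP x y) => xy'.
      by rewrite mulr_le0 // subr_le0 // lerXn2r ?nnegrE.
    by rewrite mulr_ge0 // subr_ge0 ?lerXn2r ?nnegrE // ltW.
  have : x ^+ k.+1 + y ^+ k.+1 = (x ^+ k.+1 + y ^+ k.+1) * (x + y) by rewrite xy mulr1.
  rewrite ![_ ^+ k.+2]exprSr; set X := x ^+ k.+1; set Y := y ^+ k.+1.
  rewrite -/X -/Y in m *; move=> ->; by nra.
apply: le_trans IH _; rewrite [2 ^+ k.+1]exprSr -mulrA.
by apply: ler_wpM2l => //; apply: exprn_ge0.
Qed.

(** The left side is the chance that [k + 1] draws fall on one side. The right side is its chord as
    a function of [4 * (x * y)], with equality at [x * y = 0] and at [x = y]. *)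
Lemma g_up k x y : 0 <= x -> 0 <= y -> x + y = 1 ->
  x ^+ k.+1 + y ^+ k.+1 <= 1 - (1 - (2 ^+ k)^-1) * (4 * (x * y)).
Proof.
move=> x0 y0 xy; elim: k => [|k IH].
  by rewrite !expr1 expr0 invr1 subrr mul0r subr0 xy.
case: k IH => [|k] IH.
  have -> : x ^+ 2 + y ^+ 2 = (x + y) ^+ 2 - 2 * (x * y) by ring.
  by rewrite xy expr1; lra.
have E : x ^+ k.+3 + y ^+ k.+3 = (x ^+ k.+2 + y ^+ k.+2) - x * y * (x ^+ k.+1 + y ^+ k.+1).
  have -> : x ^+ k.+2 + y ^+ k.+2 = (x ^+ k.+2 + y ^+ k.+2) * (x + y) by rewrite xy mulr1.
  by rewrite ![_ ^+ k.+3]exprS ![_ ^+ k.+2]exprS; ring.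
rewrite E; have := g_low k x0 y0 xy.
have p : 0 < 2 ^+ k :> R by rewrite exprn_gt0.
rewrite mulrC -ler_pdivrMr // div1r => lo.
move: IH; rewrite ![2 ^+ _.+1]exprS !invfM => IH.
have xy0 : 0 <= x * y by rewrite mulr_ge0.
set i := (2 ^+ k)^-1 in lo IH *; set G := x ^+ k.+1 + _ in lo *.
set G2 := x ^+ k.+2 + _ in IH *; set P := x * y in IH xy0 *.
have : P * i <= P * G by rewrite ler_wpM2l.
by move=> ?; lra.
Qed.

(** Convexity of the exponential, with the remaining weight placed at [0]. It splits a product of
    powers of two random quantities into a sum whose means can be controlled one by one. *)
Lemma interp (r t a b : R) : 0 <= r -> 0 <= t -> r + t <= 1 ->
  expR (r * a + t * b) <= r * expR a + t * expR b + (1 - r - t).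
Proof.
move=> r0 t0 rt; set c := r * a + t * b.
have tang u : expR c * (1 + (u - c)) <= expR u.
  have -> : expR u = expR c * expR (u - c) by rewrite -expRD; congr expR; ring.
  apply: ler_wpM2l; first exact: expR_ge0.
  exact: expR_ge1Dx.
have h1 := ler_wpM2l r0 (tang a); have h2 := ler_wpM2l t0 (tang b).
have rt0 : 0 <= 1 - r - t by lra.
have h3 := ler_wpM2l rt0 (tang 0).
have cE : r * a + t * b - c = 0 by rewrite /c; ring.
rewrite expR0 mulr1 in h3.
have : r * (expR c * (1 + (a - c))) + t * (expR c * (1 + (b - c))) +
       (1 - r - t) * (expR c * (1 + (0 - c))) = expR c * (1 + (r * a + t * b - c)) by ring.
by rewrite cE addr0 mulr1 => E; lra.
Qed.

Lemma sqr_le_exp x : 0 <= x -> x ^+ 2 <= 4 * expR x.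
Proof.
move=> x0; have h := expR_ge1Dx (x / 2).
have -> : expR x = expR (x / 2) ^+ 2 by rewrite -expRM_natl; congr expR; field.
have : 0 <= x / 2 <= expR (x / 2) by apply/andP; split; lra.
case/andP => u1 u2; have : (x / 2) ^+ 2 <= expR (x / 2) ^+ 2.
  by rewrite lerXn2r ?nnegrE // expR_ge0.
have -> : (x / 2) ^+ 2 = x ^+ 2 / 4 by field.
by lra.
Qed.

End Analytic.
End Moments.

(** * Lower tail of the number of NAE-solutions *)

Module LowerTail.
Import Explore Steps SwitchConf ShortCycle OccProb ClauseCount Weights Resign Moments.
Local Open Scope ring_scope.

Lemma exchange4 (R : nmodType) (I J : finType) (G : I -> I -> J -> J -> R) :
  \sum_s \sum_t \sum_x \sum_y G s t x y = \sum_x \sum_y \sum_s \sum_t G s t x y.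
Proof.
rewrite (pair_bigA _ (fun s t => \sum_x \sum_y G s t x y)) /=.
rewrite (pair_bigA _ (fun x y => \sum_s \sum_t G s t x y)) /=.
rewrite (eq_bigr (fun p => \sum_q G p.1 p.2 q.1 q.2)); last first.
  by move=> p _; rewrite (pair_bigA _ (fun x y => G p.1 p.2 x y)).
rewrite exchange_big /=; apply: eq_bigr => q _.
by rewrite (pair_bigA _ (fun s t => G s t q.1 q.2)).
Qed.

Section Moments.
Variables (R : realType) (n k : nat).
Hypotheses (k3 : (3 <= k)%N) (nk : (2 * k <= n)%N).
Implicit Types (s t : assignment n) (c : clause n k) (cs : seq (clause n k)).

Let q : R := (2 ^+ k.-1)^-1.
Let rh : R := 1 - q.
Let N : R := n%:R.

Lemma q_bd : 0 < q <= 4^-1.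
Proof.
rewrite invr_gt0 exprn_gt0 //= lef_pV2 ?posrE ?exprn_gt0 //.
have -> : 4 = 2 ^+ 2 :> R by rewrite expr2; ring.
by rewrite ler_weXn2l ?ler1n //; case: (k) k3 => [|[|[|k']]].
Qed.

Lemma rho_q : rho R k = rh.
Proof.
have k2 : (2 <= k)%N by apply: ltnW.
rewrite /rho Nb_E // /rh /q -[in 2 ^+ k](prednK (ltnW k2)) exprS.
by field; rewrite expf_neq0.
Qed.

Lemma N_gt0 : 0 < N. Proof. by rewrite ltr0n; apply: leq_trans nk; rewrite muln_gt0 /=; apply: leq_trans k3. Qed.

Definition Np : R := Nv n k R * 2 ^+ k.

Lemma sum_proper s (f : {ffun 'I_k -> 'I_n} -> {ffun 'I_k -> bool} -> R) :
  \sum_(c : clause n k | proper_clause c) f (clx c) (clv s c) =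
  \sum_(v : {ffun 'I_k -> 'I_n} | injectiveb v) \sum_b f v b.
Proof.
rewrite big_mkcond /=.
pose g (v : {ffun 'I_k -> 'I_n}) b : R := if injectiveb v then f v b else 0.
rewrite (eq_bigr (fun c => g (clx c) (clv s c))); last first.
  by move=> c _; rewrite /g properE.
rewrite sum_clause [RHS]big_mkcond /=; apply: eq_bigr => v _.
by rewrite /g; case: ifP => // _; rewrite big1.
Qed.

Lemma sum_ffb : \sum_(b : {ffun 'I_k -> bool}) 1 = 2 ^+ k :> R.
Proof. by rewrite sumr_const card_ffun card_bool card_ord natrX. Qed.

Lemma sum_const : \sum_(b : {ffun 'I_k -> bool}) (~~ nonconst b)%:R = 2 ^+ k * q.
Proof.
have k2 : (2 <= k)%N by apply: ltnW.
have : \sum_(b : {ffun 'I_k -> bool}) (~~ nonconst b)%:R + Nb k R = 2 ^+ k.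
  rewrite -sum_ffb /Nb [in X in _ + X]big_mkcond -big_split /=; apply: eq_bigr => b _.
  by case: nonconst; rewrite ?addr0 ?add0r.
rewrite Nb_E // /q -[in 2 ^+ k](prednK (ltnW k2)) exprS.
have p : (2 ^+ k.-1 : R) != 0 by rewrite expf_neq0.
by rewrite mulfK // => ?; lra.
Qed.

Lemma card_proper : \sum_(c : clause n k | proper_clause c) 1 = Np.
Proof.
rewrite (sum_proper [ffun=> true] (fun _ _ => 1)) (eq_bigr (fun _ => 1 * 2 ^+ k)).
  by rewrite -mulr_suml.
by move=> v _; rewrite sum_ffb mul1r.
Qed.

Lemma sum_viol1 s : \sum_(c : clause n k | proper_clause c) (~~ naec s c)%:R = q * Np.
Proof.
rewrite (sum_proper s (fun _ b => (~~ nonconst b)%:R)) (eq_bigr (fun _ => 1 * (2 ^+ k * q))).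
  by rewrite -mulr_suml /Np -/(Nv n k R); ring.
by move=> v _; rewrite sum_const mul1r.
Qed.

Definition bet s t : R := (\sum_x sgn R (s x == t x)) / N.

Lemma Nv_E : Nv n k R = (n ^_ k)%:R.
Proof.
rewrite /Nv sumr_const; congr (_ *+ _).
by rewrite -[in RHS](card_ord n) -[in RHS](card_ord k) -card_inj_ffuns; apply: eq_card => v; rewrite inE.
Qed.

Lemma inj_in (U : {set 'I_n}) :
  \sum_(v : {ffun 'I_k -> 'I_n} | injectiveb v) [forall j, v j \in U]%:R = (#|U| ^_ k)%:R :> R.
Proof.
rewrite -[in RHS](card_ord k) -(card_inj_ffuns_on _ (mem U)) -sum1_card natr_sum.
rewrite big_mkcond [RHS]big_mkcond /=; apply: eq_bigr => v _.
have -> : (v \in [set f in ffun_on (mem U) | injectiveb f]) =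
    [forall j, v j \in U] && injectiveb v.
  by rewrite inE; congr (_ && _); apply/ffun_onP/forallP.
by case: injectiveb; case: [forall j, _].
Qed.

Lemma ffact_ratio (a : nat) : (a <= n)%N -> (a ^_ k * n ^ k <= a ^ k * n ^_ k)%N.
Proof.
move=> an; elim: k => [|j IH]; first by rewrite !ffactn0.
rewrite !ffactnSr !expnSr mulnACA [in X in (_ <= X)%N]mulnACA.
apply: leq_mul => //; rewrite mulnBl mulnBr; apply: leq_sub2l.
by rewrite mulnC leq_mul2l an orbT.
Qed.

(** Both assignments violate the clause iff it is constant under [s] and all its variables lie on
    the same side of the partition into agreement and disagreement of [s] and [t]. Drawing without
    repetition does not raise this chance, and [g_up] expresses it through the squared overlap. *)
Lemma sum_viol2 s t : \sum_(c : clause n k | proper_clause c) (~~ naec s c && ~~ naec t c)%:R <=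
  Np * (q ^+ 2 + q * rh * bet s t ^+ 2).
Proof.
pose U := [set x | s x == t x].
have k0 : (0 < k)%N by apply: leq_trans k3.
have agree c : ~~ naec s c && ~~ naec t c =
    ~~ nonconst (clv s c) && ([forall j, clx c j \in U] || [forall j, clx c j \in ~: U]).
  rewrite /naec; case: (boolP (nonconst (clv s c))) => //= /existsPn cs.
  have cE (i j : 'I_k) : clv s c i = clv s c j.
    by apply/eqP; apply: contraNT (cs i) => ne; apply/existsP; exists j.
  have st j : clv t c j = (clv s c j == (clx c j \in U)).
    rewrite /U inE !ffunE /sat_literal; case: (tnth c j) => x b /=.
    by case: (s x); case: (t x); case: b.
  apply/existsPn/orP => [ct|H i]; last first.
    apply/existsPn => j; rewrite negbK !st (cE i j).
    case: H => /forallP H; move: (H i) (H j); rewrite ?finset.in_setC.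
      by move=> -> ->; rewrite eqxx.
    by move=> /negbTE -> /negbTE ->; rewrite eqxx.
  pose j0 := Ordinal k0; case: (boolP (clx c j0 \in U)) => j0U; [left|right];
    apply/forallP => j; have := existsPn (ct j) j0; rewrite negbK !st (cE j j0) ?finset.in_setC;
    rewrite ?j0U ?(negbTE j0U); by case: (clv s c j0); case: (clx c j \in U).
rewrite (eq_bigr (fun c => (~~ nonconst (clv s c) && ([forall j, clx c j \in U] ||
   [forall j, clx c j \in ~: U]))%:R)); last by move=> c _; rewrite agree.
rewrite (sum_proper s (fun v b => (~~ nonconst b && ([forall j, v j \in U] ||
   [forall j, v j \in ~: U]))%:R)).
apply: (@le_trans _ _ (\sum_(v : {ffun 'I_k -> 'I_n} | injectiveb v)
    ([forall j, v j \in U]%:R + [forall j, v j \in ~: U]%:R) * (2 ^+ k * q))).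
  apply: ler_sum => v _; rewrite -sum_const mulr_sumr; apply: ler_sum => b _.
  case: (nonconst b) => /=; first by rewrite mulr0.
  by rewrite mulr1; do 2 case: [forall j, _]; rewrite ?addr0 ?add0r // lerDl.
rewrite -mulr_suml big_split /= !inj_in.
set a := #|U|; have aC : #|~: U| = (n - a)%N by rewrite cardsCs finset.setCK card_ord.
have an : (a <= n)%N by rewrite -[X in (_ <= X)%N](card_ord n) max_card.
rewrite aC; pose al : R := a%:R / N; pose ga : R := (n - a)%:R / N.
have N0 := N_gt0.
have frac (b : nat) : (b <= n)%N -> (b ^_ k)%:R <= (b%:R / N) ^+ k * Nv n k R.
  move=> bn; rewrite Nv_E exprMn exprVn mulrAC ler_pdivlMr ?exprn_gt0 //.
  by rewrite /N -!natrX -!natrM ler_nat ffact_ratio.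
have al0 : 0 <= al by rewrite divr_ge0 ?ler0n // ltW.
have ga0 : 0 <= ga by rewrite divr_ge0 ?ler0n // ltW.
have ag : al + ga = 1 by rewrite /al /ga -mulrDl -natrD subnKC // divff // lt0r_neq0.
have bE : bet s t = al - ga.
  rewrite /bet /al /ga -mulrBl; congr (_ / _).
  rewrite (bigID (mem U)) /= (eq_bigr (fun _ => 1)); last by move=> x; rewrite inE => ->.
  rewrite [X in _ + X](eq_bigr (fun _ => -1)); last by move=> x; rewrite inE => /negbTE ->.
  rewrite sumrN; congr (_ - _); rewrite sumr_const // -aC; congr (_ *+ _).
  by apply: eq_card => x; rewrite unfold_in /= !inE.
have := g_up k.-1 al0 ga0 ag; rewrite prednK // -/q => gk.
have b4 : 4 * (al * ga) = 1 - bet s t ^+ 2.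
  transitivity ((al + ga) ^+ 2 - (al - ga) ^+ 2); first by ring.
  by rewrite ag expr1n bE.
rewrite b4 in gk.
apply: (@le_trans _ _ ((al ^+ k + ga ^+ k) * Nv n k R * (2 ^+ k * q))).
  apply: ler_wpM2r; first by rewrite mulr_ge0 ?exprn_ge0 // ltW //; case/andP: q_bd.
  by rewrite mulrDl; apply: lerD; apply: frac => //; apply: leq_subr.
rewrite /Np [leLHS](_ : _ = (Nv n k R * 2 ^+ k) * (q * (al ^+ k + ga ^+ k))); last by ring.
apply: ler_wpM2l; first by rewrite mulr_ge0 ?exprn_ge0 ?Nv_ge0.
rewrite [leRHS](_ : _ = q * (q + rh * bet s t ^+ 2)); last by ring.
apply: ler_wpM2l; first by rewrite ltW //; case/andP: q_bd.
by move: gk; rewrite /rh => ?; lra.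
Qed.

Definition nas cs s := all (naec s) cs.
Definition Zr cs : R := \sum_s (nas cs s)%:R.
(** [vio] is the fraction of solutions destroyed by a new clause, [bb] the mean squared overlap of
    two solutions, [Mr] the number of solutions over its mean, and [Dd] the factor by which a clause
    multiplies [Mr]. *)
Definition vio cs c : R := (\sum_s (nas cs s && ~~ naec s c)%:R) / Zr cs.
Definition bb cs : R := (\sum_s \sum_t (nas cs s && nas cs t)%:R * bet s t ^+ 2) / Zr cs ^+ 2.
Definition EZ (i : nat) : R := 2 ^+ n * rh ^+ i.
Definition Mr cs : R := Zr cs / EZ (size cs).
Definition Dd cs c : R := (1 - vio cs c) / rh.

Lemma rh_gt0 : 0 < rh. Proof. by rewrite /rh; case/andP: q_bd => ? ?; lra. Qed.
Lemma EZ_gt0 i : 0 < EZ i. Proof. by rewrite mulr_gt0 ?exprn_gt0 ?rh_gt0. Qed.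

Lemma Zr_cons cs c : 0 < Zr cs -> Zr (c :: cs) = Zr cs * (1 - vio cs c).
Proof.
move=> Z0; rewrite /vio mulrBr mulr1 mulrCA divff ?lt0r_neq0 // mulr1 /Zr -sumrB.
by apply: eq_bigr => s _ /=; rewrite /nas /=; case: naec; case: all; rewrite ?subr0 ?subrr.
Qed.

Lemma Mr_cons cs c : 0 < Zr cs -> Mr (c :: cs) = Mr cs * Dd cs c.
Proof.
move=> Z0; rewrite /Mr Zr_cons // /Dd /EZ /= exprS.
have := rh_gt0 => r0; field.
by rewrite !lt0r_neq0 ?exprn_gt0.
Qed.

Lemma vio_bd cs c : 0 < Zr cs -> 0 <= vio cs c <= 1.
Proof.
move=> Z0; apply/andP; split.
  by apply: divr_ge0; [apply: sumr_ge0|apply: ltW].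
rewrite /vio ler_pdivrMr // mul1r; apply: ler_sum => s _.
by case: nas; case: naec.
Qed.

Lemma sum_vio cs : 0 < Zr cs -> \sum_(c : clause n k | proper_clause c) vio cs c = q * Np.
Proof.
move=> Z0; rewrite /vio -mulr_suml exchange_big /=.
rewrite (eq_bigr (fun s => (nas cs s)%:R * (q * Np))).
  by rewrite -mulr_suml mulrAC divff ?lt0r_neq0 // mul1r.
move=> s _; rewrite -(sum_viol1 s) mulr_sumr; apply: eq_bigr => c _.
by case: nas; rewrite ?mul1r ?mul0r.
Qed.

(** The second moment of [vio] is a sum over pairs of solutions of the chance to lose both. By
    [sum_viol2] its excess over the independent case is proportional to the squared overlap. *)
Lemma var_vio cs : 0 < Zr cs ->
  \sum_(c : clause n k | proper_clause c) (vio cs c - q) ^+ 2 <= Np * (q * rh * bb cs).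
Proof.
move=> Z0; have Z20 : 0 < Zr cs ^+ 2 by rewrite exprn_gt0.
have sq c : vio cs c ^+ 2 = (\sum_s \sum_t (nas cs s && nas cs t)%:R *
    (~~ naec s c && ~~ naec t c)%:R) / Zr cs ^+ 2.
  rewrite /vio exprMn exprVn; congr (_ / _); rewrite expr2 mulr_suml.
  apply: eq_bigr => s _; rewrite mulr_sumr; apply: eq_bigr => t _.
  by do 2 (case: nas; case: naec); rewrite ?mulr1 ?mulr0 ?mul0r.
have -> : \sum_(c : clause n k | proper_clause c) (vio cs c - q) ^+ 2 =
    \sum_(c : clause n k | proper_clause c) vio cs c ^+ 2 - q ^+ 2 * Np.
  rewrite (eq_bigr (fun c => vio cs c ^+ 2 + ((- (2 * q)) * vio cs c + q ^+ 2 * 1))); last first.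
    by move=> c _; ring.
  rewrite !big_split /= -!mulr_sumr sum_vio // card_proper.
  by set W := \sum_(c | _) _; ring.
rewrite (eq_bigr _ (fun c _ => sq c)) -mulr_suml exchange_big /=.
have -> : q ^+ 2 * Np = (\sum_s \sum_t (nas cs s && nas cs t)%:R * (q ^+ 2 * Np)) / Zr cs ^+ 2.
  rewrite (eq_bigr (fun s => (nas cs s)%:R * (Zr cs * (q ^+ 2 * Np)))).
    by rewrite -mulr_suml -/(Zr cs); field; rewrite lt0r_neq0.
  move=> s _; rewrite /Zr mulr_suml mulr_sumr; apply: eq_bigr => t _.
  by do 2 case: nas; rewrite ?mul1r ?mul0r.
rewrite -mulrBl -sumrB /bb ![Np * _]mulrA mulrA; apply: ler_wpM2r; first by rewrite invr_ge0 ltW.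
rewrite mulr_sumr; apply: ler_sum => s _.
rewrite exchange_big /= -sumrB mulr_sumr; apply: ler_sum => t _.
rewrite -mulr_sumr -mulrBr [leRHS]mulrCA; apply: ler_wpM2l; first by rewrite ler0n.
by have := sum_viol2 s t; lra.
Qed.

(** The two-point correlation of the variables [x] and [y] in a uniform solution. Its mean square
    over all pairs of variables is again [bb]. *)
Definition Qc cs x y : R := (\sum_s (nas cs s)%:R * sgn R (s x == s y)) / Zr cs.

Lemma bb_Q cs : \sum_x \sum_y Qc cs x y ^+ 2 = N ^+ 2 * bb cs.
Proof.
have N0 := N_gt0.
have bE s t : bet s t ^+ 2 = (\sum_x \sum_y sgn R (s x == s y) * sgn R (t x == t y)) / N ^+ 2.
  rewrite /bet exprMn exprVn; congr (_ / _); rewrite expr2 mulr_suml; apply: eq_bigr => x _.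
  rewrite mulr_sumr; apply: eq_bigr => y _.
  by rewrite /sgn; case: (s x); case: (t x); case: (s y); case: (t y) => /=; ring.
rewrite /bb mulrA mulr_sumr.
rewrite (eq_bigr (fun s => \sum_t \sum_x \sum_y (nas cs s)%:R * sgn R (s x == s y) *
    ((nas cs t)%:R * sgn R (t x == t y)))); last first.
  move=> s _; rewrite mulr_sumr; apply: eq_bigr => t _; rewrite bE.
  set W := \sum_x _; transitivity ((nas cs s && nas cs t)%:R * W).
    by field; rewrite lt0r_neq0.
  rewrite /W mulr_sumr; apply: eq_bigr => x _; rewrite mulr_sumr; apply: eq_bigr => y _.
  by do 2 case: nas; rewrite /=; ring.
rewrite exchange4 mulr_suml /=; apply: eq_bigr => x _.
rewrite mulr_suml /=; apply: eq_bigr => y _.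
rewrite /Qc exprMn exprVn; congr (_ / _); rewrite expr2 mulr_suml; apply: eq_bigr => s _.
by rewrite mulr_sumr.
Qed.

Definition hv cs x y : bool := 2^-1 <= `|Qc cs x y|.
Definition triples cs : R := \sum_x \sum_y \sum_z (hv cs x y && (hv cs y z && hv cs x z))%:R.

Lemma sum_hv cs : \sum_x \sum_y (hv cs x y)%:R <= 4 * (N ^+ 2 * bb cs).
Proof.
rewrite -bb_Q mulr_sumr; apply: ler_sum => x _; rewrite mulr_sumr; apply: ler_sum => y _.
case: (boolP (hv cs x y)) => /= [h|_]; last by rewrite mulr_ge0 ?sqr_ge0.
have : 2^-1 ^+ 2 <= `|Qc cs x y| ^+ 2 by rewrite lerXn2r ?nnegrE.
rewrite -normrX (ger0_norm (sqr_ge0 _)) expr2; lra.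
Qed.

(** [hv] is a graph of strongly correlated variables and [triples] counts its triangles, with order
    and repetition. The number of common neighbours is at most the geometric mean of the degrees;
    the parameter [rt] trades a square root for terms linear and quadratic in [bb]. *)
Lemma triples_le cs (rt : R) : 0 < rt ->
  triples cs <= ((4 * (N ^+ 2 * bb cs)) * rt + (4 * (N ^+ 2 * bb cs)) ^+ 2 / rt) / 2.
Proof.
move=> r0; pose a x y : R := (hv cs x y)%:R; pose A := \sum_x \sum_y a x y.
pose deg x : R := \sum_y a x y.
pose co x y : R := \sum_z (hv cs y z && hv cs x z)%:R.
have A0 : 0 <= A by apply: sumr_ge0 => x _; apply: sumr_ge0 => y _; rewrite ler0n.
have AE := sum_hv cs; rewrite -/A in AE.
have d0 x : 0 <= deg x by apply: sumr_ge0 => y _; rewrite ler0n.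
have co0 x y : 0 <= co x y by apply: sumr_ge0 => z _; rewrite ler0n.
have co2 x y : co x y ^+ 2 <= deg x * deg y.
  rewrite expr2; apply: ler_pM => //; apply: ler_sum => z _; rewrite ler_nat;
  by case: hv; case: hv.
have T : triples cs <= (A * rt + A ^+ 2 / rt) / 2.
  have -> : A ^+ 2 = \sum_x \sum_y deg x * deg y.
    by rewrite expr2 {1}/A mulr_suml; apply: eq_bigr => x _; rewrite -/(deg x) mulr_sumr.
  rewrite /triples /A !mulr_suml -big_split /= mulr_suml; apply: ler_sum => x _.
  rewrite !mulr_suml -big_split /= mulr_suml; apply: ler_sum => y _.
  have -> : \sum_z (hv cs x y && (hv cs y z && hv cs x z))%:R = a x y * co x y.
    by rewrite /a; case: (hv cs x y) => /=; [rewrite mul1r|rewrite mul0r big1].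
  have : 0 <= (a x y * rt - co x y) ^+ 2 / rt by rewrite divr_ge0 ?sqr_ge0 // ltW.
  have aa : a x y ^+ 2 = a x y by rewrite /a; case: hv; rewrite ?expr1n ?expr0n.
  have -> : (a x y * rt - co x y) ^+ 2 / rt = a x y ^+ 2 * rt - 2 * (a x y * co x y) + co x y ^+ 2 / rt.
    by field; rewrite lt0r_neq0.
  rewrite aa; have : co x y ^+ 2 / rt <= deg x * deg y / rt by rewrite ler_pM2r ?invr_gt0.
  set u := co x y ^+ 2 / rt; set v := deg x * deg y / rt; set w := a x y * co x y.
  by move=> *; lra.
apply: le_trans T _; rewrite ler_pM2r //; apply: lerD; first by rewrite ler_pM2r.
by rewrite ler_pM2r ?invr_gt0 // lerXn2r ?nnegrE // (le_trans A0).
Qed.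

(** Such a clause is violated by more than [7 / 8] of the solutions and is constant on them, so any
    two of its literals agree with this frequency. The correlation of their variables then exceeds
    [2 * 7 / 8 - 1] in absolute value. *)
Lemma small_D cs c : 0 < Zr cs -> Dd cs c < 8^-1 ->
  forall i j, hv cs (clx c i) (clx c j).
Proof.
move=> Z0 D8 i j; have r0 := rh_gt0.
have v78 : 7 / 8 < vio cs c.
  move: D8; rewrite /Dd ltr_pdivrMr // /rh; case/andP: q_bd => ? ? ?; lra.
pose dl : bool := (tnth c i).2 == (tnth c j).2.
have key : 2 * vio cs c - 1 <= sgn R dl * Qc cs (clx c i) (clx c j).
  rewrite /Qc mulrA ler_pdivlMr // mulrBl mul1r /vio mulrA divfK ?lt0r_neq0 //.
  rewrite /Zr !mulr_sumr -sumrB; apply: ler_sum => s _.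
  case: (nas cs s) => /=; last by rewrite mul0r !mulr0 subrr.
  rewrite mul1r; case: (boolP (naec s c)) => nc /=.
    by rewrite mulr0 /sgn; case: dl; case: eqP => _; lra.
  have E : clv s c i = clv s c j.
    apply/eqP; apply: contraNT nc => ne; apply/existsP; exists i; apply/existsP; by exists j.
  move: E; rewrite !ffunE /sat_literal /dl /sgn.
  by case: (tnth c i) => x b; case: (tnth c j) => y b' /=;
     case: (s x); case: (s y); case: b; case: b' => //= _; lra.
rewrite /hv; apply: (@le_trans _ _ (sgn R dl * Qc cs (clx c i) (clx c j))).
  by apply: le_trans key; lra.
apply: le_trans (ler_norm _) _; rewrite normrM /sgn.
by case: ifP => _; rewrite ?normrN normr1 mul1r.
Qed.

Lemma swap3 (i0 i1 i2 : 'I_k) (f : 'I_n -> 'I_n -> 'I_n -> R) :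
  i0 != i1 -> i0 != i2 -> i1 != i2 ->
  N ^+ 3 * (\sum_(v : {ffun 'I_k -> 'I_n}) f (v i0) (v i1) (v i2)) =
  N ^+ k * (\sum_x \sum_y \sum_z f x y z).
Proof.
move=> n01 n02 n12.
pose u (p : {ffun 'I_k -> 'I_n} * ('I_n * ('I_n * 'I_n))) :
    {ffun 'I_k -> 'I_n} * ('I_n * ('I_n * 'I_n)) :=
  ([ffun i => if i == i0 then p.2.1 else if i == i1 then p.2.2.1
     else if i == i2 then p.2.2.2 else p.1 i],
   (p.1 i0, (p.1 i1, p.1 i2))).
have uK : involutive u.
  case=> v [x [y z]]; rewrite /u /=; congr pair.
    apply/ffunP => i; rewrite !ffunE; case: eqP => [->|_] //; case: eqP => [->|_] //.
    by case: eqP => [->|_].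
  by rewrite !ffunE !eqxx (eq_sym i1) (eq_sym i2 i0) (eq_sym i2 i1) (negbTE n01) (negbTE n02) (negbTE n12).
transitivity (\sum_(p : {ffun 'I_k -> 'I_n} * ('I_n * ('I_n * 'I_n))) f (p.1 i0) (p.1 i1) (p.1 i2)).
  rewrite -(pair_bigA _ (fun (v : {ffun 'I_k -> 'I_n}) _ => f (v i0) (v i1) (v i2))) /=.
  rewrite mulr_sumr; apply: eq_bigr => v _.
  rewrite sumr_const !card_prod card_ord -[RHS]mulr_natl !natrM; congr (_ * _).
rewrite (reindex_inj (inv_inj uK)) /=.
rewrite (eq_bigr (fun p : {ffun 'I_k -> 'I_n} * ('I_n * ('I_n * 'I_n)) => f p.2.1 p.2.2.1 p.2.2.2)).
  rewrite -(pair_bigA _ (fun (v : {ffun 'I_k -> 'I_n}) p => f p.1 p.2.1 p.2.2)) /=.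
  rewrite sumr_const card_ffun !card_ord -[LHS]mulr_natl natrX; congr (_ * _).
  rewrite -(pair_bigA _ (fun x p => f x p.1 p.2)) /=; apply: eq_bigr => x _.
  by rewrite -(pair_bigA _ (fun y z => f x y z)).
move=> [v [x [y z]]] _ /=.
by rewrite !ffunE !eqxx (eq_sym i1) (eq_sym i2 i0) (eq_sym i2 i1) (negbTE n01) (negbTE n02) (negbTE n12).
Qed.

Lemma Nv_low : N ^+ k <= 2 ^+ k * Nv n k R.
Proof.
rewrite Nv_E -!natrX -natrM ler_nat.
suff H j : (j <= k)%N -> (n ^ j <= 2 ^ j * n ^_ j)%N by apply: H.
elim: j => [//|j IH] jk; rewrite !expnS ffactnSr.
rewrite [(n ^_ j * _)%N]mulnC mulnACA; apply: leq_mul; last by apply: IH; apply: ltnW.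
by move: nk jk; clear; lia.
Qed.

(** Three positions of the clause must form a triangle of [hv]; the factor [2 ^ k] accounts for
    passing to tuples with repetitions. *)
Lemma count_small cs : 0 < Zr cs ->
  \sum_(c : clause n k | proper_clause c) (Dd cs c < 8^-1)%R%:R <=
  2 ^+ k * Np * (triples cs / N ^+ 3).
Proof.
move=> Z0; have N0 := N_gt0.
have k0 : (0 < k)%N by apply: leq_trans k3.
have k1 : (1 < k)%N by apply: leq_trans k3.
pose i0 := Ordinal k0; pose i1 := Ordinal k1; pose i2 := Ordinal k3.
pose f x y z : R := (hv cs x y && (hv cs y z && hv cs x z))%:R.
rewrite mulrA ler_pdivlMr ?exprn_gt0 //.
apply: (@le_trans _ _ (2 ^+ k * (N ^+ 3 * (\sum_(v : {ffun 'I_k -> 'I_n}) f (v i0) (v i1) (v i2))))).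
  rewrite mulrC mulrCA; apply: ler_wpM2l; first by rewrite exprn_ge0 // ltW.
  apply: (@le_trans _ _ (\sum_(c : clause n k | proper_clause c) f (clx c i0) (clx c i1) (clx c i2))).
    apply: ler_sum => c _; case: (ltP (Dd cs c)) => D8; last by rewrite ler0n.
    by rewrite /f !(small_D Z0 D8).
  rewrite (sum_proper [ffun=> true] (fun v _ => f (v i0) (v i1) (v i2))).
  rewrite mulr_sumr [leLHS]big_mkcond /=; apply: ler_sum => v _; case: ifP => _.
    by rewrite sumr_const card_ffun card_bool card_ord -[leLHS]mulr_natl natrX.
  by rewrite mulr_ge0 ?exprn_ge0.
rewrite swap3 // -/(triples cs) mulrA; apply: ler_wpM2r.
  by do 3 (apply: sumr_ge0 => ? _); rewrite ler0n.
rewrite ler_wpM2l ?exprn_ge0 // /Np mulrC.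
exact: Nv_low.
Qed.

Let s0 : R := 30^-1.
(* By Jensen's inequality [expR (s0 * (N * bb cs))] is at most [Yr cs / Mr cs ^+ 2],
   and [Yr] has bounded mean: this controls the overlap during the exposure. *)
Definition Yr cs : R :=
  (\sum_s \sum_t (nas cs s && nas cs t)%:R * expR (s0 * (N * bet s t ^+ 2))) / EZ (size cs) ^+ 2.

Lemma sum_nas2 cs : \sum_s \sum_t (nas cs s && nas cs t)%:R = Zr cs ^+ 2 :> R.
Proof.
rewrite expr2 /Zr mulr_suml; apply: eq_bigr => s _; rewrite mulr_sumr; apply: eq_bigr => t _.
by do 2 case: nas; rewrite ?mulr1 ?mulr0.
Qed.

Lemma jensen cs : 0 < Zr cs -> expR (s0 * (N * bb cs)) <= Yr cs / Mr cs ^+ 2.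
Proof.
move=> Z0; have Z2 : 0 < Zr cs ^+ 2 by rewrite exprn_gt0.
have EZ0 := EZ_gt0 (size cs).
have -> : Yr cs / Mr cs ^+ 2 =
   (\sum_s \sum_t (nas cs s && nas cs t)%:R * expR (s0 * (N * bet s t ^+ 2))) / Zr cs ^+ 2.
  by rewrite /Yr /Mr; set W := \sum_s _; field; rewrite !lt0r_neq0.
rewrite ler_pdivlMr //; set b := s0 * (N * bb cs).
have lower : \sum_s \sum_t (nas cs s && nas cs t)%:R * (expR b * (1 + (s0 * (N * bet s t ^+ 2) - b)))
    = expR b * Zr cs ^+ 2.
  transitivity (expR b * (1 - b) * (\sum_s \sum_t (nas cs s && nas cs t)%:R) +
     expR b * (s0 * N) * (\sum_s \sum_t (nas cs s && nas cs t)%:R * bet s t ^+ 2)).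
    rewrite !mulr_sumr -big_split /=; apply: eq_bigr => s _.
    by rewrite !mulr_sumr -big_split /=; apply: eq_bigr => t _; ring.
  rewrite sum_nas2; have -> : \sum_s \sum_t (nas cs s && nas cs t)%:R * bet s t ^+ 2 = bb cs * Zr cs ^+ 2.
    by rewrite /bb divfK // lt0r_neq0.
  by rewrite /b; ring.
rewrite -lower; apply: ler_sum => s _; apply: ler_sum => t _; apply: ler_wpM2l; first by rewrite ler0n.
set y := s0 * _; have -> : expR y = expR b * expR (y - b) by rewrite -expRD; congr expR; ring.
by apply: ler_wpM2l; [exact: expR_ge0|exact: expR_ge1Dx].
Qed.

Lemma Psum_cons i (f : seq (clause n k) -> R) :
  \sum_(F : i.+1.-tuple (clause n k) | all (@proper_clause n k) F) f F =
  \sum_(c : clause n k | proper_clause c)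
    \sum_(F : i.-tuple (clause n k) | all (@proper_clause n k) F) f (c :: F).
Proof.
rewrite big_mkcond /= (big_tuple_cons _ (fun F => if all (@proper_clause n k) F then f F else 0)).
rewrite [RHS]big_mkcond /=; apply: eq_bigr => c _; case: (proper_clause c) => /=.
  by rewrite [RHS]big_mkcond.
by rewrite big1.
Qed.

Lemma Psum0 (f : seq (clause n k) -> R) :
  \sum_(F : 0.-tuple (clause n k) | all (@proper_clause n k) F) f F = f [::].
Proof.
rewrite (big_pred1 [tuple]) // => F; rewrite [F]tuple0 /= eqxx //.
Qed.

Let kap : R := q / rh.

(** The constants fit exactly: [1 / 6] from the clauses and [s0 = 1 / 30] from the weight add up to
    [1 / 5], and [rademacher] with [K = 3 / 5 * N] applies because [1 / 5 * (3 / 5 + 22 / 5) = 1].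
    Its value is then [expR (5 / 3)]. *)
Lemma EY i : i%:R * kap <= N / 6 ->
  \sum_(F : i.-tuple (clause n k) | all (@proper_clause n k) F) Yr F <= Np ^+ i * expR (5 / 3).
Proof.
move=> ik; have N0 := N_gt0; have r0 := rh_gt0; case/andP: q_bd => q0 q4.
have Np0 : 0 <= Np by rewrite /Np mulr_ge0 ?Nv_ge0 ?exprn_ge0.
have EZ0 := EZ_gt0 i.
pose G s t : R := \sum_(c : clause n k | proper_clause c) (naec s c && naec t c)%:R.
have GE s t : 0 <= G s t <= Np * rh ^+ 2 * expR (kap * bet s t ^+ 2).
  apply/andP; split; first by apply: sumr_ge0.
  have : G s t = Np - q * Np - q * Np +
      \sum_(c : clause n k | proper_clause c) (~~ naec s c && ~~ naec t c)%:R.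
    rewrite -{2}(sum_viol1 s) -(sum_viol1 t) -card_proper -!sumrB -big_split /=.
    by apply: eq_bigr => c _; case: naec; case: naec => /=; ring.
  move=> ->; have := sum_viol2 s t => v2.
  apply: (@le_trans _ _ (Np * (rh ^+ 2 + q * rh * bet s t ^+ 2))).
    by move: v2; rewrite /rh => ?; lra.
  rewrite -[leRHS]mulrA; apply: ler_wpM2l => //.
  have -> : rh ^+ 2 + q * rh * bet s t ^+ 2 = rh ^+ 2 * (1 + kap * bet s t ^+ 2).
    by rewrite /kap; field; rewrite lt0r_neq0.
  by apply: ler_wpM2l; [rewrite exprn_ge0 // ltW|exact: expR_ge1Dx].
have prod s t : \sum_(F : i.-tuple (clause n k) | all (@proper_clause n k) F)
    (nas F s && nas F t)%:R = G s t ^+ i.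
  elim: i {ik EZ0} => [|i IH]; first by rewrite (Psum0 (fun F => (nas F s && nas F t)%:R)).
  rewrite (Psum_cons _ (fun F => (nas F s && nas F t)%:R)) exprS -IH mulr_suml; apply: eq_bigr => c _.
  rewrite mulr_sumr; apply: eq_bigr => F _; rewrite /nas /=.
  by case: naec; case: naec; rewrite ?mul1r ?mul0r //= andbF.
have -> : \sum_(F : i.-tuple (clause n k) | all (@proper_clause n k) F) Yr F =
    (\sum_s \sum_t G s t ^+ i * expR (s0 * (N * bet s t ^+ 2))) / EZ i ^+ 2.
  rewrite /Yr (eq_bigr (fun F : i.-tuple (clause n k) => (\sum_s \sum_t (nas F s && nas F t)%:R *
     expR (s0 * (N * bet s t ^+ 2))) / EZ i ^+ 2)); last by move=> F _; rewrite size_tuple.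
  rewrite -mulr_suml exchange_big /=; congr (_ / _); apply: eq_bigr => s _.
  rewrite exchange_big /=; apply: eq_bigr => t _.
  by rewrite -prod mulr_suml.
rewrite ler_pdivrMr ?exprn_gt0 //.
pose a : R := (5 * N)^-1.
have a0 : 0 <= a by rewrite invr_ge0 mulr_ge0 // ltW.
have term s t : G s t ^+ i * expR (s0 * (N * bet s t ^+ 2)) <=
    Np ^+ i * rh ^+ (2 * i) * expR (a * (\sum_x sgn R (s x == t x)) ^+ 2).
  have /andP[G0 G1] := GE s t.
  apply: (@le_trans _ _ ((Np * rh ^+ 2 * expR (kap * bet s t ^+ 2)) ^+ i *
     expR (s0 * (N * bet s t ^+ 2)))).
    by apply: ler_wpM2r; [exact: expR_ge0|rewrite lerXn2r ?nnegrE // (le_trans G0)].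
  rewrite 2!exprMn -(exprM rh) -expRM_natl -[leLHS]mulrA -expRD.
  apply: ler_wpM2l; first by rewrite mulr_ge0 ?exprn_ge0 // ltW.
  rewrite ler_expR; have b0 : 0 <= bet s t ^+ 2 by rewrite sqr_ge0.
  have -> : a * (\sum_x sgn R (s x == t x)) ^+ 2 = N / 5 * bet s t ^+ 2.
    by rewrite /a /bet; set W := \sum_x _; field; rewrite lt0r_neq0.
  have := ler_wpM2r b0 ik; rewrite /s0 -mulrA => h; lra.
have inner s : \sum_(t : assignment n) expR (a * (\sum_x sgn R (s x == t x)) ^+ 2) <= 2 ^+ n * expR (5 / 3).
  have -> : \sum_(t : assignment n) expR (a * (\sum_x sgn R (s x == t x)) ^+ 2) =
     \sum_(u : n.-tuple bool) expR (a * (\sum_(b <- u) sgn R b) ^+ 2).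
    pose g (u : n.-tuple bool) : assignment n := [ffun x => s x == tnth u x].
    rewrite (reindex g) /=; last first.
      exists (fun t : assignment n => [tuple s x == t x | x < n]) => [u _|t _].
        by apply: eq_from_tnth => x; rewrite tnth_mktuple /g ffunE; case: (s x); case: (tnth u x).
      by apply/ffunP => x; rewrite ffunE tnth_mktuple; case: (s x); case: (t x).
    apply: eq_bigr => u _; congr (expR (_ * _ ^+ 2)).
    by rewrite big_tuple; apply: eq_bigr => x _; rewrite /g ffunE; case: (s x); case: (tnth u x).
  have K0 : 0 < 3 / 5 * N by rewrite mulr_gt0.
  apply: le_trans (rademacher K0 a0 _) _.
    apply: ler_of_eqA; rewrite /a -/N; by field; rewrite lt0r_neq0.
  apply: ler_of_eqA; congr (_ * expR _); rewrite -/N; by field; rewrite lt0r_neq0.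
apply: (@le_trans _ _ (\sum_(s : assignment n) Np ^+ i * rh ^+ (2 * i) * (2 ^+ n * expR (5 / 3)))).
  apply: ler_sum => s _; apply: le_trans (ler_sum _ (fun t _ => term s t)) _.
  rewrite -mulr_sumr; apply: ler_wpM2l; last exact: inner.
  by rewrite mulr_ge0 ?exprn_ge0 // ltW.
rewrite sumr_const card_ffun card_bool card_ord -[leLHS]mulr_natl natrX /EZ.
by apply: ler_of_eqA; rewrite mulnC exprM; ring.
Qed.

Lemma kap_bd : 0 < kap <= 3^-1.
Proof.
case/andP: q_bd => q0 q4; have r0 := rh_gt0; rewrite divr_gt0 //=.
by rewrite ler_pdivrMr // /rh; lra.
Qed.

(** No clause multiplies [Mr] by less than [1 / 8]; this removes the jumps that would spoil a
    negative moment. *)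
Fixpoint good cs : bool :=
  if cs is c :: cs' then good cs' && (8^-1 <= Dd cs' c)%R else true.

Lemma Zr_nil : Zr [::] = 2 ^+ n.
Proof. by rewrite /Zr /= sumr_const card_ffun card_bool card_ord natrX. Qed.

Lemma Mr_nil : Mr [::] = 1.
Proof. by rewrite /Mr /EZ Zr_nil expr0 mulr1 divff // expf_neq0. Qed.

Lemma good_pos cs : good cs -> 0 < Zr cs.
Proof.
elim: cs => [|c cs IH] /=; first by rewrite Zr_nil exprn_gt0.
case/andP => /IH Z0 D8; rewrite Zr_cons // mulr_gt0 //.
have r0 := rh_gt0; move: D8; rewrite /Dd ler_pdivlMr // => ?; nra.
Qed.

Lemma Mr_gt0 cs : 0 < Zr cs -> 0 < Mr cs.
Proof. by move=> Z0; rewrite divr_gt0 // EZ_gt0. Qed.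

Lemma Yr_gt0 cs : 0 < Zr cs -> 0 < Yr cs.
Proof.
move=> Z0; have := lt_le_trans (expR_gt0 _) (jensen Z0).
by rewrite pmulr_lgt0 // invr_gt0 exprn_gt0 // Mr_gt0.
Qed.

Definition ell cs : R := - ln (Mr cs).

(** Logarithm of [jensen]: a large overlap forces [Yr] to be large or [Mr] to be small, and the
    means of both are under control along the exposure. *)
Lemma bb_ell cs : 0 < Zr cs -> s0 * (N * bb cs) <= ln (Yr cs) + 2 * ell cs.
Proof.
move=> Z0; have M0 := Mr_gt0 Z0; have Y0 := Yr_gt0 Z0.
have -> : ln (Yr cs) + 2 * ell cs = ln (Yr cs / Mr cs ^+ 2).
  rewrite lnM ?posrE ?invr_gt0 ?exprn_gt0 // lnV ?posrE ?exprn_gt0 // expr2 lnM ?posrE //.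
  by rewrite /ell; ring.
rewrite -ler_expR lnK; first exact: jensen.
by rewrite posrE divr_gt0 // exprn_gt0.
Qed.

Lemma bb_ge0 cs : 0 <= bb cs.
Proof.
rewrite /bb divr_ge0 ?sqr_ge0 //; apply: sumr_ge0 => s _; apply: sumr_ge0 => t _.
by rewrite mulr_ge0 ?sqr_ge0.
Qed.

(** With [Dd = 1 - X >= 1 / 8] one has [Dd^-1 <= 1 + X + 8 * X ^ 2]. The linear term averages to
    zero, as [Mr] is a martingale, and the quadratic term is a variance, bounded through [bb]. *)
Lemma step_bound cs (th : R) : 0 < Zr cs -> 0 <= th <= 1 ->
  \sum_(c : clause n k | proper_clause c)
    (8^-1 <= Dd cs c)%R%:R * expR (th * ell (c :: cs)) <=
  Np * (expR (th * ell cs) * (1 + 8 * th * (kap * bb cs))).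
Proof.
move=> Z0 /andP[th0 th1]; have r0 := rh_gt0; case/andP: q_bd => q0 q4.
pose X c := 1 - Dd cs c.
have XE c : X c = (vio cs c - q) / rh by rewrite /X /Dd /rh; field; rewrite lt0r_neq0 // -/rh.
have each c : (8^-1 <= Dd cs c)%R%:R * expR (th * ell (c :: cs)) <=
    expR (th * ell cs) * (1 + th * (X c + 8 * X c ^+ 2)).
  have X1 : - (1 / 3) <= X c.
    have /andP[v0 v1] := vio_bd c Z0.
    by rewrite XE ler_pdivlMr // /rh; lra.
  have p0 : 0 <= 1 + th * (X c + 8 * X c ^+ 2).
    have : 0 <= X c ^+ 2 by rewrite sqr_ge0.
    by move=> ?; nra.
  case: (boolP (8^-1 <= Dd cs c)) => D8; last by rewrite mul0r mulr_ge0 // expR_ge0.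
  have D0 : 0 < Dd cs c by lra.
  rewrite mul1r /ell Mr_cons // lnM ?posrE ?Mr_gt0 // opprD mulrDr expRD.
  apply: ler_wpM2l; first exact: expR_ge0.
  have th10 : th + 0 <= 1 by rewrite addr0.
  have := interp (- ln (Dd cs c)) 0 th0 (lexx 0) th10.
  rewrite mul0r !addr0 mul0r addr0 subr0 expRN lnK ?posrE // => h.
  apply: le_trans h _.
  have : (Dd cs c)^-1 <= 1 + X c + 8 * X c ^+ 2.
    have -> : (Dd cs c)^-1 = 1 + X c + X c ^+ 2 / Dd cs c.
      by rewrite /X; field; rewrite lt0r_neq0.
    rewrite lerD2l mulrC; apply: ler_wpM2r; first by rewrite sqr_ge0.
    by rewrite invf_ple ?posrE.
  by move=> ?; nra.
apply: le_trans (ler_sum _ (fun c _ => each c)) _.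
rewrite -mulr_sumr mulrCA; apply: ler_wpM2l; first exact: expR_ge0.
have sX : \sum_(c : clause n k | proper_clause c) X c = 0.
  rewrite (eq_bigr (fun c => (vio cs c - q * 1) / rh)); last by move=> c _; rewrite XE mulr1.
  rewrite -mulr_suml sumrB -mulr_sumr sum_vio // card_proper subrr mul0r //.
have sX2 : \sum_(c : clause n k | proper_clause c) X c ^+ 2 <= Np * (kap * bb cs).
  rewrite (eq_bigr (fun c => (vio cs c - q) ^+ 2 / rh ^+ 2)); last first.
    by move=> c _; rewrite XE exprMn exprVn.
  rewrite -mulr_suml ler_pdivrMr ?exprn_gt0 //; apply: le_trans (var_vio Z0) _.
  by apply: ler_of_eqA; rewrite /kap; field; rewrite lt0r_neq0.
rewrite (eq_bigr (fun c => 1 + (th * X c + (th * 8) * X c ^+ 2))); last by move=> c _; ring.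
rewrite big_split /= card_proper big_split /= -!mulr_sumr sX mulr0 add0r.
have := ler_wpM2l (_ : 0 <= th * 8) sX2; rewrite mulr_ge0 // => /(_ isT).
by move=> ?; lra.
Qed.

(** [240] is the factor [8] of [step_bound] times [s0^-1 = 30]. After [i] clauses the exponent of
    the negative moment is [ww ^ i]: its decrease in each step pays for the term [2 * ell] of
    [bb_ell]. As [i * kap <= N / 6], the whole loss is at most [expR (3 * 240 / 6)], whence
    [thm]. *)
Let k1 : R := 240 * kap.
Let ww : R := (1 + 3 * k1 / N)^-1.
Let E0 : R := expR (5 / 3).
Let thm : R := expR (- 120).

Lemma k1_gt0 : 0 < k1. Proof. by rewrite mulr_gt0 //; case/andP: kap_bd. Qed.

Lemma den_gt0 : 0 < 1 + 3 * k1 / N.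
Proof. by rewrite addr_gt0 // divr_gt0 ?N_gt0 // mulr_gt0 // k1_gt0. Qed.

Lemma ww_bd : 0 < ww <= 1.
Proof.
rewrite invr_gt0 den_gt0 /= invf_le1 ?den_gt0 // lerDl.
by rewrite divr_ge0 ?ltW ?N_gt0 // mulr_gt0 // k1_gt0.
Qed.

Lemma th_low i : i%:R * kap <= N / 6 -> thm <= ww ^+ i <= 1.
Proof.
move=> ik; have N0 := N_gt0; case/andP: ww_bd => w0 w1.
have -> : ww ^+ i <= 1 by apply: exprn_ile1 => //; apply: ltW.
rewrite andbT /ww exprVn.
have h : (1 + 3 * k1 / N) ^+ i <= expR 120.
  apply: (@le_trans _ _ (expR (3 * k1 / N) ^+ i)).
    by rewrite lerXn2r ?nnegrE ?expR_ge0 ?expR_ge1Dx // ltW ?den_gt0.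
  rewrite -expRM_natl ler_expR /k1.
  have -> : i%:R * (3 * (240 * kap) / N) = 720 * (i%:R * kap) / N by ring.
  by rewrite ler_pdivrMr //; lra.
rewrite /thm expRN lef_pV2 ?posrE ?expR_gt0 ?exprn_gt0 ?den_gt0 //.
Qed.

Definition Hsum i : R := \sum_(F : i.-tuple (clause n k) | all (@proper_clause n k) F)
  (good F)%:R * expR (ww ^+ i * ell F).

Lemma Np_ge0 : 0 <= Np. Proof. by rewrite /Np mulr_ge0 ?Nv_ge0 ?exprn_ge0. Qed.

Lemma card_P i : \sum_(F : i.-tuple (clause n k) | all (@proper_clause n k) F) 1 = Np ^+ i.
Proof.
elim: i => [|i IH]; first by rewrite (Psum0 (fun _ => 1)) expr0.
rewrite (Psum_cons _ (fun _ => 1)) (eq_bigr (fun _ => 1 * Np ^+ i)).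
  by rewrite -mulr_suml card_proper exprS.
by move=> c _; rewrite IH mul1r.
Qed.

Lemma E0_ge1 : 1 <= E0. Proof. by rewrite /E0 -[leLHS]expR0 ler_expR; lra. Qed.

(** By [bb_ell] the growth in one step is a small power of [Yr] times a small negative power of
    [Mr]. The latter is absorbed by the decrease of the exponent from [th] to [th']; [interp] then
    leaves a convex combination of [expR (th * ell)], [Yr] and [1], each of mean at most [E0]. *)
Lemma Hbound i : i%:R * kap <= N / 6 -> Hsum i <= Np ^+ i * E0.
Proof.
have N0 := N_gt0; case/andP: ww_bd => w0 w1; have k10 := k1_gt0.
case/andP: kap_bd => kap0 _.
elim: i => [|i IH] ik.
  rewrite /Hsum (Psum0 (fun F => (good F)%:R * expR (ww ^+ 0 * ell F))) /= !expr0.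
  by rewrite /ell Mr_nil ln1 oppr0 mulr0 expR0 !mul1r E0_ge1.
have ik' : i%:R * kap <= N / 6.
  by apply: le_trans ik; rewrite ler_wpM2r ?ler_nat // ltW.
have HI := IH ik'; have YI := EY ik'.
set th := ww ^+ i; pose th' := th * ww.
have th0 : 0 < th by rewrite exprn_gt0.
have th1 : th <= 1 by rewrite exprn_ile1 // ltW.
have th'01 : 0 <= th' <= 1.
  apply/andP; split; first by apply: mulr_ge0; apply: ltW.
  by rewrite -[leRHS](mulr1 1); apply: ler_pM => //; apply: ltW.
(* Weights for [interp]: [t] is the power of [Yr], and [r] satisfies [r * th = th' + 2 * t], the
   total power of [Mr^-1]. *)
pose t := k1 * th' / N; pose r := ww + 2 * k1 * ww / N.
have t0 : 0 <= t.
  by apply: divr_ge0; [apply: mulr_ge0; [exact: ltW|case/andP: th'01]|exact: ltW].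
have r0 : 0 <= r.
  apply: addr_ge0; first exact: ltW.
  by apply: divr_ge0; [apply: mulr_ge0; [apply: mulr_ge0 => //; exact: ltW|exact: ltW]|exact: ltW].
have rt : r + t <= 1.
  have -> : 1 = ww * (1 + 3 * k1 / N) by rewrite mulVf // lt0r_neq0 ?den_gt0.
  have : t <= k1 * ww / N.
    rewrite /t /th' ler_pM2r ?invr_gt0 // ler_pM2l //.
    by rewrite -[leRHS]mul1r; apply: ler_wpM2r => //; apply: ltW.
  rewrite /r; move=> ?; have -> : ww * (1 + 3 * k1 / N) = ww + 2 * k1 * ww / N + k1 * ww / N by ring.
  by lra.
have step (F : i.-tuple (clause n k)) : good F ->
   \sum_(c : clause n k | proper_clause c)
    (8^-1 <= Dd F c)%R%:R * expR (th' * ell (c :: F)) <=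
   Np * (r * expR (th * ell F) + t * Yr F + (1 - r - t)).
  move=> gF; have Z0 := good_pos gF.
  apply: le_trans (step_bound Z0 th'01) _; apply: ler_wpM2l; first exact: Np_ge0.
  have := interp (th * ell F) (ln (Yr F)) r0 t0 rt; rewrite lnK ?posrE ?Yr_gt0 //.
  apply: le_trans.
  have E1 : 1 + 8 * th' * (kap * bb F) <= expR (t * (ln (Yr F) + 2 * ell F)).
    apply: le_trans (expR_ge1Dx _) _; rewrite ler_expR.
    have := ler_wpM2l t0 (bb_ell Z0); apply: le_trans; apply: ler_of_eqA.
    by rewrite /t /k1 /s0; field; rewrite lt0r_neq0.
  apply: le_trans (ler_wpM2l (expR_ge0 _) E1) _.
  rewrite -expRD ler_expR; apply: ler_of_eqA; rewrite /r /t /th'.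
  by field; rewrite lt0r_neq0.
rewrite /Hsum (Psum_cons _ (fun F => (good F)%:R * expR (ww ^+ i.+1 * ell F))) exchange_big /=.
apply: (@le_trans _ _ (\sum_(F : i.-tuple (clause n k) | all (@proper_clause n k) F)
   Np * (r * ((good F)%:R * expR (th * ell F)) + t * Yr F + (1 - r - t) * 1))).
  apply: ler_sum => F _; have [gF|gF] := boolP (good F); last first.
    rewrite big1 ?mul0r ?mulr0 ?add0r; last by move=> c _; rewrite mul0r.
    have Y0 : 0 <= Yr F.
      rewrite /Yr divr_ge0 ?sqr_ge0 //; do 2 (apply: sumr_ge0 => ? _).
      by rewrite mulr_ge0 ?expR_ge0.
    by apply: mulr_ge0; [exact: Np_ge0|apply: addr_ge0; [exact: mulr_ge0|rewrite mulr1; lra]].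
  rewrite mul1r mulr1; apply: le_trans (step F gF); apply: ler_of_eqA; apply: eq_bigr => c _.
  by rewrite exprSr.
rewrite -mulr_sumr !big_split /= -!mulr_sumr card_P exprS -mulrA; apply: ler_wpM2l; first exact: Np_ge0.
have h1 := ler_wpM2l r0 HI; have h2 := ler_wpM2l t0 YI.
have h3 : (1 - r - t) * Np ^+ i <= (1 - r - t) * (Np ^+ i * E0).
  apply: ler_wpM2l; first by lra.
  by rewrite ler_peMr ?E0_ge1 // exprn_ge0 // Np_ge0.
rewrite /Hsum -/th in h1; rewrite -/E0 in h2.
set A := \sum_(F | _) _ in h1 *; set B := \sum_(F | _) _ in h2 *.
by set C := Np ^+ i * E0 in h1 h2 h3 *; lra.
Qed.

Definition tail_const : R := 2 ^+ k * (2 + (576 * 1000) / thm ^+ 2 * (2 * E0 + 1)).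

(** A step leaves [good] only through a triangle of strongly correlated variables. While [bb] is of
    order [1 / N], at most order [N ^ (3/2)] of the [N ^ 3] triples are triangles, which gives a
    failure probability of order [N ^ (-3/2)] per step. *)
Lemma bad_bound i : i%:R * kap <= N / 6 ->
  \sum_(F : i.-tuple (clause n k) | all (@proper_clause n k) F) (~~ good F)%:R <=
  i%:R * (tail_const / (N * Num.sqrt N)) * Np ^+ i.
Proof.
have N0 := N_gt0; pose rt := Num.sqrt N.
have rt0 : 0 < rt by rewrite sqrtr_gt0.
have rt2 : rt * rt = N by rewrite -expr2 sqr_sqrtr // ltW.
case/andP: kap_bd => kap0 _.
elim: i => [|i IH] ik.
  by rewrite (Psum0 (fun F => (~~ good F)%:R)) /= !mul0r.
have ik' : i%:R * kap <= N / 6.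
  by apply: le_trans ik; rewrite ler_wpM2r ?ler_nat // ltW.
have HI := Hbound ik'; have YI := EY ik'; have /andP[th0 th1] := th_low ik'.
set th := ww ^+ i in th0 th1.
have thm0 : 0 < thm by apply: expR_gt0.
(* In the bound of [eta * z] by [(2 * eta / th) * (th * ell) + eta * ln Yr] both weights are at most
   [1 / 2], because [thm <= th <= 1]; so [interp] applies. *)
pose eta := thm / 4; have eta0 : 0 < eta by rewrite divr_gt0.
have step (F : i.-tuple (clause n k)) : good F ->
    \sum_(c : clause n k | proper_clause c) (Dd F c < 8^-1)%R%:R <=
    Np * (2 ^+ k / (N * rt) * (2 + (576 * 1000) / thm ^+ 2 * (expR (th * ell F) + Yr F + 1))).
  move=> gF; have Z0 := good_pos gF.
  apply: le_trans (count_small Z0) _.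
  rewrite [leLHS](_ : _ = Np * (2 ^+ k * (triples F / N ^+ 3))); last by ring.
  apply: ler_wpM2l; first exact: Np_ge0.
  rewrite -mulrA; apply: ler_wpM2l; first by rewrite exprn_ge0.
  have b0 := bb_ge0 F; pose u := N * bb F.
  have u0 : 0 <= u by rewrite mulr_ge0 // ltW.
  have T1 : triples F / N ^+ 3 <= (N * rt)^-1 * (2 + 10 * u ^+ 2).
    rewrite ler_pdivrMr ?exprn_gt0 //; apply: le_trans (triples_le F rt0) _.
    rewrite [leRHS](_ : _ = rt ^+ 3 * (2 + 10 * u ^+ 2)); last first.
      by rewrite -rt2; field; rewrite lt0r_neq0.
    rewrite [leLHS](_ : _ = rt ^+ 3 * (2 * u + 8 * u ^+ 2)); last first.
      by rewrite /u -rt2; field; rewrite lt0r_neq0.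
    apply: ler_wpM2l; first by rewrite exprn_ge0 // ltW.
    have : 0 <= (u - 1) ^+ 2 by rewrite sqr_ge0.
    by move=> ?; nra.
  apply: le_trans T1 _; apply: ler_wpM2l; first by rewrite invr_ge0 mulr_ge0 // ltW.
  rewrite lerD2l.
  pose z := s0 * u; have z0 : 0 <= z by apply: mulr_ge0 => //; rewrite /s0 invr_ge0.
  have zl : z <= ln (Yr F) + 2 * ell F := bb_ell Z0.
  have s1 := @sqr_le_exp R (eta * z) (mulr_ge0 (ltW eta0) z0).
  have s2 : expR (eta * z) <= expR (th * ell F) + Yr F + 1.
    have r0 : 0 <= 2 * eta / th by rewrite divr_ge0 ?mulr_ge0 ?ltW // (lt_le_trans thm0).
    have rh1 : 2 * eta / th <= 1 / 2.
      by rewrite ler_pdivrMr ?(lt_le_trans thm0) // /eta; lra.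
    have e1 : eta <= 1 / 2 by rewrite /eta; lra.
    have rt1 : 2 * eta / th + eta <= 1 by lra.
    have := interp (th * ell F) (ln (Yr F)) r0 (ltW eta0) rt1.
    rewrite lnK ?posrE ?Yr_gt0 // => h.
    apply: (@le_trans _ _ (expR (2 * eta / th * (th * ell F) + eta * ln (Yr F)))).
      rewrite ler_expR; apply: le_trans (ler_wpM2l (ltW eta0) zl) _; apply: ler_of_eqA.
      by field; rewrite lt0r_neq0 // (lt_le_trans thm0).
    apply: le_trans h _.
    have a1 := expR_ge0 (th * ell F); have a2 := ltW (Yr_gt0 Z0).
    by nra.
  rewrite [leLHS](_ : _ = (144 * 1000) / thm ^+ 2 * (eta * z) ^+ 2); last first.
    by rewrite /z /s0 /eta; field; rewrite lt0r_neq0.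
  have c0 : 0 <= (144 * 1000) / thm ^+ 2.
    by apply: divr_ge0; [apply: mulr_ge0; exact: ler0n|exact: sqr_ge0].
  have s3 : (eta * z) ^+ 2 <= 4 * (expR (th * ell F) + Yr F + 1) by lra.
  apply: le_trans (ler_wpM2l c0 s3) _; apply: ler_of_eqA; field.
  by rewrite lt0r_neq0.
rewrite (Psum_cons _ (fun F => (~~ good F)%:R)) exchange_big /=.
pose c1 : R := 2 ^+ k / (N * rt).
have [c2 c2E] : exists c2 : R, c2 = (576 * 1000) / thm ^+ 2 by eexists.
rewrite -c2E in step.
have c10 : 0 <= c1 by rewrite divr_ge0 ?exprn_ge0 ?mulr_ge0 // ltW.
have c20 : 0 <= c2.
  rewrite c2E.
  by apply: divr_ge0; [apply: mulr_ge0; exact: ler0n|exact: sqr_ge0].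
apply: (@le_trans _ _ (\sum_(F : i.-tuple (clause n k) | all (@proper_clause n k) F)
   Np * ((~~ good F)%:R + c1 * (2 * 1 + c2 * ((good F)%:R * expR (th * ell F) + Yr F + 1))))).
  apply: ler_sum => F _; have Y0 : 0 <= Yr F.
    rewrite /Yr divr_ge0 ?sqr_ge0 //; do 2 (apply: sumr_ge0 => ? _).
    by rewrite mulr_ge0 ?expR_ge0.
  have [gF|gF] := boolP (good F); last first.
    rewrite (eq_bigr (fun _ => 1)) // card_proper -[leLHS]mulr1; apply: ler_wpM2l; first exact: Np_ge0.
    rewrite lerDl; apply: mulr_ge0 => //; apply: addr_ge0; first by rewrite mulr1.
    by apply: mulr_ge0 => //; rewrite mul0r add0r; apply: addr_ge0.
  rewrite add0r mul1r mulr1; apply: le_trans (step F gF); apply: ler_sum => c _.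
  by rewrite /= -ltNge.
rewrite -mulr_sumr !big_split /= -!mulr_sumr !big_split /= -!mulr_sumr !big_split /= card_P.
have P0 : 0 <= Np ^+ i by rewrite exprn_ge0 // Np_ge0.
have IH' := IH ik'; rewrite exprS.
rewrite [leRHS](_ : _ = Np * (i.+1%:R * (tail_const / (N * Num.sqrt N)) * Np ^+ i)); last by ring.
apply: ler_wpM2l; first exact: Np_ge0.
have -> : i.+1%:R * (tail_const / (N * Num.sqrt N)) * Np ^+ i =
  i%:R * (tail_const / (N * Num.sqrt N)) * Np ^+ i + c1 * (2 * Np ^+ i + c2 * (Np ^+ i * E0 + Np ^+ i * E0 + Np ^+ i)).
  by rewrite -addn1 natrD /tail_const /c1 -c2E -/rt; ring.
apply: lerD => //; apply: ler_wpM2l => //; rewrite lerD2l; apply: ler_wpM2l => //.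
by apply: lerD => //; apply: lerD.
Qed.

(** Markov's inequality for the negative moment of order [ww ^ m >= thm], after setting aside the
    formulas that are not good. *)
Lemma lower_tail m a : 0 < a <= 1 -> m%:R * kap <= N / 6 ->
  \sum_(F : m.-tuple (clause n k) | all (@proper_clause n k) F) (Mr F < a)%R%:R <=
  (m%:R * (tail_const / (N * Num.sqrt N)) + E0 * expR (thm * ln a)) * Np ^+ m.
Proof.
move=> /andP[a0 a1] mk; have HI := Hbound mk; have BI := bad_bound mk.
have /andP[th0 th1] := th_low mk.
have la : ln a <= 0 by rewrite -ln1 ler_ln ?posrE.
apply: (@le_trans _ _ (\sum_(F : m.-tuple (clause n k) | all (@proper_clause n k) F)
   ((~~ good F)%:R + expR (thm * ln a) * ((good F)%:R * expR (ww ^+ m * ell F))))).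
  apply: ler_sum => F _; have [gF|gF] := boolP (good F); last first.
    by rewrite mul0r mulr0 addr0; case: (_ < _).
  rewrite add0r mul1r; case: (ltP (Mr F) a) => [Ma|_]; last by rewrite mulr_ge0 ?expR_ge0.
  rewrite -expRD -[leLHS]expR0 ler_expR /ell.
  have M0 := Mr_gt0 (good_pos gF).
  have : ln (Mr F) <= ln a by rewrite ler_ln ?posrE // ltW.
  have thm0 : 0 < thm by apply: expR_gt0.
  by move=> ?; nra.
rewrite big_split /= -mulr_sumr mulrDl; apply: lerD => //.
rewrite [leRHS](_ : _ = expR (thm * ln a) * (Np ^+ m * E0)); last by ring.
by apply: ler_wpM2l; [exact: expR_ge0|exact: HI].
Qed.

End Moments.
End LowerTail.

(** * A structured language, its compiler and the correctness of the compiler *)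

Module Compiler.
Import CoinTree Moments.
Inductive expr := EV of nat | EN of nat | EB of binop & expr & expr | EL of expr.

Inductive com :=
| CSkip
| CAsg of nat & expr
| CSto of expr & expr
| CFlip of nat
| CSeq of com & com
| CIf of expr & expr & com & com
| CFor of nat & nat & com.

Definition store := ((nat -> nat) * (nat -> nat))%type.

Section Machine.
Variable w : nat.

Fixpoint ev (e : expr) (s : store) : nat :=
  match e with
  | EV x => s.1 x
  | EN c => c %% 2 ^ w
  | EB o a b => eval_op o (ev a s) (ev b s) %% 2 ^ w
  | EL a => s.2 (ev a s)
  end.

Definition incr x (s : store) : store := (upd s.1 x ((s.1 x + 1) %% 2 ^ w), s.2).

(** The number of rounds of a loop is fixed on entry, so every tree is finite. The compiled loop
    rereads its bound in each round; the two agree because [wf] forbids the body to write the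
    counter or the bound. *)
Fixpoint sem (c : com) (s : store) : rtree store :=
  match c with
  | CSkip => Ret s
  | CAsg x e => Ret (upd s.1 x (ev e s), s.2)
  | CSto e e' => Ret (s.1, upd s.2 (ev e s) (ev e' s))
  | CFlip x => Flp (Ret (upd s.1 x (false %% 2 ^ w), s.2))
                   (Ret (upd s.1 x (true %% 2 ^ w), s.2))
  | CSeq c1 c2 => bind (sem c1 s) (sem c2)
  | CIf e1 e2 c1 c2 => if ev e1 s < ev e2 s then sem c1 s else sem c2 s
  | CFor x y c1 =>
      iter (s.1 y) (fun t => bind t (fun s1 => bind (sem c1 s1) (fun s2 => Ret (incr x s2))))
        (Ret (upd s.1 x 0, s.2))
  end.

(* Registers 0 and 1 hold the constants 0 and 1, registers from 60 on are
   temporaries of the expression compiler. *)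
Fixpoint cx (d : nat) (e : expr) : seq instr :=
  match e with
  | EV x => [:: Op Add (60 + d) x 0]
  | EN c => [:: Const (60 + d) c]
  | EB o a b => cx d a ++ cx d.+1 b ++ [:: Op o (60 + d) (60 + d) (60 + d.+1)]
  | EL a => cx d a ++ [:: Read (60 + d) (60 + d)]
  end.

Fixpoint cc (i : nat) (c : com) : seq instr :=
  match c with
  | CSkip => [::]
  | CAsg x e => cx 0 e ++ [:: Op Add x 60 0]
  | CSto e e' => (cx 0 e ++ cx 1 e') ++ [:: Write 60 61]
  | CFlip x => [:: Coin x]
  | CSeq c1 c2 => let p1 := cc i c1 in p1 ++ cc (i + size p1) c2
  | CIf e1 e2 c1 c2 =>
      let pe := cx 0 e1 ++ cx 1 e2 in
      let p2 := cc (i + size pe + 1) c2 in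
      let j := i + size pe + 1 + size p2 + 1 in
      let p1 := cc j c1 in
      pe ++ ([:: Blt 60 61 j] ++ (p2 ++ ([:: Blt 0 1 (j + size p1)] ++ p1)))
  | CFor x y c1 =>
      let p := cc (i + 3) c1 in
      [:: Const x 0; Blt x y (i + 3); Blt 0 1 (i + 5 + size p)] ++
      (p ++ [:: Op Add x x 1; Blt 0 1 (i + 1)])
  end.

Fixpoint wfe (e : expr) : bool :=
  match e with EV x => x < 60 | EN _ => true | EB _ a b => wfe a && wfe b | EL a => wfe a end.

Fixpoint wr (c : com) : seq nat :=
  match c with
  | CSkip | CSto _ _ => [::]
  | CAsg x _ | CFlip x => [:: x]
  | CSeq c1 c2 | CIf _ _ c1 c2 => wr c1 ++ wr c2
  | CFor x _ c1 => x :: wr c1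
  end.

Fixpoint lr (c : com) : seq nat :=
  match c with
  | CSeq c1 c2 | CIf _ _ c1 c2 => lr c1 ++ lr c2
  | CFor _ y c1 => y :: lr c1
  | _ => [::]
  end.

Definition okr x := (1 < x) && (x < 60).

Fixpoint wf (c : com) : bool :=
  match c with
  | CSkip => true
  | CAsg x e => okr x && wfe e
  | CSto e e' => wfe e && wfe e'
  | CFlip x => okr x
  | CSeq c1 c2 => wf c1 && wf c2
  | CIf e1 e2 c1 c2 => [&& wfe e1, wfe e2, wf c1 & wf c2]
  | CFor x y c1 => [&& okr x, y < 60, x != y, x \notin wr c1, y \notin wr c1 & wf c1]
  end.

(** Depends on bounds for the loop registers only. Both branches of a conditional are charged, so
    the cost is independent of data and coins. *)
Fixpoint cost (rho : nat -> nat) (c : com) : nat :=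
  match c with
  | CSkip => 0
  | CAsg x e => size (cx 0 e) + 1
  | CSto e e' => size (cx 0 e) + size (cx 1 e') + 1
  | CFlip x => 1
  | CSeq c1 c2 => cost rho c1 + cost rho c2
  | CIf e1 e2 c1 c2 => size (cx 0 e1) + size (cx 1 e2) + 2 + cost rho c1 + cost rho c2
  | CFor x y c1 => 3 + rho y * (cost rho c1 + 3)
  end.

Variable p : program.

(** On every branch the machine follows the tree and reaches a state related to the leaf within [B]
    steps. A step whose outcome ignores the coin leaves the tree unchanged. *)
Inductive Sim (A : Type) (Q : A -> state -> Prop) : state -> nat -> rtree A -> Prop :=
| SimRet a s B : Q a s -> Sim Q s B (Ret a)
| SimStep s s' B t : (forall b, step p w s b = s') -> Sim Q s' B t -> Sim Q s B.+1 t
| SimFlip s B t0 t1 : Sim Q (step p w s false) B t0 -> Sim Q (step p w s true) B t1 ->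
    Sim Q s B.+1 (Flp t0 t1).

Lemma bindR (A : Type) (t : rtree A) : bind t (fun a => Ret a) = t.
Proof. by elim: t => //= t0 -> t1 ->. Qed.

Lemma Sim_leq (A : Type) (Q : A -> state -> Prop) s B B' t :
  B <= B' -> Sim Q s B t -> Sim Q s B' t.
Proof.
move=> + S; elim: S B' => {s B t} [a s B q|s s' B t E _ IH|s B t0 t1 _ I0 _ I1] [|B'] //.
- by move=> _; apply: SimRet.
- by move=> _; apply: SimRet.
- by move=> le; apply: SimStep E (IH _ le).
- by move=> le; apply: SimFlip (I0 _ le) (I1 _ le).
Qed.

Lemma Sim_weak (A : Type) (Q Q' : A -> state -> Prop) s B t :
  (forall a s, Q a s -> Q' a s) -> Sim Q s B t -> Sim Q' s B t.
Proof.
move=> QQ S; elim: S => {s B t} [a s B q|s s' B t E _ IH|s B t0 t1 _ I0 _ I1].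
- exact/SimRet/QQ.
- exact: SimStep E IH.
- exact: SimFlip.
Qed.

Lemma Sim_bind (A A' : Type) (Q : A -> state -> Prop) (Q' : A' -> state -> Prop) s B B' t f :
  Sim Q s B t -> (forall a s', Q a s' -> Sim Q' s' B' (f a)) ->
  Sim Q' s (B + B') (bind t f).
Proof.
move=> S k; elim: S => {s B t} [a s B q|s s' B t E _ IH|s B t0 t1 _ I0 _ I1] /=.
- by apply: Sim_leq (k _ _ q); apply: leq_addl.
- by rewrite addSn; apply: SimStep E IH.
- by rewrite addSn; apply: SimFlip.
Qed.

Definition code_at i q := forall j, j < size q -> onth p (i + j) = onth q j.

Lemma onth_cat_ (q1 q2 : seq instr) j : onth (q1 ++ q2) j =
  if j < size q1 then onth q1 j else onth q2 (j - size q1).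
Proof. by elim: q1 j => [|a q1 IH] [|j] //=; rewrite ?subn0 // IH ltnS subSS. Qed.

Lemma code_at_cat i q1 q2 : code_at i (q1 ++ q2) <->
  code_at i q1 /\ code_at (i + size q1) q2.
Proof.
split=> [H|[H1 H2] j].
  split=> j jq.
    by rewrite H ?size_cat ?onth_cat_ ?jq // (leq_trans jq) // leq_addr.
  rewrite -addnA H ?size_cat ?ltn_add2l // onth_cat_ ltnNge leq_addr /=.
  by rewrite addKn.
rewrite size_cat onth_cat_ => jq; case: ltnP => j1; first exact: H1.
by rewrite -(H2 (j - size q1)) ?ltn_subLR // -addnA subnKC.
Qed.

Lemma code_at1 i a q : code_at i (a :: q) -> onth p i = Some a.
Proof. by move=> /(_ 0 (ltn0Sn _)); rewrite addn0. Qed.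

Lemma code_atS i a q : code_at i (a :: q) -> code_at i.+1 q.
Proof. by move=> H j jq; rewrite addSnnS (H j.+1). Qed.

Hypothesis w0 : 0 < w.

Definition Inv (s : store) :=
  [/\ s.1 0 = 0, s.1 1 = 1, forall x, x < 60 -> s.1 x < 2 ^ w & forall a, s.2 a < 2 ^ w].
Definition agree i (s : store) (S : state) :=
  [/\ pc S = i, forall x, x < 60 -> reg S x = s.1 x & memory S = s.2].

Lemma pow_gt0 : 0 < 2 ^ w. Proof. by rewrite expn_gt0. Qed.

Lemma ev_bd e s : wfe e -> Inv s -> ev e s < 2 ^ w.
Proof.
case: e => [x|c|o a b|a] /= we [s0 s1 bx bm]; [exact: bx| | |exact: bm].
- by rewrite ltn_mod pow_gt0.
- by rewrite ltn_mod pow_gt0.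
Qed.

(** The form with a continuation chains the code of operands and of their consumer without naming
    intermediate states. Registers below [60 + d] survive: the temporaries form a stack. *)
Lemma sim_expr (A : Type) (Q : A -> state -> Prop) e d i s S B t :
  wfe e -> Inv s -> code_at i (cx d e) -> agree i s S ->
  (forall S', [/\ pc S' = i + size (cx d e), reg S' (60 + d) = ev e s,
     memory S' = s.2 & forall x, x < 60 + d -> reg S' x = reg S x] -> Sim Q S' B t) ->
  Sim Q S (size (cx d e) + B) t.
Proof.
elim: e d i S B => [x|c|o a IHa b IHb|a IHa] d i [j r M] B /= we I co [/= E1 rx mE] k.
- subst j; have [s0 s1 bx bm] := I.
  apply: (SimStep (s' := State i.+1 (upd r (60 + d) (s.1 x)) M)).
    move=> b; rewrite /= (code_at1 co) /= !rx // s0 addn0 modn_small //; exact: bx.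
  apply: k; split=> //=; [by rewrite addn1|by rewrite /upd eqxx|].
  by move=> y yd; rewrite /upd; case: eqP => // E; move: yd; rewrite E ltnn.
- subst j; apply: (SimStep (s' := State i.+1 (upd r (60 + d) (c %% 2 ^ w)) M)).
    by move=> b; rewrite /= (code_at1 co).
  apply: k; split=> //=; [by rewrite addn1|by rewrite /upd eqxx|].
  by move=> y yd; rewrite /upd; case: eqP => // E; move: yd; rewrite E ltnn.
- subst j; case/andP: we => wa wb.
  move/code_at_cat: co => [ca /code_at_cat[cb co]].
  rewrite !size_cat -!addnA; apply: (IHa d i) => //.
  move=> [ja ra Ma] [/= ja_ va ma fa]; apply: (IHb d.+1 (i + size (cx d a))) => //.
    by split=> //= x x60; rewrite fa ?rx // (leq_trans x60) // leq_addr.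
  move=> [jb rb Mb] [/= jb_ vb mb fb]; subst jb.
  apply: (SimStep (s' := State (i + size (cx d a) + size (cx d.+1 b)).+1
     (upd rb (60 + d) (eval_op o (ev a s) (ev b s) %% 2 ^ w)) Mb)).
    by move=> b'; rewrite /= (code_at1 co) /= vb fb ?va // addnS.
  apply: k; split=> //=; [by rewrite !size_cat /= addn1 !addnS addnA|by rewrite /upd eqxx|].
  move=> y yd; rewrite /upd; case: eqP => [E|_]; first by move: yd; rewrite E ltnn.
  by rewrite fb ?fa // addnS ltnS ltnW.
- subst j; move/code_at_cat: co => [ca co]; rewrite size_cat -addnA.
  apply: (IHa d i) => // -[ja ra Ma] [/= ja_ va ma fa]; subst ja.
  apply: (SimStep (s' := State (i + size (cx d a)).+1 (upd ra (60 + d) (s.2 (ev a s))) Ma)).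
    by move=> b'; rewrite /= (code_at1 co) /= va ma.
  apply: k; split=> //=; [by rewrite size_cat /= addn1 addnS|by rewrite /upd eqxx|].
  move=> y yd; rewrite /upd; case: eqP => [E|_]; first by move: yd; rewrite E ltnn.
  by rewrite fa.
Qed.

Definition post i c (s s' : store) (S : state) :=
  [/\ agree (i + size (cc i c)) s' S, Inv s' & forall z, z \notin wr c -> s'.1 z = s.1 z].

Lemma Inv_upd s x v : okr x -> Inv s -> v < 2 ^ w -> Inv (upd s.1 x v, s.2).
Proof.
move=> /andP[x1 x60] [s0 s1 bx bm] vw; split=> //=.
- by rewrite /upd; case: eqP => // E; rewrite -E in x1.
- by rewrite /upd; case: eqP => // E; rewrite -E in x1.
- by move=> y y60; rewrite /upd; case: eqP => // _; apply: bx.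
Qed.

Lemma agree_upd i s S x v : agree i s S ->
  agree i.+1 (upd s.1 x v, s.2) (State i.+1 (upd (reg S) x v) (memory S)).
Proof.
by move=> [_ rx mE]; split=> //= y y60; rewrite /upd; case: eqP => // _; apply: rx.
Qed.

Lemma state_eta S : S = State (pc S) (reg S) (memory S). Proof. by case: S. Qed.

Lemma blt_step S x y l : onth p (pc S) = Some (Blt x y l) ->
  forall b, step p w S b =
    State (if reg S x < reg S y then l else (pc S).+1) (reg S) (memory S).
Proof. by case: S => i r M /= ->. Qed.

Lemma op_step S o x y z : onth p (pc S) = Some (Op o x y z) ->
  forall b, step p w S b = State (pc S).+1
    (upd (reg S) x (eval_op o (reg S y) (reg S z) %% 2 ^ w)) (memory S).
Proof. by case: S => i r M /= ->. Qed.

(** [Blt 0 1] is the unconditional jump, since registers 0 and 1 keep their constants. *)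
Lemma jump_step i s S l : Inv s -> agree i s S -> onth p i = Some (Blt 0 1 l) ->
  forall b, step p w S b = State l (reg S) (memory S).
Proof.
move=> [s0 s1 _ _] [pcE rx _] on b; rewrite (state_eta S) pcE /= on !rx //.
by rewrite s0 s1.
Qed.

(** The bounds [s.1 y <= rho y] are assumed at the start only; they persist inside loops because [c]
    writes no register that bounds a loop. *)
Lemma sim_com rho c i s S : wf c -> Inv s ->
  {in lr c, forall y, s.1 y <= rho y /\ y \notin wr c} ->
  code_at i (cc i c) -> agree i s S ->
  Sim (post i c s) S (cost rho c) (sem c s).
Proof.
elim: c i s S => [|x e|e e'|x|c1 IH1 c2 IH2|e1 e2 c1 IH1 c2 IH2|x y c IH] i s S /=.
- by move=> _ I _ _ ag; apply: SimRet; split=> //; rewrite addn0.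
- case/andP=> ox we I _ /code_at_cat[ce co] ag; have [s0 s1 bx bm] := I.
  apply: (sim_expr we I ce ag) => -[j r M] [/= jE ve mE fr]; subst j.
  have evb := ev_bd we I.
  apply: (SimStep (s' := State (i + size (cx 0 e)).+1 (upd r x (ev e s)) M)).
    move=> b; rewrite /= (code_at1 co) /= [r 60]ve [r 0]fr //.
    by have [_ rx _] := ag; rewrite rx // s0 addn0 modn_small.
  apply: SimRet; split; last 2 [exact: Inv_upd].
  + rewrite size_cat /= addn1 addnS; have [_ rx _] := ag.
    have := @agree_upd (i + size (cx 0 e)) s (State (i + size (cx 0 e)) r M) x (ev e s).
    by rewrite /= -mE; apply; split=> //= z z60; rewrite fr // rx.
  + by move=> z; rewrite inE /= /upd => /negbTE ->.
- case/andP=> we we' I _ /code_at_cat[/code_at_cat[ce ce'] co] ag.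
  have [s0 s1 bx bm] := I; rewrite -addnA.
  apply: (sim_expr we I ce ag) => -[j r M] [/= jE ve mE fr].
  have [_ rx _] := ag.
  apply: (sim_expr (i := i + size (cx 0 e)) (d := 1) we' I ce').
    by split=> //= z z60; rewrite fr // rx.
  move=> [j' r' M'] [/= jE' ve' mE' fr']; subst j'.
  apply: (SimStep (s' := State (i + size (cx 0 e) + size (cx 1 e')).+1 r' (upd M' (ev e s) (ev e' s)))).
    move=> b; rewrite /= -addnA -size_cat (code_at1 co) /= [r' 61]ve' [r' 60]fr' // [r 60]ve.
    by rewrite size_cat addnA.
  apply: SimRet; split=> //.
  + split=> /=; [by rewrite !size_cat /=; clear; lia| |by rewrite mE'].
    by move=> z z60; rewrite fr' ?fr ?rx // (leq_trans z60).
  + by split=> //= a; rewrite /upd; case: eqP => // _; apply: ev_bd.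
- move=> ox I _ co ag; have [pcE rx mE] := ag.
  have st b : step p w S b = State i.+1 (upd (reg S) x (b %% 2 ^ w)) (memory S).
    by rewrite (state_eta S) pcE /= (code_at1 co).
  have fin b : post i (CFlip x) s (upd s.1 x (b %% 2 ^ w), s.2)
      (State i.+1 (upd (reg S) x (b %% 2 ^ w)) (memory S)).
    split; first by rewrite /= addn1; apply: agree_upd ag.
      by apply: Inv_upd => //; rewrite ltn_mod pow_gt0.
    by move=> z; rewrite inE /= /upd => /negbTE ->.
  by apply: SimFlip; rewrite st; apply: SimRet; apply: fin.
- case/andP=> w1 w2 I L /code_at_cat[k1 k2] ag.
  apply: (Sim_bind (IH1 i s S w1 I _ k1 ag)).
    by move=> y yl; have [|l1 l2] := L y; rewrite ?mem_cat ?yl //; move: l2; rewrite mem_cat => /norP[].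
  move=> s' S' [ag' I' fr'].
  have L2 : {in lr c2, forall y, s'.1 y <= rho y /\ y \notin wr c2}.
    move=> y yl; have [|l1 l2] := L y; rewrite ?mem_cat ?yl ?orbT //.
    by move: l2; rewrite mem_cat => /norP[n1 n2]; rewrite fr'.
  apply: Sim_weak (IH2 _ s' S' w2 I' L2 k2 ag') => s2 S3 [ag2 I2 fr2]; split=> //.
    by rewrite /= size_cat addnA.
  by move=> z; rewrite /= mem_cat => /norP[z1 z2]; rewrite fr2 // fr'.
- case/and4P=> we1 we2 w1 w2 I L /code_at_cat[/code_at_cat[ce1 ce2] co] ag.
  have {co} [co1 co] : onth p (i + size (cx 0 e1 ++ cx 1 e2)) = Some (Blt 60 61 _) /\ _ :=
    conj (code_at1 co) (code_atS co).
  move: co => /= /code_at_cat[k2 co].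
  have co2 := code_at1 co; have k1 := code_atS co.
  have [_ rx _] := ag.
  rewrite -!addnA; apply: (sim_expr we1 I ce1 ag) => -[j r M] [/= jE ve mE fr].
  apply: (sim_expr (i := i + size (cx 0 e1)) (d := 1) we2 I ce2).
    by split=> //= z z60; rewrite fr // rx.
  move=> [j' r' M'] [/= jE' ve' mE' fr']; subst j'.
  have ag' l : agree l s (State l r' M').
    by split=> //= z z60; rewrite fr' ?fr ?rx // (leq_trans z60).
  set pe := cx 0 e1 ++ cx 1 e2 in co1 k2 co2 k1 *.
  set q2 := cc (i + size pe + 1) c2 in co1 k2 co2 k1 *.
  set jj := i + size pe + 1 + size q2 + 1 in co1 k2 co2 k1 *.
  set q1 := cc jj c1 in co2 k1 *.
  have szE : i + size (cc i (CIf e1 e2 c1 c2)) = jj + size q1.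
    rewrite /= -/pe -/q2 -/jj -/q1 size_cat /= size_cat /= /jj.
    by rewrite !addn1 !addSn !addnS !addnA.
  rewrite addSn; apply: (SimStep (s' := State (if ev e1 s < ev e2 s then jj else i + size pe + 1) r' M')).
    move=> b; rewrite /= -addnA -size_cat -/pe co1 [r' 61]ve' [r' 60]fr' // [r 60]ve.
    by rewrite addn1.
  case: ltnP => cmp.
    apply: (@Sim_leq _ _ _ (cost rho c1)); first by rewrite add1n -addnS leq_addr.
    have L1 : {in lr c1, forall y, s.1 y <= rho y /\ y \notin wr c1}.
      move=> y yl; have [|l1 l2] := L y; rewrite ?mem_cat ?yl //.
      by move: l2; rewrite mem_cat => /norP[].
    have k1' : code_at jj q1.
      by move: k1; congr code_at; rewrite /jj !addn1.
    apply: Sim_weak (IH1 jj s _ w1 I L1 k1' (ag' jj)) => s2 S3 [ag2 I2 fr2]; split=> //.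
      by rewrite szE.
    by move=> z; rewrite /= mem_cat => /norP[z1 z2]; rewrite fr2.
  have L2 : {in lr c2, forall y, s.1 y <= rho y /\ y \notin wr c2}.
    move=> y yl; have [|l1 l2] := L y; rewrite ?mem_cat ?yl ?orbT //.
    by move: l2; rewrite mem_cat => /norP[].
  have k2' : code_at (i + size pe + 1) q2 by move: k2; rewrite addn1.
  have S2 := IH2 _ s _ w2 I L2 k2' (ag' _).
  apply: (@Sim_leq _ _ _ (cost rho c2 + 1)); first by rewrite add1n addn1 ltnS leq_addl.
  rewrite -[sem c2 s](_ : bind (sem c2 s) (fun s => Ret s) = _); last first.
    by elim: (sem c2 s) => //= t0 -> t1 ->.
  apply: (Sim_bind S2) => s2 S3 [ag2 I2 fr2].
  apply: (SimStep (s' := State (jj + size q1) (reg S3) (memory S3))).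
    by apply: (jump_step I2 ag2); rewrite -co2 -/q2 addn1.
  apply: SimRet; split=> //; first by rewrite szE; case: ag2.
  by move=> z; rewrite /= mem_cat => /norP[z1 z2]; rewrite fr2.
- case/and5P=> ox y60 xy xw /andP[yw wc] I L co ag.
  set q := cc (i + 3) c in co *.
  have c0 := code_at1 co; have {}co := code_atS co.
  have c1 := code_at1 co; have {}co := code_atS co.
  have c2 := code_at1 co; have {}co := code_atS co.
  move/code_at_cat: co => [cq co].
  have c3 := code_at1 co; have {}co := code_atS co; have c4 := code_at1 co => {co}.
  have [pcE rx mE] := ag.
  have szE : i + size (cc i (CFor x y c)) = i + 5 + size q.
    by rewrite /= -/q size_cat /= addn2 !addnS addn0 !addSn.
  have y_in : y \in lr (CFor x y c) by rewrite /= mem_head.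
  have [ry _] := L y y_in.
  have x60 : x < 60 by case/andP: ox.
  rewrite -(addnC (rho y * _)); apply: (@Sim_leq _ _ _ (1 + (s.1 y * (cost rho c + 3) + 2))).
    by rewrite addnC -addnA leq_add2r leq_mul2r ry orbT.
  apply: (SimStep (s' := State i.+1 (upd (reg S) x 0) (memory S))).
    by move=> b; rewrite (state_eta S) pcE /= c0 mod0n.
  pose top (s' : store) S' := agree i.+1 s' S' /\ Inv s' /\
    (forall z, z \notin x :: wr c -> s'.1 z = s.1 z).
  have fin s' S' : top s' S' -> s'.1 x = s.1 y ->
      Sim (post i (CFor x y c) s) S' 2 (Ret s').
    move=> [ag' [I' fr']] sx; have [pcE' rx' mE'] := ag'.
    have ys : s'.1 y = s.1 y by apply: fr'; rewrite inE negb_or eq_sym xy.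
    apply: (SimStep (s' := State i.+2 (reg S') (memory S'))).
      by move=> b; rewrite (blt_step (x := x) (y := y) (l := i + 3)) ?pcE' // !rx' // sx ys ltnn.
    have ag2 : agree i.+2 s' (State i.+2 (reg S') (memory S')) by split.
    apply: (SimStep (s' := State (i + 5 + size q) (reg S') (memory S'))).
      by move=> b; rewrite (jump_step I' ag2 c2).
    by apply: SimRet; split=> //; rewrite szE; split.
  pose body := fun t => bind t (fun s1 => bind (sem c s1) (fun s2 => Ret (incr x s2))).
  have loop l : l <= s.1 y -> forall S1 , top (upd s.1 x 0, s.2) S1 ->
      Sim (fun s' S' => top s' S' /\ s'.1 x = l) S1 (l * (cost rho c + 3))
        (iter l body (Ret (upd s.1 x 0, s.2))).
    elim: l => [|l IHl] ly S1 t1.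
      by apply: SimRet; split=> //=; rewrite /upd eqxx.
    rewrite mulSn addnC /=; apply: (Sim_bind (IHl (ltnW ly) S1 t1)).
    move=> s' S' [[ag' [I' fr']] sx]; have [pcE' rx' mE'] := ag'.
    have ys : s'.1 y = s.1 y by apply: fr'; rewrite inE negb_or eq_sym xy.
    rewrite addnS; apply: (SimStep (s' := State (i + 3) (reg S') (memory S'))).
      by move=> b; rewrite (blt_step (x := x) (y := y) (l := i + 3)) ?pcE' // !rx' // sx ys ly.
    have L' : {in lr c, forall z, s'.1 z <= rho z /\ z \notin wr c}.
      move=> z zl; have [|l1 l2] := L z; first by rewrite /= inE zl orbT.
      by move: (l2); rewrite /= inE => /norP[_ ?]; rewrite fr'.
    have cq' : code_at (i + 3) q by move: cq; rewrite !addnS addn0.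
    have ag2 : agree (i + 3) s' (State (i + 3) (reg S') (memory S')) by split.
    apply: (Sim_bind (IH _ s' _ wc I' L' cq' ag2)) => s2 S2 [ag3 I2 fr2].
    have [pcE2 rx2 mE2] := ag3; have [z0 z1 bx bm] := I2.
    have sx2 : s2.1 x = l by rewrite fr2.
    (* The counter cannot overflow: it never exceeds the loop bound, which fits into a word. *)
    have lw : l + 1 < 2 ^ w.
      have [_ _ + _] := I; move=> /(_ y y60); apply: leq_ltn_trans; by rewrite addn1.
    apply: (SimStep (s' := State (i + 3 + size q).+1 (upd (reg S2) x (l + 1)) (memory S2))).
      have c3' : onth p (pc S2) = Some (Op Add x x 1).
        by rewrite pcE2 -/q -c3; congr onth; rewrite !addnS addn0.
      by move=> b; rewrite (op_step c3') pcE2 -/q /= !rx2 // sx2 z1 modn_small.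
    have I3 : Inv (upd s2.1 x (l + 1), s2.2) by apply: Inv_upd.
    have ag4 := agree_upd x (l + 1) ag3; rewrite -/q in ag4.
    apply: (SimStep (s' := State i.+1 (upd (reg S2) x (l + 1)) (memory S2))).
      have c4' : onth p (i + 3 + size q).+1 = Some (Blt 0 1 i.+1).
        by rewrite -(addn1 i) -c4 !addnS addn0.
      exact: (jump_step I3 ag4 c4').
    apply: SimRet; split; last by rewrite /incr /= /upd eqxx sx2 addn1 modn_small // -addn1.
    rewrite /incr sx2 modn_small //; split; last split=> //.
      by case: ag4 => _ a1 a2; split.
    move=> z zN; rewrite /= /upd; move: (zN); rewrite inE => /norP[/negbTE -> zw].
    by rewrite fr2 ?fr'.
  have t0 : top (upd s.1 x 0, s.2) (State i.+1 (upd (reg S) x 0) (memory S)).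
    split; first exact: agree_upd ag.
    split; first by apply: Inv_upd => //; apply: pow_gt0.
    by move=> z; rewrite inE /= /upd => /norP[/negbTE ->].
  have L0 := loop _ (leqnn _) _ t0.
  rewrite -[iter _ _ _]bindR.
  by apply: (Sim_bind L0) => s' S' [t' sx]; apply: fin.
Qed.

End Machine.
End Compiler.

(** * Halting and output law of a simulated program *)

Module Simulation.
Import CoinTree Moments Compiler.
Section Run.
Variables (w : nat) (p : program).

Lemma halted_step s b : halted p s -> step p w s b = s.
Proof.
case: s => i r M; rewrite /halted /= => h.
suff -> : onth p i = None by [].
by move: h; elim: p i => [|c q IH] [|i] //= h; apply: IH.
Qed.

Lemma halted_run s bs : halted p s -> run p w s bs = s.
Proof. by move=> h; rewrite /run; elim: bs => //= b bs IH; rewrite halted_step. Qed.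

Lemma Sim_halts (A : Type) (Q : A -> state -> Prop) s B t :
  Sim w p Q s B t -> (forall a s', Q a s' -> halted p s') ->
  forall bs, (B <= size bs)%N -> halted p (run p w s bs).
Proof.
move=> S hQ; elim: S => {s B t} [a s B q|s s' B t E _ IH|s B t0 t1 _ I0 _ I1] bs.
- by move=> _; rewrite halted_run; apply: hQ q.
- by case: bs => //= b bs h; rewrite /run /= E; apply: IH.
- by case: bs => //= b bs h; rewrite /run /=; case: b; [apply: I1|apply: I0].
Qed.

Local Open Scope ring_scope.
Variable R : realType.

(** Bits of deterministic steps and bits after halting are summed out and give a factor 2 each; the
    bits that remain are the tosses of the tree. *)
Lemma Sim_law (A : Type) (Q : A -> state -> Prop) s B t (f : state -> R) (g : A -> R) :
  Sim w p Q s B t -> (forall a s', Q a s' -> halted p s') ->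
  (forall a s', Q a s' -> f s' = g a) ->
  forall T, (B <= T)%N -> \sum_(bs : T.-tuple bool) f (run p w s bs) = 2 ^+ T * Ex g t.
Proof.
move=> S hQ fg; elim: S => {s B t} [a s B q|s s' B t E _ IH|s B t0 t1 _ I0 _ I1] T.
- move=> _; rewrite (eq_bigr (fun _ => g a)).
    by rewrite sumr_const card_tuple card_bool -[LHS]mulr_natl natrX.
  by move=> bs _; rewrite halted_run; [apply: fg|apply: hQ q].
- case: T => // T h; rewrite (big_tuple_cons _ (fun bs => f (run p w s bs))) /=.
  rewrite big_bool /= !E !(IH T) // exprS; ring.
- case: T => // T h; rewrite (big_tuple_cons _ (fun bs => f (run p w s bs))) /=.
  rewrite big_bool /= -/(run _ _ _ _) -/(run _ _ _ _).
  rewrite (eq_bigr (fun bs : T.-tuple bool => f (run p w (step p w s true) bs))) //.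
  rewrite [X in _ + X](eq_bigr (fun bs : T.-tuple bool => f (run p w (step p w s false) bs))) //.
  by rewrite I1 // I0 // exprS /=; field.
Qed.

End Run.
End Simulation.

(** * Proof rules relating programs to coin-tossing trees *)

Module RamState.
Import Explore Steps SwitchConf ClauseCount Resign CoinTree Switching Compiler.
Section RelatedTrees.

(** Trees of the same shape with related leaves. Program and algorithm toss their coins in the same
    order, so equality of shape takes the place of a coupling. *)
Inductive RT (A B : Type) (Q : A -> B -> Prop) : rtree A -> rtree B -> Prop :=
| RTret a b : Q a b -> RT Q (Ret a) (Ret b)
| RTflp t0 t1 u0 u1 : RT Q t0 u0 -> RT Q t1 u1 -> RT Q (Flp t0 t1) (Flp u0 u1).

Lemma RT_bind (A A' B B' : Type) (Q : A -> B -> Prop) (Q' : A' -> B' -> Prop) t u f g :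
  RT Q t u -> (forall a b, Q a b -> RT Q' (f a) (g b)) -> RT Q' (bind t f) (bind u g).
Proof. by move=> h fg; elim: h => [a b /fg //|t0 t1 u0 u1 _ h0 _ h1]; apply: RTflp. Qed.

Lemma RT_weak (A B : Type) (Q Q' : A -> B -> Prop) t u :
  (forall a b, Q a b -> Q' a b) -> RT Q t u -> RT Q' t u.
Proof.
by move=> h; elim=> [a b q|t0 t1 u0 u1 _ h0 _ h1]; [apply: RTret; apply: h|apply: RTflp].
Qed.

Lemma RT_Ex (R : realType) (A B : Type) (Q : A -> B -> Prop) t u (f : A -> R) (g : B -> R) :
  (forall a b, Q a b -> f a = g b) -> RT Q t u -> Ex f t = Ex g u.
Proof. by move=> h; elim=> [a b /h //|t0 t1 u0 u1 _ h0 _ h1] /=; rewrite h0 h1. Qed.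

Fixpoint it (A : Type) (g : nat -> A -> rtree A) N a : rtree A :=
  if N is N'.+1 then bind (it g N' a) (g N') else Ret a.

Definition Dt (A : Type) (Q : A -> Prop) (t : rtree A) := exists2 s, t = Ret s & Q s.

Inductive Lf (A : Type) (P : A -> Prop) : rtree A -> Prop :=
| LfR a : P a -> Lf P (Ret a)
| LfF t0 t1 : Lf P t0 -> Lf P t1 -> Lf P (Flp t0 t1).

Lemma Lf_bind (A B : Type) (P : A -> Prop) (P' : B -> Prop) t f :
  Lf P t -> (forall a, P a -> Lf P' (f a)) -> Lf P' (bind t f).
Proof. by move=> h fg; elim: h => [a /fg //|t0 t1 _ h0 _ h1]; apply: LfF. Qed.

Lemma Lf_weak (A : Type) (P P' : A -> Prop) t : (forall a, P a -> P' a) -> Lf P t -> Lf P' t.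
Proof. by move=> h; elim=> [a /h|t0 t1 _ h0 _ h1]; [apply: LfR|apply: LfF]. Qed.

Lemma RT_Lf (A B : Type) (Q : A -> B -> Prop) P t u :
  RT Q t u -> Lf P t -> RT (fun a b => Q a b /\ P a) t u.
Proof.
elim=> [a b q|t0 t1 u0 u1 _ h0 _ h1] l; inversion l; subst; first by apply: RTret.
by apply: RTflp; [apply: h0|apply: h1].
Qed.

Lemma Dt_Lf (A : Type) (Q : A -> Prop) P t : Dt Q t -> Lf P t -> Dt (fun a => Q a /\ P a) t.
Proof. by case=> a -> q l; inversion l; subst; exists a. Qed.

End RelatedTrees.

Section Rules.
Variable w : nat.
Notation sem := (sem w).
Notation ev := (ev w).

Definition fr (c : com) (s s' : store) := forall z, z \notin wr c -> s'.1 z = s.1 z.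

(** The frame rule: it supplies the values of the registers that an invariant does not mention. *)
Lemma sem_fr c s : Lf (fr c s) (sem c s).
Proof.
elim: c s => [|x e|e e'|x|c1 I1 c2 I2|e1 e2 c1 I1 c2 I2|x y c IH] s.
- by apply: LfR.
- by apply: LfR => z; rewrite inE /= /upd => /negbTE ->.
- by apply: LfR.
- by apply: LfF; apply: LfR => z; rewrite inE /= /upd => /negbTE ->.
- apply: (Lf_bind (I1 s)) => s1 h1; apply: Lf_weak (I2 s1) => s2 h2.
  by move=> z; rewrite /= mem_cat => /norP[z1 z2]; rewrite h2 ?h1.
- rewrite /=; case: ifP => _; [apply: Lf_weak (I1 s) => s2 h2|apply: Lf_weak (I2 s) => s2 h2];
  by move=> z; rewrite /= mem_cat => /norP[z1 z2]; rewrite h2.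
- rewrite /=; elim: (s.1 y) => [|l IHl] /=.
    by apply: LfR => z; rewrite inE /= /upd => /norP[/negbTE ->].
  apply: (Lf_bind IHl) => s1 h1; apply: (Lf_bind (IH s1)) => s2 h2; apply: LfR.
  move=> z; rewrite inE /= /upd => /norP[zx zc]; rewrite (negbTE zx) h2 // h1 // inE negb_or zx //.
Qed.

Lemma fr_seq c1 c2 s s1 s2 : fr c1 s s1 -> fr c2 s1 s2 -> fr (CSeq c1 c2) s s2.
Proof. by move=> f1 f2 z; rewrite [wr _]/= mem_cat => /norP[z1 z2]; rewrite f2 ?f1. Qed.

Lemma fr_for x y c s s1 s2 : fr (CFor x y c) s s1 -> fr c s1 s2 -> fr (CFor x y c) s s2.
Proof.
by move=> f1 f2 z zn; rewrite f2 ?f1 //; move: zn; rewrite [wr _]/= inE => /norP[].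
Qed.

Lemma Dt_seq Q Q' c1 c2 s : Dt Q (sem c1 s) ->
  (forall s1, fr c1 s s1 -> Q s1 -> Dt Q' (sem c2 s1)) -> Dt Q' (sem (CSeq c1 c2) s).
Proof. by move=> h H; have [s1 /= -> [q f]] := Dt_Lf h (sem_fr c1 s); apply: H. Qed.

Lemma Dt_asg (Q : store -> Prop) x e s : Q (upd s.1 x (ev e s), s.2) -> Dt Q (sem (CAsg x e) s).
Proof. by exists (upd s.1 x (ev e s), s.2). Qed.

Lemma Dt_skip (Q : store -> Prop) s : Q s -> Dt Q (sem CSkip s).
Proof. by exists s. Qed.

Lemma Dt_if Q (b : bool) e1 e2 c1 c2 s : (ev e1 s < ev e2 s) = b ->
  (b -> Dt Q (sem c1 s)) -> (~~ b -> Dt Q (sem c2 s)) -> Dt Q (sem (CIf e1 e2 c1 c2) s).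
Proof. by rewrite /= => ->; case: b => h1 h2; [apply: h1|apply: h2]. Qed.

Lemma Dt_weak (Q Q' : store -> Prop) t : Dt Q t -> (forall s, Q s -> Q' s) -> Dt Q' t.
Proof. by case=> s -> q h; exists s => //; apply: h. Qed.

Lemma Dt_for N (I : nat -> store -> Prop) (Q : store -> Prop) x y c s :
  s.1 y = N -> N < 2 ^ w -> x \notin wr c -> I 0 (upd s.1 x 0, s.2) ->
  (forall i s1, i < N -> s1.1 x = i -> fr (CFor x y c) s s1 -> I i s1 ->
     Dt (fun s2 => I i.+1 (upd s2.1 x i.+1, s2.2)) (sem c s1)) ->
  (forall s1, fr (CFor x y c) s s1 -> I N s1 -> Q s1) ->
  Dt Q (sem (CFor x y c) s).
Proof.
move=> yN NW xc I0 step fin.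
have loop l : l <= N -> exists2 s1, [/\ s1.1 x = l, fr (CFor x y c) s s1 & I l s1] &
    iter l (fun t => bind t (fun s1 => bind (sem c s1) (fun s2 => Ret (incr w x s2))))
        (Ret (upd s.1 x 0, s.2)) = Ret s1.
  elim: l => [|l IH] lN.
    exists (upd s.1 x 0, s.2) => //; split=> //; first by rewrite /= /upd eqxx.
    by move=> z; rewrite inE /= /upd => /norP[/negbTE ->].
  have [s1 [xl f1 Il] E] := IH (ltnW lN).
  have [s2 E2 [I2 f2]] := Dt_Lf (step l s1 lN xl f1 Il) (sem_fr c s1).
  have x2 : s2.1 x = l by rewrite f2.
  exists (upd s2.1 x l.+1, s2.2); last first.
    by rewrite iterS E /= E2 /= /incr x2 addn1 modn_small // (leq_ltn_trans lN).
  split=> //; first by rewrite /= /upd eqxx.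
  move=> z zn; move: (zn); rewrite inE => /norP[zx zc]; rewrite /= /upd (negbTE zx) f2 // f1 //.
have [s1 [_ f1 IN] E] := loop N (leqnn N).
by exists s1; [rewrite /= yN|apply: fin].
Qed.

Lemma RT_det (B : Type) Q (Q' : store -> B -> Prop) c1 c2 s u : Dt Q (sem c1 s) ->
  (forall s1, fr c1 s s1 -> Q s1 -> RT Q' (sem c2 s1) u) -> RT Q' (sem (CSeq c1 c2) s) u.
Proof. by move=> h H; have [s1 /= -> [q f]] := Dt_Lf h (sem_fr c1 s); apply: H. Qed.

Lemma RT_seq (A B : Type) (Q : store -> A -> Prop) (Q' : store -> B -> Prop) c1 c2 s u g :
  RT Q (sem c1 s) u -> (forall s1 a, fr c1 s s1 -> Q s1 a -> RT Q' (sem c2 s1) (g a)) ->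
  RT Q' (sem (CSeq c1 c2) s) (bind u g).
Proof. by move=> h H; apply: (RT_bind (RT_Lf h (sem_fr c1 s))) => s1 a [q f]; apply: H. Qed.

Lemma RT_Dt (B : Type) (Q : store -> B -> Prop) t b : Dt (fun s => Q s b) t -> RT Q t (Ret b).
Proof. by case=> s -> q; apply: RTret. Qed.

Lemma RT_if (B : Type) Q (b : bool) e1 e2 c1 c2 s (u : rtree B) : (ev e1 s < ev e2 s) = b ->
  (b -> RT Q (sem c1 s) u) -> (~~ b -> RT Q (sem c2 s) u) -> RT Q (sem (CIf e1 e2 c1 c2) s) u.
Proof. by rewrite /= => ->; case: b => h1 h2; [apply: h1|apply: h2]. Qed.

Lemma RT_for (A : Type) N (I : nat -> store -> A -> Prop) (Q : store -> A -> Prop) g a x y c s :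
  s.1 y = N -> N < 2 ^ w -> x \notin wr c -> I 0 (upd s.1 x 0, s.2) a ->
  (forall i s1 a1, i < N -> s1.1 x = i -> fr (CFor x y c) s s1 -> I i s1 a1 ->
     RT (fun s2 a2 => I i.+1 (upd s2.1 x i.+1, s2.2) a2) (sem c s1) (g i a1)) ->
  (forall s1 a1, fr (CFor x y c) s s1 -> I N s1 a1 -> Q s1 a1) ->
  RT Q (sem (CFor x y c) s) (it g N a).
Proof.
move=> yN NW xc I0 step fin.
have loop l : l <= N -> RT (fun s1 a1 => [/\ s1.1 x = l, fr (CFor x y c) s s1 & I l s1 a1])
    (iter l (fun t => bind t (fun s1 => bind (sem c s1) (fun s2 => Ret (incr w x s2))))
        (Ret (upd s.1 x 0, s.2))) (it g l a).
  elim: l => [|l IH] lN.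
    apply: RTret; split=> //; first by rewrite /= /upd eqxx.
    by move=> z; rewrite inE /= /upd => /norP[/negbTE ->].
  apply: (RT_bind (IH (ltnW lN))) => s1 a1 [xl f1 Il].
  rewrite -[g l a1]bindR.
  apply: (RT_bind (RT_Lf (step l s1 a1 lN xl f1 Il) (sem_fr c s1))) => s2 a2 [I2 f2].
  have x2 : s2.1 x = l by rewrite f2.
  rewrite /incr x2 addn1 modn_small ?(leq_ltn_trans lN) //; apply: RTret.
  split=> //; first by rewrite /= /upd eqxx.
  move=> z zn; move: (zn); rewrite inE => /norP[zx zc]; rewrite /= /upd (negbTE zx) f2 // f1 //.
rewrite /= yN; apply: RT_weak (loop N (leqnn N)) => s1 a1 [_ f1 IN]; exact: fin.
Qed.

(** The algorithm recurses over lists while the program iterates; [u i] is the algorithm on the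
    prefix of length [i] and [g i] its increment. *)
Lemma RT_for_seq (A : Type) N (I : nat -> store -> A -> Prop) (Q : store -> A -> Prop)
    (u : nat -> A -> rtree A) g a x y c s :
  s.1 y = N -> N < 2 ^ w -> x \notin wr c -> u 0 a = Ret a ->
  (forall i, i < N -> u i.+1 a = bind (u i a) (g i)) -> I 0 (upd s.1 x 0, s.2) a ->
  (forall i s1 a1, i < N -> s1.1 x = i -> fr (CFor x y c) s s1 -> I i s1 a1 ->
     RT (fun s2 a2 => I i.+1 (upd s2.1 x i.+1, s2.2) a2) (sem c s1) (g i a1)) ->
  (forall s1 a1, fr (CFor x y c) s s1 -> I N s1 a1 -> Q s1 a1) ->
  RT Q (sem (CFor x y c) s) (u N a).
Proof.
move=> yN NW xc u0 uS I0 step fin.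
suff E i : i <= N -> it g i a = u i a by rewrite -E //; apply: RT_for I0 step fin.
by elim: i => [|i IH] iN /=; [rewrite u0|rewrite IH ?(ltnW iN) // uS].
Qed.

End Rules.
End RamState.

(** * The program on the memory of the machine, routine by routine *)

Module Refinement.
Import Explore Steps SwitchConf ClauseCount Resign CoinTree Switching Compiler RamState.
(** Loop invariants are existential statements over the indices visited so far; this is their
    update. *)
Lemma ex_ltS p (i : 'I_p) (P : pred 'I_p) :
  [exists e : 'I_p, (e < i.+1) && P e] = [exists e : 'I_p, (e < i) && P e] || P i.
Proof.
apply/existsP/orP => [[e /andP[ei Pe]]|[/existsP[e /andP[ei Pe]]|Pi]].
- move: ei; rewrite ltnS leq_eqVlt => /orP[/eqP/val_inj E|ei]; [by right; rewrite -E|left].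
  by apply/existsP; exists e; rewrite ei.
- by exists e; rewrite Pe (ltn_trans ei).
- by exists i; rewrite Pi ltnSn.
Qed.

Lemma ex_lt0 p (P : pred 'I_p) : [exists e : 'I_p, (e < 0) && P e] = false.
Proof. by apply/existsP => -[e]. Qed.

Lemma ex_ltT p (P : pred 'I_p) : [exists e : 'I_p, (e < p) && P e] = [exists e, P e].
Proof. by apply: eq_existsb => e; rewrite ltn_ord. Qed.

Section Count.
Variables (k : nat) (b : pred 'I_k).
Definition cnt_lt i := count b (take i (enum 'I_k)).

Lemma cnt_lt0 : cnt_lt 0 = 0. Proof. by rewrite /cnt_lt take0. Qed.
Lemma cnt_ltS (i : 'I_k) : cnt_lt i.+1 = cnt_lt i + b i.
Proof.
rewrite /cnt_lt (take_nth i) ?size_enum_ord // nth_ord_enum -cats1 count_cat /= addn0 //.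
Qed.
Lemma cnt_ltT : cnt_lt k = #|[set j | b j]|.
Proof.
rewrite /cnt_lt take_oversize ?size_enum_ord // -sum1_count big_enum_cond /= -sum1dep_card.
by apply: eq_bigl => j; rewrite ?inE.
Qed.
Lemma cnt_lt_leq i : cnt_lt i <= k.
Proof. by apply: leq_trans (count_size _ _) _; rewrite size_take size_enum_ord; case: ltnP => // /ltnW. Qed.
End Count.

Lemma minorE k (b : {ffun 'I_k -> bool}) j :
  minor b j = ((if b j then #|[set i | b i]| else k - #|[set i | b i]|) < 2).
Proof.
have -> : (if b j then #|[set i | b i]| else k - #|[set i | b i]|) = #|[set i | b i == b j]|.
  case: (b j); first by apply: eq_card => i; rewrite !inE eqb_id.
  have C := cardsC [set i | b i]; rewrite card_ord in C.
  have le : #|[set i | b i]| <= k by rewrite -[leqRHS]card_ord max_card.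
  apply: (@addnI #|[set i | b i]|); rewrite subnKC //; etransitivity; first exact: (esym C).
  by congr addn; apply: eq_card => i; rewrite !inE eqbF_neg.
rewrite ltnS (cardsD1 j) inE eqxx -[_ <= 1]/(_ <= 0) leqn0 cards_eq0.
apply/forallP/eqP => [h|h i].
  apply/setP => i; rewrite !inE; case: (eqVneq i j) => //= ij.
  by have := h i; rewrite ij /= => /negbTE ->.
by apply/implyP => ij; have /setP/(_ i) := h; rewrite !inE ij /= => ->.
Qed.

Lemma nonconstE k (b : {ffun 'I_k -> bool}) :
  nonconst b = (0 < #|[set i | b i]|) && (#|[set i | b i]| < k).
Proof.
have C := cardsC [set i | b i]; rewrite card_ord in C.
have -> : (#|[set i | b i]| < k) = (0 < #|~: [set i | b i]|).
  have aux a c d : a + c = d -> (a < d) = (0 < c) by move=> <-; rewrite -{1}[a]addn0 ltn_add2l.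
  exact: aux C.
apply/existsP/andP => [[i /existsP[j ij]]|[/card_gt0P[i] + /card_gt0P[j]]].
  case bi: (b i) ij => ij; (split; apply/card_gt0P); [exists i|exists j|exists j|exists i];
  by rewrite !inE ?bi //; move: ij; case: (b j).
by rewrite !inE => bi bj; exists i; apply/existsP; exists j; rewrite bi (negbTE bj).
Qed.

Section World.
Variables (n k m : nat) (F : formula n k m) (w T r sq : nat).
Hypotheses (k3 : 2 < k) (Fp : proper_formula F).
Definition NN := n.*2 + m * k + 2.
Hypothesis hW : 16 * NN * NN <= 2 ^ w.
Hypotheses (TW : T < 2 ^ w) (rW : r < 2 ^ w) (sqW : sq < 2 ^ w) (sqn : sq <= n) .
Notation sem := (sem w).
Notation ev := (ev w).
Notation x_ e j := (clx (tnth F e) j).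

Record world := Wd { wval : assignment n; wmk : {set 'I_n}; wol : {set 'I_n};
  wac : {set 'I_m}; wg0 : {set 'I_m}; wL : seq 'I_m; wB : seq 'I_m }.

(* Array [a] occupies the addresses from [a * NN] to [a * NN + NN - 1]: input,
   assignment, two marks of the graph search, active clauses, clauses on short
   cycles, list of the latter, current block. *)
Definition cell wd a i : option nat :=
  match a with
  | 0 => Some (nth 0 (input F) i)
  | 1 => omap (fun x : 'I_n => nat_of_bool (wval wd x)) (insub i)
  | 2 => omap (fun x : 'I_n => nat_of_bool (x \in wmk wd)) (insub i)
  | 3 => omap (fun x : 'I_n => nat_of_bool (x \in wol wd)) (insub i)
  | 4 => omap (fun x : 'I_m => nat_of_bool (x \in wac wd)) (insub i)
  | 5 => omap (fun x : 'I_m => nat_of_bool (x \in wg0 wd)) (insub i)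
  | 6 => omap (@nat_of_ord m) (onth (wL wd) i)
  | 7 => omap (@nat_of_ord m) (onth (wB wd) i)
  | _ => None
  end.

Definition Rg (s : store) :=
  [/\ s.1 2 = n, s.1 3 = m, s.1 4 = k, s.1 5 = NN & [/\ s.1 7 = T, s.1 8 = r, s.1 9 = sq & s.1 1 = 1]].

(** Addresses at which [cell] is [None] are unconstrained, so a list may be shortened without
    erasing its stale entries. *)
Definition Hw wd (s : store) := Rg s /\
  forall a i v, a < 8 -> i < NN -> cell wd a i = Some v -> s.2 (a * NN + i) = v.

Lemma NN_gt0 : 1 < NN. Proof. by rewrite /NN addn2. Qed.
Lemma W_big : 16 * NN <= 2 ^ w.
Proof. apply: leq_trans hW; rewrite leq_pmulr //; exact: ltnW NN_gt0. Qed.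
Lemma n_lt : n < NN. Proof. rewrite /NN; lia. Qed.
Lemma mk_lt : m * k < NN. Proof. rewrite /NN; lia. Qed.
Lemma m_lt : m < NN. Proof. apply: leq_ltn_trans mk_lt; rewrite leq_pmulr //; exact: leq_trans k3. Qed.
Lemma pos_lt (e : 'I_m) (j : 'I_k) : e * k + j < m * k.
Proof.
have : e.+1 * k <= m * k by rewrite leq_mul2r ltn_ord orbT.
rewrite mulSn; apply: leq_trans; by rewrite addnC ltn_add2r ltn_ord.
Qed.
Lemma NW : NN < 2 ^ w.
Proof. have := W_big; have := NN_gt0; lia. Qed.
Lemma small c : c <= 16 * NN - 1 -> c < 2 ^ w.
Proof. have := W_big; have := NN_gt0; lia. Qed.
Lemma kW (e : 'I_m) : k < NN.
Proof.
apply: leq_ltn_trans mk_lt; rewrite leq_pmull //; exact: leq_ltn_trans (ltn_ord e).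
Qed.

Lemma Hw_reg wd s x v : 9 < x -> Hw wd s -> Hw wd (upd s.1 x v, s.2).
Proof.
move=> x9 [[h2 h3 h4 h5 [h7 h8 h9 h1]] hm]; split=> //.
have ne y : y < 10 -> upd s.1 x v y = s.1 y.
  by move=> y9; rewrite /upd; case: eqP => // E; move: x9 y9; rewrite E ltnS ltnNge => /negbTE ->.
by split=> /=; rewrite ?ne //; split; rewrite ne.
Qed.

Lemma Hw_weak wd wd' s : Hw wd s ->
  (forall b j u, cell wd' b j = Some u -> cell wd b j = Some u) -> Hw wd' s.
Proof. by move=> [rg hm] h; split=> // a i v a8 iN /h; apply: hm. Qed.

Lemma addr_inj a b i j : i < NN -> j < NN -> a * NN + i = b * NN + j -> a = b /\ i = j.
Proof.
move=> iN jN E; have ab : a = b.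
  have := congr1 (fun z => z %/ NN) E; rewrite /= !divnMDl ?(ltnW NN_gt0) //.
  by rewrite !divn_small // !addn0.
by split=> //; move: E; rewrite ab => /addnI.
Qed.

Lemma Hw_st wd wd' s a i v : a < 8 -> i < NN -> Hw wd s ->
  (forall u, cell wd' a i = Some u -> u = v) ->
  (forall b j u, (b != a) || (j != i) -> cell wd' b j = Some u -> cell wd b j = Some u) ->
  Hw wd' (s.1, upd s.2 (a * NN + i) v).
Proof.
move=> a8 iN [rg hm] h1 h2; split=> // b j u b8 jN E; rewrite /= /upd.
case: eqP => [/addr_inj [] // eb ej|ne].
  by rewrite eb ej in E; rewrite (h1 _ E).
apply: hm => //; apply: h2 E; rewrite -negb_and; apply/negP => /andP[/eqP eb /eqP ej].
by apply: ne; rewrite eb ej.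
Qed.

Lemma Hw_val v mk ol ac g0 L B (v' : assignment n) s (x : 'I_n) (b : bool) :
  Hw (Wd v mk ol ac g0 L B) s -> (forall y, v' y = if y == x then b else v y) ->
  Hw (Wd v' mk ol ac g0 L B) (s.1, upd s.2 (1 * NN + x) b).
Proof.
move=> hw hE; apply: (Hw_st _ _ hw) => // [|u|]; first exact: ltn_trans (ltn_ord x) n_lt.
  by rewrite /= valK /= hE eqxx => -[].
move=> [|[|[|[|[|[|[|[|b']]]]]]]] j u //=; case: insubP => //= y _ <-.
by case: (eqVneq y x) => [->|yx]; rewrite ?eqxx //= => _; rewrite hE (negbTE yx).
Qed.

Lemma Hw_mk v mk ol ac g0 L B (mk' : {set 'I_n}) s (x : 'I_n) (b : bool) :
  Hw (Wd v mk ol ac g0 L B) s -> (forall y, (y \in mk') = if y == x then b else y \in mk) ->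
  Hw (Wd v mk' ol ac g0 L B) (s.1, upd s.2 (2 * NN + x) b).
Proof.
move=> hw hE; apply: (Hw_st _ _ hw) => // [|u|]; first exact: ltn_trans (ltn_ord x) n_lt.
  by rewrite /= valK /= hE eqxx => -[].
move=> [|[|[|[|[|[|[|[|b']]]]]]]] j u //=; case: insubP => //= y _ <-.
by case: (eqVneq y x) => [->|yx]; rewrite ?eqxx //= => _; rewrite hE (negbTE yx).
Qed.

Lemma Hw_ol v mk ol ac g0 L B (ol' : {set 'I_n}) s (x : 'I_n) (b : bool) :
  Hw (Wd v mk ol ac g0 L B) s -> (forall y, (y \in ol') = if y == x then b else y \in ol) ->
  Hw (Wd v mk ol' ac g0 L B) (s.1, upd s.2 (3 * NN + x) b).
Proof.
move=> hw hE; apply: (Hw_st _ _ hw) => // [|u|]; first exact: ltn_trans (ltn_ord x) n_lt.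
  by rewrite /= valK /= hE eqxx => -[].
move=> [|[|[|[|[|[|[|[|b']]]]]]]] j u //=; case: insubP => //= y _ <-.
by case: (eqVneq y x) => [->|yx]; rewrite ?eqxx //= => _; rewrite hE (negbTE yx).
Qed.

Lemma Hw_ac v mk ol ac g0 L B (ac' : {set 'I_m}) s (x : 'I_m) (b : bool) :
  Hw (Wd v mk ol ac g0 L B) s -> (forall y, (y \in ac') = if y == x then b else y \in ac) ->
  Hw (Wd v mk ol ac' g0 L B) (s.1, upd s.2 (4 * NN + x) b).
Proof.
move=> hw hE; apply: (Hw_st _ _ hw) => // [|u|]; first exact: ltn_trans (ltn_ord x) m_lt.
  by rewrite /= valK /= hE eqxx => -[].
move=> [|[|[|[|[|[|[|[|b']]]]]]]] j u //=; case: insubP => //= y _ <-.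
by case: (eqVneq y x) => [->|yx]; rewrite ?eqxx //= => _; rewrite hE (negbTE yx).
Qed.

Lemma Hw_g0 v mk ol ac g0 L B (g0' : {set 'I_m}) s (x : 'I_m) (b : bool) :
  Hw (Wd v mk ol ac g0 L B) s -> (forall y, (y \in g0') = if y == x then b else y \in g0) ->
  Hw (Wd v mk ol ac g0' L B) (s.1, upd s.2 (5 * NN + x) b).
Proof.
move=> hw hE; apply: (Hw_st _ _ hw) => // [|u|]; first exact: ltn_trans (ltn_ord x) m_lt.
  by rewrite /= valK /= hE eqxx => -[].
move=> [|[|[|[|[|[|[|[|b']]]]]]]] j u //=; case: insubP => //= y _ <-.
by case: (eqVneq y x) => [->|yx]; rewrite ?eqxx //= => _; rewrite hE (negbTE yx).
Qed.

Definition addr a e := EB Add (EB Mul (EN a) (EV 5)) e.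
Definition ar a e := EL (addr a e).
Definition st a i v := CSto (addr a i) v.
Definition lit e j := EL (EB Add (EN 2) (EB Add (EB Mul e (EV 4)) j)).
Definition var e j := EB Div (lit e j) (EN 2).
Definition sg e j := EB Defs.Sub (lit e j) (EB Mul (EN 2) (var e j)).
(** With truncated subtraction this is one minus the distance between the value of the variable and
    the sign of the literal. *)
Definition lvx e j := EB Defs.Sub (EN 1)
  (EB Add (EB Defs.Sub (ar 1 (var e j)) (sg e j)) (EB Defs.Sub (sg e j) (ar 1 (var e j)))).

Lemma evB o a b s : ev (EB o a b) s = eval_op o (ev a s) (ev b s) %% 2 ^ w.
Proof. by []. Qed.
Lemma evL a s : ev (EL a) s = s.2 (ev a s). Proof. by []. Qed.
Lemma evV x s : ev (EV x) s = s.1 x. Proof. by []. Qed.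

Lemma evN c s : c < 16 -> ev (EN c) s = c.
Proof. by move=> c16; apply: modn_small; apply: small; have := NN_gt0; lia. Qed.

Lemma ev_addr a e s wd i : a < 8 -> i < NN -> Hw wd s -> ev e s = i -> ev (addr a e) s = a * NN + i.
Proof.
move=> a8 iN [[_ _ _ h5 _] _] E; rewrite /addr !evB evN; last by lia.
rewrite evV /eval_op.
have aN : a * NN <= 7 * NN by rewrite leq_mul2r -ltnS a8 orbT.
have ? := NN_gt0.
by rewrite h5 E [a * NN %% _]modn_small ?modn_small //; apply: small; lia.
Qed.

Lemma ev_ar a e s wd i v : a < 8 -> i < NN -> Hw wd s -> ev e s = i -> cell wd a i = Some v ->
  ev (ar a e) s = v.
Proof. by move=> a8 iN hw E C; rewrite /ar evL (ev_addr a8 iN hw E); case: hw => _; apply. Qed.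

Lemma Dt_st Q a e e' s wd i v : a < 8 -> i < NN -> Hw wd s -> ev e s = i -> ev e' s = v ->
  Q (s.1, upd s.2 (a * NN + i) v) -> Dt Q (sem (st a e e') s).
Proof.
by move=> a8 iN hw E E' q; exists (s.1, upd s.2 (a * NN + i) v); rewrite // -(ev_addr a8 iN hw E) -E'.
Qed.

Lemma nth_flat (A : Type) (x0 : A) (ss : seq (seq A)) i j : i < size ss -> j < k ->
  all (fun q => size q == k) ss -> nth x0 (flatten ss) (i * k + j) = nth x0 (nth [::] ss i) j.
Proof.
move=> + jk; elim: ss i => [//|q ss IH] [|i] /= si /andP[/eqP sq' al].
  by rewrite nth_cat sq' mul0n add0n jk.
by rewrite nth_cat sq' mulSn -addnA ltnNge leq_addr /= addKn IH.
Qed.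

Lemma size_flat (A : Type) (ss : seq (seq A)) :
  all (fun q => size q == k) ss -> size (flatten ss) = size ss * k.
Proof. by elim: ss => //= q ss IH /andP[/eqP sq' al]; rewrite size_cat sq' IH // mulSn. Qed.

Lemma nth_input (e : 'I_m) (j : 'I_k) :
  nth 0 (input F) (2 + (e * k + j)) = encode_literal (tnth (tnth F e) j).
Proof.
rewrite /input /=; set fl := flatten _.
have al : all (fun q => size q == k) [seq tval c | c <- F].
  by rewrite all_map; apply/allP => c _ /=; rewrite size_tuple.
have sz : e < size [seq tval c | c <- F] by rewrite size_map size_tuple.
have szf : e * k + j < size fl by rewrite size_flat // size_map size_tuple pos_lt.
rewrite (nth_map (tnth (tnth F e) j)) // nth_flat // (nth_map (tnth F e)) ?size_tuple //.
by rewrite -!tnth_nth.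
Qed.

Section Exprs.
Variables (wd : world) (s : store) (ee jj : expr) (e : 'I_m) (j : 'I_k).
Hypotheses (hw : Hw wd s) (hee : ev ee s = e) (hjj : ev jj s = j).

Lemma ev_lit : ev (lit ee jj) s = encode_literal (tnth (tnth F e) j).
Proof.
have [[_ _ h4 _ _] hm] := hw; have pl := pos_lt e j; have mN := mk_lt; have ? := NN_gt0.
have -> : ev (lit ee jj) s = s.2 (2 + (e * k + j)).
  rewrite /lit evL !evB evN // hee hjj evV h4 /eval_op.
  rewrite [e * k %% _]modn_small; last by apply: small; lia.
  rewrite [(e * k + j) %% _]modn_small; last by apply: small; lia.
  by rewrite modn_small //; apply: small; lia.
have -> : 2 + (e * k + j) = 0 * NN + (2 + (e * k + j)) by [].
apply: hm => //; first by rewrite /NN; lia.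
by rewrite /= -nth_input.
Qed.

Lemma enc_lt (l : literal n) : encode_literal l < NN.
Proof. rewrite /encode_literal /NN; case: l => x b /=; have := ltn_ord x; case: b => /=; lia. Qed.

Lemma ev_var : ev (var ee jj) s = x_ e j.
Proof.
have := enc_lt (tnth (tnth F e) j) => h; have ? := NN_gt0.
rewrite /var evB ev_lit evN // /eval_op.
rewrite ffunE modn_small; last by apply: small; apply: leq_trans (leq_div _ _) _; lia.
by rewrite /encode_literal; case: (tnth _ j) => x b /=; case: b => /=; lia.
Qed.

Lemma ev_sg : ev (sg ee jj) s = (tnth (tnth F e) j).2.
Proof.
have := enc_lt (tnth (tnth F e) j) => h; have ? := NN_gt0.
rewrite /sg evB ev_lit evB ev_var evN // ffunE /eval_op.
move: h; rewrite /encode_literal; case: (tnth _ j) => x b /= h.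
rewrite [2 * x %% _]modn_small; last by apply: small; case: b h => /=; lia.
by rewrite modn_small; [case: b h => /=; lia|apply: small; case: b h => /=; lia].
Qed.

Lemma ev_arx a (f : 'I_n -> bool) : 0 < a < 4 ->
  (forall x : 'I_n, cell wd a x = Some (nat_of_bool (f x))) ->
  ev (ar a (var ee jj)) s = f (x_ e j).
Proof.
move=> a03 h; apply: (ev_ar (i := x_ e j) _ _ hw) => //; [by lia|exact: ltn_trans n_lt|exact: ev_var].
Qed.

Lemma ev_lv : ev (lvx ee jj) s = clv (wval wd) (tnth F e) j.
Proof.
have ? := NN_gt0.
have h1 : ev (ar 1 (var ee jj)) s = wval wd (x_ e j).
  by apply: ev_arx => // x; rewrite /= valK.
have sm (b : nat) : b < 3 -> b %% 2 ^ w = b by move=> ?; apply: modn_small; apply: small; lia.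
have -> : ev (lvx ee jj) s = (1 - ((wval wd (x_ e j) - (tnth (tnth F e) j).2) %% 2 ^ w +
     ((tnth (tnth F e) j).2 - wval wd (x_ e j)) %% 2 ^ w) %% 2 ^ w) %% 2 ^ w.
  by rewrite /lvx evB evN // (evB Add) (evB Defs.Sub (ar 1 (var ee jj))) (evB Defs.Sub (sg ee jj)) ev_sg h1.
rewrite !ffunE /sat_literal; set a := wval wd _; case: (tnth _ j) a => x b a /=.
by case: a; case: b; rewrite /= !sm.
Qed.

End Exprs.

Lemma cell1 v mk ol ac g0 L B (x : 'I_n) :
  cell (Wd v mk ol ac g0 L B) 1 x = Some (nat_of_bool (v x)).
Proof. by rewrite /= valK. Qed.
Lemma cell2 v mk ol ac g0 L B (x : 'I_n) :
  cell (Wd v mk ol ac g0 L B) 2 x = Some (nat_of_bool (x \in mk)).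
Proof. by rewrite /= valK. Qed.
Lemma cell3 v mk ol ac g0 L B (x : 'I_n) :
  cell (Wd v mk ol ac g0 L B) 3 x = Some (nat_of_bool (x \in ol)).
Proof. by rewrite /= valK. Qed.

Definition clr := CFor 10 2 (st 2 (EV 10) (EN 0)).

Lemma clr_ok v mk ol ac g0 L B s : Hw (Wd v mk ol ac g0 L B) s ->
  Dt (Hw (Wd v finset.set0 ol ac g0 L B)) (sem clr s).
Proof.
move=> hw; apply: (Dt_for (N := n) (I := fun i =>
    Hw (Wd v [set y in mk | i <= y] ol ac g0 L B))) => //.
- by case: hw => -[].
- exact: ltn_trans n_lt NW.
- apply: Hw_reg => //; have -> : [set y in mk | 0 <= y] = mk by apply/setP => y; rewrite inE andbT.
  exact: hw.
- move=> i s1 iN x1 _ h1; pose x := Ordinal iN.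
  apply: (Dt_st (i := x) (v := false) _ _ h1) => //; [exact: ltn_trans n_lt|by rewrite evN|].
  apply: Hw_reg => //; apply: (Hw_mk h1) => y; rewrite !inE.
  by rewrite ltn_neqAle eq_sym -(inj_eq val_inj) /=; case: eqP; rewrite ?andbF.
- move=> s1 _; suff -> : [set y in mk | n <= y] = finset.set0 by [].
  by apply/setP => y; rewrite !inE leqNgt ltn_ord andbF.
Qed.

Definition cpy := CFor 10 2 (st 3 (EV 10) (ar 2 (EV 10))).

Lemma cpy_ok v mk ol ac g0 L B s : Hw (Wd v mk ol ac g0 L B) s ->
  Dt (Hw (Wd v mk mk ac g0 L B)) (sem cpy s).
Proof.
move=> hw; apply: (Dt_for (N := n) (I := fun i =>
    Hw (Wd v mk [set y : 'I_n | if y < i then y \in mk else y \in ol] ac g0 L B))) => //.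
- by case: hw => -[].
- exact: ltn_trans n_lt NW.
- apply: Hw_reg => //; have -> : [set y : 'I_n | if y < 0 then y \in mk else y \in ol] = ol.
    by apply/setP => y; rewrite inE.
  exact: hw.
- move=> i s1 iN x1 _ h1; pose x := Ordinal iN.
  have xN : x < NN by exact: ltn_trans n_lt.
  apply: (Dt_st (i := x) (v := x \in mk) _ _ h1) => //.
    by apply: (ev_ar (i := x) _ _ h1) => //; exact: cell2.
  apply: Hw_reg => //; apply: (Hw_ol h1) => y; rewrite !inE ltnS leq_eqVlt.
  by rewrite -[(y : nat) == i]/(y == x); case: eqP => [->|].
- move=> s1 _; suff -> : [set y : 'I_n | if y < n then y \in mk else y \in ol] = mk by [].
  by apply/setP => y; rewrite !inE ltn_ord.
Qed.

Definition mkc_ x := CFor 13 4 (st 2 (var (EV x) (EV 13)) (EN 1)).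

Lemma mkc_ok v mk ol ac g0 L B s x (e : 'I_m) : x != 13 -> Hw (Wd v mk ol ac g0 L B) s -> s.1 x = e ->
  Dt (Hw (Wd v (mk :|: VF F e) ol ac g0 L B)) (sem (mkc_ x) s).
Proof.
move=> x13 hw xe; apply: (Dt_for (N := k) (I := fun i =>
    Hw (Wd v [set y | (y \in mk) || [exists j : 'I_k, (j < i) && (x_ e j == y)]] ol ac g0 L B))) => //.
- by case: hw => -[].
- exact: ltn_trans (kW e) NW.
- apply: Hw_reg => //; set mk0 := [set y | _]; have -> : mk0 = mk; last exact: hw.
  by apply/setP => y; rewrite inE ex_lt0 orbF.
- move=> i s1 ik x1 f1 h1; pose j := Ordinal ik.
  have xe1 : s1.1 x = e by rewrite f1 // inE.
  apply: (Dt_st (i := x_ e j) (v := true) _ _ h1) => //.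
  + exact: ltn_trans (ltn_ord _) n_lt.
  + by apply: (ev_var h1).
  + by rewrite evN.
  apply: Hw_reg => //; apply: (Hw_mk h1) => y; rewrite !inE (ex_ltS j (fun j => x_ e j == y)).
  by rewrite eq_sym; case: eqP; rewrite ?orbT ?orbF.
- move=> s1 _; set mk0 := [set y | _]; have -> // : mk0 = mk :|: VF F e.
  apply/setP => y; rewrite !inE ex_ltT; congr (_ || _).
  by apply/existsP/imsetP => [[j /eqP <-]|[j _ ->]]; exists j.
Qed.

Definition cntc x := CSeq (CAsg 31 (EN 0)) (CFor 32 4 (CAsg 31 (EB Add (EV 31) (lvx (EV x) (EV 32))))).
Definition ntrue (v : assignment n) e := #|[set j | clv v (tnth F e) j]|.

Lemma cntc_ok wd s x (e : 'I_m) : x \notin [:: 31; 32] -> Hw wd s -> s.1 x = e ->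
  Dt (fun s' => Hw wd s' /\ s'.1 31 = ntrue (wval wd) e) (sem (cntc x) s).
Proof.
rewrite !inE => /norP[x31 x32] hw xe; apply: (Dt_seq (Q := fun s1 => Hw wd s1 /\ s1.1 31 = 0)).
  by apply: Dt_asg; split; [apply: Hw_reg|rewrite /= mod0n].
move=> s1 f1 [h1 c1]; apply: (Dt_for (N := k) (I := fun i s2 =>
    Hw wd s2 /\ s2.1 31 = cnt_lt (clv (wval wd) (tnth F e)) i)) => //.
- by case: h1 => -[].
- exact: ltn_trans (kW e) NW.
- by split; [apply: Hw_reg|rewrite cnt_lt0].
- move=> i s2 ik y2 f2 [h2 c2]; pose j := Ordinal ik; apply: Dt_asg; split.
    by apply: Hw_reg => //; apply: Hw_reg.
  have xe2 : s2.1 x = e by rewrite f2 ?f1 // !inE ?(negbTE x31) ?(negbTE x32).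
  have E := @ev_lv wd s2 (EV x) (EV 32) e j h2 xe2 y2.
  rewrite -[LHS]/(ev (EB Add (EV 31) (lvx (EV x) (EV 32))) s2) evB evV E c2 /eval_op.
  rewrite -[RHS]/(cnt_lt _ j.+1) cnt_ltS modn_small //.
  have := cnt_lt_leq (clv (wval wd) (tnth F e)) i => ?.
  have := kW e; have ? := NN_gt0; case: (clv _ _ _) => ? /=; apply: small; lia.
- by move=> s2 _ [h2 c2]; split=> //; rewrite c2 cnt_ltT.
Qed.

(* [mc < 2] tests whether literal [EV 13] of clause [EV x] is the unique minority
   literal; register 31 holds the number of true literals of that clause. *)
Definition mc x := EB Add (EB Mul (lvx (EV x) (EV 13)) (EV 31))
  (EB Mul (EB Defs.Sub (EN 1) (lvx (EV x) (EV 13))) (EB Defs.Sub (EV 4) (EV 31))).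

Lemma mc_ok wd s x (e : 'I_m) (j : 'I_k) : Hw wd s -> s.1 x = e -> s.1 13 = j ->
  s.1 31 = ntrue (wval wd) e ->
  (ev (mc x) s < ev (EN 2) s) = minor (clv (wval wd) (tnth F e)) j.
Proof.
move=> hw xe xj c; rewrite minorE -/(ntrue _ _) evN //.
have E := @ev_lv wd s (EV x) (EV 13) e j hw xe xj.
have [[_ _ h4 _ _] _] := hw; have ? := NN_gt0; have := kW e => kN.
have nk : ntrue (wval wd) e <= k by rewrite -[leqRHS]card_ord max_card.
rewrite /mc (evB Add) (evB Mul (lvx _ _)) (evB Mul (EB _ _ _)) (evB Defs.Sub (EN 1)) (evB Defs.Sub (EV 4)) E !evV h4 c evN // /eval_op.
have sm a : a <= k -> a %% 2 ^ w = a by move=> ck; apply: modn_small; apply: small; lia.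
have sm1 (a : nat) : a < 2 -> a %% 2 ^ w = a by move=> ck; apply: modn_small; apply: small; lia.
case: (clv _ _ _) => /=; first by rewrite subnn mul1n mod0n mul0n mod0n addn0 !sm.
by rewrite subn0 mul0n mod0n add0n (sm1 1) // mul1n !sm ?leq_subr.
Qed.

Definition tst1 um x := if um then mc x else EN 0.
Definition tst2 (um : bool) := if um then EN 2 else EN 1.
Definition scan um := CFor 13 4 (CIf (EN 0) (ar 3 (var (EV 11) (EV 13)))
   (CIf (tst1 um 11) (tst2 um) (CAsg 12 (EN 1)) CSkip) CSkip).
(** A round reads the marks from the copy in array 3 and writes to array 2, so a variable marked in
    this round fires clauses in the next round only. The number of rounds is thus the depth of the
    search. *)
Definition rnd um g1 g2 := CSeq cpy (CFor 11 3 (CSeq (CAsg 12 (EN 0))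
  (CSeq (CIf g1 g2 (CSeq (if um then cntc 11 else CSkip) (scan um)) CSkip)
        (CIf (EN 0) (EV 12) (mkc_ 11) CSkip)))).

Definition tpos (um : bool) v e j := um ==> minor (clv v (tnth F e)) j.
Definition actv um (G : pred 'I_m) v (mk : {set 'I_n}) e :=
  G e && [exists j, (x_ e j \in mk) && tpos um v e j].
Definition grw um G v mk : {set 'I_n} := mk :|: \bigcup_(e | actv um G v mk e) VF F e.

Lemma scan_ok (um : bool) v mk ol ac g0 L B s (e : 'I_m) : Hw (Wd v mk ol ac g0 L B) s -> s.1 11 = e ->
  s.1 12 = 0 -> (um -> s.1 31 = ntrue v e) ->
  Dt (fun s' => Hw (Wd v mk ol ac g0 L B) s' /\
     s'.1 12 = [exists j, (x_ e j \in ol) && tpos um v e j]) (sem (scan um) s).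
Proof.
move=> hw xe z12 c31; apply: (Dt_for (N := k) (I := fun i s2 => Hw (Wd v mk ol ac g0 L B) s2 /\
   s2.1 12 = [exists j : 'I_k, (j < i) && ((x_ e j \in ol) && tpos um v e j)])) => //.
- by case: hw => -[].
- exact: ltn_trans (kW e) NW.
- by split; [apply: Hw_reg|rewrite ex_lt0].
- move=> i s1 ik y1 f1 [h1 c1]; pose j := Ordinal ik.
  have xe1 : s1.1 11 = e by rewrite f1 //; case: um {c31 f1 c1}.
  apply: (Dt_if (b := x_ e j \in ol)).
  + rewrite evN // (@ev_arx _ s1 (EV 11) (EV 13) e j h1 xe1 y1 3 (fun x => x \in ol)) //.
      by case: (_ \in ol).
    by move=> x; exact: cell3.
  + move=> jo; apply: (Dt_if (b := tpos um v e j)).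
    * rewrite /tpos; case: um c31 f1 c1 => c31 f1 c1; last by rewrite /tst1 /tst2 !evN.
      rewrite implyTb; apply: (mc_ok (j := j) h1 xe1 y1); by rewrite f1 ?c31.
    * move=> tj; apply: Dt_asg; split; first by do 2 apply: Hw_reg => //.
      rewrite /upd [LHS]/= -[1 %% _]/(ev (EN 1) s1) evN //.
      by rewrite (ex_ltS j (fun j => (x_ e j \in ol) && tpos um v e j)) jo tj orbT.
    * move=> tj; apply: Dt_skip; split; first by apply: Hw_reg.
      by rewrite /upd [LHS]/= c1 (ex_ltS j (fun j => (x_ e j \in ol) && tpos um v e j)) (negbTE tj) andbF orbF.
  + move=> jo; apply: Dt_skip; split; first by apply: Hw_reg.
    by rewrite /upd [LHS]/= c1 (ex_ltS j (fun j => (x_ e j \in ol) && tpos um v e j)) (negbTE jo) orbF.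
- by move=> s1 _ [h1 c1]; split=> //; rewrite c1 ex_ltT.
Qed.

Lemma rnd_ok um g1 g2 (G : pred 'I_m) v mk ol ac g0 L B s :
  Hw (Wd v mk ol ac g0 L B) s ->
  (forall (e : 'I_m) s1 mk1 ol1, Hw (Wd v mk1 ol1 ac g0 L B) s1 -> s1.1 11 = e ->
     fr (rnd um g1 g2) s s1 -> (ev g1 s1 < ev g2 s1) = G e) ->
  Dt (Hw (Wd v (grw um G v mk) mk ac g0 L B)) (sem (rnd um g1 g2) s).
Proof.
move=> hw hG; apply: (Dt_seq (cpy_ok hw)) => s1 f1 h1.
apply: (Dt_for (N := m) (I := fun i => Hw (Wd v [set y | (y \in mk) ||
   [exists e : 'I_m, (e < i) && (actv um G v mk e && (y \in VF F e))]] mk ac g0 L B))) => //.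
- by case: h1 => -[].
- exact: ltn_trans m_lt NW.
- by case: um {hG}.
- apply: Hw_reg => //; set mk0 := [set y | _]; have -> : mk0 = mk; last exact: h1.
  by apply/setP => y; rewrite inE ex_lt0 orbF.
- move=> i s2 im xe f2 h2; pose e := Ordinal im.
  have fs : fr (rnd um g1 g2) s s2 := fr_seq f1 f2.
  set mk2 := [set y | _] in h2.
  apply: (Dt_seq (Q := fun s3 => Hw (Wd v mk2 mk ac g0 L B) s3 /\ s3.1 12 = 0)).
    by apply: Dt_asg; split; [apply: Hw_reg|rewrite /= mod0n].
  move=> s3 f3 [h3 z3]; have xe3 : s3.1 11 = e by rewrite f3.
  have fs3 : fr (rnd um g1 g2) s s3.
    move=> z zn; rewrite f3 ?fs //.
    by apply: contraNN zn; rewrite inE => /eqP ->; case: um {hG f2 fs h2 mk2 h3}.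
  apply: (Dt_seq (Q := fun s4 => Hw (Wd v mk2 mk ac g0 L B) s4 /\ s4.1 12 = actv um G v mk e)).
    apply: (Dt_if (hG e s3 mk2 mk h3 xe3 fs3)) => Ge; last first.
      by apply: Dt_skip; split=> //; rewrite /actv (negbTE Ge).
    apply: (Dt_seq (Q := fun s4 => [/\ Hw (Wd v mk2 mk ac g0 L B) s4 , s4.1 12 = 0, s4.1 11 = e &
        (um -> s4.1 31 = ntrue v e)])).
      case: (um); last by apply: Dt_skip.
      have := @cntc_ok _ s3 11 e isT h3 xe3 => hc.
      apply: Dt_weak (Dt_Lf hc (sem_fr w _ _)) _ => s4 [[h4 c4] f4]; split=> //; by rewrite f4.
    move=> s4 _ [h4 z4 x4 c4]; apply: Dt_weak (scan_ok h4 x4 z4 c4) _ => s5 [h5 c5]; split=> //.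
    by rewrite c5 /actv Ge.
  move=> s4 f4 [h4 z4].
  have xe4 : s4.1 11 = e by rewrite f4 //; case: um {hG f2 fs h2 mk2 h3 fs3 f4 h4 z4}.
  have upE (mk' : {set 'I_n}) : mk' = mk2 :|: (if actv um G v mk e then VF F e else finset.set0) ->
     mk' = [set y | (y \in mk) || [exists e : 'I_m, (e < i.+1) && (actv um G v mk e && (y \in VF F e))]].
    move=> ->; apply/setP => y; rewrite !inE (ex_ltS e (fun e => actv um G v mk e && (y \in VF F e))) orbA.
    by congr (_ || _); case: ifP => //; rewrite inE.
  apply: (Dt_if (b := actv um G v mk e)).
  + by rewrite evN //= z4; case: actv.
  + move=> ae; apply: Dt_weak (mkc_ok (x := 11) isT h4 xe4) _ => s5 h5.
    by apply: Hw_reg => //; rewrite -(upE (mk2 :|: VF F e)) // ae.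
  + move=> ae; apply: Dt_skip; apply: Hw_reg => //; rewrite -(upE mk2) //.
    by rewrite (negbTE ae) finset.setU0.
- move=> s2 _; set mk0 := [set y | _]; have -> // : mk0 = grw um G v mk.
  apply/setP => y; rewrite !inE ex_ltT; congr (_ || _).
  apply/existsP/bigcupP => [[e /andP[ae ye]]|[e ae ye]]; exists e => //; exact/andP.
Qed.

Definition rch um g1 g2 y := CFor 14 y (rnd um g1 g2).

Lemma rch_ok um g1 g2 y N (G : pred 'I_m) v mk ol ac g0 L B s :
  Hw (Wd v mk ol ac g0 L B) s -> s.1 y = N -> N < 2 ^ w ->
  (forall (e : 'I_m) s1 mk1 ol1, Hw (Wd v mk1 ol1 ac g0 L B) s1 -> s1.1 11 = e ->
     fr (rch um g1 g2 y) s s1 -> (ev g1 s1 < ev g2 s1) = G e) ->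
  Dt (fun s' => exists ol', Hw (Wd v (iter N (grw um G v) mk) ol' ac g0 L B) s') (sem (rch um g1 g2 y) s).
Proof.
move=> hw yN NW' hG; apply: (Dt_for (N := N) (I := fun i s' => exists ol',
   Hw (Wd v (iter i (grw um G v) mk) ol' ac g0 L B) s')) => //.
- by case: um {hG}.
- by exists ol; apply: Hw_reg.
- move=> i s1 iN x1 f1 [ol1 h1].
  apply: Dt_weak (rnd_ok (G := G) h1 _) _.
    move=> e s2 mk2 ol2 h2 xe f2; apply: (hG e s2 mk2 ol2 h2 xe).
    exact: fr_for f1 f2.
  by move=> s2 h2; eexists; apply: Hw_reg => //; exact: h2.
Qed.

Lemma grw_um (ac : {set 'I_m}) v mk :
  grw true (fun e => e \in ac) v mk = grow (VF F) (mn (umF F v) ac) mk.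
Proof.
rewrite /grw /grow; congr (_ :|: _); apply: eq_bigl => e; rewrite /actv /tpos /mn /=.
apply/andP/existsP => [[eA /existsP[j /andP[jm mj]]]|[y /andP[ym /andP[eA /existsP[j /andP[/eqP xj mj]]]]]].
  by exists (x_ e j); rewrite jm eA umF_pos.
by split=> //; apply/existsP; exists j; rewrite xj ym.
Qed.

Lemma grw_pl (K : {set 'I_m}) v mk :
  grw false (fun e => e \in K) v mk = grow (VF F) (pl (VF F) K) mk.
Proof.
rewrite /grw /grow; congr (_ :|: _); apply: eq_bigl => e; rewrite /actv /tpos /pl /=.
apply/andP/existsP => [[eA /existsP[j /andP[jm _]]]|[y /andP[ym /andP[eA /imsetP[j _ xj]]]]].
  by exists (x_ e j); rewrite jm eA clx_V.
by split=> //; apply/existsP; exists j; rewrite -xj ym.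
Qed.

(** The test in arithmetic form: a clause obstructs the switch iff [S] cuts it and contains a second
    variable of it or its minority variable. *)
Lemma clause_okE v (S : {set 'I_n}) e :
  let c := #|[set j | x_ e j \in S]| in
  let bd := [exists j, (x_ e j \in S) && minor (clv v (tnth F e)) j] in
  clause_ok (VF F) (umF F v) S e = ~~ [&& 0 < c, c < k & 0 < (c - 1) + bd].
Proof.
move=> c bd; have ck : c <= k by rewrite -[leqRHS]card_ord max_card.
have VS : (VF F e \subset S) = (c == k).
  rewrite eqn_leq ck /=; apply/fintype.subsetP/idP => [h|kc y /imsetP[j _ ->]].
    rewrite -[leqLHS]card_ord; apply: subset_leq_card; apply/fintype.subsetP => j _.
    by rewrite inE h ?clx_V.
  have : [set j | x_ e j \in S] = [set: 'I_k].
    by apply/eqP; rewrite eqEcard finset.subsetT cardsT card_ord.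
  by move/setP/(_ j); rewrite !inE.
rewrite /clause_ok VS; case: (eqVneq c k) => [E|ne].
  by rewrite E ltnn andbF.
have cltk : c < k by rewrite ltn_neqAle ne.
rewrite cltk /=; case: (posnP c) => [c0|cgt].
  rewrite c0 /=; apply/forallP => y; apply/implyP; rewrite inE => /andP[/imsetP[j _ ->] jS].
  by have := card0_eq c0 j; rewrite inE jS.
rewrite /= -eqn0Ngt addn_eq0 subn_eq0.
apply/forallP/andP => [h|[c1 nb] y].
  split.
    rewrite leqNgt; apply/negP => /card_gt1P[i [j [iS jS ij]]].
    rewrite !inE in iS jS; have := h (x_ e i); rewrite inE clx_V iS /= => /andP[_ /forallP/(_ (x_ e j))].
    by rewrite inE clx_V jS /= => /eqP/(clx_inj Fp) E; rewrite E eqxx in ij.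
  rewrite eqb0; apply/existsP => -[j /andP[jS mj]]; have := h (x_ e j).
  by rewrite inE clx_V jS /= umF_pos // mj.
apply/implyP; rewrite inE => /andP[/imsetP[j _ ->] jS]; apply/andP; split.
  rewrite umF_pos //; apply/negP => mj; move: nb; rewrite eqb0 => /existsP; apply.
  by exists j; rewrite jS.
apply/forallP => z; apply/implyP; rewrite inE => /andP[/imsetP[i _ ->] iS].
have [<- //|ij] := eqVneq i j; exfalso.
have : 1 < c by apply/card_gt1P; exists i, j; rewrite !inE iS jS.
by rewrite ltnNge c1.
Qed.

Definition cscan := CFor 13 4 (CIf (EN 0) (ar 2 (var (EV 11) (EV 13)))
  (CSeq (CAsg 33 (EB Add (EV 33) (EN 1))) (CIf (mc 11) (EN 2) (CAsg 34 (EN 1)) CSkip)) CSkip).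
Definition cdec := CIf (EN 0) (EV 33) (CIf (EV 33) (EV 4)
  (CIf (EN 0) (EB Add (EB Defs.Sub (EV 33) (EN 1)) (EV 34)) (CAsg 15 (EN 0)) CSkip) CSkip) CSkip.
Definition chk := CFor 11 3 (CIf (EN 0) (ar 4 (EV 11))
  (CSeq (cntc 11) (CSeq (CAsg 33 (EN 0)) (CSeq (CAsg 34 (EN 0)) (CSeq cscan cdec)))) CSkip).
Definition flp := CIf (EN 0) (EV 15) (CFor 10 2 (CIf (EN 0) (ar 2 (EV 10))
  (st 1 (EV 10) (EB Defs.Sub (EN 1) (ar 1 (EV 10)))) CSkip)) CSkip.
Definition swc := CSeq clr (CSeq (st 2 (EV 20) (EN 1))
  (CSeq (rch true (EN 0) (ar 4 (EV 11)) 7) (CSeq (CAsg 15 (EN 1)) (CSeq chk flp)))).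

Lemma cell_ac v mk ol ac g0 L B (e : 'I_m) :
  cell (Wd v mk ol ac g0 L B) 4 e = Some (nat_of_bool (e \in ac)).
Proof. by rewrite /= valK. Qed.
Lemma cell_g0 v mk ol ac g0 L B (e : 'I_m) :
  cell (Wd v mk ol ac g0 L B) 5 e = Some (nat_of_bool (e \in g0)).
Proof. by rewrite /= valK. Qed.

Lemma ev_ac v mk ol ac g0 L B s x (e : 'I_m) : Hw (Wd v mk ol ac g0 L B) s -> s.1 x = e ->
  ev (ar 4 (EV x)) s = (e \in ac).
Proof.
move=> hw xe; apply: (ev_ar (i := e) _ _ hw) => //; last exact: cell_ac.
exact: ltn_trans m_lt.
Qed.
Lemma ev_g0 v mk ol ac g0 L B s x (e : 'I_m) : Hw (Wd v mk ol ac g0 L B) s -> s.1 x = e ->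
  ev (ar 5 (EV x)) s = (e \in g0).
Proof.
move=> hw xe; apply: (ev_ar (i := e) _ _ hw) => //; last exact: cell_g0.
exact: ltn_trans m_lt.
Qed.
Lemma ev_mk v mk ol ac g0 L B s x y (e : 'I_m) (j : 'I_k) : Hw (Wd v mk ol ac g0 L B) s ->
  s.1 x = e -> s.1 y = j -> ev (ar 2 (var (EV x) (EV y))) s = (x_ e j \in mk).
Proof.
move=> hw xe xj; apply: (@ev_arx _ s (EV x) (EV y) e j hw xe xj 2 (fun x => x \in mk)) => // z.
exact: cell2.
Qed.

Lemma cscan_ok v mk ol ac g0 L B s (e : 'I_m) : Hw (Wd v mk ol ac g0 L B) s -> s.1 11 = e ->
  s.1 31 = ntrue v e -> s.1 33 = 0 -> s.1 34 = 0 ->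
  Dt (fun s' => [/\ Hw (Wd v mk ol ac g0 L B) s', s'.1 33 = #|[set j | x_ e j \in mk]| &
     s'.1 34 = [exists j, (x_ e j \in mk) && minor (clv v (tnth F e)) j]]) (sem cscan s).
Proof.
move=> hw xe c31 z33 z34; pose P j := (x_ e j \in mk) && minor (clv v (tnth F e)) j.
apply: (Dt_for (N := k) (I := fun i s2 => [/\ Hw (Wd v mk ol ac g0 L B) s2,
   s2.1 33 = cnt_lt (fun j => x_ e j \in mk) i & s2.1 34 = [exists j : 'I_k, (j < i) && P j]])) => //.
- by case: hw => -[].
- exact: ltn_trans (kW e) NW.
- by split; [apply: Hw_reg|rewrite cnt_lt0|rewrite ex_lt0].
- move=> i s1 ik y1 f1 [h1 c1 d1]; pose j := Ordinal ik.
  have xe1 : s1.1 11 = e by rewrite f1.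
  have S1 := cnt_ltS (fun j => x_ e j \in mk) j; have S2 := ex_ltS j P.
  apply: (Dt_if (b := x_ e j \in mk)).
  + by rewrite evN // (ev_mk (j := j) h1 xe1 y1); case: (_ \in mk).
  + move=> jm; apply: (Dt_seq (Q := fun s2 => [/\ Hw (Wd v mk ol ac g0 L B) s2, s2.1 13 = j,
       s2.1 33 = cnt_lt (fun j => x_ e j \in mk) i.+1, s2.1 34 = s1.1 34 & s2.1 11 = e /\ s2.1 31 = ntrue v e])).
      apply: Dt_asg; split=> //; last by split; [exact: xe1|exact: etrans (f1 31 isT) c31].
      rewrite -[LHS]/(ev (EB Add (EV 33) (EN 1)) s1) evB evV evN // c1 S1 jm /eval_op modn_small //.
      have := cnt_lt_leq (fun j => x_ e j \in mk) i; have := kW e; have := NN_gt0.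
      by move=> *; apply: small; lia.
    move=> s2 _ [h2 y2 c2 d2 [x2 t2]].
    apply: (Dt_if (mc_ok h2 x2 y2 t2)) => mj.
      apply: Dt_asg; split; [exact: h2|exact: c2|].
      by rewrite -[LHS]/(1 %% 2 ^ w) -[1 %% _]/(ev (EN 1) s2) evN // S2 /P jm mj orbT.
    apply: Dt_skip; split; [by apply: Hw_reg|exact: c2|].
    by rewrite -[LHS]/(s2.1 34) d2 d1 S2 /P (negbTE mj) andbF orbF.
  + move=> jm; apply: Dt_skip; split; first by apply: Hw_reg.
      by rewrite -[LHS]/(s1.1 33) c1 S1 (negbTE jm) addn0.
    by rewrite -[LHS]/(s1.1 34) d1 S2 /P (negbTE jm) orbF.
- by move=> s1 _ [h1 c1 d1]; split; rewrite // ?c1 ?cnt_ltT // d1 ex_ltT.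
Qed.

Lemma chk_ok v mk ol ac g0 L B s : Hw (Wd v mk ol ac g0 L B) s -> s.1 15 = 1 ->
  Dt (fun s' => Hw (Wd v mk ol ac g0 L B) s' /\
    s'.1 15 = switchable (VF F) (umF F v) ac mk) (sem chk s).
Proof.
move=> hw o15; pose P e := (e \in ac) && ~~ clause_ok (VF F) (umF F v) mk e.
apply: (Dt_for (N := m) (I := fun i s2 => Hw (Wd v mk ol ac g0 L B) s2 /\
   s2.1 15 = ~~ [exists e : 'I_m, (e < i) && P e])) => //.
- by case: hw => -[].
- exact: ltn_trans m_lt NW.
- by split; [apply: Hw_reg|rewrite ex_lt0].
- move=> i s1 im xe f1 [h1 o1]; pose e := Ordinal im; have S1 := ex_ltS e P.
  apply: (Dt_if (b := e \in ac)).
  + by rewrite evN // (ev_ac h1 (xe : s1.1 11 = e)); case: (_ \in ac).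
  + move=> ea; apply: (Dt_seq (cntc_ok (x := 11) (e := e) isT h1 xe)) => s2 f2 [h2 c2].
    apply: (Dt_seq (Q := fun s3 => [/\ Hw (Wd v mk ol ac g0 L B) s3, s3.1 11 = e,
       s3.1 31 = ntrue v e, s3.1 33 = 0 & s3.1 15 = s1.1 15])).
      apply: Dt_asg; split; [by apply: Hw_reg|exact: etrans (f2 11 isT) xe|exact: c2| |exact: (f2 15 isT)].
      by rewrite /= mod0n.
    move=> s3 _ [h3 x3 c3 z3 o3].
    apply: (Dt_seq (Q := fun s4 => [/\ Hw (Wd v mk ol ac g0 L B) s4, s4.1 11 = e,
       s4.1 31 = ntrue v e, s4.1 33 = 0 & s4.1 34 = 0 /\ s4.1 15 = s1.1 15])).
      by apply: Dt_asg; split; [apply: Hw_reg|exact: x3|exact: c3|exact: z3|split; [rewrite /= mod0n|exact: o3]].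
    move=> s4 _ [h4 x4 c4 z4 [y4 o4]].
    apply: (Dt_seq (cscan_ok h4 x4 c4 z4 y4)) => s5 f5 [h5 c5 d5].
    have o5 : s5.1 15 = s1.1 15 by rewrite f5.
    have cE := clause_okE v mk e; rewrite /= -c5 -d5 in cE.
    have keep : clause_ok (VF F) (umF F v) mk e ->
        Dt (fun s2 => Hw (Wd v mk ol ac g0 L B) (upd s2.1 11 i.+1, s2.2) /\
           (upd s2.1 11 i.+1, s2.2).1 15 = ~~ [exists e : 'I_m, (e < i.+1) && P e]) (sem CSkip s5).
      move=> ok; apply: Dt_skip; split; first by apply: Hw_reg.
      by rewrite -[LHS]/(s5.1 15) o5 o1 S1 /P ok andbF orbF.
    have h45 : s5.1 4 = k by case: h5 => -[].
    have kN := kW e; have ? := NN_gt0.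
    have c5k : s5.1 33 <= k by rewrite c5 -[leqRHS]card_ord max_card.
    have d51 : s5.1 34 <= 1 by rewrite d5 leq_b1.
    apply: (Dt_if (b := 0 < s5.1 33)); [by rewrite evN| |] => b1; last first.
      by apply: keep; rewrite cE (negbTE b1).
    apply: (Dt_if (b := s5.1 33 < k)); [by rewrite !evV h45| |] => b2; last first.
      by apply: keep; rewrite cE (negbTE b2) andbF.
    apply: (Dt_if (b := 0 < s5.1 33 - 1 + s5.1 34)).
    * rewrite evB (evB Defs.Sub) !evV !evN // /eval_op [(s5.1 33 - 1) %% _]modn_small; last by apply: small; lia.
      by rewrite modn_small //; apply: small; lia.
    * move=> b3; apply: Dt_asg; split; first exact: h5.
      by rewrite -[LHS]/(0 %% 2 ^ w) mod0n S1 /P ea cE b1 b2 b3 orbT.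
    * by move=> b3; apply: keep; rewrite cE (negbTE b3) !andbF.
  + move=> ea; apply: Dt_skip; split; first by apply: Hw_reg.
    by rewrite -[LHS]/(s1.1 15) o1 S1 /P (negbTE ea) orbF.
- move=> s1 _ [h1 o1]; split=> //; rewrite o1 ex_ltT negb_exists /switchable.
  by congr nat_of_bool; apply: eq_forallb => e; rewrite /P negb_and negbK implybE.
Qed.

Lemma flp_ok v mk ol ac g0 L B s (b : bool) : Hw (Wd v mk ol ac g0 L B) s -> s.1 15 = b ->
  Dt (Hw (Wd (if b then flipS mk v else v) mk ol ac g0 L B)) (sem flp s).
Proof.
move=> hw o15; apply: (Dt_if (b := b)); first by rewrite evN // evV o15; case: b {o15}.
  move=> b1; rewrite b1; apply: (Dt_for (N := n) (I := fun i =>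
     Hw (Wd [ffun y : 'I_n => v y (+) ((y < i) && (y \in mk))] mk ol ac g0 L B))) => //.
  - by case: hw => -[].
  - exact: ltn_trans n_lt NW.
  - apply: Hw_reg => //; set v0 := finfun _; have -> : v0 = v by apply/ffunP => y; rewrite ffunE addbF.
    exact: hw.
  - move=> i s1 iN x1 _ h1; pose x := Ordinal iN; have xN : x < NN by exact: ltn_trans n_lt.
    apply: (Dt_if (b := x \in mk)).
    + by rewrite evN // (ev_ar (i := x) _ _ h1 _ (cell2 _ _ _ _ _ _ _ x)) //; case: (x \in mk).
    + move=> xm; apply: (Dt_st (i := x) (v := ~~ v x) _ _ h1) => //.
        rewrite evB evN // (ev_ar (i := x) _ _ h1 _ (cell1 _ _ _ _ _ _ _ x)) // ffunE /= ltnn addbF.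
        by case: (v x); rewrite /eval_op /= ?mod0n // -[1 %% _]/(ev (EN 1) s1) evN.
      apply: Hw_reg => //; apply: (Hw_val h1) => y; rewrite !ffunE ltnS leq_eqVlt.
      rewrite -[(y : nat) == i]/(y == x); case: eqP => [->|] //.
      by rewrite xm addbT.
    + move=> xm; apply: Dt_skip; apply: Hw_reg => //; set v1 := finfun _ in h1 *; set v2 := finfun _.
      have -> // : v2 = v1; apply/ffunP => y; rewrite !ffunE ltnS leq_eqVlt.
      by rewrite -[(y : nat) == i]/(y == x); case: eqP => [->|] //; rewrite (negbTE xm) !andbF.
  - move=> s1 _; set v0 := finfun _; have -> // : v0 = flipS mk v.
    by apply/ffunP => y; rewrite !ffunE ltn_ord.
by move=> b0; rewrite (negbTE b0); apply: Dt_skip.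
Qed.

Lemma iter_ext (A : Type) (f g : A -> A) i x : f =1 g -> iter i f x = iter i g x.
Proof. by move=> fg; elim: i => //= i ->. Qed.

Lemma swc_ok v mk ol ac g0 L B s (x : 'I_n) : Hw (Wd v mk ol ac g0 L B) s -> s.1 20 = x ->
  Dt (fun s' => exists mk' ol', Hw (Wd (sw F ac T x v) mk' ol' ac g0 L B) s') (sem swc s).
Proof.
move=> hw x20; apply: (Dt_seq (clr_ok hw)) => s1 f1 h1.
apply: (Dt_seq (Q := Hw (Wd v [set x] ol ac g0 L B))).
  apply: (Dt_st (i := x) (v := true) _ _ h1) => //; [exact: ltn_trans n_lt|by rewrite evV f1|by rewrite evN|].
  by apply: (Hw_mk h1) => y; rewrite !inE; case: eqP.
move=> s2 f2 h2; apply: (Dt_seq (rch_ok (G := fun e => e \in ac) (N := T) h2 _ TW _)).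
- by case: h2 => -[_ _ _ _ []].
- by move=> e s3 mk3 ol3 h3 xe _; rewrite evN // (ev_ac h3 xe); case: (e \in ac).
move=> s3 _ [ol3]; rewrite (iter_ext _ _ (grw_um ac v)) -/(clus F ac T x v) => h3.
apply: (Dt_seq (Q := fun s4 => Hw (Wd v (clus F ac T x v) ol3 ac g0 L B) s4 /\ s4.1 15 = 1)).
  by apply: Dt_asg; split; [apply: Hw_reg|rewrite -[LHS]/(ev (EN 1) s3) evN].
move=> s4 _ [h4 o4]; apply: (Dt_seq (chk_ok h4 o4)) => s5 _ [h5 o5].
by apply: Dt_weak (flp_ok h5 o5) _ => s6 h6; exists (clus F ac T x v), ol3.
Qed.

Definition vch cap := CSeq (CAsg 22 (EN 0)) (CFor 23 cap (CIf (EV 23) (EV 24)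
  (CSeq (CAsg 25 (ar 7 (EV 23))) (CSeq (cntc 25) (CSeq (CIf (EV 31) (EN 1) (CAsg 22 (EN 1)) CSkip)
     (CIf (EV 31) (EV 4) CSkip (CAsg 22 (EN 1)))))) CSkip)).

Lemma onth_nth (A : Type) (x0 : A) q i : i < size q -> onth q i = Some (nth x0 q i).
Proof. by elim: q i => [//|x q IH] [|i] //= h; apply: IH. Qed.

Lemma onth_over (A : Type) (q : seq A) i : size q <= i -> onth q i = None.
Proof. by elim: q i => [|x q IH] [|i] //= h; apply: IH. Qed.

Lemma cellB v mk ol ac g0 L B i (e0 : 'I_m) : i < size B ->
  cell (Wd v mk ol ac g0 L B) 7 i = Some (nat_of_ord (nth e0 B i)).
Proof. by move=> iB; rewrite /= (onth_nth e0). Qed.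

Lemma naec_ntrue v e : naec v (tnth F e) = (0 < ntrue v e) && (ntrue v e < k).
Proof. exact: nonconstE. Qed.

Lemma vch_ok cap N v mk ol ac g0 L B s : Hw (Wd v mk ol ac g0 L B) s -> s.1 cap = N -> N < 2 ^ w ->
  cap \notin [:: 22; 23; 25; 31; 32] ->
  size B <= N -> size B <= m -> s.1 24 = size B ->
  Dt (fun s' => Hw (Wd v mk ol ac g0 L B) s' /\ s'.1 22 = viol F B v) (sem (vch cap) s).
Proof.
move=> hw capN NW' cn BN Bm b24.
apply: (Dt_seq (Q := fun s1 => Hw (Wd v mk ol ac g0 L B) s1 /\ s1.1 22 = 0)).
  by apply: Dt_asg; split; [apply: Hw_reg|rewrite /= mod0n].
move=> s1 f1 [h1 z1]; apply: (Dt_for (N := N) (I := fun i s2 => Hw (Wd v mk ol ac g0 L B) s2 /\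
   s2.1 22 = viol F (take i B) v)) => //.
- by rewrite f1 //; move: cn; rewrite !inE !negb_or => /and5P[].
- by split; [apply: Hw_reg|rewrite take0].
- move=> i s2 iN x2 f2 [h2 c2]; have b2 : s2.1 24 = size B by rewrite f2 ?f1.
  apply: (Dt_if (b := i < size B)); first by rewrite !evV x2 b2.
    move=> iB; have e0 : 'I_m by case: (B) iB => // e.
    pose e := nth e0 B i; have iNN : i < NN by apply: leq_trans iB (leq_trans Bm (ltnW m_lt)).
    have tE : viol F (take i.+1 B) v = viol F (take i B) v || ~~ naec v (tnth F e).
      by rewrite /viol (take_nth e0) // -cats1 has_cat /= orbF.
    apply: (Dt_seq (Q := fun s3 => [/\ Hw (Wd v mk ol ac g0 L B) s3, s3.1 25 = e & s3.1 22 = s2.1 22])).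
      apply: Dt_asg; split; [by apply: Hw_reg| |by []].
      by apply: (@ev_ar 7 (EV 23) s2 (Wd v mk ol ac g0 L B) i) => //; exact: cellB.
    move=> s3 _ [h3 x3 c3]; apply: (Dt_seq (cntc_ok (x := 25) (e := e) isT h3 x3)) => s4 f4 [h4 c4].
    have z4 : s4.1 22 = viol F (take i B) v by rewrite f4 // c3.
    apply: (Dt_seq (Q := fun s5 => [/\ Hw (Wd v mk ol ac g0 L B) s5, s5.1 31 = ntrue v e &
        s5.1 22 = viol F (take i B) v || (ntrue v e < 1)])).
      apply: (Dt_if (b := ntrue v e < 1)); first by rewrite evV evN // c4.
        move=> lt; apply: Dt_asg; split; [by apply: Hw_reg|exact: c4|].
        by rewrite -[LHS]/(ev (EN 1) s4) evN // lt orbT.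
      by move=> lt; apply: Dt_skip; split=> //; rewrite z4 (negbTE lt) orbF.
    move=> s5 _ [h5 c5 z5].
    apply: (Dt_if (b := ntrue v e < k)).
    + by rewrite !evV c5; case: h5 => -[_ _ ->].
    + move=> lt; apply: Dt_skip; split; first by apply: Hw_reg.
      by rewrite -[LHS]/(s5.1 22) z5 tE naec_ntrue lt andbT -leqNgt ltnS.
    + move=> lt; apply: Dt_asg; split; first exact: h5.
      by rewrite -[LHS]/(ev (EN 1) s5) evN // tE naec_ntrue (negbTE lt) andbF orbT.
  rewrite -leqNgt => iB; apply: Dt_skip; split; first by apply: Hw_reg.
  by rewrite -[LHS]/(s2.1 22) c2 !take_oversize // ltnW.
- by move=> s2 _ [h2 c2]; split=> //; rewrite c2 take_oversize.
Qed.

Definition flips cap := CFor 23 cap (CIf (EV 23) (EV 24) (CSeq (CAsg 25 (ar 7 (EV 23)))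
  (CFor 26 4 (CSeq (CFlip 27) (CIf (EN 0) (EV 27) (CSeq (CAsg 20 (var (EV 25) (EV 26))) swc) CSkip)))) CSkip).

Definition Hv ac g0 L B (s : store) (v : assignment n) := exists mk ol, Hw (Wd v mk ol ac g0 L B) s.

Lemma Hv_reg ac g0 L B s v x a : 9 < x -> Hv ac g0 L B s v -> Hv ac g0 L B (upd s.1 x a, s.2) v.
Proof. by move=> x9 [mk [ol h]]; exists mk, ol; apply: Hw_reg. Qed.

Lemma tryX_cat swp (X1 X2 : seq 'I_n) (v : assignment n) :
  tryX swp (X1 ++ X2) v = bind (tryX swp X1 v) (tryX swp X2).
Proof. by elim: X1 v => //= x X1 IH v; rewrite !IH. Qed.

Lemma flip_ok ac g0 L B v s (e : 'I_m) (j : 'I_k) : Hv ac g0 L B s v -> s.1 25 = e -> s.1 26 = j ->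
  RT (Hv ac g0 L B)
     (sem (CSeq (CFlip 27) (CIf (EN 0) (EV 27) (CSeq (CAsg 20 (var (EV 25) (EV 26))) swc) CSkip)) s)
     (flipK (sw F ac T) (x_ e j) v).
Proof.
move=> [mk [ol hw]] xe xj.
have b27 (b : bool) : (0 < b %% 2 ^ w) = b.
  by case: b => /=; rewrite ?mod0n // -[1 %% _]/(ev (EN 1) s) evN.
set c := CIf _ _ _ _.
have H (b : bool) : RT (Hv ac g0 L B) (sem c (upd s.1 27 (b %% 2 ^ w), s.2))
    (Ret (if b then sw F ac T (x_ e j) v else v)).
  apply: RT_Dt; apply: (Dt_if (b := b)); first by rewrite evN // evV; exact: b27.
    move=> ->; set s1 := (upd s.1 27 _, s.2); have h1 : Hw (Wd v mk ol ac g0 L B) s1 by apply: Hw_reg.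
    apply: (Dt_seq (Q := fun s2 => Hw (Wd v mk ol ac g0 L B) s2 /\ s2.1 20 = x_ e j)).
      apply: Dt_asg; split; first by apply: Hw_reg.
      by rewrite -[LHS]/(ev (var (EV 25) (EV 26)) s1); exact: (@ev_var _ s1 (EV 25) (EV 26) e j h1 xe xj).
    by move=> s2 _ [h2 x2]; apply: swc_ok h2 x2.
  by move=> /negbTE ->; apply: Dt_skip; exists mk, ol; apply: Hw_reg.
by apply: RTflp; [exact: (H false)|exact: (H true)].
Qed.

Lemma flips_ok cap N ac g0 L B v s : Hv ac g0 L B s v -> s.1 cap = N -> N < 2 ^ w ->
  size B <= N -> size B <= m -> s.1 24 = size B ->
  RT (Hv ac g0 L B) (sem (flips cap) s) (tryX (sw F ac T) (XB F B) v).
Proof.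
move=> hv capN NW' BN Bm b24.
pose u i v := tryX (sw F ac T) (XB F (take i B)) v.
have -> : tryX (sw F ac T) (XB F B) v = u N v by rewrite /u take_oversize.
pose g i v := if onth B i is Some e then tryX (sw F ac T) (codom (clx (tnth F e))) v else Ret v.
apply: (RT_for_seq (I := fun _ => Hv ac g0 L B) (u := u) (g := g) capN) => //.
- by rewrite /u take0.
- move=> i iN; rewrite /u /g; case: (ltnP i (size B)) => iB; last first.
    rewrite !take_oversize ?(leqW iB) //.
    by rewrite onth_over // bindR.
  have e0 : 'I_m by case: (B) iB => // e.
  rewrite (onth_nth e0) // (take_nth e0) // /XB map_rcons flatten_rcons.
  by rewrite tryX_cat.
- move=> i s1 v1 iN x1 f1 h1; have b1 : s1.1 24 = size B by rewrite f1.
  apply: (RT_if (b := i < size B)); first by rewrite !evV x1 b1.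
    move=> iB; have e0 : 'I_m by case: (B) iB => // e.
    pose e := nth e0 B i; have iNN : i < NN by apply: leq_trans iB (leq_trans Bm (ltnW m_lt)).
    rewrite /g (onth_nth e0) // -/e.
    apply: (RT_det (Q := fun s2 => Hv ac g0 L B s2 v1 /\ s2.1 25 = e)).
      case: h1 => mk [ol h1]; apply: Dt_asg; split; first by exists mk, ol; apply: Hw_reg.
      by apply: (@ev_ar 7 (EV 23) s1 (Wd v1 mk ol ac g0 L B) i) => //; exact: cellB.
    move=> s2 f2 [h2 x2].
    pose u' i v := tryX (sw F ac T) [seq clx (tnth F e) j | j <- take i (enum 'I_k)] v.
    have -> : tryX (sw F ac T) (codom (clx (tnth F e))) v1 = u' k v1.
      by rewrite /u' take_oversize ?size_enum_ord // codomE.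
    pose g' i v := if insub i is Some j then flipK (sw F ac T) (x_ e j) v else Ret v.
    apply: (RT_for_seq (I := fun _ => Hv ac g0 L B) (u := u') (g := g')) => //.
    + by case: h2 => mk [ol [[]]].
    + exact: ltn_trans (kW e) NW.
    + by rewrite /u' take0.
    + move=> l lk; rewrite /u' /g' (take_nth (Ordinal lk)) ?size_enum_ord // map_rcons -cats1 tryX_cat.
      have -> : nth (Ordinal lk) (enum 'I_k) l = Ordinal lk by rewrite -[l]/(val (Ordinal lk)) nth_ord_enum.
      by congr bind; apply/funext => v2; rewrite (insubT (fun l => l < k) lk) /=; congr Flp.
    + move=> l s3 v3 lk x3 f3 h3; rewrite /g' (insubT (fun l => l < k) lk).
      apply: RT_weak (flip_ok h3 (e := e) _ _) => [s4 v4 h4||].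
      * by apply: Hv_reg.
      * by rewrite f3.
      * by rewrite x3.
  rewrite -leqNgt => iB; rewrite /g.
  rewrite onth_over //.
  by apply: RT_Dt; apply: Dt_skip; apply: Hv_reg.
Qed.

Definition blk cap tri := CFor 21 tri (CSeq (vch cap) (CIf (EN 0) (EV 22) (flips cap) CSkip)).

Lemma blk_ok cap tri N N' ac g0 L B v s : Hv ac g0 L B s v ->
  s.1 cap = N -> N < 2 ^ w -> cap < 10 -> s.1 tri = N' -> N' < 2 ^ w ->
  size B <= N -> size B <= m -> s.1 24 = size B ->
  RT (Hv ac g0 L B) (sem (blk cap tri) s) (blockF F ac T B N' v).
Proof.
move=> hv capN NW' c10 triN NW'' BN Bm b24.
have lt9 l : cap \notin [seq z <- l | 9 < z].
  by rewrite mem_filter negb_and -leqNgt -ltnS c10.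
apply: (RT_for_seq (I := fun _ => Hv ac g0 L B) (u := fun i => blockF F ac T B i)
   (g := fun _ => roundK (sw F ac T) (viol F B) (XB F B)) triN) => //.
move=> i s1 v1 iN x1 f1 [mk [ol h1]].
have c1 : s1.1 cap = N.
  by rewrite f1 //; exact: (lt9 (wr (blk cap tri))).
apply: (RT_det (vch_ok (cap := cap) h1 c1 NW' _ BN Bm _)).
- exact: (lt9 [:: 22; 23; 25; 31; 32]).
- by rewrite f1.
move=> s2 f2 [h2 z2].
have c2 : s2.1 cap = N by rewrite f2 //; exact: (lt9 (wr (vch cap))).
have b2 : s2.1 24 = size B by rewrite f2 ?f1.
apply: (RT_if (b := viol F B v1)); first by rewrite evN // evV z2; case: viol.
  move=> vi; rewrite /roundK vi.
  have hv2 : Hv ac g0 L B s2 v1 by exists mk, ol.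
  by apply: RT_weak (flips_ok hv2 c2 NW' BN Bm b2) => s3 v3 h3; apply: Hv_reg.
move=> vi; rewrite /roundK (negbTE vi); apply: RT_Dt; apply: Dt_skip.
by apply: Hv_reg => //; exists mk, ol.
Qed.

(** A plain search of [r] rounds from each variable of each clause, avoiding this clause. A round is
    linear in [n], so the detection takes time of order [n ^ 2 * log n]. *)
Definition det := CFor 16 3 (CSeq (st 5 (EV 16) (EN 0)) (CFor 17 4 (CSeq clr
  (CSeq (st 2 (var (EV 16) (EV 17)) (EN 1))
  (CSeq (rch false (EN 0) (EB Add (EB Defs.Sub (EV 11) (EV 16)) (EB Defs.Sub (EV 16) (EV 11))) 8)
  (CFor 13 4 (CIf (EN 0) (ar 2 (var (EV 16) (EV 13)))
     (CIf (EN 0) (EB Add (EB Defs.Sub (EV 13) (EV 17)) (EB Defs.Sub (EV 17) (EV 13)))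
       (st 5 (EV 16) (EN 1)) CSkip) CSkip))))))).

Lemma ev_dist s x y a b : s.1 x = a -> s.1 y = b -> a < NN -> b < NN ->
  (ev (EN 0) s < ev (EB Add (EB Defs.Sub (EV x) (EV y)) (EB Defs.Sub (EV y) (EV x))) s) = (a != b).
Proof.
move=> xa yb aN bN; have ? := NN_gt0.
rewrite evN // evB !(evB Defs.Sub) !evV xa yb /eval_op.
rewrite [(a - b) %% _]modn_small; last by apply: small; lia.
rewrite [(b - a) %% _]modn_small; last by apply: small; lia.
by rewrite modn_small; [lia|apply: small; lia].
Qed.

Definition G0 := shortcyc (VF F) r.
Definition closes e (j0 j : 'I_k) :=
  (x_ e j \in reach (VF F) (pl (VF F) [set~ e]) [set x_ e j0] r) && (j != j0).

Lemma G0E e : (e \in G0) = [exists j0, [exists j, closes e j0 j]].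
Proof.
apply/shortcycP/existsP => [[x [y [/imsetP[i _ ->] /imsetP[j _ ->] ij h]]]|[i /existsP[j /andP[h ji]]]].
  exists i; apply/existsP; exists j; rewrite /closes h.
  by apply: contraNneq ij => ->.
exists (x_ e i), (x_ e j); rewrite !clx_V; split=> //.
by rewrite (inj_eq (@clx_inj _ _ _ _ Fp e)) eq_sym.
Qed.

Definition Hd v ac g0 L B s := exists mk ol, Hw (Wd v mk ol ac g0 L B) s.

Lemma det_ok v ac g0 L B s : Hd v ac g0 L B s -> Dt (Hd v ac G0 L B) (sem det s).
Proof.
move=> hd; apply: (Dt_for (N := m) (I := fun i =>
   Hd v ac [set e : 'I_m | if e < i then e \in G0 else e \in g0] L B)) => //.
- by case: hd => mk [ol [[]]].
- exact: ltn_trans m_lt NW.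
- case: hd => mk [ol hw]; exists mk, ol; apply: Hw_reg => //; set g1 := [set e | _].
  by have -> : g1 = g0 by apply/setP => e; rewrite inE.
- move=> i s1 im x1 f1; set g1 := [set e | _] => -[mk1 [ol1 h1]]; pose e0 := Ordinal im.
  have e0N : e0 < NN by exact: ltn_trans m_lt.
  pose g2 (b : bool) := [set e | if e == e0 then b else e \in g1].
  have g2b b (b' : bool) : forall y, (y \in g2 b') = if y == e0 then b' else y \in g2 b.
    by move=> y; rewrite !inE; case: eqP.
  apply: (Dt_seq (Q := Hd v ac (g2 false) L B)).
    apply: (Dt_st (i := e0) (v := false) _ _ h1) => //; first by rewrite evN.
    exists mk1, ol1; apply: (Hw_g0 h1) => y; by rewrite !inE.
  move=> s2 f2 h2; have x2 : s2.1 16 = e0 by rewrite f2.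
  apply: (Dt_for (N := k) (I := fun i =>
     Hd v ac (g2 [exists j0 : 'I_k, (j0 < i) && [exists j, closes e0 j0 j]]) L B)) => //.
  + by case: h2 => mk [ol [[]]].
  + exact: ltn_trans (kW e0) NW.
  + rewrite ex_lt0; case: h2 => mk [ol h2]; by exists mk, ol; apply: Hw_reg.
  + move=> l s3 lk x3 f3; set b3 := [exists j0, _] => -[mk3 [ol3 h3]]; pose j0 := Ordinal lk.
    have x3' : s3.1 16 = e0 by rewrite f3.
    apply: (Dt_seq (clr_ok h3)) => s4 f4 h4.
    have x4 : s4.1 16 = e0 by rewrite f4. have y4 : s4.1 17 = j0 by rewrite f4.
    apply: (Dt_seq (Q := Hw (Wd v [set x_ e0 j0] ol3 ac (g2 b3) L B))).
      apply: (Dt_st (i := x_ e0 j0) (v := true) _ _ h4) => //.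
      * exact: ltn_trans (ltn_ord _) n_lt.
      * exact: (ev_var h4).
      * by rewrite evN.
      by apply: (Hw_mk h4) => y; rewrite !inE; case: eqP.
    move=> s5 f5 h5; have x5 : s5.1 16 = e0 by rewrite f5. have y5 : s5.1 17 = j0 by rewrite f5.
    apply: (Dt_seq (rch_ok (G := fun e => e \in [set~ e0]) (N := r) h5 _ rW _)).
    * by case: h5 => -[_ _ _ _ []].
    * move=> e s6 mk6 ol6 h6 xe f6; have x6 : s6.1 16 = e0 by rewrite f6.
      by rewrite (ev_dist xe x6 (ltn_trans (ltn_ord e) m_lt) e0N) !inE.
    move=> s6 f6 [ol6]; rewrite (iter_ext _ _ (grw_pl [set~ e0] v)) -/(reach _ _ _ _) => h6.
    set S := reach _ _ _ _ in h6.
    have x6 : s6.1 16 = e0 by rewrite f6. have y6 : s6.1 17 = j0 by rewrite f6.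
    apply: (Dt_for (N := k) (I := fun i s' => exists ol',
      Hw (Wd v S ol' ac (g2 (b3 || [exists j : 'I_k, (j < i) && closes e0 j0 j])) L B) s')) => //.
    * by case: h6 => -[].
    * exact: ltn_trans (kW e0) NW.
    * by rewrite ex_lt0 orbF; exists ol6.
    * move=> q s7 qk x7 f7; set b7 := [exists j, _] => -[ol7 h7]; pose j := Ordinal qk.
      have S7 := ex_ltS j (closes e0 j0); rewrite -/b7 in S7.
      have x7' : s7.1 16 = e0 by rewrite f7. have y7 : s7.1 17 = j0 by rewrite f7.
      have kN := kW e0.
      have keep : ~~ closes e0 j0 j ->
         Dt (fun s8 => exists ol', Hw (Wd v S ol' ac
             (g2 (b3 || [exists j : 'I_k, (j < q.+1) && closes e0 j0 j])) L B)
              (upd s8.1 13 q.+1, s8.2)) (sem CSkip s7).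
        by move=> nc; apply: Dt_skip; exists ol7; rewrite S7 (negbTE nc) orbF.
      apply: (Dt_if (b := x_ e0 j \in S)); first by rewrite evN // (ev_mk (j := j) h7 x7' x7); case: (_ \in S).
        move=> jS; apply: (Dt_if (b := j != j0)).
        - rewrite (ev_dist (a := j) (b := j0)) //; exact: ltn_trans kN.
        - move=> jj; apply: (Dt_st (i := e0) (v := true) _ _ h7) => //; first by rewrite evN.
          exists ol7; rewrite S7 /closes jS jj !orbT.
          by apply: Hw_reg => //; apply: (Hw_g0 h7); apply: g2b.
        - by move=> jj; apply: keep; rewrite /closes (negbTE jj) andbF.
      by move=> jS; apply: keep; rewrite /closes (negbTE jS).
    * move=> s7 _; rewrite ex_ltT => -[ol7 h7]; exists S, ol7; apply: Hw_reg => //.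
      by rewrite (ex_ltS j0 (fun j0 => [exists j, closes e0 j0 j])).
  + move=> s3 _; rewrite ex_ltT -G0E => -[mk3 [ol3 h3]]; exists mk3, ol3; apply: Hw_reg => //.
    set g3 := [set e : 'I_m | _]; have -> // : g3 = g2 (e0 \in G0).
    apply/setP => e; rewrite !inE ltnS leq_eqVlt -[(e : nat) == i]/(e == e0).
    by case: eqP => [->|].
- move=> s1 _ [mk [ol h]]; exists mk, ol; move: h; set g3 := [set e : 'I_m | _].
  by have -> : g3 = G0 by apply/setP => e; rewrite inE ltn_ord.
Qed.

Definition l0 := CSeq (CAsg 18 (EN 0)) (CFor 16 3 (CIf (EN 0) (ar 5 (EV 16)) (CIf (EV 18) (EV 9)
  (CSeq (st 6 (EV 18) (EV 16)) (CAsg 18 (EB Add (EV 18) (EN 1)))) CSkip) CSkip)).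

(** Lists are capped, at [sq] clauses on short cycles and at [T] clauses per component, to secure
    the time bound on every input. On typical formulas nothing is cut off. *)
Definition sel N (A : {set 'I_m}) i := take N [seq e <- take i (enum 'I_m) | e \in A].

Lemma take_rcons_if (A : Type) (q : seq A) N e :
  take N (rcons q e) = if size (take N q) < N then rcons (take N q) e else take N q.
Proof.
case: (ltnP (size q) N) => qN; first by rewrite (take_oversize (ltnW qN)) qN take_oversize ?size_rcons.
by rewrite size_takel // ltnn -cats1 takel_cat.
Qed.

Lemma sel0 N A : sel N A 0 = [::]. Proof. by rewrite /sel take0. Qed.
Lemma selT N A : sel N A m = take N (enum A).
Proof. rewrite /sel [take m _]take_oversize ?size_enum_ord //; congr take.
by rewrite [in LHS]enumT /enum_mem; apply: eq_filter. Qed.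
Lemma selS N A (e : 'I_m) : sel N A e.+1 =
  if (e \in A) && (size (sel N A e) < N) then rcons (sel N A e) e else sel N A e.
Proof.
rewrite /sel (take_nth e) ?size_enum_ord // nth_ord_enum filter_rcons.
by case: (e \in A) => //=; exact: take_rcons_if.
Qed.
Lemma size_sel N A i : size (sel N A i) <= m.
Proof.
have tl (q : seq 'I_m) a : size (take a q) <= size q by rewrite size_take_min geq_minr.
apply: leq_trans (tl _ _) _; rewrite size_filter; apply: leq_trans (count_size _ _) _.
by apply: leq_trans (tl _ _) _; rewrite size_enum_ord.
Qed.

Definition L0s := sel sq G0 m.

Lemma Hw_L v mk ol ac g0 L B s (e : 'I_m) : size L < NN -> Hw (Wd v mk ol ac g0 L B) s ->
  Hw (Wd v mk ol ac g0 (rcons L e) B) (s.1, upd s.2 (6 * NN + size L) e).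
Proof.
move=> LN hw; apply: (Hw_st _ _ hw) => // [u|].
  by rewrite /= (onth_nth e) ?size_rcons // nth_rcons ltnn eqxx => -[].
move=> [|[|[|[|[|[|[|[|b']]]]]]]] j u //= jL; case: (ltnP j (size (rcons L e))) => jl.
  move: jl; rewrite size_rcons ltnS leq_eqVlt (negbTE jL) /= => jl.
  by rewrite !(onth_nth e) ?size_rcons ?nth_rcons ?jl // ltnW.
by rewrite onth_over.
Qed.

Lemma Hw_B v mk ol ac g0 L B s (e : 'I_m) : size B < NN -> Hw (Wd v mk ol ac g0 L B) s ->
  Hw (Wd v mk ol ac g0 L (rcons B e)) (s.1, upd s.2 (7 * NN + size B) e).
Proof.
move=> LN hw; apply: (Hw_st _ _ hw) => // [u|].
  by rewrite /= (onth_nth e) ?size_rcons // nth_rcons ltnn eqxx => -[].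
move=> [|[|[|[|[|[|[|[|b']]]]]]]] j u //= jL; case: (ltnP j (size (rcons B e))) => jl.
  move: jl; rewrite size_rcons ltnS leq_eqVlt (negbTE jL) /= => jl.
  by rewrite !(onth_nth e) ?size_rcons ?nth_rcons ?jl // ltnW.
by rewrite onth_over.
Qed.

Lemma l0_ok v ac L B s : Hd v ac G0 L B s ->
  Dt (fun s' => Hd v ac G0 L0s B s' /\ s'.1 18 = size L0s) (sem l0 s).
Proof.
move=> [mk [ol hw]]; apply: (Dt_seq (Q := fun s1 => Hw (Wd v mk ol ac G0 [::] B) s1 /\ s1.1 18 = 0)).
  apply: Dt_asg; split; last by rewrite /= mod0n.
  by apply: Hw_reg => //; apply: Hw_weak hw _ => -[|[|[|[|[|[|[|[|b']]]]]]]] [|j] u.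
move=> s1 _ [h1 z1]; apply: (Dt_for (N := m) (I := fun i s2 =>
  Hw (Wd v mk ol ac G0 (sel sq G0 i) B) s2 /\ s2.1 18 = size (sel sq G0 i))) => //.
- by case: h1 => -[].
- exact: ltn_trans m_lt NW.
- by rewrite sel0.
- move=> i s2 im x2 f2 [h2 c2]; pose e := Ordinal im; have S2 := selS sq G0 e.
  have sN : size (sel sq G0 i) < NN by apply: leq_ltn_trans (size_sel _ _ _) m_lt.
  apply: (Dt_if (b := e \in G0)); first by rewrite evN // (ev_g0 h2 (x2 : s2.1 16 = e)); case: (_ \in G0).
    move=> eG; apply: (Dt_if (b := size (sel sq G0 i) < sq)).
    + by rewrite !evV c2; case: h2 => -[_ _ _ _ [_ _ ->]].
    + move=> lt; have S2' : sel sq G0 i.+1 = rcons (sel sq G0 i) e by rewrite S2 eG lt.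
      apply: (Dt_seq (Q := fun s3 => Hw (Wd v mk ol ac G0 (sel sq G0 i.+1) B) s3 /\ s3.1 18 = size (sel sq G0 i))).
        apply: (Dt_st (i := size (sel sq G0 i)) (v := e) _ _ h2) => //.
        by split=> //; rewrite S2'; apply: Hw_L.
      move=> s3 _ [h3 c3]; apply: Dt_asg; split; first exact: h3.
      rewrite -[LHS]/(ev (EB Add (EV 18) (EN 1)) s3) evB evV evN // c3 /eval_op S2' size_rcons addn1.
      by rewrite modn_small //; apply: small; have := NN_gt0; lia.
    + by move=> ge; apply: Dt_skip; rewrite S2 eG (negbTE ge).
  by move=> eG; apply: Dt_skip; rewrite S2 (negbTE eG).
- by move=> s2 _ [h2 c2]; split=> //; exists mk, ol.
Qed.

Definition coll := CFor 30 3 (CIf (EN 0) (ar 5 (EV 30)) (CIf (EV 24) (EV 7)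
  (CSeq (CAsg 12 (EN 0)) (CSeq (CFor 13 4 (CIf (EN 0) (ar 2 (var (EV 30) (EV 13))) (CAsg 12 (EN 1)) CSkip))
   (CIf (EN 0) (EV 12) (CSeq (st 7 (EV 24) (EV 30)) (CAsg 24 (EB Add (EV 24) (EN 1)))) CSkip))) CSkip) CSkip).

Definition cmp (S : {set 'I_n}) := [set g in G0 | ~~ [disjoint VF F g & S]].

Lemma touchE g (S : {set 'I_n}) : ~~ [disjoint VF F g & S] = [exists j, x_ g j \in S].
Proof.
apply/pred0Pn/existsP => [[y /andP[/imsetP[j _ ->] jS]]|[j jS]]; first by exists j.
by exists (x_ g j); rewrite /= clx_V.
Qed.

Lemma coll_ok v S ol ac L s : Hw (Wd v S ol ac G0 L [::]) s -> s.1 24 = 0 ->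
  Dt (fun s' => Hw (Wd v S ol ac G0 L (sel T (cmp S) m)) s' /\ s'.1 24 = size (sel T (cmp S) m)) (sem coll s).
Proof.
move=> h1 z1; apply: (Dt_for (N := m) (I := fun i s2 =>
  Hw (Wd v S ol ac G0 L (sel T (cmp S) i)) s2 /\ s2.1 24 = size (sel T (cmp S) i))) => //.
- by case: h1 => -[].
- exact: ltn_trans m_lt NW.
- by rewrite sel0.
- move=> i s2 im x2 f2 [h2 c2]; pose e := Ordinal im; have S2 := selS T (cmp S) e.
  set q := sel T (cmp S) i in S2 c2 h2 *.
  have sN : size q < NN by apply: leq_ltn_trans (size_sel _ _ _) m_lt.
  have keep s3 : Hw (Wd v S ol ac G0 L q) s3 -> s3.1 24 = size q -> ~~ ((e \in cmp S) && (size q < T)) ->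
      Dt (fun s4 => Hw (Wd v S ol ac G0 L (sel T (cmp S) i.+1)) (upd s4.1 30 i.+1, s4.2) /\
         (upd s4.1 30 i.+1, s4.2).1 24 = size (sel T (cmp S) i.+1)) (sem CSkip s3).
    by move=> h3 c3 /negbTE nn; apply: Dt_skip; rewrite S2 nn.
  apply: (Dt_if (b := e \in G0)); first by rewrite evN // (ev_g0 h2 (x2 : s2.1 30 = e)); case: (_ \in G0).
    move=> eG; apply: (Dt_if (b := size q < T)).
    + by rewrite !evV c2; case: h2 => -[_ _ _ _ [-> _ _]].
    + move=> lt; apply: (Dt_seq (Q := fun s3 => [/\ Hw (Wd v S ol ac G0 L q) s3, s3.1 24 = size q, s3.1 30 = e & s3.1 12 = 0])).
        by apply: Dt_asg; split=> //; rewrite /= mod0n.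
      move=> s3 _ [h3 c3 x3 z3].
      apply: (Dt_seq (Q := fun s4 => Hw (Wd v S ol ac G0 L q) s4 /\ s4.1 12 = [exists j, x_ e j \in S])).
        apply: (Dt_for (N := k) (I := fun l s4 => Hw (Wd v S ol ac G0 L q) s4 /\
           s4.1 12 = [exists j : 'I_k, (j < l) && (x_ e j \in S)])) => //.
        - by case: h3 => -[].
        - exact: ltn_trans (kW e) NW.
        - by rewrite ex_lt0.
        - move=> l s4 lk x4 f4 [h4 z4]; pose j := Ordinal lk; have S4 := ex_ltS j (fun j => x_ e j \in S).
          have x4' : s4.1 30 = e by rewrite f4.
          apply: (Dt_if (b := x_ e j \in S)); first by rewrite evN // (ev_mk (j := j) h4 x4' x4); case: (_ \in S).
            move=> jS; apply: Dt_asg; split; first exact: h4.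
            by rewrite -[LHS]/(ev (EN 1) s4) evN // S4 jS orbT.
          move=> jS; apply: Dt_skip; split; first exact: h4.
          by rewrite -[LHS]/(s4.1 12) z4 S4 (negbTE jS) orbF.
        - by move=> s4 _ [h4 z4]; split=> //; rewrite z4 ex_ltT.
      move=> s4 f4 [h4 z4]; have c4 : s4.1 24 = size q by rewrite f4.
      have x4 : s4.1 30 = e by rewrite f4.
      have eC : (e \in cmp S) = [exists j, x_ e j \in S] by rewrite inE eG touchE.
      apply: (Dt_if (b := e \in cmp S)); first by rewrite evN // evV z4 eC; case: existsP.
        move=> ec; have S2' : sel T (cmp S) i.+1 = rcons q e by rewrite S2 ec lt.
        apply: (Dt_seq (Q := fun s5 => Hw (Wd v S ol ac G0 L (rcons q e)) s5 /\ s5.1 24 = size q)).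
          apply: (Dt_st (i := size q) (v := e) _ _ h4) => //.
          by split=> //; apply: Hw_B.
        move=> s5 _ [h5 c5]; apply: Dt_asg; rewrite S2'; split; first exact: h5.
        rewrite -[LHS]/(ev (EB Add (EV 24) (EN 1)) s5) evB evV evN // c5 /eval_op size_rcons addn1.
        by rewrite modn_small //; apply: small; have := NN_gt0; lia.
      by move=> ec; apply: keep => //; rewrite (negbTE ec).
    + by move=> ge; apply: keep => //; rewrite (negbTE ge) andbF.
  by move=> eG; apply: keep => //; rewrite inE (negbTE eG).
Qed.

Definition acts := CFor 23 7 (CIf (EV 23) (EV 24) (st 4 (ar 7 (EV 23)) (EN 1)) CSkip).

Lemma acts_ok v mk ol ac g0 L B s : Hw (Wd v mk ol ac g0 L B) s -> s.1 24 = size B -> size B <= T ->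
  size B <= m -> Dt (Hw (Wd v mk ol (ac :|: [set e in B]) g0 L B)) (sem acts s).
Proof.
move=> hw b24 BT Bm; apply: (Dt_for (N := T) (I := fun i =>
   Hw (Wd v mk ol (ac :|: [set e in take i B]) g0 L B))) => //.
- by case: hw => -[_ _ _ _ []].
- rewrite take0; have -> : ac :|: [set e in [::]] = ac by apply/setP => e; rewrite !inE orbF.
  exact: hw.
- move=> i s2 iT x2 f2 h2; have b2 : s2.1 24 = size B by rewrite f2.
  apply: (Dt_if (b := i < size B)); first by rewrite !evV x2 b2.
    move=> iB; have e0 : 'I_m by case: (B) iB => // e.
    pose e := nth e0 B i; have iNN : i < NN by apply: leq_trans iB (leq_trans Bm (ltnW m_lt)).
    apply: (Dt_st (i := e) (v := true) _ _ h2) => //.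
    + exact: ltn_trans m_lt.
    + by apply: (@ev_ar 7 (EV 23) s2 (Wd v mk ol (ac :|: [set e in take i B]) g0 L B) i) => //; exact: cellB.
    + by rewrite evN.
    apply: Hw_reg => //; apply: (Hw_ac h2) => y; rewrite !inE (take_nth e0) // mem_rcons inE -/e.
    by case: eqP; rewrite ?orbT.
  rewrite -leqNgt => iB; apply: Dt_skip; apply: Hw_reg => //; move: h2.
  by rewrite !take_oversize // ltnW.
- by move=> s2 _; rewrite take_oversize.
Qed.

Lemma cov_cat (a b : seq (seq 'I_m * nat)) : cov (a ++ b) = cov a :|: cov b.
Proof. by apply/setP => e; rewrite !inE has_cat. Qed.
Lemma cov1 (B : seq 'I_m) N : cov [:: (B, N)] = [set e in B].
Proof. by apply/setP => e; rewrite !inE /= orbF. Qed.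

(** The next block may depend on the set of clauses already active, which is recomputed through
    [cov]. *)
Fixpoint sc (bl : nat -> {set 'I_m} -> seq (seq 'I_m * nat)) (A0 : {set 'I_m}) i :=
  if i is i'.+1 then let S := sc bl A0 i' in S ++ bl i' (A0 :|: cov S) else [::].

(* [bl0] activates a clause off short cycles, [bl1] the component of the [i]-th
   clause on a short cycle. *)
Definition bl0 i (A : {set 'I_m}) : seq (seq 'I_m * nat) :=
  if insub i is Some e then (if e \in G0 then [::] else [:: ([:: e], T)]) else [::].
Definition bl1 i (A : {set 'I_m}) : seq (seq 'I_m * nat) :=
  if onth L0s i is Some e then
    (if e \in A then [::] else [:: (take T (enum (comp (VF F) r T e)), sq)]) else [::].
Definition sc0 := sc bl0 finset.set0 m.
Definition sched := sc0 ++ sc bl1 (finset.set0 :|: cov sc0) sq.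

Definition p0 := CFor 28 3 (CIf (ar 5 (EV 28)) (EN 1) (CSeq (st 7 (EN 0) (EV 28))
  (CSeq (CAsg 24 (EN 1)) (CSeq (blk 1 7) (st 4 (EV 28) (EN 1))))) CSkip).

Definition Hb ac s v := exists B, Hv ac G0 L0s B s v.

Lemma sc_alg bl A0 v i : alg F T A0 (sc bl A0 i.+1) v =
  bind (alg F T A0 (sc bl A0 i) v) (alg F T (A0 :|: cov (sc bl A0 i)) (bl i (A0 :|: cov (sc bl A0 i)))).
Proof. by rewrite /= alg_cat. Qed.

Lemma p0_ok s v : Hb finset.set0 s v -> s.1 18 = size L0s ->
  RT (fun s' v' => Hb (finset.set0 :|: cov sc0) s' v' /\ s'.1 18 = size L0s) (sem p0 s) (alg F T finset.set0 sc0 v).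
Proof.
move=> hb c18; pose A i : {set 'I_m} := finset.set0 :|: cov (sc bl0 finset.set0 i).
apply: (RT_for_seq (N := m) (I := fun i s' v' => Hb (A i) s' v')
   (u := fun i => alg F T finset.set0 (sc bl0 finset.set0 i)) (g := fun i => alg F T (A i) (bl0 i (A i)))) => //.
- by case: hb => B [mk [ol [[]]]].
- exact: ltn_trans m_lt NW.
- by move=> i _; exact: sc_alg.
- rewrite /A; have -> : finset.set0 :|: cov (sc bl0 finset.set0 0) = finset.set0 by apply/setP => e; rewrite !inE.
  exact: hb.
- move=> i s1 v1 im x1 f1 [B1 [mk1 [ol1 h1]]]; pose e := Ordinal im.
  have bE : bl0 i (A i) = if e \in G0 then [::] else [:: ([:: e], T)].
    by rewrite /bl0 (insubT (fun i => i < m) im).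
  have AS : A i.+1 = A i :|: cov (bl0 i (A i)) by rewrite /A /= cov_cat finset.setUA.
  apply: (RT_if (b := e \notin G0)).
  + by rewrite evN // (ev_g0 h1 (x1 : s1.1 28 = e)); case: (_ \in G0).
  + move=> eG; rewrite AS bE (negbTE eG) cov1.
    have h1' : Hw (Wd v1 mk1 ol1 (A i) G0 L0s [::]) s1.
      by apply: Hw_weak h1 _ => -[|[|[|[|[|[|[|[|b']]]]]]]] [|j] u.
    apply: (RT_det (Q := fun s2 => Hw (Wd v1 mk1 ol1 (A i) G0 L0s [:: e]) s2)).
      apply: (Dt_st (i := 0) (v := e) _ _ h1') => //; [exact: ltnW NN_gt0|by rewrite evN|].
      exact: (@Hw_B v1 mk1 ol1 (A i) G0 L0s [::] s1 e (ltnW NN_gt0) h1').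
    move=> s2 f2 h2; have x2 : s2.1 28 = e by rewrite f2.
    apply: (RT_det (Q := fun s3 => Hw (Wd v1 mk1 ol1 (A i) G0 L0s [:: e]) s3 /\ s3.1 24 = 1)).
      by apply: Dt_asg; split; [exact: h2|rewrite -[LHS]/(ev (EN 1) s2) evN].
    move=> s3 f3 [h3 c3]; have x3 : s3.1 28 = e by rewrite f3.
    have hv3 : Hv (A i) G0 L0s [:: e] s3 v1 by exists mk1, ol1.
    have [[_ _ _ _ [h7 _ _ h11]] _] := h3.
    have m0 : 0 < m := leq_ltn_trans (leq0n i) im.
    have oneW : 1 < 2 ^ w by apply: small; have := NN_gt0; lia.
    apply: (RT_seq (blk_ok (cap := 1) (tri := 7) hv3 h11 oneW isT h7 TW (leqnn 1) m0 c3)) => s4 v4 f4 [mk4 [ol4 h4]].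
    apply: RT_Dt; apply: (Dt_st (i := e) (v := true) _ _ h4) => //.
    * exact: ltn_trans m_lt.
    * by rewrite evV f4.
    * by rewrite evN.
    exists [:: e], mk4, ol4; apply: Hw_reg => //; apply: (Hw_ac h4) => y; rewrite !inE.
    by case: eqP; rewrite ?orbT ?orbF.
  + rewrite negbK => eG; rewrite AS bE eG.
    have -> : A i :|: cov [::] = A i by apply/setP => y; rewrite !inE orbF.
    by apply: RT_Dt; apply: Dt_skip; exists B1, mk1, ol1.
- move=> s1 v1 f1 h1; split; first exact: h1.
  by rewrite f1.
Qed.

Definition p1 := CFor 29 9 (CIf (EV 29) (EV 18) (CSeq (CAsg 28 (ar 6 (EV 29))) (CIf (ar 4 (EV 28)) (EN 1)
  (CSeq clr (CSeq (mkc_ 28) (CSeq (rch false (EN 0) (ar 5 (EV 11)) 7) (CSeq (CAsg 24 (EN 0))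
   (CSeq coll (CSeq (blk 7 9) acts)))))) CSkip)) CSkip).

Lemma p1_ok s v A0 : Hb A0 s v -> s.1 18 = size L0s ->
  RT (fun s' v' => exists A, Hb A s' v') (sem p1 s) (alg F T A0 (sc bl1 A0 sq) v).
Proof.
move=> hb c18; pose A i : {set 'I_m} := A0 :|: cov (sc bl1 A0 i).
apply: (RT_for_seq (N := sq) (I := fun i s' v' => Hb (A i) s' v')
   (u := fun i => alg F T A0 (sc bl1 A0 i)) (g := fun i => alg F T (A i) (bl1 i (A i)))) => //.
- by case: hb => B [mk [ol [[_ _ _ _ [_ _ -> _]]]]].
- by move=> i _; exact: sc_alg.
- rewrite /A; have -> : A0 :|: cov (sc bl1 A0 0) = A0 by apply/setP => e; rewrite !inE orbF.
  exact: hb.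
- move=> i s1 v1 im x1 f1 [B1 [mk1 [ol1 h1]]].
  have AS : A i.+1 = A i :|: cov (bl1 i (A i)) by rewrite /A /= cov_cat finset.setUA.
  have c1 : s1.1 18 = size L0s by rewrite f1.
  have keep s2 : bl1 i (A i) = [::] -> Hw (Wd v1 mk1 ol1 (A i) G0 L0s B1) s2 ->
      RT (fun s3 a2 => Hb (A i.+1) (upd s3.1 29 i.+1, s3.2) a2) (sem CSkip s2) (alg F T (A i) (bl1 i (A i)) v1).
    move=> E h2; rewrite AS E; have -> : A i :|: cov [::] = A i by apply/setP => y; rewrite !inE orbF.
    by apply: RT_Dt; apply: Dt_skip; exists B1, mk1, ol1.
  apply: (RT_if (b := i < size L0s)); [by rewrite !evV x1 c1| |] => iL; last first.
    apply: keep => //; rewrite /bl1.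
    by rewrite onth_over // leqNgt.
  have e0 : 'I_m by case: L0s iL => // e.
  pose e := nth e0 L0s i.
  have iNN : i < NN by apply: leq_trans iL (leq_trans (size_sel _ _ _) (ltnW m_lt)).
  apply: (RT_det (Q := fun s2 => Hw (Wd v1 mk1 ol1 (A i) G0 L0s B1) s2 /\ s2.1 28 = e)).
    apply: Dt_asg; split; first exact: h1.
    apply: (@ev_ar 6 (EV 29) s1 (Wd v1 mk1 ol1 (A i) G0 L0s B1) i) => //.
    by rewrite /= (onth_nth e0).
  move=> s2 f2 [h2 x2].
  have bE : bl1 i (A i) = if e \in A i then [::] else [:: (take T (enum (comp (VF F) r T e)), sq)].
    by rewrite /bl1 (onth_nth e0).
  apply: (RT_if (b := e \notin A i)).
  + by rewrite evN // (ev_ac h2 x2); case: (_ \in A i).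
  + move=> eA; rewrite AS bE (negbTE eA) cov1.
    have h2' : Hw (Wd v1 mk1 ol1 (A i) G0 L0s [::]) s2.
      by apply: Hw_weak h2 _ => -[|[|[|[|[|[|[|[|b']]]]]]]] [|j] u.
    apply: (RT_det (clr_ok h2')) => s3 f3 h3; have x3 : s3.1 28 = e by rewrite f3.
    apply: (RT_det (mkc_ok (x := 28) isT h3 x3)) => s4 f4; rewrite finset.set0U => h4.
    apply: (RT_det (rch_ok (G := fun e => e \in G0) (N := T) h4 _ TW _)).
    * by case: h4 => -[_ _ _ _ []].
    * by move=> e' s5 mk5 ol5 h5 xe _; rewrite evN // (ev_g0 h5 xe); case: (_ \in G0).
    move=> s5 f5 [ol5]; rewrite (iter_ext _ _ (grw_pl G0 v1)) -/(reach _ _ _ _) => h5.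
    set S := reach _ _ _ _ in h5.
    have cE : cmp S = comp (VF F) r T e by [].
    apply: (RT_det (Q := fun s6 => Hw (Wd v1 S ol5 (A i) G0 L0s [::]) s6 /\ s6.1 24 = 0)).
      by apply: Dt_asg; split; [exact: h5|rewrite /= mod0n].
    move=> s6 _ [h6 z6]; apply: (RT_det (coll_ok h6 z6)) => s7 _; rewrite selT cE => -[h7 c7].
    set B := take T _ in h7 c7 *.
    have BT : size B <= T by rewrite size_take_min geq_minl.
    have Bm : size B <= m by rewrite -[B]selT; exact: size_sel.
    have hv7 : Hv (A i) G0 L0s B s7 v1 by exists S, ol5.
    have [[_ _ _ _ [h77 _ h79 _]] _] := h7.
    apply: (RT_seq (blk_ok (cap := 7) (tri := 9) hv7 h77 TW isT h79 sqW BT Bm c7)) => s8 v8 f8 [mk8 [ol8 h8]].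
    have c8 : s8.1 24 = size B by rewrite f8.
    apply: RT_Dt; apply: Dt_weak (acts_ok h8 c8 BT Bm) _ => s9 h9.
    by exists B, mk8, ol8.
  + by rewrite negbK => eA; apply: keep => //; rewrite bE eA.
- by move=> s1 v1 _ h1; eexists; exact: h1.
Qed.

Definition setv (v : assignment n) (x : 'I_n) b : assignment n := [ffun y => if y == x then b else v y].
Fixpoint initX (X : seq 'I_n) v : rtree (assignment n) :=
  if X is x :: X' then bind (Flp (Ret (setv v x false)) (Ret (setv v x true))) (initX X') else Ret v.

Lemma initX_cat X1 X2 v : initX (X1 ++ X2) v = bind (initX X1 v) (initX X2).
Proof. by elim: X1 v => //= x X1 IH v; rewrite !IH. Qed.

Definition ini := CFor 10 2 (CSeq (CFlip 19) (st 1 (EV 10) (EV 19))).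

Lemma ini_ok v ac g0 L B s : Hv ac g0 L B s v ->
  RT (Hv ac g0 L B) (sem ini s) (initX (enum 'I_n) v).
Proof.
move=> hv; pose u i := initX (take i (enum 'I_n)).
have -> : initX (enum 'I_n) v = u n v by rewrite /u take_oversize ?size_enum_ord.
pose g i v := if insub i is Some x then initX [:: x] v else Ret v.
apply: (RT_for_seq (I := fun _ => Hv ac g0 L B) (u := u) (g := g)) => //.
- by case: hv => mk [ol [[]]].
- exact: ltn_trans n_lt NW.
- by rewrite /u take0.
- move=> l lk; rewrite /u /g (take_nth (Ordinal lk)) ?size_enum_ord // -cats1 initX_cat.
  have -> : nth (Ordinal lk) (enum 'I_n) l = Ordinal lk by rewrite -[l]/(val (Ordinal lk)) nth_ord_enum.
  by congr bind; apply/funext => v2; rewrite (insubT (fun l => l < n) lk).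
- move=> i s1 v1 iN x1 f1 [mk [ol h1]]; pose x := Ordinal iN; rewrite /g (insubT (fun l => l < n) iN).
  have xN : x < NN by exact: ltn_trans n_lt.
  have H (b : bool) : RT (fun s2 a2 => Hv ac g0 L B (upd s2.1 10 i.+1, s2.2) a2)
     (sem (st 1 (EV 10) (EV 19)) (upd s1.1 19 (b %% 2 ^ w), s1.2)) (Ret (setv v1 x b)).
    apply: RT_Dt; have h2 : Hw (Wd v1 mk ol ac g0 L B) (upd s1.1 19 (b %% 2 ^ w), s1.2) by exact: h1.
    apply: (Dt_st (i := x) (v := b) _ _ h2) => //.
      rewrite -[LHS]/(b %% 2 ^ w) modn_small //; apply: small; have := NN_gt0; case: b {h2} => /=; lia.
    by exists mk, ol; apply: Hw_reg => //; apply: (Hw_val h2) => y; rewrite ffunE.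
  by apply: RTflp; [exact: (H false)|exact: (H true)].
Qed.

Definition out := CFor 10 2 (CSto (EV 10) (ar 1 (EV 10))).

Lemma out_ok v mk ol ac g0 L B s : Hw (Wd v mk ol ac g0 L B) s ->
  Dt (fun s' : store => forall x : 'I_n, s'.2 x = nat_of_bool (v x)) (sem out s).
Proof.
move=> hw; apply: (Dt_for (N := n) (I := fun i (s' : store) => [/\ s'.1 5 = NN,
   forall x : 'I_n, s'.2 (1 * NN + x) = nat_of_bool (v x) &
   forall x : 'I_n, x < i -> s'.2 x = nat_of_bool (v x)])) => //.
- by case: hw => -[].
- exact: ltn_trans n_lt NW.
- case: hw => -[_ _ _ h5 _] hm; split=> // x.
  apply: (hm 1) => //; [exact: ltn_trans n_lt|exact: cell1].
- move=> i s1 iN x1 _ [h5 h1 h2]; pose x := Ordinal iN; have xN : x < NN by exact: ltn_trans n_lt.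
  have E : ev (ar 1 (EV 10)) s1 = v x.
    rewrite /ar evL /addr evB (evB Mul) evN // !evV h5 x1 /eval_op.
    have ? := NN_gt0; rewrite [1 * NN %% _]modn_small; last by apply: small; lia.
    rewrite modn_small; last by apply: small; rewrite /= in xN; lia.
    exact: (h1 x).
  exists (s1.1, upd s1.2 i (v x)); first by rewrite -E -[in RHS]x1.
  split=> // y; rewrite /= /upd; last first.
    by rewrite ltnS leq_eqVlt => /orP[/eqP yi|yi]; [rewrite yi eqxx; congr (nat_of_bool (v _)); apply: val_inj|case: eqP => // yi'; [rewrite yi' ltnn in yi|exact: h2]].
  (* The output overwrites the input alone: array 1 starts at [NN], beyond every address written
     here. *)
  by case: eqP => [E1|_] //; exfalso; move: E1 xN; rewrite mul1n /=; lia.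
- by move=> s1 _ [_ _ h] x; apply: h.
Qed.

Definition Main := CSeq ini (CSeq det (CSeq l0 (CSeq p0 (CSeq p1 out)))).

Lemma main_ok v s : Hw (Wd v finset.set0 finset.set0 finset.set0 finset.set0 [::] [::]) s ->
  RT (fun (s' : store) (v' : assignment n) => forall x : 'I_n, s'.2 x = nat_of_bool (v' x)) (sem Main s)
    (bind (initX (enum 'I_n) v) (alg F T finset.set0 sched)).
Proof.
move=> hw; have hv : Hv finset.set0 finset.set0 [::] [::] s v by exists finset.set0, finset.set0.
apply: (RT_seq (ini_ok hv)) => s1 v1 _ h1.
apply: (RT_det (det_ok (h1 : Hd v1 _ _ _ _ s1))) => s2 _ h2.
apply: (RT_det (l0_ok h2)) => s3 _ [h3 c3].
rewrite /sched alg_cat.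
have hb3 : Hb finset.set0 s3 v1 by exists [::].
apply: (RT_seq (p0_ok hb3 c3)) => s4 v4 _ [h4 c4].
rewrite -[alg _ _ _ _ v4]bindR.
apply: (RT_seq (p1_ok h4 c4)) => s5 v5 _ [A [B [mk [ol h5]]]].
by apply: RT_Dt; apply: out_ok h5.
Qed.

End World.
End Refinement.

(** * Preparation of the registers, word length and running time *)

Module RunningTime.
Import Explore Steps SwitchConf ClauseCount Resign CoinTree Switching Moments Compiler Simulation RamState Refinement.
Section SquareRoot.
Variable n : nat.
(** Mirrors the linear scan of the program. For positive [n], [sqf] is the largest number with
    square below [n]; it serves as number of attempts and as cap on the clauses on short cycles. *)
Fixpoint sqi i := if i is i'.+1 then (if i' * i' < n then i' else sqi i') else 0.
Definition sqf := sqi n.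

Lemma sqi_sq i : sqi i * sqi i <= n.
Proof. by elim: i => [|i IH] //=; case: ifP => // /ltnW. Qed.
Lemma sqi_max i j : j < i -> j * j < n -> j <= sqi i.
Proof.
elim: i => [//|i IH] /=; rewrite ltnS leq_eqVlt => /orP[/eqP -> ->//|ji] jn.
by case: ifP => // _; [exact: ltnW|exact: IH].
Qed.
Lemma sqi_le i : sqi i <= i.
Proof. by elim: i => [|i IH] //=; case: ifP => _; [|apply: leq_trans IH _]. Qed.
Lemma sqf_up : n <= sqf.+1 * sqf.+1.
Proof.
rewrite leqNgt; apply/negP => lt.
have : sqf.+1 <= sqf.
  apply: sqi_max => //; apply: leq_ltn_trans lt; exact: leq_pmull.
by rewrite ltnn.
Qed.
End SquareRoot.

Lemma lt_up_log n a : (2 ^ a < n) = (a < up_log 2 n).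
Proof.
apply/idP/idP => h; rewrite ltnNge; apply/negP => le.
  have := leq_trans (up_logP n (isT : 1 < 2)) (leq_pexp2l (isT : 0 < 2) le).
  by rewrite leqNgt h.
by have := up_log_min (isT : 1 < 2) le; rewrite leqNgt h.
Qed.

Lemma up_log_le n : up_log 2 n <= n.
Proof. by apply: up_log_min => //; apply: ltnW; apply: ltn_expl. Qed.

Section Program.
Variables (k C C1 ra rb : nat).
Hypothesis k3 : 2 < k.
Definition K0 := 16 + C + C1 + ra + rb + k.
Definition word_const := K0 + 3.

(** For [m > C * n] the register holding [m] is set to 0 by truncated subtraction: the clauses are
    then ignored, but the running time is bounded in terms of [n] for every input. *)
Definition Pre1 := CSeq (CAsg 2 (EL (EN 0))) (CSeq (CAsg 3 (EL (EN 1))) (CSeq (CAsg 4 (EN k))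
 (CSeq (CAsg 5 (EB Add (EB Add (EB Mul (EN 2) (EV 2)) (EB Mul (EV 3) (EV 4))) (EN 2)))
 (CSeq (CAsg 3 (EB Mul (EV 3) (EB Defs.Sub (EN 1) (EB Defs.Sub (EV 3) (EB Mul (EN C) (EV 2))))))
 (CSeq (CAsg 6 (EN 0)) (CSeq (CAsg 9 (EN 0)) (CAsg 40 (EN 1)))))))).
Definition Pre2 := CSeq (CFor 10 2 (CIf (EV 40) (EV 2)
    (CSeq (CAsg 40 (EB Add (EV 40) (EV 40))) (CAsg 6 (EB Add (EV 6) (EN 1)))) CSkip))
  (CSeq (CAsg 7 (EB Mul (EN C1) (EV 6))) (CSeq (CAsg 8 (EB Div (EB Mul (EN ra) (EV 6)) (EN rb)))
   (CFor 10 2 (CIf (EB Mul (EV 10) (EV 10)) (EV 2) (CAsg 9 (EV 10)) CSkip)))).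

Definition full := CSeq Pre1 (CSeq Pre2 Main).
Definition prog : program := Const 1 1 :: cc 1 full.

Definition lgn n := up_log 2 n.
Definition Tn n := C1 * lgn n.
Definition rn n := (ra * lgn n) %/ rb.

Section Input.
Variables (n m : nat) (F : formula n k m).
Let w := word_length word_const n k m.
Let N := NN n k m.
Definition mm := if C * n < m then 0 else m.
Notation sem := (sem w).
Notation ev := (ev w).

(** The word length is [K0 + 3] times a logarithm of [N]: three of these powers of [N] give the
    cube, and the others exceed [2 ^ K0], which covers the constants of the program. *)
Lemma hK : K0 * (N * N * N) <= 2 ^ w.
Proof.
rewrite /w /word_length -/(NN n k m) -/N [word_const * _]mulnC expnM /word_const.
have NN2 : N <= 2 ^ up_log 2 N by exact: up_logP.
have N2 : 2 <= N by exact: NN_gt0.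
apply: (@leq_trans (N ^ (K0 + 3))); last by rewrite leq_exp2r // addn3.
rewrite expnD; apply: leq_mul; last by rewrite !expnS expn0 muln1 mulnA.
apply: (@leq_trans (2 ^ K0)); first exact: ltnW (ltn_expl K0 (isT : 1 < 2)).
by rewrite leq_exp2r // /K0; lia.
Qed.

Lemma w16 : 16 * N * N <= 2 ^ w.
Proof.
apply: leq_trans hK; have N2 : 2 <= N by exact: NN_gt0.
rewrite -!mulnA; apply: leq_mul; first by rewrite /K0; lia.
by rewrite leq_mul2l leq_pmulr ?orbT // ltnW.
Qed.

Lemma smallK c a : c <= K0 -> a <= N * N -> c * a < 2 ^ w.
Proof.
move=> cK aN; have N2 : 2 <= N by exact: NN_gt0.
have K1 : 0 < K0 by rewrite /K0; lia.
apply: leq_trans hK; apply: (@leq_trans (K0 * (N * N)).+1).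
  by rewrite ltnS leq_mul.
rewrite -addn1; apply: (@leq_trans (K0 * (N * N) * 2)).
  by rewrite muln2 -addnn leq_add2l muln_gt0 K1 /= muln_gt0; lia.
by rewrite -!mulnA leq_mul2l leq_mul2l leq_mul2l N2 !orbT.
Qed.

Lemma smallk c : c <= K0 -> c < 2 ^ w.
Proof.
move=> cK; rewrite -[c]muln1; apply: smallK => //.
by have := NN_gt0 n k m; rewrite -/N => ?; rewrite muln_gt0; lia.
Qed.

Lemma smallN a : a <= N * N -> a < 2 ^ w.
Proof. by move=> h; rewrite -[a]mul1n; apply: smallK => //; rewrite /K0; lia. Qed.

Lemma evK c s : c <= K0 -> ev (EN c) s = c.
Proof. by move=> cK; apply: modn_small; apply: smallk. Qed.

Lemma Dt_let Q x e c s v : ev e s = v -> Dt Q (sem c (upd s.1 x v, s.2)) ->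
  Dt Q (sem (CSeq (CAsg x e) c) s).
Proof. by move=> <-. Qed.

Definition s0 : store := (fun x => if x == 1 then 1 else 0, nth 0 (input F)).

Definition P1 (s : store) := [/\ s.1 0 = 0, s.1 1 = 1, s.1 2 = n, s.1 3 = mm &
  [/\ s.1 4 = k, s.1 5 = N, s.1 6 = 0, s.1 9 = 0 & s.1 40 = 1] /\ s.2 = nth 0 (input F)].

Lemma n_le : n <= N. Proof. by rewrite /N /NN; lia. Qed.
Lemma m_le : m <= N. Proof. by apply: leq_trans (leq_pmulr m (leq_trans (isT : 0 < 3) k3)) _; rewrite /N /NN; lia. Qed.
Lemma N_NN a : a <= N -> a <= N * N.
Proof. by move=> h; apply: leq_trans h _; rewrite leq_pmulr // ltnW // NN_gt0. Qed.

Lemma pre1_ok : Dt P1 (sem Pre1 s0).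
Proof.
have K1 c : c <= 16 -> c <= K0 by rewrite /K0; lia.
have CK : C <= K0 by rewrite /K0; lia.
have nN := n_le; have mN := m_le.
have mkN : m * k <= N by rewrite /N /NN; lia.
have nnN : 2 * n + m * k + 2 = N by rewrite /N /NN mul2n.
apply: (Dt_let (v := n)); first by rewrite evL evK ?K1.
apply: (Dt_let (v := m)); first by rewrite evL evK ?K1.
apply: (Dt_let (v := k)); first by rewrite evK // /K0; lia.
apply: (Dt_let (v := N)).
  rewrite evB (evB _ Add (EB _ _ _)) (evB _ Mul (EN 2)) (evB _ Mul (EV 3)) !evK ?K1 // !evV /eval_op /= /upd /=.
  rewrite [(2 * n) %% _]modn_small; last by apply: smallN; apply: N_NN; lia.
  rewrite [(m * k) %% _]modn_small; last by apply: smallN; apply: N_NN.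
  rewrite [(_ + _ * _) %% _]modn_small; last by apply: smallN; apply: N_NN; lia.
  by rewrite nnN modn_small //; apply: smallN; apply: N_NN.
apply: (Dt_let (v := mm)).
  rewrite evB (evB _ Defs.Sub (EN 1)) (evB _ Defs.Sub (EV 3)) (evB _ Mul (EN C)) (evK _ (K1 1 isT)) (evK _ CK).
  rewrite !evV /eval_op /= /upd /=.
  rewrite [(C * n) %% _]modn_small; last by apply: smallK; [rewrite /K0; lia|apply: N_NN].
  rewrite [(m - _) %% _]modn_small; last by apply: smallN; apply: N_NN; lia.
  rewrite [(1 - _) %% _]modn_small; last by apply: smallk; rewrite /K0; lia.
  rewrite /mm; case: ltnP => h.
    have -> : 1 - (m - C * n) = 0 by lia.
    by rewrite muln0 mod0n.
  have -> : 1 - (m - C * n) = 1 by lia.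
  by rewrite muln1 modn_small //; apply: smallN; apply: N_NN.
apply: (Dt_let (v := 0)); first by rewrite evK ?K1.
apply: (Dt_let (v := 0)); first by rewrite evK ?K1.
have e1 : ev (EN 1) s0 = 1 by rewrite evK ?K1.
by apply: Dt_asg; split=> //; split=> //; split=> //; exact: e1.
Qed.

Definition P2 (s : store) := [/\ s.1 0 = 0, s.1 1 = 1, s.1 2 = n, s.1 3 = mm &
  [/\ s.1 4 = k, s.1 5 = N, s.1 7 = Tn n, s.1 8 = rn n & s.1 9 = sqf n] /\ s.2 = nth 0 (input F)].

Lemma lg_le : lgn n <= n. Proof. exact: up_log_le. Qed.

Lemma pre2_ok s : P1 s -> Dt P2 (sem Pre2 s).
Proof.
have K1 c : c <= 16 -> c <= K0 by rewrite /K0; lia.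
have nN := n_le; have lgl := lg_le.
move=> [h0 h1 h2 h3 [[h4 h5 h6 h9 h40] hm]].
pose Fx (s' : store) := [/\ s'.1 0 = 0, s'.1 1 = 1, s'.1 2 = n, s'.1 3 = mm &
  [/\ s'.1 4 = k & s'.1 5 = N] /\ s'.2 = nth 0 (input F)].
apply: (Dt_seq (Q := fun s1 => [/\ Fx s1, s1.1 6 = lgn n & s1.1 9 = 0])).
  apply: (Dt_for (N := n) (I := fun i s1 => [/\ Fx s1, s1.1 6 = minn i (lgn n), s1.1 40 = 2 ^ s1.1 6 & s1.1 9 = 0])) => //.
  - by apply: smallN; apply: N_NN.
  - by split=> //=; rewrite /upd /= ?h6 ?min0n ?h40.
  - move=> i s1 iN x1 _ [[g0 g1 g2 g3 [[g4 g5] gm]] g6 g40 g9].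
    have lt : (2 ^ minn i (lgn n) < n) = (i < lgn n).
      by rewrite lt_up_log gtn_min ltnn orbF.
    apply: (Dt_if (b := i < lgn n)); first by rewrite !evV g40 g2 g6.
      move=> il; have mi : minn i (lgn n) = i by apply/minn_idPl; apply: ltnW.
      have t2 : 2 ^ i < n by rewrite -lt mi in il.
      apply: (Dt_let (v := 2 ^ i.+1)).
        rewrite evB !evV g40 g6 mi /eval_op addnn -mul2n -expnS modn_small //.
        by apply: smallN; apply: N_NN; rewrite expnS; move: nN t2; rewrite /N /NN; lia.
      apply: Dt_asg; split=> //=; rewrite /upd /=.
        rewrite -[LHS]/(ev (EB Add (EV 6) (EN 1)) (upd s1.1 40 (2 ^ i.+1), s1.2)) evB evK ?K1 // evV /= /upd /= g6 mi addn1.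
        by rewrite (minn_idPl il) modn_small //; apply: smallN; apply: N_NN; lia.
      rewrite -[X in _ = 2 ^ X]/(ev (EB Add (EV 6) (EN 1)) (upd s1.1 40 (2 ^ i.+1), s1.2)) evB evK ?K1 // evV /= /upd /= g6 mi addn1.
      by rewrite modn_small //; apply: smallN; apply: N_NN; lia.
    rewrite -leqNgt => il; apply: Dt_skip; split=> //=; rewrite /upd /= g6.
    by rewrite !(minn_idPr _) // leqW.
  - by move=> s1 _ [fx g6 g40 g9]; split=> //; rewrite g6; apply/minn_idPr.
move=> s1 _ [[g0 g1 g2 g3 [[g4 g5] gm]] g6 g9].
have lN : lgn n <= N * N by apply: N_NN; apply: leq_trans nN.
apply: (Dt_let (v := Tn n)).
  by rewrite evB evV evK ?g6 /eval_op ?modn_small //; [apply: smallK|]; rewrite /K0; lia.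
apply: (Dt_let (v := rn n)).
  rewrite evB (evB _ Mul) evV !evK; try by rewrite /K0; lia.
  rewrite /eval_op -[(upd _ _ _, _).1 6]/(s1.1 6) g6 [(ra * _) %% _]modn_small; last by apply: smallK => //; rewrite /K0; lia.
  rewrite modn_small //; apply: leq_ltn_trans (leq_div _ _) _; apply: smallK => //; rewrite /K0; lia.
apply: (Dt_for (N := n) (I := fun i s2 => [/\ Fx s2, s2.1 7 = Tn n, s2.1 8 = rn n & s2.1 9 = sqi n i])) => //.
- by apply: smallN; apply: N_NN.
- move=> i s2 iN x2 _ [[e0 e1 e2 e3 [[e4 e5] em]] e7 e8 e9].
  apply: (Dt_if (b := i * i < n)).
  + rewrite evB !evV x2 e2 /eval_op modn_small //; apply: smallN; apply: leq_mul; lia.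
  + by move=> lt; apply: Dt_asg; split=> //=; rewrite /upd /= x2 lt.
  + by move=> ge; apply: Dt_skip; split=> //=; rewrite /upd /= e9 (negbTE ge).
- by move=> s2 _ [[e0 e1 e2 e3 [[e4 e5] em]] e7 e8 e9].
Qed.

Lemma Hw_init s : P2 s -> mm = m ->
  Hw F (Tn n) (rn n) (sqf n) (Wd [ffun=> false] finset.set0 finset.set0 finset.set0 finset.set0 [::] [::]) s.
Proof.
move=> [h0 h1 h2 h3 [[h4 h5 h7 h8 h9] hm]] mE; rewrite mE in h3; split; first by split.
have szi : size (input F) <= N.
  rewrite /input /= size_map (@size_flat k); last by rewrite all_map; apply/allP => c _ /=; rewrite size_tuple.
  by rewrite size_map size_tuple /N /NN; lia.
move=> [|a] i v a8 iN; first by rewrite hm mul0n add0n => -[<-].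
have -> : s.2 (a.+1 * N + i) = 0.
  by rewrite hm nth_default // (leq_trans szi) // mulSn -addnA leq_addr.
by case: a a8 => [|[|[|[|[|[|[|a]]]]]]] _ //=; try (case: insubP => //= x _ _; rewrite ?ffunE ?inE => -[]); case: i {iN}.
Qed.

Lemma input_lt a : nth 0 (input F) a < 2 ^ w.
Proof.
have NW : N < 2 ^ w by apply: smallN; apply: N_NN.
apply: leq_trans NW; have N0 : 0 < N by rewrite /N /NN; lia.
case: (ltnP a (size (input F))) => h; last by rewrite nth_default.
have : all (fun v => v <= N) (input F).
  rewrite /input /= n_le m_le /=; apply/allP => v /mapP[l _ ->].
  by rewrite /encode_literal /N /NN; case: l => x b /=; have := ltn_ord x; case: b => /=; lia.
by move/all_nthP => /(_ 0 a h); rewrite ltnS.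
Qed.

Lemma Inv_s0 : Inv w s0.
Proof.
have W1 : 1 < 2 ^ w by apply: smallk; rewrite /K0; lia.
split=> // [x x60|]; last exact: input_lt.
by rewrite /=; case: eqP => // _; apply: ltnW.
Qed.

End Input.

Definition rho n x := match x with 1 => 1 | 2 => n | 3 => C * n | 4 => k | 7 => Tn n
  | 8 => ra * lgn n | 9 => sqf n | _ => 0 end.
Definition time_bound n := 1 + (cost (rho n) Pre1 + (cost (rho n) Pre2 + cost (rho n) Main)).

Lemma Sim_Lf (A : Type) w p (Q : A -> state -> Prop) (P : A -> Prop) s B t :
  Sim w p Q s B t -> Lf P t -> Sim w p (fun a s' => Q a s' /\ P a) s B t.
Proof.
elim=> {s B t} [a s B q|s s' B t E _ IH|s B t0 t1 _ I0 _ I1] l.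
- by inversion l; subst; apply: SimRet.
- by apply: SimStep E _; apply: IH.
- by inversion l; subst; apply: SimFlip; [apply: I0|apply: I1].
Qed.

Lemma Dt_Lf_of (A : Type) (Q : A -> Prop) t : Dt Q t -> Lf Q t.
Proof. by case=> a -> q; apply: LfR. Qed.

Section Run.
Variables (n m : nat) (F : formula n k m).
Let w := word_length word_const n k m.

Lemma wf_full : [/\ wf Pre1, wf Pre2 & wf Main].
Proof. by []. Qed.

Lemma cc_seq i c1 c2 : cc i (CSeq c1 c2) = cc i c1 ++ cc (i + size (cc i c1)) c2.
Proof. by []. Qed.

Lemma pc_end c1 c2 c3 S : let i2 := 1 + size (cc 1 c1) in let i3 := i2 + size (cc i2 c2) in
  pc S = i3 + size (cc i3 c3) -> halted (Const 1 1 :: cc 1 (CSeq c1 (CSeq c2 c3))) S.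
Proof. by move=> i2 i3 E; rewrite /halted E -cat1s !cc_seq !size_cat -/i2 -/i3 /i3 /i2 !addnA. Qed.

Lemma bindRet (A B : Type) (a : A) (f : A -> rtree B) : bind (Ret a) f = f a.
Proof. by []. Qed.

Lemma prog_sim : Sim w prog (fun (s' : store) S => halted prog S /\ memory S = s'.2)
  (init F) (time_bound n) (sem w full (s0 F)).
Proof.
have [wf1 wf2 wf3] := wf_full.
have ca : code_at prog 1 (cc 1 full) by move=> j _; rewrite add1n.
have [ca1] := (proj1 (code_at_cat _ _ _ _) ca).
set i2 := 1 + size (cc 1 Pre1) => ca23.
have [ca2] := (proj1 (code_at_cat _ _ _ _) ca23).
set i3 := i2 + size (cc i2 Pre2) => ca3.
have one : 1 %% 2 ^ w = 1 by apply: modn_small; apply: smallk; rewrite /K0; lia.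
apply: (SimStep (s' := State 1 (s0 F).1 (s0 F).2)).
  move=> b; rewrite /init /step /= one; congr State; apply/funext => x; by rewrite /upd.
have ag : agree 1 (s0 F) (State 1 (s0 F).1 (s0 F).2) by split.
apply: (Sim_bind (Sim_Lf (sim_com (rho := rho n) wf1 (Inv_s0 F) _ ca1 ag) (Dt_Lf_of (pre1_ok F)))) => //.
move=> s1 S1 [[ag1 I1 _] P1s].
apply: (Sim_bind (Sim_Lf (sim_com (rho := rho n) wf2 I1 _ ca2 ag1) (Dt_Lf_of (pre2_ok P1s)))).
  by move=> y; rewrite /= !inE orbb => /eqP ->; case: P1s => _ _ -> _ _.
move=> s2 S2 [[ag2 I2 _] P2s].
have [_ r1 r2 r3 [[r4 r5 r7 r8 r9] _]] := P2s.
have L : {in lr Main, forall y, s2.1 y <= rho n y /\ y \notin wr Main}.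
  have al : all (fun y => y \in [:: 1; 2; 3; 4; 7; 8; 9]) (lr Main) by [].
  move=> y /(allP al); rewrite !inE.
  have r3' : s2.1 3 <= C * n by rewrite r3 /mm; case: ltnP.
  have r8' : s2.1 8 <= ra * lgn n by rewrite r8; exact: leq_div.
  by case/or4P => [/eqP->|/eqP->|/eqP->|/or4P[/eqP->|/eqP->|/eqP->|/eqP->]]; split=> //=; rewrite ?r1 ?r2 ?r4 ?r7 ?r9.
apply: Sim_weak (sim_com wf3 I2 L ca3 ag2) => s3 S3 [[pcE _ mE] _ _]; split=> //.
exact: (@pc_end Pre1 Pre2 Main S3 pcE).
Qed.

Lemma prog_halts bs : time_bound n <= size bs -> halted prog (exec prog word_const F bs).
Proof. by move=> h; apply: (Sim_halts prog_sim) => // a s' []. Qed.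

Hypotheses (Fp : proper_formula F) (mC : m <= C * n).

Lemma prog_law (R : realType) t v : time_bound n <= t -> output_dist R prog word_const t F v =
  law R (bind (initX (enum 'I_n) [ffun=> false]) (alg F (Tn n) finset.set0 (sched F (Tn n) (rn n) (sqf n)))) v.
Proof.
move=> h; pose g (s' : store) : R := (([ffun i : 'I_n => s'.2 i != 0] : assignment n) == v)%:R%R.
have E := @Sim_law w prog R _ _ _ _ _ (fun S => (output n S == v)%:R%R) g prog_sim _ _ t h.
rewrite /output_dist.
have -> : #|[set bs : t.-tuple bool | output n (exec prog word_const F bs) == v]|%:R%R =
    (\sum_(bs : t.-tuple bool) (output n (run prog w (init F) bs) == v)%:R)%R :> R.
  by rewrite -sum1dep_card natr_sum big_mkcond /=; apply: eq_bigr => bs _; case: eqP.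
rewrite E; last 2 first.
- by move=> a s' [].
- by move=> a s' [_ mE]; rewrite /output mE.
rewrite [(2 ^+ t * _)%R]mulrC mulfK ?expf_neq0 //.
have mE : mm n m = m by rewrite /mm ltnNge mC.
have [s1 e1 p1] := pre1_ok F; have [s2 e2 p2] := pre2_ok p1.
have -> : sem w full (s0 F) = bind (sem w Pre1 (s0 F)) (fun s => bind (sem w Pre2 s) (sem w Main)) by [].
rewrite /w e1 bindRet e2 bindRet /law.
have nN := n_le n m; have lN : lgn n <= NN n k m * NN n k m.
  by apply: N_NN; apply: leq_trans nN; exact: lg_le.
apply: RT_Ex (main_ok _ _ _ _ _ _ _ (Hw_init p2 mE)) => //.
- by move=> a b ab; rewrite /g; congr (nat_of_bool (_ == v))%:R%R; apply/ffunP => x; rewrite ffunE ab; case: (b x).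
- exact: w16.
- by apply: smallK => //; rewrite /K0; lia.
- by apply: leq_ltn_trans (leq_div _ _) _; apply: smallK => //; rewrite /K0; lia.
- by apply: smallN; apply: N_NN; apply: leq_trans nN; exact: sqi_le.
- exact: sqi_le.
Qed.

End Run.

(** The comparison functions are shifted to be positive everywhere, so that constant costs are
    absorbed without exceptional [n]. *)
Definition bo (f g : nat -> nat) := exists K, forall n, f n <= K * g n.
Definition co c n := cost (rho n) c.
Definition gX n := n.+1.
Definition gY n := (lgn n).+1.
Definition gZ n := (sqf n).+1.
Definition g1 (_ : nat) := 1.
Definition gm (f g : nat -> nat) n := f n * g n.
Definition pos (g : nat -> nat) := forall n, 0 < g n.

Lemma pos_m f g : pos f -> pos g -> pos (gm f g).
Proof. by move=> pf pg n; rewrite muln_gt0 pf pg. Qed.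
Lemma bo_add f f' g : bo f g -> bo f' g -> bo (fun n => f n + f' n) g.
Proof. by move=> [K h] [K' h']; exists (K + K') => n; rewrite mulnDl leq_add. Qed.
Lemma bo_cst a g : pos g -> bo (fun _ => a) g.
Proof. by move=> pg; exists a => n; rewrite leq_pmulr. Qed.
Lemma bo_mul f f' g g' : bo f g -> bo f' g' -> bo (fun n => f n * f' n) (gm g g').
Proof. by move=> [K h] [K' h']; exists (K * K') => n; rewrite /gm mulnACA leq_mul. Qed.
Lemma bo_mono f g g' : bo f g -> (forall n, g n <= 4 * g' n) -> bo f g'.
Proof. by move=> [K h] gg; exists (K * 4) => n; apply: leq_trans (h n) _; rewrite -mulnA leq_mul2l gg orbT. Qed.
Lemma bo_nl c g : (forall rho rho', cost rho c = cost rho' c) -> pos g -> bo (co c) g.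
Proof. by move=> h pg; exists (cost (rho 0) c) => n; rewrite /co (h _ (rho 0)) leq_pmulr. Qed.
Lemma bo_seq c1 c2 g : bo (co c1) g -> bo (co c2) g -> bo (co (CSeq c1 c2)) g.
Proof. exact: bo_add. Qed.
Lemma bo_if e1 e2 c1 c2 g : pos g -> bo (co c1) g -> bo (co c2) g -> bo (co (CIf e1 e2 c1 c2)) g.
Proof.
move=> pg h1 h2; apply: bo_add h2; apply: bo_add h1; exact: bo_cst.
Qed.
Lemma bo_for x y c f g : pos f -> pos g -> bo (fun n => rho n y) f -> bo (co c) g ->
  bo (co (CFor x y c)) (gm f g).
Proof.
move=> pf pg hy hc; apply: bo_add; first exact: bo_cst (pos_m pf pg).
by apply: bo_mul hy _; apply: bo_add hc _; exact: bo_cst.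
Qed.
Arguments bo_for [x y c f g].
Lemma p1_ : pos g1. Proof. by []. Qed.
Lemma pX : pos gX. Proof. by []. Qed.
Lemma pY : pos gY. Proof. by []. Qed.
Lemma pZ : pos gZ. Proof. by []. Qed.
Hint Resolve p1_ pX pY pZ pos_m : core.

Lemma b1 : bo (fun n => rho n 1) g1. Proof. by exists 1. Qed.
Lemma b2 : bo (fun n => rho n 2) gX. Proof. by exists 1 => n; rewrite mul1n /gX /=. Qed.
Lemma b3 : bo (fun n => rho n 3) gX. Proof. by exists C => n; rewrite /gX /= leq_mul2l leqnSn orbT. Qed.
Lemma b4 : bo (fun n => rho n 4) g1. Proof. by exists k => n; rewrite /= muln1. Qed.
Lemma b7 : bo (fun n => rho n 7) gY. Proof. by exists C1 => n; rewrite /gY /= /Tn leq_mul2l leqnSn orbT. Qed.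
Lemma b8 : bo (fun n => rho n 8) gY. Proof. by exists ra => n; rewrite /gY /= leq_mul2l leqnSn orbT. Qed.
Lemma b9 : bo (fun n => rho n 9) gZ. Proof. by exists 1 => n; rewrite mul1n /gZ /=. Qed.

Lemma gm1 f n : gm f g1 n <= 4 * f n. Proof. by rewrite /gm muln1; lia. Qed.
Lemma gml f g n : pos g -> f n <= 4 * gm f g n.
Proof. by move=> pg; rewrite /gm mulnCA leq_pmulr // muln_gt0 pg. Qed.
Lemma g1l g n : pos g -> g1 n <= 4 * g n. Proof. by move=> pg; rewrite /g1 muln_gt0 pg. Qed.

Lemma bo_kf x c : bo (co c) g1 -> bo (co (CFor x 4 c)) g1.
Proof. by move=> h; apply: bo_mono (bo_for (f := g1) _ _ b4 h) _ => // n; exact: gm1. Qed.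
Lemma bo_up c g : pos g -> bo (co c) g1 -> bo (co c) g.
Proof. by move=> pg h; apply: bo_mono h _ => n; exact: g1l. Qed.
Lemma bo_nf x c : bo (co c) g1 -> bo (co (CFor x 2 c)) gX.
Proof. by move=> h; apply: bo_mono (bo_for (f := gX) _ _ b2 h) _ => // n; exact: gm1. Qed.
Lemma bo_mf x c : bo (co c) g1 -> bo (co (CFor x 3 c)) gX.
Proof. by move=> h; apply: bo_mono (bo_for (f := gX) _ _ b3 h) _ => // n; exact: gm1. Qed.

Lemma bo_clr : bo (co clr) gX. Proof. by apply: bo_nf; apply: bo_nl. Qed.
Lemma bo_mkc x : bo (co (mkc_ x)) g1. Proof. by apply: bo_kf; apply: bo_nl. Qed.
Lemma bo_cntc x : bo (co (cntc x)) g1.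
Proof. by apply: bo_seq; [apply: bo_nl|apply: bo_kf; apply: bo_nl]. Qed.
Lemma bo_rnd um a b : bo (co (rnd um a b)) gX.
Proof.
apply: bo_seq; first by apply: bo_nf; apply: bo_nl.
apply: bo_mf; apply: bo_seq; first exact: bo_nl.
apply: bo_seq.
  apply: bo_if => //; last exact: bo_nl.
  apply: bo_seq; first by case: um; [exact: bo_cntc|exact: bo_nl].
  by apply: bo_kf; apply: bo_nl.
by apply: bo_if => //; [exact: bo_mkc|exact: bo_nl].
Qed.
Definition gXY := gm gX gY.
Lemma pXY : pos gXY. Proof. exact: pos_m. Qed.
Hint Resolve pXY : core.
Lemma bo_XY c : bo (co c) gX -> bo (co c) gXY.
Proof. by move=> h; apply: bo_mono h _ => n; exact: gml. Qed.
Lemma bo_rch um a b y : bo (fun n => rho n y) gY -> bo (co (rch um a b y)) gXY.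
Proof.
move=> hy; apply: bo_mono (bo_for (f := gY) _ _ hy (bo_rnd um a b)) _ => // n.
by rewrite /gXY /gm mulnC; lia.
Qed.
Lemma bo_swc : bo (co swc) gXY.
Proof.
apply: bo_seq; first by apply: bo_XY; exact: bo_clr.
apply: bo_seq; first exact: bo_nl.
apply: bo_seq; first exact: bo_rch b7.
apply: bo_seq; first exact: bo_nl.
apply: bo_XY; apply: bo_seq.
  apply: bo_mf; apply: bo_if => //; last exact: bo_nl.
  apply: bo_seq; first exact: bo_cntc.
  apply: bo_seq; first exact: bo_nl.
  apply: bo_seq; first exact: bo_nl.
  by apply: bo_seq; [apply: bo_kf; apply: bo_nl|exact: bo_nl].
by apply: bo_if => //; [apply: bo_nf|]; apply: bo_nl.
Qed.
Lemma bo_blk cap tri f g : pos f -> pos g -> bo (fun n => rho n cap) f -> bo (fun n => rho n tri) g ->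
  bo (co (blk cap tri)) (gm g (gm f gXY)).
Proof.
move=> pf pg hf hg; apply: bo_for => //; first exact: pos_m.
have pp : pos (gm f gXY) by exact: pos_m.
apply: bo_seq.
  apply: bo_seq; first exact: bo_nl.
  apply: bo_for => //; apply: bo_up => //; apply: bo_if => //; last exact: bo_nl.
  apply: bo_seq; first exact: bo_nl.
  apply: bo_seq; first exact: bo_cntc.
  by apply: bo_seq; exact: bo_nl.
apply: bo_if => //; last exact: bo_nl.
apply: bo_for => //; apply: bo_if => //; last exact: bo_nl.
apply: bo_seq; first exact: bo_nl.
apply: bo_mono (bo_for (f := g1) (g := gXY) _ _ b4 _) _ => // [|n]; last by rewrite /gm mul1n; lia.
apply: bo_seq; first exact: bo_nl.
apply: bo_if => //; last exact: bo_nl.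
by apply: bo_seq; [exact: bo_nl|exact: bo_swc].
Qed.

Definition gF := gm gXY gXY.
Lemma pF : pos gF. Proof. exact: pos_m. Qed.
Hint Resolve pF : core.
Lemma bo_F c : bo (co c) gXY -> bo (co c) gF.
Proof. by move=> h; apply: bo_mono h _ => n; exact: gml. Qed.

(** The loops over components and over attempts, of length about [sqrt n] each, together cost one
    factor [n]. *)
Lemma gZZ n : gZ n * gZ n <= 4 * gX n.
Proof. by rewrite /gZ /gX; have := sqi_sq n n; have := sqi_le n n; rewrite -/(sqf n); nia. Qed.

Lemma bo_Main : bo (co Main) gF.
Proof.
apply: bo_seq; first by apply: bo_F; apply: bo_XY; apply: bo_nf; apply: bo_nl.
apply: bo_seq.
  apply: bo_mono (bo_for (f := gX) (g := gXY) _ _ b3 _) _ => // [|n]; last first.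
    apply: leq_trans (leq_mul (leq_pmulr (gX n) (pY n)) (leqnn (gXY n))) _.
    by rewrite /gF /gXY /gm; lia.
  apply: bo_seq; first exact: bo_nl.
  apply: bo_mono (bo_for (f := g1) (g := gXY) _ _ b4 _) _ => // [|n]; last by rewrite /gm mul1n; lia.
  apply: bo_seq; first by apply: bo_XY; exact: bo_clr.
  apply: bo_seq; first exact: bo_nl.
  apply: bo_seq; first exact: bo_rch b8.
  by apply: bo_up => //; apply: bo_kf; apply: bo_nl.
apply: bo_seq.
  apply: bo_F; apply: bo_XY; apply: bo_seq; first exact: bo_nl.
  by apply: bo_mf; apply: bo_nl.
apply: bo_seq.
  apply: bo_mono (bo_for (f := gX) (g := gm gY (gm g1 gXY)) _ _ b3 _) _ => // [|n]; last by rewrite /gF /gXY /gm /g1; lia.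
    apply: bo_if => //; last exact: bo_nl.
    have pp : pos (gm gY (gm g1 gXY)) by apply: pos_m => //; apply: pos_m.
    apply: bo_seq; first exact: bo_nl.
    apply: bo_seq; first exact: bo_nl.
    by apply: bo_seq; [exact: bo_blk b1 b7|exact: bo_nl].
apply: bo_seq; last by apply: bo_F; apply: bo_XY; apply: bo_nf; apply: bo_nl.
have pp : pos (gm gZ (gm gY gXY)) by apply: pos_m => //; apply: pos_m.
have up c : bo (co c) gXY -> bo (co c) (gm gZ (gm gY gXY)).
  move=> h; apply: bo_mono h _ => n; by rewrite /gm 2!mulnA; apply: leq_pmull; rewrite !muln_gt0.
apply: bo_mono (bo_for (f := gZ) (g := gm gZ (gm gY gXY)) _ _ b9 _) _ => // [|n]; last first.
  rewrite /gm /gF /gm mulnA; apply: leq_trans (leq_mul (gZZ n) (leqnn _)) _.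
  by rewrite /gXY /gm; lia.
apply: bo_if => //; last exact: bo_nl.
apply: bo_seq; first exact: bo_nl.
apply: bo_if => //; last exact: bo_nl.
apply: bo_seq; first by apply: up; apply: bo_XY; exact: bo_clr.
apply: bo_seq; first by apply: up; apply: bo_up => //; exact: bo_mkc.
apply: bo_seq; first by apply: up; exact: bo_rch b7.
apply: bo_seq; first exact: bo_nl.
apply: bo_seq.
  apply: up; apply: bo_XY; apply: bo_mf; apply: bo_if => //; last exact: bo_nl.
  apply: bo_if => //; last exact: bo_nl.
  apply: bo_seq; first exact: bo_nl.
  by apply: bo_seq; [apply: bo_kf; apply: bo_nl|exact: bo_nl].
apply: bo_seq; first exact: bo_blk b7 b9.
apply: up; apply: bo_mono (bo_for (f := gY) (g := g1) _ _ b7 _) _ => // [|n]; first exact: bo_nl.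
apply: leq_trans (gm1 gY n) _; apply: leq_mul => //; exact: leq_pmull (pX n).
Qed.

Lemma bo_Tt : bo time_bound gF.
Proof.
apply: bo_add; first exact: bo_cst.
apply: bo_add; first exact: bo_nl.
apply: bo_add; last exact: bo_Main.
apply: bo_F; apply: bo_XY; apply: bo_seq; first by apply: bo_nf; apply: bo_nl.
apply: bo_seq; first exact: bo_nl.
by apply: bo_seq; [exact: bo_nl|apply: bo_nf; apply: bo_nl].
Qed.

End Program.
End RunningTime.

(** * Bad events in the planted model *)

Module PlantedEvents.
Import Explore Steps SwitchConf ShortCycle OccProb ClauseCount Weights Resign CoinTree Switching Moments.
Local Open Scope ring_scope.

Definition cycc n k l : seq (step_pred (clause n k)) := rcons (nseq l (sP (@Vc n k))) (sT (@Vc n k)).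

Section MapOcc.
Variables (n k m : nat) (F : formula n k m) (s : assignment n).
Let tn := @tnth m (clause n k) F.
Let V := @Vc n k.
Let um := @umc n k s.
Let VI := VF F.
Let uI := umF F s.

(** The combinatorial part speaks of indices in a fixed formula, the counting part of clauses;
    [tnth F] translates between them. *)
Definition rl (A : step_pred 'I_m) (B : step_pred (clause n k)) :=
  forall p e, A p e = B (map tn p) (tn e).
Fixpoint rls As Bs : Prop :=
  match As, Bs with
  | [::], [::] => True | A :: As', B :: Bs' => rl A B /\ rls As' Bs' | _, _ => False
  end.

Lemma rls_cat As Bs As' Bs' : rls As Bs -> rls As' Bs' -> rls (As ++ As') (Bs ++ Bs').
Proof. by elim: As Bs => [|A As IH] [|B Bs] //= [h1 h2] h; split=> //; apply: IH. Qed.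
Lemma rls_nseq l A B : rl A B -> rls (nseq l A) (nseq l B).
Proof. by move=> h; elim: l => //= l IH; split. Qed.
Lemma rls_occ As Bs p t : rls As Bs -> occ As p t = occF Bs F p t.
Proof.
elim: As Bs p t => [|A As IH] [|B Bs] p [|e t] //= [h1 h2].
by rewrite h1 (IH _ _ _ h2).
Qed.

Lemma Vs_map p : Vs V (map tn p) = Vs VI p. Proof. by rewrite /Vs big_map. Qed.
Lemma lastV_map p : lastV V (map tn p) = lastV VI p.
Proof. by case: p => //= e p; rewrite last_map. Qed.
Lemma lastum_map p : lastum um (map tn p) = lastum uI p.
Proof. by apply/funext => y; case: p => //= e p; rewrite last_map. Qed.

Lemma rF0 : rl (sF0 VI uI) (sF0 V um). Proof. by move=> p e; rewrite /sF0 Vs_map. Qed.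
Lemma rF : rl (sF VI uI) (sF V um). Proof. by move=> p e; rewrite /sF lastV_map lastum_map. Qed.
Lemma rN0 : rl (sN0 VI) (sN0 V). Proof. by move=> p e; rewrite /sN0 Vs_map. Qed.
Lemma rP : rl (sP VI) (sP V). Proof. by move=> p e; rewrite /sP lastV_map. Qed.
Lemma rB0 : rl (sB0 VI uI) (sB0 V um). Proof. by move=> p e; rewrite /sB0 lastV_map. Qed.
Lemma rB : rl (sB VI uI) (sB V um). Proof. by move=> p e; rewrite /sB lastum_map. Qed.
Lemma rT : rl (sT VI) (sT V). Proof. by move=> p e; rewrite /sT Vs_map. Qed.

Lemma rls_rcons As Bs A B : rls As Bs -> rl A B -> rls (rcons As A) (rcons Bs B).
Proof. by move=> h1 h2; rewrite -!cats1; apply: rls_cat. Qed.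
Lemma rls_fw a : rls (fw VI uI a) (fw V um a).
Proof. by case: a => //= a; split; [exact: rF0|apply: rls_nseq; exact: rF]. Qed.
Lemma rls_bw a : rls (bw VI uI a) (bw V um a).
Proof. by case: a => //= a; split; [exact: rB0|apply: rls_nseq; exact: rB]. Qed.
Lemma rls_conf a ob : rls (conf VI uI a ob) (conf V um a ob).
Proof.
case: ob => [b|]; last by apply: rls_rcons; [exact: rls_fw|exact: rT].
apply: rls_cat; last by apply: rls_rcons; [exact: rls_bw|exact: rT].
by case: a => [|a]; [split; [exact: rN0|]|apply: rls_rcons; [exact: rls_fw|exact: rP]].
Qed.
Lemma rls_cyc l : rls (cyc_steps VI l) (cycc n k l).
Proof. by apply: rls_rcons; [apply: rls_nseq; exact: rP|exact: rT]. Qed.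
Lemma rls_pret l : rls (plainret VI l) (plainret V l).
Proof.
case: l => [|[|l]] /=; [by split; [exact: rT|]|by split; [exact: rT|]|].
by split; [exact: rN0|apply: rls_rcons; [apply: rls_nseq; exact: rP|exact: rT]].
Qed.

Definition EvF (Bs : seq (step_pred (clause n k))) (e : 'I_m) (G : formula n k m) :=
  [exists t : (size Bs).-tuple 'I_m, occF Bs G [:: e] t].

Lemma EvF_occ As Bs e t : rls As Bs -> occ As [:: e] t -> EvF Bs e F.
Proof.
move=> h; rewrite (rls_occ _ _ h) => o; have /eqP sz := occF_size o.
by apply/existsP; exists (Tuple sz).
Qed.

End MapOcc.

Section Bounds.
Variables (R : realType) (n k m T r : nat).
Hypotheses (n2 : (2 <= n)%N) (k3 : (2 < k)%N) (rT : (r < T)%N).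
Variables (D lam : R).
Hypotheses (D1 : 1 <= D) (DE : m%:R * x1 R n k <= D) (lam0 : 0 < lam) (lam1 : lam <= 1)
  (lamE : m%:R * xl R n k <= lam).
Implicit Types (F : formula n k m) (s : assignment n).

Let w (als : seq R) := \prod_(al <- als) (m%:R * al).
(** Room for the clause [e], a prefix of at most [T] clauses, two branches of at most [T] clauses
    each, and the junction and closing clauses. *)
Definition Zb := (3 * T + 4)%N.
Let wTz := wT n k D Zb.
(** The first summand is for a cluster still growing after [T] rounds; the second for a closed
    configuration of cost at least [r], over all choices of the two lengths. *)
Definition bad_weight : R := D * Zb%:R / lam * lam ^+ T.+1 +
  (T.+1 * T.+2)%:R * (D ^+ 3 * Zb%:R ^+ 2 / lam ^+ 2 * lam ^+ r * wT n k D Zb).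
Let cn s (P : pred (formula n k m)) : R := cnt R (okc s) P.

Lemma wT0 : 0 <= wTz. Proof. exact: wT_ge0. Qed.

Lemma EvF_bound s Bs als e : bounded_by (okc s) 1 Bs als ->
  cn s (EvF Bs e) <= w als * cn s xpredT.
Proof. by move=> b; apply: (@occ_prob R _ (okc s) m Bs als [:: e]). Qed.

(** [P0] describes the block itself: it is empty for a single clause and a cycle for a component. *)
Definition Bad P0 s (e : 'I_m) F :=
  EvF (P0 ++ fw (@Vc n k) (umc s) T.+1) e F ||
  [exists l : 'I_T.+1, exists ob : option 'I_T.+1, (r <= confcost l (omap val ob))%N &&
    EvF (P0 ++ conf (@Vc n k) (umc s) l (omap val ob)) e F].

Lemma orR (a b : bool) : (a || b)%:R <= a%:R + b%:R :> R.
Proof. by case: a; case: b; rewrite /= ?addr0 ?add0r // lerDl. Qed.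
Lemma existsR (I : finType) (P : pred I) : [exists i, P i]%:R <= \sum_i (P i)%:R :> R.
Proof.
case: existsP => [[i Pi]|_]; last exact: sumr_ge0.
by rewrite (bigD1 i) //= Pi lerDl sumr_ge0.
Qed.

Lemma cn_exists (I : finType) s (P : I -> pred (formula n k m)) :
  cn s (fun F => [exists i, P i F]) <= \sum_i cn s (P i).
Proof. by rewrite /cn /cnt exchange_big /=; apply: ler_sum => F _; exact: existsR. Qed.

Lemma cn_sub s (P Q : pred (formula n k m)) : (forall F, proper_formula F -> P F -> Q F) ->
  cn s P <= cn s Q.
Proof.
move=> h; apply: ler_sum => F CF; have Fp : proper_formula F.
  by apply: sub_all CF => c /andP[].
by case: (boolP (P F)) => [/(h _ Fp) ->|_]; rewrite ?ler0n.
Qed.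

Lemma cn_ge0 s P : 0 <= cn s P. Proof. exact: cnt_ge0. Qed.

Lemma Bad_bound P0 a0 om s e : bounded_by (okc s) 1 P0 a0 -> 0 <= w a0 <= om -> (size P0 <= T)%N ->
  cn s (Bad P0 s e) <= om * bad_weight * cn s xpredT.
Proof.
move=> b0 /andP[w0 wom] sP; have om0 : 0 <= om by apply: le_trans wom.
set tot := cn s xpredT; have tot0 : 0 <= tot by exact: cn_ge0.
have wap a b : w (a ++ b) = w a * w b by exact: big_cat.
apply: (@le_trans _ _ (cn s (EvF (P0 ++ fw (@Vc n k) (umc s) T.+1) e) +
   \sum_(l : 'I_T.+1) \sum_(ob : option 'I_T.+1) cn s (fun F => (r <= confcost l (omap val ob))%N &&
    EvF (P0 ++ conf (@Vc n k) (umc s) l (omap val ob)) e F))).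
  apply: (@le_trans _ _ (cn s (EvF (P0 ++ fw (@Vc n k) (umc s) T.+1) e) +
     cn s (fun F => [exists l : 'I_T.+1, exists ob : option 'I_T.+1, (r <= confcost l (omap val ob))%N &&
       EvF (P0 ++ conf (@Vc n k) (umc s) l (omap val ob)) e F]))).
    by rewrite /cn /cnt -big_split /=; apply: ler_sum => F _; exact: orR.
  rewrite lerD2l; apply: le_trans (cn_exists _ _) _; apply: ler_sum => l _; exact: cn_exists.
have hz : (1 + size P0 <= Zb)%N by rewrite /Zb; move: sP; clear; lia.
have Z0 : (0 < Zb)%N by rewrite /Zb addnC.
have hfw := @w_fw R n k m k3 D lam D1 DE lam0 lam1 lamE (1 + size P0) Zb T.+1 hz Z0.
rewrite /bad_weight mulrDr mulrDl; apply: lerD.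
  apply: le_trans (EvF_bound e (bounded_cat b0 (bd_fw R s n2 k3 _ _))) _ => //.
  apply: ler_wpM2r => //; rewrite wap; apply: ler_pM => //.
    by have /andP[] := hfw.
  by have /andP[] := hfw.
set be := (_ * _ * wT n k D Zb).
have be0 : 0 <= be.
  rewrite /be !mulr_ge0 ?invr_ge0 ?exprn_ge0 ?wT0 ?(ltW lam0) //; exact: le_trans D1.
apply: (@le_trans _ _ (\sum_(l : 'I_T.+1) \sum_(ob : option 'I_T.+1) om * be * tot)).
  apply: ler_sum => l _; apply: ler_sum => ob _.
  case: (leqP r (confcost l (omap val ob))) => rc /=; last first.
    by rewrite /cn /cnt big1 //; exact: mulr_ge0 (mulr_ge0 om0 be0) tot0.
  apply: le_trans (EvF_bound e (bounded_cat b0 (bd_conf R s n2 k3 _ _ _))) _ => //.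
  apply: ler_wpM2r => //; rewrite wap; apply: ler_pM => //.
    by apply: w_ge0 (bd_conf R s n2 k3 _ _ _).
  have lT := ltn_ord l.
  have obT : (odflt 0 (omap val ob) <= T)%N by case: ob {rc} => //= b; rewrite -ltnS ltn_ord.
  apply: le_trans (@w_conf R n k m n2 k3 D lam D1 DE lam0 lam1 lamE (1 + size P0) Zb l (omap val ob) _) _.
    by rewrite /Zb; move: lT obT sP; clear; lia.
  rewrite /be; apply: ler_wpM2r; first exact: wT0.
  apply: ler_wpM2l; last by apply: ler_wiXn2l => //; apply: ltW.
  by rewrite !mulr_ge0 ?invr_ge0 ?exprn_ge0 ?(ltW lam0) //; exact: le_trans D1.
rewrite !sumr_const card_option !card_ord -mulrnA -[leLHS]mulr_natl mulnC; apply: ler_of_eqA; ring.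
Qed.

Definition bicb F := `[< exists e, bicyclic (VF F) r e >].

Lemma cyc_w l : (l < r)%N -> 0 <= w (cyca R n k 1 l) <= D ^+ r * wTz.
Proof.
move=> lr; have lZ : (1 + l <= Zb)%N by rewrite /Zb; move: lr rT; clear; lia.
have /andP[h1 h2] := @w_cyc R n k m n2 k3 D D1 DE 1 Zb l lZ.
apply/andP; split=> //; apply: le_trans h2 _.
by apply: ler_wpM2r; [exact: wT0|apply: ler_weXn2l => //; exact: ltnW].
Qed.

Lemma pret_w l j : (l < r)%N -> (j <= r)%N -> 0 <= w (preta R n k (1 + l.+1) j.+1) <= D * Zb%:R * D ^+ r.+1 * wTz.
Proof.
move=> lr jr; have lZ : (1 + l.+1 + j.+1 <= Zb)%N by rewrite /Zb; move: lr jr rT; clear; lia.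
have Z0 : (0 < Zb)%N by rewrite /Zb addnC.
have /andP[h1 h2] := @w_pret R n k m n2 k3 D D1 DE (1 + l.+1) Zb j.+1 lZ Z0.
apply/andP; split=> //; apply: le_trans h2 _.
apply: ler_wpM2r; first exact: wT0.
apply: ler_wpM2l; last exact: ler_weXn2l.
by rewrite mulr_ge0 //; exact: le_trans D1.
Qed.

Lemma size_cycc l : size (cycc n k l) = l.+1.
Proof. by rewrite size_rcons size_nseq. Qed.

Lemma sum_ord_le (p : nat) (f : 'I_p -> R) c : (forall i, f i <= c) -> \sum_i f i <= p%:R * c.
Proof.
move=> h; apply: le_trans (ler_sum _ (fun i _ => h i)) _.
by rewrite sumr_const card_ord mulr_natl.
Qed.

(** Two closing steps give two factors [wT] of order [1 / n], against one free choice among [m]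
    clauses. *)
Lemma bic_bound s : cn s bicb <=
  m%:R * (r%:R * (r.+1%:R * (D ^+ r * wTz * (D * Zb%:R * D ^+ r.+1 * wTz) * cn s xpredT))).
Proof.
pose P (e : 'I_m) (l : 'I_r) (j : 'I_r.+1) := EvF (cycc n k l ++ plainret (@Vc n k) j.+1) e.
apply: (@le_trans _ _ (cn s (fun F => [exists e, exists l, exists j, P e l j F]))).
  apply: cn_sub => F _ /asboolP[e [l [Q [j [t [lr jr oQ ot]]]]]].
  apply/existsP; exists e; apply/existsP; exists (Ordinal lr); apply/existsP.
  exists (Ordinal (jr : (j < r.+1)%N)); apply: (@EvF_occ n k m F (cyc_steps (VF F) l ++ plainret (VF F) j.+1) _ _ (Q ++ t)).
    by apply: rls_cat; [exact: rls_cyc|exact: rls_pret].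
  by rewrite occ_cat ?(occ_size oQ) // oQ.
apply: le_trans (cn_exists _ _) _; apply: sum_ord_le => e.
apply: le_trans (cn_exists _ _) _; apply: sum_ord_le => l.
apply: le_trans (cn_exists _ _) _; apply: sum_ord_le => j.
have bb := bounded_cat (bd_cyc R s n2 k3 1 l) (bd_pret R s n2 k3 (1 + size (cycc n k l)) j.+1).
apply: le_trans (EvF_bound e bb) _.
apply: ler_wpM2r; first exact: cn_ge0.
rewrite /w big_cat /= size_cycc.
have /andP[a1 a2] := cyc_w (ltn_ord l).
have jr : (j <= r)%N by rewrite -ltnS ltn_ord.
have /andP[c1 c2] := pret_w (ltn_ord l) jr.
exact: ler_pM.
Qed.

Definition G0nb (e : 'I_m) F := (e \in shortcyc (VF F) r) && ~~ bicb F.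

Lemma nbicP F : ~~ bicb F -> forall e, ~ bicyclic (VF F) r e.
Proof. by move=> /asboolPn h e b; apply: h; exists e. Qed.

Lemma cyc_exists s (Q : 'I_r -> pred (formula n k m)) (P : pred (formula n k m)) (b : R) : 0 <= b ->
  (forall F, proper_formula F -> P F -> exists l, Q l F) -> (forall l, cn s (Q l) <= b) -> cn s P <= r%:R * b.
Proof.
move=> b0 h hb; apply: (@le_trans _ _ (cn s (fun F => [exists l, Q l F]))).
  by apply: cn_sub => F Fp /(h F Fp)[l Ql]; apply/existsP; exists l.
by apply: le_trans (cn_exists _ _) _; apply: sum_ord_le.
Qed.

Lemma G0nb_bound s e : cn s (G0nb e) <= r%:R * (D ^+ r * wTz * cn s xpredT).
Proof.
apply: (@cyc_exists s (fun l => EvF (cycc n k l) e)).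
- by rewrite !mulr_ge0 ?cn_ge0 ?wT0 ?exprn_ge0 // (le_trans _ D1).
- move=> F _ /andP[eG /nbicP nb].
  have [l [Q [lr oQ _ _ _]]] := comp_cycle rT nb eG.
  exists (Ordinal lr); apply: (@EvF_occ n k m F (cyc_steps (VF F) l) _ _ Q) => //; exact: rls_cyc.
move=> l; apply: le_trans (EvF_bound e (bd_cyc R s n2 k3 1 l)) _.
apply: ler_wpM2r; first exact: cn_ge0.
by have /andP[] := cyc_w (ltn_ord l).
Qed.

Definition Bad1 s e F := [exists l : 'I_r, Bad (cycc n k l) s e F].

Lemma Bad0_bound s e : cn s (Bad [::] s e) <= bad_weight * cn s xpredT.
Proof.
rewrite -[bad_weight]mul1r; apply: (@Bad_bound [::] [::]) => //.
by rewrite /w big_nil lexx ler01.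
Qed.

(** Closing the cycle of the component contributes a further factor of order [1 / n], which
    outweighs the [sqrt n] attempts made on it. *)
Lemma Bad1_bound s e : cn s (Bad1 s e) <= r%:R * (D ^+ r * wTz * bad_weight) * cn s xpredT.
Proof.
apply: le_trans (cn_exists _ _) _; rewrite -mulrA; apply: sum_ord_le => l.
apply: Bad_bound (bd_cyc R s n2 k3 1 l) (cyc_w (ltn_ord l)) _.
by rewrite -/(cycc n k l) size_cycc; apply: leq_trans (ltn_ord l) (ltnW rT).
Qed.

End Bounds.
End PlantedEvents.

(** * Transfer from the planted to the uniform model *)

Module Planted.
Import Explore Steps SwitchConf OccProb ClauseCount Resign CoinTree Switching Moments LowerTail.
Local Open Scope ring_scope.

Section Planted.
Variables (R : realType) (n k m : nat).
Hypothesis (k3 : (2 < k)%N).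
Let k2 : (2 <= k)%N := ltnW k3.
Implicit Types (s : assignment n) (F : formula n k m).
Let rr := Resign.rho R k.
Let NP := Np R n k ^+ m.

Lemma cnt_sat s (P : pred (formula n k m)) :
  cnt R (okc s) P = \sum_(F | proper_formula F) (nae_sat F s)%:R * (P F)%:R.
Proof.
rewrite /cnt (eq_bigl (fun F => proper_formula F && nae_sat F s)); last first.
  by move=> F; rewrite nae_satE -all_predI.
rewrite big_mkcondr /=; apply: eq_bigr => F _; by case: nae_sat; rewrite ?mul1r ?mul0r.
Qed.

Lemma rr_gt0 : 0 < rr.
Proof.
rewrite /rr rho_q // subr_gt0 invf_lt1 ?exprn_gt0 // exprn_egt1 ?ltr1n //.
by move: k3; case: (k) => [|[|]].
Qed.

Lemma resign_sum0 s (g : formula n k m -> R) : (forall F e xi, g (resign F e xi) = g F) ->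
  \sum_(F | proper_formula F) (nae_sat F s)%:R * g F = rr ^+ m * \sum_(F | proper_formula F) g F.
Proof.
move=> gr; rewrite (@resign_sum R n k m s (fun _ => finset.set0)) //.
rewrite mulr_sumr; apply: eq_bigr => F _; rewrite cards0 subn0.
have -> : nae_on finset.set0 F s by apply/forallP => e; rewrite inE.
by rewrite mul1r.
Qed.

Lemma sum_proper : \sum_(F : formula n k m | proper_formula F) 1 = NP :> R.
Proof. exact: card_P. Qed.

Lemma cnt_tot s : cnt R (okc s) (fun _ : formula n k m => true) = rr ^+ m * NP.
Proof.
by rewrite cnt_sat (@resign_sum0 s (fun _ => 1)) // sum_proper.
Qed.

(** An event that sees no signs has the same probability in the planted and in the uniform model, so
    its bound is carried over without loss. *)
Lemma V_event s (E : pred (formula n k m)) (b : R) : (forall F e xi, E (resign F e xi) = E F) ->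
  cnt R (okc s) E <= b * cnt R (okc s) (fun _ : formula n k m => true) ->
  \sum_(F | proper_formula F) (E F)%:R <= b * NP.
Proof.
move=> Er; rewrite cnt_tot cnt_sat resign_sum0; last by move=> F e xi; rewrite Er.
by rewrite mulrCA ler_pM2l // exprn_gt0 ?rr_gt0.
Qed.

Definition ZK (K : {set 'I_m}) F : R := \sum_s (nae_on K F s)%:R.

Lemma ZK_card K F : ZK K F = #|nae_on K F|%:R.
Proof.
rewrite /ZK -natr_sum; congr _%:R; rewrite -sum1_card [RHS]big_mkcond /=.
by apply: eq_bigr => s _; rewrite -[s \in _]/(nae_on K F s); case: (nae_on K F s).
Qed.

Lemma ZrE F : Zr R F = \sum_s (nae_sat F s)%:R.
Proof. by apply: eq_bigr => s _; rewrite nae_satE. Qed.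

Lemma sum_Zr (K : formula n k m -> {set 'I_m}) (h : formula n k m -> R) :
  (forall F e xi, K (resign F e xi) = K F) ->
  (forall F e xi, e \notin K F -> h (resign F e xi) = h F) ->
  \sum_(F | proper_formula F) Zr R F * h F =
  \sum_(F | proper_formula F) ZK (K F) F * rr ^+ (m - #|K F|) * h F.
Proof.
move=> Kr hr.
transitivity (\sum_s \sum_(F : formula n k m | proper_formula F) (nae_sat F s)%:R * h F).
  rewrite exchange_big /=; apply: eq_bigr => F _; by rewrite ZrE mulr_suml.
rewrite (eq_bigr _ (fun s _ => @resign_sum R n k m s K h Kr hr)) exchange_big /=.
by apply: eq_bigr => F _; rewrite /ZK !mulr_suml.
Qed.

Lemma EZE i : EZ R n k i = 2 ^+ n * rr ^+ i.
Proof. by rewrite /EZ /rr rho_q. Qed.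

Lemma ind_Mr (a : R) F : 0 < a -> (a <= Mr R F)%R%:R <= a^-1 * (EZ R n k m)^-1 * Zr R F :> R.
Proof.
move=> a0; have E0 : 0 < EZ R n k m by rewrite EZE mulr_gt0 ?exprn_gt0 ?rr_gt0.
have Z0 : 0 <= Zr R F by apply: sumr_ge0.
have ME : Mr R F = Zr R F / EZ R n k m by rewrite /Mr size_tuple.
case: (boolP (a <= Mr R F)%R) => [h|_]; last first.
  by apply: mulr_ge0 => //; apply: mulr_ge0; rewrite invr_ge0 ltW.
by rewrite -mulrA ler_pdivlMl // mulr1 mulrC -ME.
Qed.

Lemma Mr_sum (a : R) (h : formula n k m -> R) : 0 < a -> (forall F, 0 <= h F) ->
  \sum_(F | proper_formula F) (a <= Mr R F)%R%:R * h F <=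
  a^-1 * (EZ R n k m)^-1 * \sum_(F | proper_formula F) Zr R F * h F.
Proof.
move=> a0 h0; rewrite mulr_sumr; apply: ler_sum => F _; rewrite mulrA.
by apply: ler_wpM2r => //; exact: ind_Mr.
Qed.

(* Weighting a uniform formula by [Zr] plants a uniform assignment; on the event
   [a <= Mr R F] this reweighting costs at most the factor [a^-1]. *)
Lemma planted (K : formula n k m -> {set 'I_m}) (bad : assignment n -> pred (formula n k m)) (a b : R) :
  0 < a ->
  (forall F e xi, K (resign F e xi) = K F) ->
  (forall s F e xi, e \notin K F -> bad s (resign F e xi) = bad s F) ->
  (forall s, cnt R (okc s) (bad s) <= b * cnt R (okc s) (fun _ : formula n k m => true)) ->
  \sum_(F | proper_formula F) (a <= Mr R F)%R%:R *
     ((\sum_(s | nae_on (K F) F s) (bad s F)%:R) / #|nae_on (K F) F|%:R) <= a^-1 * b * NP.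
Proof.
move=> a0 Kr br hb; set h := fun F : formula n k m => (\sum_(s | nae_on (K F) F s) (bad s F)%:R) / #|nae_on (K F) F|%:R : R.
have h0 F : 0 <= h F by rewrite /h mulr_ge0 ?invr_ge0 ?sumr_ge0.
have E0 : 0 < EZ R n k m by rewrite EZE mulr_gt0 ?exprn_gt0 ?rr_gt0.
have nr s F e xi : e \notin K F -> nae_on (K F) (resign F e xi) s = nae_on (K F) F s.
  move=> eK; apply: eq_forallb => i; case: (boolP (i \in K F)) => //= iK.
  by rewrite tnth_upd; case: eqP => // ie; move: eK; rewrite -ie iK.
have hr F e xi : e \notin K F -> h (resign F e xi) = h F.
  move=> eK; rewrite /h Kr; congr (_ / _%:R).
    by apply: eq_big => [s|s _]; [exact: nr|rewrite br].
  by apply: eq_card => s; exact: nr.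
apply: le_trans (Mr_sum a0 h0) _.
rewrite (sum_Zr Kr hr).
have -> : \sum_(F | proper_formula F) ZK (K F) F * rr ^+ (m - #|K F|) * h F =
   \sum_s cnt R (okc s) (bad s).
  transitivity (\sum_(F : formula n k m | proper_formula F) \sum_s (nae_on (K F) F s)%:R * rr ^+ (m - #|K F|) * (bad s F)%:R).
    apply: eq_bigr => F _; rewrite /h ZK_card.
    have sE : \sum_(s | nae_on (K F) F s) (bad s F)%:R = \sum_s (nae_on (K F) F s)%:R * (bad s F)%:R :> R.
      by rewrite big_mkcond /=; apply: eq_bigr => s _; case: nae_on; rewrite ?mul1r ?mul0r.
    have [Z|Z] := eqVneq (#|nae_on (K F) F|%:R : R) 0.
      rewrite Z !mul0r; apply/esym/big1 => s _; have /card0_eq/(_ s) : #|nae_on (K F) F| = 0%N.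
        by apply/eqP; rewrite -(pnatr_eq0 R) Z.
      by move=> hs; have -> : nae_on (K F) F s = false by []; rewrite !mul0r.
    rewrite [LHS](_ : _ = rr ^+ (m - #|K F|) * \sum_(s | nae_on (K F) F s) (bad s F)%:R); last by field.
    by rewrite sE mulr_sumr; apply: eq_bigr => s _; ring.
  rewrite exchange_big /=; apply: eq_bigr => s _; rewrite cnt_sat.
  by rewrite (@resign_sum R n k m s K (fun F => (bad s F)%:R)) // => F e xi eK; rewrite br.
apply: (@le_trans _ _ (a^-1 / EZ R n k m * \sum_(s : assignment n) b * (rr ^+ m * NP))).
  apply: ler_wpM2l; first by rewrite mulr_ge0 ?invr_ge0 ?ltW.
  by apply: ler_sum => s _; rewrite -(cnt_tot s); exact: hb.
rewrite sumr_const card_ffun card_bool card_ord EZE -[X in _ * X]mulr_natr natrX.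
have := rr_gt0; rewrite lt0r => /andP[/(expf_neq0 m) r0 _].
have p2 : (2 ^+ n : R) != 0 by rewrite expf_neq0.
by apply: ler_of_eqA; field; rewrite p2 r0 gt_eqF.
Qed.

(** [L] implies that the clauses of [K F] have few solutions. Weighting by [Zr] therefore makes it
    rare by a factor [eta], while each of the at most [i] clauses of [K F], whose signs are not
    averaged, costs a factor [rr^-1]. *)
Lemma low_event (K : formula n k m -> {set 'I_m}) (E L : pred (formula n k m)) (a b eta : R) (i : nat) s :
  0 < a -> 0 <= eta ->
  (forall F e xi, K (resign F e xi) = K F) ->
  (forall F e xi, E (resign F e xi) = E F) ->
  (forall F e xi, e \notin K F -> L (resign F e xi) = L F) ->
  (forall F, L F -> E F /\ (#|K F| <= i)%N /\ ZK (K F) F <= 2 ^+ n * eta) ->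
  cnt R (okc s) E <= b * cnt R (okc s) (fun _ : formula n k m => true) ->
  \sum_(F | proper_formula F) (a <= Mr R F)%R%:R * (L F)%:R <= a^-1 * (eta * rr^-1 ^+ i * b) * NP.
Proof.
move=> a0 e0 Kr Er Lr hL hE.
apply: le_trans (Mr_sum a0 _) _ => [F|]; first exact: ler0n.
rewrite (@sum_Zr K) //; last by move=> F e xi eK; rewrite Lr.
have r0 := rr_gt0.
have r1 : rr <= 1 by rewrite /rr rho_q // gerBl invr_ge0 exprn_ge0.
have rm : rr ^+ m != 0 by rewrite expf_neq0 // gt_eqF.
have p2 : (2 ^+ n : R) != 0 by rewrite expf_neq0.
have main : \sum_(F | proper_formula F) ZK (K F) F * rr ^+ (m - #|K F|) * (L F)%:R <=
    2 ^+ n * eta * (rr ^+ m * rr^-1 ^+ i) * \sum_(F : formula n k m | proper_formula F) (E F)%:R.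
  rewrite mulr_sumr; apply: ler_sum => F _; case: (boolP (L F)) => [/hL[EF [Ki Zl]]|_]; last first.
    by rewrite mulr0 !mulr_ge0 ?invr_ge0 ?exprn_ge0 ?invr_ge0 ?(ltW r0).
  rewrite EF !mulr1; apply: ler_pM => //.
  - by apply: sumr_ge0.
  - by rewrite exprn_ge0 // ltW.
  have Km : (#|K F| <= m)%N by have := max_card (mem (K F)); rewrite card_ord.
  rewrite -[in leRHS](subnK Km) exprD -mulrA ler_peMr ?exprn_ge0 ?(ltW r0) //.
  rewrite exprVn -(subnK Ki) exprD invfM mulrCA mulfV ?expf_neq0 ?gt_eqF // mulr1.
  by rewrite invf_ge1 ?exprn_gt0 // exprn_ile1 // ltW.
apply: le_trans (ler_wpM2l _ main) _.
  by rewrite mulr_ge0 ?invr_ge0 ?ltW // EZE mulr_gt0 ?exprn_gt0.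
apply: le_trans (ler_wpM2l _ (ler_wpM2l _ (V_event Er hE))) _.
- by rewrite mulr_ge0 ?invr_ge0 ?ltW // EZE mulr_gt0 ?exprn_gt0.
- by rewrite !mulr_ge0 ?exprn_ge0 ?invr_ge0 ?(ltW r0).
rewrite EZE; apply: ler_of_eqA; field; by rewrite p2 rm gt_eqF // gt_eqF.
Qed.

End Planted.
End Planted.

(** * The schedule depends on the variables of the clauses only *)

Module Schedule.
Import Explore Steps SwitchConf ShortCycle OccProb ClauseCount Weights Resign CoinTree Switching Moments LowerTail Refinement PlantedEvents Planted.
Local Open Scope ring_scope.

Section VOnly.
Variables (n k m : nat).
Implicit Types (s : assignment n) (F : formula n k m) (A : {set 'I_m}).

Lemma tnth_resign F e xi i :
  tnth (resign F e xi) i = if i == e then flipc (tnth F e) xi else tnth F i.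
Proof. exact: tnth_upd. Qed.

Lemma clx_resign F e xi i : clx (tnth (resign F e xi) i) = clx (tnth F i).
Proof. by rewrite tnth_resign; case: eqP => // ->; rewrite clx_flip. Qed.

Lemma VF_resign F e xi : VF (resign F e xi) = VF F.
Proof. by apply/funext => i; rewrite /VF /Vc clx_resign. Qed.

Lemma XB_resign F e xi B : XB (resign F e xi) B = XB F B.
Proof. by rewrite /XB; congr flatten; apply: eq_map => i; rewrite clx_resign. Qed.

Lemma umF_resign F e xi s i : i != e -> umF (resign F e xi) s i = umF F s i.
Proof. by move=> ie; rewrite /umF tnth_resign (negbTE ie). Qed.

Lemma G0_resign F e xi r : G0 (resign F e xi) r = G0 F r.
Proof. by rewrite /G0 VF_resign. Qed.

Lemma bic_resign F e xi r : bicb r (resign F e xi) = bicb r F.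
Proof. by rewrite /bicb VF_resign. Qed.

Lemma badsw_resign F A T (W : {set 'I_n}) e xi x s : e \notin A ->
  badsw (resign F e xi) A T W x s = badsw F A T W x s.
Proof.
move=> eA; have ie i : i \in A -> i != e by move=> iA; apply: contraNneq eA => <-.
have mE : mn (umF (resign F e xi) s) A = mn (umF F s) A.
  by apply/funext => i; apply/funext => y; rewrite /mn; case: (boolP (i \in A)) => //= /ie h; rewrite umF_resign.
have cE : clus (resign F e xi) A T x s = clus F A T x s by rewrite /clus /cluster VF_resign mE.
rewrite /badsw cE; congr (~~ (_ && _)); apply: eq_forallb => i.
case: (boolP (i \in A)) => //= /ie h; rewrite /clause_ok VF_resign.
by congr (_ || _); apply: eq_forallb => y; rewrite umF_resign.
Qed.

Section Sched.
Variables (T r sq : nat).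

(** [A0] and [A1] are the clauses active when the block of [e] is reached, in the first phase and in
    the phase of short cycles; [As0] is the state between the two phases. *)
Definition A0 F (e : 'I_m) := finset.set0 :|: cov (sc (bl0 F T r) finset.set0 e).
Definition As0 F := finset.set0 :|: cov (sc0 F T r).
Definition A1 F (e : 'I_m) := As0 F :|: cov (sc (bl1 F T r sq) (As0 F) (index e (L0s F r sq))).
Definition Bk F (e : 'I_m) := take T (enum (comp (VF F) r T e)).

Lemma bl0_resign F e xi : bl0 (resign F e xi) T r = bl0 F T r.
Proof. by rewrite /bl0 G0_resign. Qed.
Lemma A0_resign F e xi : A0 (resign F e xi) = A0 F.
Proof. by rewrite /A0 bl0_resign. Qed.
Lemma As0_resign F e xi : As0 (resign F e xi) = As0 F.
Proof. by rewrite /As0 /sc0 bl0_resign. Qed.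
Lemma L0s_resign F e xi : L0s (resign F e xi) r sq = L0s F r sq.
Proof. by rewrite /L0s G0_resign. Qed.
Lemma A1_resign F e xi : A1 (resign F e xi) = A1 F.
Proof. by rewrite /A1 As0_resign /bl1 L0s_resign VF_resign. Qed.
Lemma Bk_resign F e xi : Bk (resign F e xi) = Bk F.
Proof. by rewrite /Bk VF_resign. Qed.

Lemma cov_sc (bl : nat -> {set 'I_m} -> seq (seq 'I_m * nat)) A i g : g \in cov (sc bl A i) <->
  exists2 j, (j < i)%N & g \in cov (bl j (A :|: cov (sc bl A j))).
Proof.
elim: i => [|i IH] /=; first by split=> [|[]//]; rewrite inE.
rewrite cov_cat inE; split=> [/orP[/IH[j ji gj]|gi]|[j]].
- by exists j => //; apply: ltnW.
- by exists i.
rewrite ltnS leq_eqVlt => /orP[/eqP-> ->|ji gj]; first by rewrite orbT.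
by apply/orP; left; apply/IH; exists j.
Qed.

Lemma cov_bl0 F (j : nat) A g : g \in cov (bl0 F T r j A) <-> (g \notin G0 F r) && (nat_of_ord g == j).
Proof.
rewrite /bl0; case: insubP => [e _ ej|nj].
  case: ifP => eG.
    split; first by rewrite inE.
    case/andP => gG /eqP gj; move: gG; have -> : g = e by apply: val_inj; rewrite /= ej gj.
    by rewrite eG.
  rewrite cov1; split=> [|/andP[_ /eqP gj]]; rewrite inE mem_seq1.
    by move/eqP->; apply/andP; split; [exact: negbT eG|rewrite -ej].
  by apply/eqP/val_inj; rewrite /= ej gj.
split; first by rewrite inE.
by case/andP => _ /eqP gj; move: nj; rewrite -gj ltn_ord.
Qed.

Lemma As0E F : As0 F = ~: G0 F r.
Proof.
apply/setP => g; rewrite /As0 finset.set0U [RHS]inE; apply/idP/idP => [/cov_sc[j _ /cov_bl0/andP[]]//|gG].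
by apply/cov_sc; exists (nat_of_ord g) => //; apply/cov_bl0; rewrite gG eqxx.
Qed.

Lemma A0E F e g : (g \in A0 F e) = (g \notin G0 F r) && (g < e)%N.
Proof.
rewrite /A0 finset.set0U; apply/idP/idP => [/cov_sc[j je /cov_bl0/andP[-> /eqP gj]]|/andP[gG ge]]; first by rewrite gj.
by apply/cov_sc; exists (nat_of_ord g) => //; apply/cov_bl0; rewrite gG eqxx.
Qed.

Lemma L0s_G0 F e : e \in L0s F r sq -> e \in G0 F r.
Proof. by rewrite /L0s selT => /mem_take; rewrite mem_enum. Qed.
Lemma L0s_all F e : (#|G0 F r| <= sq)%N -> e \in G0 F r -> e \in L0s F r sq.
Proof. by move=> h eG; rewrite /L0s selT take_oversize ?mem_enum // -cardE. Qed.
Lemma L0s_uniq F : uniq (L0s F r sq).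
Proof. by rewrite /L0s selT take_uniq // enum_uniq. Qed.
Lemma L0s_size F : (size (L0s F r sq) <= sq)%N.
Proof. by rewrite /L0s selT size_take; case: ltnP. Qed.

Hypotheses (k0 : (0 < k)%N) (rT : (r < T)%N).

Lemma comp_self F e : e \in G0 F r -> e \in comp (VF F) r T e.
Proof.
move=> eG; rewrite inE eG /=; apply/pred0Pn.
exists (clx (tnth F e) (Ordinal k0)); rewrite /= clx_V; apply: (fintype.subsetP (reach_sub _ _ _ _)); exact: clx_V.
Qed.

Section NB.
Variable F : formula n k m.
Hypothesis nb : ~~ bicb r F.

Lemma comp_small e : e \in G0 F r -> (#|comp (VF F) r T e| <= r.+1)%N.
Proof.
move=> eG; have [l [Q [lr oQ sub _ _]]] := comp_cycle rT (nbicP nb) eG.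
apply: (@leq_trans (size (e :: Q))).
  rewrite cardE; apply: uniq_leq_size; first exact: enum_uniq.
  by move=> g; rewrite mem_enum; apply: sub.
by rewrite /= (occ_size oQ) size_rcons size_nseq ltnS.
Qed.

Lemma Bk_comp e g : e \in G0 F r -> (g \in Bk F e) = (g \in comp (VF F) r T e).
Proof.
move=> eG; rewrite /Bk take_oversize ?mem_enum // -cardE.
exact: leq_trans (comp_small eG) rT.
Qed.

Lemma Bk_size e : e \in G0 F r -> (size (Bk F e) <= r.+1)%N.
Proof.
move=> eG; apply: leq_trans (comp_small eG); rewrite /Bk size_take cardE.
by case: ltnP => // h; apply: ltnW.
Qed.

(** An active clause on the cycle of [e] would have come with an earlier component. Since that
    component would meet the cycle of [e], it would contain [e], which would then be active as
    well. *)
Lemma A1_avoid e : e \in G0 F r -> e \notin A1 F e ->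
  exists l Q, [/\ (l < r)%N, occ (cyc_steps (VF F) l) [:: e] Q, {subset Bk F e <= e :: Q} &
    avoids (e :: Q) (enum (A1 F e))].
Proof.
move=> eG eA; have [l [Q [lr oQ sub QG sep]]] := comp_cycle rT (nbicP nb) eG.
exists l, Q; split=> // [g|g]; first by rewrite Bk_comp //; apply: sub.
rewrite mem_enum => gA; apply/negP => gQ.
move: gA; rewrite inE As0E inE (QG _ gQ) /= => /cov_sc[j ji].
rewrite /bl1; case E: (onth _ j) => [e0|]; last by rewrite inE.
have e0L : e0 \in L0s F r sq by apply/onthP; exists j.
have e0G := L0s_G0 e0L.
case: ifP => e0A; first by rewrite inE.
rewrite cov1 inE -/(Bk F e0) Bk_comp // => gc.
suff ec : e \notin comp (VF F) r T e0 by have := sep e0 e0G ec g gQ; rewrite gc.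
apply/negP => ec; move: eA; rewrite /A1 inE As0E inE eG /=; case/negP.
by apply/cov_sc; exists j => //; rewrite /bl1 E e0A cov1 inE -/(Bk F e0) Bk_comp.
Qed.

Lemma cov_all : (#|G0 F r| <= sq)%N -> finset.set0 :|: cov (sched F T r sq) = [set: 'I_m].
Proof.
move=> hG; apply/setP => g; rewrite finset.set0U /sched cov_cat finset.in_setU finset.in_setT.
have := As0E F; rewrite {1}/As0 finset.set0U => ->; rewrite finset.in_setC.
case: (boolP (g \in G0 F r)) => //= gG.
have gL := L0s_all hG gG.
have iL : (index g (L0s F r sq) < size (L0s F r sq))%N by rewrite index_mem.
have oL : onth (L0s F r sq) (index g (L0s F r sq)) = Some g.
  by rewrite (onth_nth g) // nth_index.
case: (boolP (g \in A1 F g)) => gA.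
  move: gA; rewrite /A1 inE As0E inE gG /= => /cov_sc[j ji gj].
  by apply/cov_sc; exists j => //; exact: ltn_trans ji (leq_trans iL (L0s_size F)).
apply/cov_sc; exists (index g (L0s F r sq)); first exact: leq_trans iL (L0s_size F).
move: gA; rewrite /A1 As0E => /negbTE gA; rewrite {1}/bl1 oL gA.
by rewrite cov1 inE -/(Bk F g) Bk_comp // comp_self.
Qed.

End NB.
End Sched.
End VOnly.
End Schedule.

(** * Error terms of the schedule *)

Module ErrorTerms.
Import Explore Steps SwitchConf ShortCycle OccProb ClauseCount Weights Resign CoinTree Switching Moments LowerTail Refinement PlantedEvents Planted Schedule.
Local Open Scope ring_scope.

Section Errors.
Variables (R : realType) (n k m T r sq : nat).
Hypotheses (k3 : (2 < k)%N) (rT : (r < T)%N).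
Implicit Types (s : assignment n) (F : formula n k m) (A : {set 'I_m}).

Lemma Bad_intro F s (P0' : seq (step_pred 'I_m)) (P0 : seq (step_pred (clause n k))) e Q : rls F P0' P0 -> occ P0' [:: e] Q ->
  ((exists t, occ (fw (VF F) (umF F s) T.+1) (e :: Q) t) \/
   exists l ob t, [/\ (l <= T)%N, (odflt 0 ob <= T)%N, occ (conf (VF F) (umF F s) l ob) (e :: Q) t &
     (r <= confcost l ob)%N]) ->
  Bad T r P0 s e F.
Proof.
move=> rl0 oQ; have cat As Bs t : rls F As Bs -> occ As (e :: Q) t -> EvF (P0 ++ Bs) e F.
  move=> rl1 ot; apply: (@EvF_occ n k m F (P0' ++ As) _ e (Q ++ t)); first exact: rls_cat.
  by rewrite occ_cat ?(occ_size oQ) // oQ.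
case=> [[t ot]|[l [ob [t [lT obT ot rc]]]]]; apply/orP.
  by left; apply: cat ot; exact: rls_fw.
right; apply/existsP; exists (Ordinal (lT : (l < T.+1)%N)).
have [ob' obE] : exists ob' : option 'I_T.+1, omap val ob' = ob.
  by case: ob obT {ot rc} => [b|_]; [move=> bT; exists (Some (Ordinal (bT : (b < T.+1)%N)))|exists None].
apply/existsP; exists ob'; rewrite obE rc /=; apply: cat ot; exact: rls_conf.
Qed.

Lemma WB1 F e : WB F [:: e] = VF F e.
Proof.
apply/setP => x; rewrite inE /XB /= cats0; apply/codomP/imsetP => [[j ->]|[j _ ->]]; by exists j.
Qed.

(** The bad events of whole blocks are stated so that they ignore the signs of inactive clauses, as
    [planted] demands. *)
Definition b0 (e : 'I_m) s F := (e \notin G0 F r) &&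
  has (fun x => badsw F (A0 T r F e) T (WB F [:: e]) x s) (XB F [:: e]).
Definition b1 (e : 'I_m) s F := [&& ~~ bicb r F, e \in G0 F r, e \notin A1 T r sq F e &
  has (fun x => badsw F (A1 T r sq F e) T (WB F (Bk T r F e)) x s) (XB F (Bk T r F e))].

Lemma umF_V F s e y : umF F s e y -> y \in VF F e. Proof. exact: umc_V. Qed.
Lemma umF_inj F s e y z : umF F s e y -> umF F s e z -> y = z. Proof. exact: umc_inj. Qed.

Lemma A0E' F e g : (g \in A0 T r F e) = (g \notin G0 F r) && (g < e)%N.
Proof. first [exact: A0E | exact: (@A0E n k m T r 0 F e g)]. Qed.

Lemma b0_Bad e s F : b0 e s F -> Bad T r [::] s e F.
Proof.
case/andP=> eG /hasP[x xX bx].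
apply: (@Bad_intro F s [::] [::] e [::]) => //.
have av : avoids [:: e] (enum (A0 T r F e)).
  by move=> g; rewrite mem_enum A0E' => /andP[_ ge]; rewrite mem_seq1; apply/eqP => E; move: ge; rewrite E ltnn.
have xW : x \in WB F [:: e] by rewrite inE.
have sub : WB F [:: e] \subset Vs (VF F) [:: e] by rewrite WB1 /Vs big_seq1.
have := switch_conf (@umF_V F s) (@umF_inj F s) r av xW sub bx.
case=> [|[l [ob [t [lT obT ot rc]]]]]; first by left.
right; exists l, ob, t; split=> //; apply: rc; exists e; split=> //; first exact: WB1.
by move=> g; rewrite A0E' => /andP[].
Qed.

(** A configuration of cost below [r] attached to the cycle would, without its minorities, be a
    short ear: two meeting short cycles. So the cost is at least [r] here too. *)
Lemma b1_Bad e s F : b1 e s F -> Bad1 T r s e F.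
Proof.
case/and4P=> nb eG eA /hasP[x xX bx].
have [l [Q [lr oQ BQ av]]] := A1_avoid rT nb eG eA.
apply/existsP; exists (Ordinal lr); apply: (Bad_intro (rls_cyc F l) oQ).
have xW : x \in WB F (Bk T r F e) by rewrite inE.
have sub : WB F (Bk T r F e) \subset Vs (VF F) (e :: Q).
  apply/fintype.subsetP => y; rewrite inE => /flattenP[q /mapP[g gB ->] /codomP[j ->]].
  by apply: (in_Vs (c := g)); [exact: BQ|exact: clx_V].
have := switch_conf (@umF_V F s) (@umF_inj F s) r av xW sub bx.
case=> [|[a [ob [t [lT obT ot _]]]]]; first by left.
right; exists a, ob, t; split=> //; rewrite leqNgt; apply/negP => cr.
have ct := conf_plain (@umF_V F s) (isT : e :: Q != [::]) ot.
apply: (nbicP nb (e := e)); exists l, Q, (size (conf (VF F) (umF F s) a ob)).-1, t.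
have sz := size_conf (VF F) (umF F s) a ob.
have sp : (0 < size (conf (VF F) (umF F s) a ob))%N by rewrite sz; case: (ob) => [b|]; rewrite ?addn2.
split=> //; last by rewrite prednK.
by rewrite sz; move: cr; rewrite /confcost; case: (ob) => [b|] /=; clear; lia.
Qed.

Lemma b0_resign e s F e' xi : e' \notin A0 T r F e -> b0 e s (resign F e' xi) = b0 e s F.
Proof.
move=> eA; rewrite /b0 G0_resign A0_resign /WB !XB_resign; congr (_ && _).
by apply: eq_has => x; rewrite badsw_resign.
Qed.

Lemma b1_resign e s F e' xi : e' \notin A1 T r sq F e -> b1 e s (resign F e' xi) = b1 e s F.
Proof.
move=> eA; rewrite /b1 bic_resign G0_resign A1_resign Bk_resign /WB !XB_resign; congr [&& _, _, _ & _].
by apply: eq_has => x; rewrite badsw_resign.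
Qed.

Definition h0 e F : R := (\sum_(s | nae_on (A0 T r F e) F s) (b0 e s F)%:R) / #|nae_on (A0 T r F e) F|%:R.
Definition h1 e F : R := (\sum_(s | nae_on (A1 T r sq F e) F s) (b1 e s F)%:R) / #|nae_on (A1 T r sq F e) F|%:R.
Lemma h0_ge0 e F : 0 <= h0 e F. Proof. by rewrite mulr_ge0 ?invr_ge0 ?sumr_ge0. Qed.
Lemma h1_ge0 e F : 0 <= h1 e F. Proof. by rewrite mulr_ge0 ?invr_ge0 ?sumr_ge0. Qed.

(** Badness for one variable is replaced by badness for some variable of the block, at the price of
    the block size. *)
Lemma blk_le (S : pred (assignment n)) (bad : 'I_n -> pred (assignment n)) X N :
  block_err R S bad X N <= N%:R * ((size X)%:R * ((\sum_(s | S s) (has (bad^~ s) X)%:R) / #|S|%:R)).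
Proof.
apply: ler_wpM2l => //; rewrite mulrA; apply: ler_wpM2r; first by rewrite invr_ge0.
rewrite /nbad exchange_big /= mulr_sumr; apply: ler_sum => s _.
elim: X => [|x X IH]; first by rewrite big_nil mulr0.
rewrite big_cons /= -natr1 mulrDl mul1r addrC; apply: lerD.
  apply: le_trans IH _; apply: ler_wpM2l => //.
  by case: (bad x s); case: (has _ X).
by case: (bad x s); case: (has _ X).
Qed.

Lemma XB_size F B : size (XB F B) = (k * size B)%N.
Proof.
elim: B => [|e B IH]; first by rewrite muln0.
by rewrite /XB /= size_cat size_codom card_ord -/(XB F B) IH mulnS.
Qed.

Lemma missB_ZK F B : missB F R B = 1 - ZK R [set e in B] F / 2 ^+ n.
Proof.
have p2 : (2 ^+ n : R) != 0 by rewrite expf_neq0.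
rewrite /missB /ZK; apply/eqP; rewrite eq_sym subr_eq -mulrDl -big_split /= eq_sym.
apply/eqP; rewrite -[RHS](divff p2); congr (_ / _).
rewrite (eq_bigr (fun _ => 1)) ?sumr_const ?card_ffun ?card_bool ?card_ord ?natrX // => s _.
have := nae_on_cup F finset.set0 B s; rewrite finset.set0U => ->.
have -> : nae_on finset.set0 F s by apply/forallP => e; rewrite inE.
by case: viol; rewrite /= ?addr0 ?add0r.
Qed.

(** Flipping variables of the clause acts on its truth values like changing its signs, so averaging
    over assignments amounts to averaging over signs. *)
Lemma sum_naec F e : proper_formula F -> \sum_s (naec s (tnth F e))%:R = 2 ^+ n * Resign.rho R k.
Proof.
move=> Fp; have p2 : (2 ^+ k : R) != 0 by rewrite expf_neq0.
pose Sx (xi : {ffun 'I_k -> bool}) : {set 'I_n} := [set clx (tnth F e) j | j : 'I_k & xi j].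
have one xi : \sum_(s : assignment n) (naec s (tnth F e))%:R = \sum_(s : assignment n) (naec s (flipc (tnth F e) xi))%:R :> R.
  have inj : injective (fun s : assignment n => flipS (Sx xi) s).
    move=> s t /ffunP E; apply/ffunP => y; have := E y; rewrite !ffunE; exact: addIb.
  rewrite [LHS](reindex_inj inj) /=; apply: eq_bigr => s _; congr (nat_of_bool (nonconst _))%:R.
  apply/ffunP => j; rewrite clv_flipS clv_flip; congr (_ (+) _).
  apply/imsetP/idP => [[i]|xj]; last by exists j; rewrite ?inE.
  by rewrite inE => xi1 /(clx_inj Fp) ->.
apply: (mulfI p2); rewrite /Resign.rho.
have -> : 2 ^+ k * (2 ^+ n * (Nb k R / 2 ^+ k)) = 2 ^+ n * Nb k R by field.
have {1}-> : 2 ^+ k = \sum_(xi : {ffun 'I_k -> bool}) 1 :> R.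
  by rewrite sumr_const card_ffun card_bool card_ord natrX.
rewrite mulr_suml (eq_bigr _ (fun xi _ => mul1r _)) (eq_bigr _ (fun xi _ => one xi)) exchange_big /=.
rewrite (eq_bigr (fun _ => Nb k R)); last by move=> s _; exact: sum_flip.
by rewrite sumr_const card_ffun card_bool card_ord -[LHS]mulr_natl natrX.
Qed.

Lemma missB1 F e : proper_formula F -> missB F R [:: e] = 2 ^- k.-1.
Proof.
move=> Fp; rewrite missB_ZK; have -> : ZK R [set g in [:: e]] F = 2 ^+ n * Resign.rho R k.
  rewrite -(sum_naec e Fp); apply: eq_bigr => s _; congr (nat_of_bool _)%:R.
  apply/forallP/idP => [/(_ e)|h g]; first by rewrite inE inE eqxx.
  by rewrite !inE; apply/implyP => /eqP ->.
have p2 : (2 ^+ n : R) != 0 by rewrite expf_neq0.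
by rewrite mulrAC divff // mul1r rho_q // opprB addrC subrK.
Qed.

Lemma missB_ge0 F B : 0 <= missB F R B.
Proof. by rewrite mulr_ge0 ?invr_ge0 ?exprn_ge0 ?sumr_ge0. Qed.

Lemma err_cat F A c1 c2 : err F R T A (c1 ++ c2) = err F R T A c1 + err F R T (A :|: cov c1) c2.
Proof.
elim: c1 A => [|[B N] c1 IH] A /=.
  by rewrite add0r; congr err; apply/setP => e; rewrite !inE orbF.
rewrite IH addrA; congr (_ + err _ _ _ _ _); apply/setP => e; by rewrite !inE orbA.
Qed.

Lemma err_sc F (bl : nat -> {set 'I_m} -> seq (seq 'I_m * nat)) A i : err F R T A (sc bl A i) =
  \sum_(j < i) err F R T (A :|: cov (sc bl A j)) (bl j (A :|: cov (sc bl A j))).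
Proof. by elim: i => [|i IH] /=; rewrite ?big_ord0 // big_ord_recr /= err_cat IH. Qed.

Lemma err_sc0 F : proper_formula F ->
  err F R T finset.set0 (sc0 F T r) <= \sum_e (T%:R * (k%:R * h0 e F) + 2 ^- k.-1 ^+ T).
Proof.
move=> Fp; rewrite err_sc; apply: ler_sum => e _; rewrite -/(A0 T r F e).
have pos : 0 <= T%:R * (k%:R * h0 e F) + 2 ^- k.-1 ^+ T.
  apply: addr_ge0; last by rewrite exprn_ge0 // invr_ge0 exprn_ge0.
  by apply: mulr_ge0 => //; apply: mulr_ge0 => //; exact: h0_ge0.
rewrite /bl0 valK; case: ifP => // eG.
rewrite /= addr0 /errB missB1 // lerD2r; apply: le_trans (blk_le _ _ _ _) _.
rewrite XB_size muln1; apply: ler_wpM2l => //; apply: ler_wpM2l => //.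
apply: ler_of_eqA; rewrite /h0; congr (_ / _); apply: eq_bigr => s _.
by rewrite /b0 eG.
Qed.

Lemma sum_onth (L : seq 'I_m) (f : 'I_m -> R) N : uniq L -> (forall e, 0 <= f e) ->
  \sum_(i < N) (if onth L i is Some e then f e else 0) <= \sum_e f e.
Proof.
move=> uL f0.
apply: (@le_trans _ _ (\sum_(i < N) \sum_e (onth L i == Some e)%:R * f e)).
  apply: ler_sum => i _; case: (onth L i) => [e|]; last by apply: sumr_ge0 => e _; rewrite mulr_ge0.
  by rewrite (bigD1 e) //= eqxx mul1r lerDl; apply: sumr_ge0 => g _; rewrite mulr_ge0.
rewrite exchange_big /=; apply: ler_sum => e _; rewrite -mulr_suml ler_piMl //.
apply: (@le_trans _ _ (\sum_(i < N) (nat_of_ord i == index e L)%:R)).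
  apply: ler_sum => i _; case: eqP => // oi; case: eqP => //; case.
  have iL : (i < size L)%N by rewrite -onthTE oi.
  by move: oi; rewrite (Refinement.onth_nth e) // => -[<-]; rewrite index_uniq.
case: (ltnP (index e L) N) => h; last by rewrite big1 // => i _; case: eqP => // E; have := ltn_ord i; rewrite E ltnNge h.
rewrite (bigD1 (Ordinal h)) //= eqxx big1 ?addr0 // => i /eqP iN.
by case: eqP => // E; case: iN; exact: val_inj.
Qed.

(** A component satisfied by less than a fraction [eta] of all assignments: there the attempts would
    succeed too rarely. *)
Definition low eta e F := G0nb r e F && (1 - eta < missB F R (Bk T r F e))%R.

Lemma err_sc1 F eta : eta <= 1 -> ~~ bicb r F -> (forall e, ~~ low eta e F) ->
  err F R T (As0 T r F) (sc (bl1 F T r sq) (As0 T r F) sq) <=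
  \sum_e (sq%:R * ((k * r.+1)%:R * h1 e F)) + sq%:R * (1 - eta) ^+ sq.
Proof.
move=> eta1 nb nl; rewrite err_sc.
have m0 : 0 <= (1 - eta) ^+ sq by rewrite exprn_ge0 // subr_ge0.
have f0 e : 0 <= sq%:R * ((k * r.+1)%:R * h1 e F) by apply: mulr_ge0 => //; apply: mulr_ge0 => //; exact: h1_ge0.
apply: (@le_trans _ _ (\sum_(i < sq) ((if onth (L0s F r sq) i is Some e then sq%:R * ((k * r.+1)%:R * h1 e F) else 0) + (1 - eta) ^+ sq))); last first.
  rewrite big_split /= sumr_const card_ord -[X in _ + X]mulr_natl lerD2r.
  by apply: sum_onth => //; exact: L0s_uniq.
apply: ler_sum => i _; rewrite {2}/bl1; case E: (onth _ i) => [e|] /=; last by rewrite add0r.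
case: ifP => [_|eA]; first by rewrite addr_ge0.
have eL : e \in L0s F r sq by apply/onthP; exists (nat_of_ord i).
have eG := L0s_G0 eL.
have iL : (i < size (L0s F r sq))%N by rewrite -onthTE E.
have iE : index e (L0s F r sq) = i.
  by move: E; rewrite (Refinement.onth_nth e) // => -[<-]; rewrite index_uniq ?L0s_uniq.
rewrite /= addr0 /errB -/(Bk T r F e); apply: lerD; last first.
  rewrite lerXn2r ?nnegrE ?missB_ge0 ?subr_ge0 // leNgt.
  by have := nl e; rewrite /low /G0nb -/(G0 F r) eG nb.
have AE : As0 T r F :|: cov (sc (bl1 F T r sq) (As0 T r F) i) = A1 T r sq F e by rewrite /A1 iE.
rewrite AE in eA *; apply: le_trans (blk_le _ _ _ _) _; rewrite XB_size.
apply: ler_wpM2l => //; apply: ler_pM => //.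
- by rewrite mulr_ge0 ?invr_ge0 ?sumr_ge0.
- by rewrite ler_nat leq_mul2l (Bk_size rT) ?orbT.
apply: ler_of_eqA; rewrite /h1; congr (_ / _); apply: eq_bigr => s _.
by rewrite /b1 nb eG eA.
Qed.

Lemma err_sched F eta : eta <= 1 -> proper_formula F -> ~~ bicb r F -> (forall e, ~~ low eta e F) ->
  err F R T finset.set0 (sched F T r sq) <=
  \sum_e (T%:R * (k%:R * h0 e F) + sq%:R * ((k * r.+1)%:R * h1 e F)) +
  (m%:R * 2 ^- k.-1 ^+ T + sq%:R * (1 - eta) ^+ sq).
Proof.
move=> eta1 Fp nb nl; rewrite /sched err_cat.
apply: le_trans (lerD (err_sc0 Fp) (err_sc1 eta1 nb nl)) _.
rewrite !big_split /= sumr_const card_ord -mulr_natl; apply: ler_of_eqA; ring.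
Qed.

Lemma avgX_rcons X x (g : assignment n -> R) : avgX (rcons X x) g = avg x (avgX X g).
Proof. by elim: X g => [|y X IH] g //=; rewrite IH. Qed.

Lemma Ex_initX (f : assignment n -> R) X v : Ex f (initX X v) = avgX (rev X) f v.
Proof.
elim: X v => [|x X IH] v //=; rewrite !IH rev_cons avgX_rcons /avg.
have [E0 E1] : (setv v x (v x) = v) /\ (setv v x (~~ v x) = flip1 x v).
  split; apply/ffunP => y; rewrite !ffunE; case: (eqVneq y x) => [->|_]; by rewrite ?addbT ?addbF.
by congr (_ / _); case E : (v x) E0 E1 => /= -> ->; rewrite // addrC.
Qed.

(** Independent fair values are uniform on all assignments, the solutions of the empty set of
    clauses, where the induction of [alg_tv] starts. *)
Lemma law_init F sch v a :
  law R (bind (initX (enum 'I_n) v) (alg F T finset.set0 sch)) a =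
  push (uniform R (nae_on finset.set0 F)) (alg F T finset.set0 sch) a.
Proof.
rewrite /law Ex_bind Ex_initX (@avgX_const R n [set: 'I_n]); first last.
- by move=> s t st; congr Ex; congr alg; apply/ffunP => y; apply: st; rewrite inE.
- by apply/setP => y; rewrite !inE mem_rev mem_enum.
rewrite /push mulr_suml; apply: eq_bigr => s _; rewrite mulrC; congr (_ * _).
have al t : nae_on finset.set0 F t by apply/forallP => e; rewrite inE.
rewrite /uniform al div1r; congr (_^-1).
rewrite (eq_card (B := {: assignment n})) ?card_ffun ?card_bool ?card_ord ?natrX //.
Qed.

Lemma tv_sched F v : proper_formula F -> (exists s, nae_sat F s) -> ~~ bicb r F -> (#|G0 F r| <= sq)%N ->
  tv (law R (bind (initX (enum 'I_n) v) (alg F T finset.set0 (sched F T r sq)))) (uniform R (nae_sat F)) <=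
  err F R T finset.set0 (sched F T r sq).
Proof.
move=> Fp ex nb hG; have := alg_tv Fp R T finset.set0 (sched F T r sq) ex.
rewrite (cov_all (ltnW (ltnW k3)) rT nb hG).
have -> : law R (bind (initX (enum 'I_n) v) (alg F T finset.set0 (sched F T r sq))) =
    push (uniform R (nae_on finset.set0 F)) (alg F T finset.set0 (sched F T r sq)).
  by apply/funext => a; exact: law_init.
have nE : nae_on [set: 'I_m] F =1 nae_sat F.
  move=> s; rewrite nae_satE; apply/forallP/all_tnthP => h e; first by have := h e; rewrite inE.
  by apply/implyP => _; exact: h.
have -> // : uniform R (nae_on [set: 'I_m] F) = uniform R (nae_sat F).
apply/funext => s; rewrite /uniform nE; congr (_ / _%:R); apply: eq_card => t; exact: nE.
Qed.

End Errors.
End ErrorTerms.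

(** * Probability that the sampler misses its target *)

Module FailureProb.
Import Explore Steps SwitchConf ShortCycle OccProb ClauseCount Weights Resign CoinTree Switching Moments LowerTail Refinement PlantedEvents Planted Schedule ErrorTerms.
Local Open Scope ring_scope.

Section Final.
Variables (R : realType) (n k m T r sq : nat).
Hypotheses (k3 : (2 < k)%N) (rT : (r < T)%N) (kn : (2 * k <= n)%N).
Variables (D lam a eta tgt : R).
Hypotheses (D1 : 1 <= D) (DE : m%:R * x1 R n k <= D) (lam0 : 0 < lam) (lam1 : lam <= 1)
  (lamE : m%:R * xl R n k <= lam) (a01 : 0 < a <= 1) (eta0 : 0 <= eta) (eta1 : eta <= 1) (tgt0 : 0 < tgt)
  (mk : m%:R * (2 ^- k.-1 / (1 - 2 ^- k.-1)) <= n%:R / 6 :> R)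
  (det : m%:R * 2 ^- k.-1 ^+ T + sq%:R * (1 - eta) ^+ sq <= tgt / 2).
Variables (p : program) (c t : nat).
Hypothesis HO : forall F : formula n k m, proper_formula F -> forall v,
  output_dist R p c t F v = law R (bind (initX (enum 'I_n) [ffun => false]) (alg F T finset.set0 (sched F T r sq))) v.
Implicit Types (F : formula n k m).

Let n2 : (2 <= n)%N. Proof. by move: k3 kn; clear; lia. Qed.
Let NP := Np R n k ^+ m.
Let a0 : 0 < a. Proof. by case/andP: a01. Qed.
Let wTz : R := wT n k D (Zb T).
Let G : R := r%:R * (D ^+ r * wTz).
Let bt : R := bad_weight n k T r D lam.
Let s0 : assignment n := [ffun => false].

(** One term per way to fail: few solutions, two meeting short cycles, more than [sq] clauses on
    short cycles, a component with few solutions, a large error of the switches. [mr] is real so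
    that [d n / k] can be inserted for every [n]. *)
Definition failure_bound (mr : R) : R :=
  (mr * (tail_const R k / (n%:R * Num.sqrt n%:R)) + expR (5 / 3) * expR (expR (-120) * ln a)) +
  mr * (r%:R * (r.+1%:R * (D ^+ r * wTz * (D * (Zb T)%:R * D ^+ r.+1 * wTz)))) +
  sq.+1%:R^-1 * (mr * G) +
  mr * (a^-1 * (eta * (Resign.rho R k)^-1 ^+ r.+1 * G)) +
  2 / tgt * (T%:R * (k%:R * (mr * (a^-1 * bt))) + sq%:R * ((k * r.+1)%:R * (mr * (a^-1 * (G * bt))))).

Let SP (f : formula n k m -> R) := \sum_(F | proper_formula F) f F.

Lemma SP_bic : SP (fun F => (bicb r F)%:R) <=
  m%:R * (r%:R * (r.+1%:R * (D ^+ r * wTz * (D * (Zb T)%:R * D ^+ r.+1 * wTz)))) * NP.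
Proof.
apply: (@V_event R n k m k3 s0 (bicb r)); first by move=> F e xi; exact: bic_resign.
apply: le_trans (bic_bound n2 k3 rT D1 DE s0) _; rewrite -/wTz.
apply: ler_of_eqA; ring.
Qed.

Lemma G0nb_cnt (e : 'I_m) : cnt R (@okc n k s0) (fun F : formula n k m => G0nb r e F) <= G * cnt R (okc s0) (fun _ : formula n k m => true).
Proof.
by apply: le_trans (G0nb_bound n2 k3 rT D1 DE s0 e) _; rewrite -/wTz /G !mulrA.
Qed.

Lemma G0nb_resign e F e' xi : G0nb r e (resign F e' xi) = G0nb r e F.
Proof. by rewrite /G0nb VF_resign bic_resign. Qed.

Lemma SP_G0 e : SP (fun F => (G0nb r e F)%:R) <= G * NP.
Proof. apply: V_event (G0nb_cnt e) => // F e' xi; exact: G0nb_resign. Qed.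

Lemma SP_low (e : 'I_m) : SP (fun F => (a <= Mr R F)%R%:R * (low T r eta e F)%:R) <=
  a^-1 * (eta * (Resign.rho R k)^-1 ^+ r.+1 * G) * NP.
Proof.
apply: (@low_event R n k m k3 (fun F => [set g in Bk T r F e]) (G0nb r e) (low T r eta e) a G eta r.+1 s0).
- exact: a0.
- exact: eta0.
- by move=> F e' xi; rewrite Bk_resign.
- by move=> F e' xi; exact: G0nb_resign.
- move=> F e' xi; rewrite inE => eB; rewrite /low G0nb_resign Bk_resign; congr (_ && (_ < _)%R).
  rewrite /missB; congr (_ / _); apply: eq_bigr => s _; congr (nat_of_bool _)%:R.
  apply: eq_in_has => g gB; rewrite tnth_resign; case: eqP => // ge.
  by move: eB; rewrite -ge gB.
- move=> F /andP[E]; have /andP[eG nb] := E; rewrite missB_ZK => lw; split=> //; split.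
    by rewrite cardsE; apply: leq_trans (card_size _) (Bk_size rT nb eG).
  have p2 : 0 < 2 ^+ n :> R by rewrite exprn_gt0.
  by rewrite mulrC -ler_pdivrMr //; move: lw; rewrite ltrD2l ltrN2 => /ltW.
exact: G0nb_cnt.
Qed.

Lemma SP_h0 e : SP (fun F => (a <= Mr R F)%R%:R * h0 R T r e F) <= a^-1 * bt * NP.
Proof.
apply: (@planted R n k m k3 (fun F => A0 T r F e) (fun s F => b0 T r e s F) a bt a0).
- by move=> F e' xi; rewrite A0_resign.
- by move=> s F e' xi; exact: b0_resign.
move=> s; have hB : cnt R (okc s) (fun F : formula n k m => Bad T r [::] s e F) <= bt * cnt R (okc s) (fun _ : formula n k m => true).
  by apply: Bad0_bound.
apply: le_trans hB; apply: cnt_sub => F _; exact: b0_Bad.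
Qed.

Lemma SP_h1 e : SP (fun F => (a <= Mr R F)%R%:R * h1 R T r sq e F) <= a^-1 * (G * bt) * NP.
Proof.
apply: (@planted R n k m k3 (fun F => A1 T r sq F e) (fun s F => b1 T r sq e s F) a (G * bt) a0).
- by move=> F e' xi; rewrite A1_resign.
- by move=> s F e' xi; exact: b1_resign.
move=> s; have := Bad1_bound n2 k3 rT D1 DE lam0 lam1 lamE s e; rewrite -/wTz -/bt => hB.
have -> : G * bt = r%:R * (D ^+ r * wTz * bt) by rewrite /G; ring.
apply: le_trans hB; apply: cnt_sub => F _; exact: b1_Bad.
Qed.

Definition Er F : R := \sum_e (T%:R * (k%:R * h0 R T r e F) + sq%:R * ((k * r.+1)%:R * h1 R T r sq e F)).

Lemma Er_ge0 F : 0 <= Er F.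
Proof.
apply: sumr_ge0 => e _; apply: addr_ge0; apply: mulr_ge0 => //; apply: mulr_ge0 => //; [exact: h0_ge0|exact: h1_ge0].
Qed.

Lemma good F : proper_formula F -> (a <= Mr R F)%R -> ~~ bicb r F -> (#|G0 F r| <= sq)%N ->
  (forall e : 'I_m, ~~ low T r eta e F) -> Er F <= tgt / 2 -> @samples_within R p c t n k m tgt F.
Proof.
move=> Fp aM nb hG nl hE.
have ex : exists s, nae_sat F s.
  have : 0 < Mr R F by exact: lt_le_trans aM.
  move=> Mp; apply/existsP; apply: contraT => /existsPn no.
  move: Mp; rewrite /Mr (_ : Zr R F = 0) ?mul0r ?ltxx //.
  by rewrite ZrE big1 // => s _; rewrite (negbTE (no s)).
apply/andP; split; first by apply/existsP.
have -> : output_dist R p c t (n:=n) (k:=k) (m:=m) F = law R (bind (initX (enum 'I_n) [ffun => false]) (alg F T finset.set0 (sched F T r sq))).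
  by apply/funext => v; exact: HO.
apply: le_trans (tv_sched R k3 rT _ Fp ex nb hG) _.
apply: le_trans (err_sched sq k3 rT eta1 Fp nb nl) _.
by rewrite [tgt in leRHS]splitr; exact: lerD hE det.
Qed.

(** The third and the last term are Markov bounds. The indicators of [a <= Mr R F] make the terms
    that involve signs accessible to the planted bounds. *)
Lemma bad_le F : proper_formula F -> (~~ @samples_within R p c t n k m tgt F)%:R <=
  (Mr R F < a)%R%:R + (bicb r F)%:R + sq.+1%:R^-1 * (\sum_(e < m) (G0nb r e F)%:R) +
  (\sum_(e < m) (a <= Mr R F)%R%:R * (low T r eta e F)%:R) + 2 / tgt * ((a <= Mr R F)%R%:R * Er F) :> R.
Proof.
move=> Fp.
have t1 : 0 <= (Mr R F < a)%R%:R :> R by [].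
have t2 : 0 <= (bicb r F)%:R :> R by [].
have t3 : 0 <= sq.+1%:R^-1 * (\sum_(e < m) (G0nb r e F)%:R) :> R.
  by apply: mulr_ge0; [rewrite invr_ge0|apply: sumr_ge0].
have t4 : 0 <= \sum_(e < m) (a <= Mr R F)%R%:R * (low T r eta e F)%:R :> R.
  by apply: sumr_ge0 => e _; rewrite mulr_ge0.
have t5 : 0 <= 2 / tgt * ((a <= Mr R F)%R%:R * Er F).
  by apply: mulr_ge0; [rewrite divr_ge0 // ltW|apply: mulr_ge0 => //; exact: Er_ge0].
have dd (x1 x2 x3 x4 x5 : R) : 0 <= x1 -> 0 <= x2 -> 0 <= x3 -> 0 <= x4 -> 0 <= x5 ->
    [\/ 1 <= x1, 1 <= x2, 1 <= x3 | 1 <= x4] \/ 1 <= x5 -> 1 <= x1 + x2 + x3 + x4 + x5.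
  by move=> ? ? ? ? ? [[]|] ?; lra.
case: (boolP (samples_within _ _ _ _ _)) => [_|bad]; first by rewrite !addr_ge0.
apply: dd => //.
have [Ma|aM] := ltP (Mr R F) a; first by left; apply: Or41.
case: (boolP (bicb r F)) => [_|nb]; first by left; apply: Or42.
case: (leqP #|G0 F r| sq) => [hG|hG]; last first.
  left; apply: Or43; rewrite ler_pdivlMl // mulr1.
  rewrite (eq_bigr (fun e => (e \in G0 F r)%:R)); last by move=> e _; rewrite /G0nb nb andbT.
  rewrite -natr_sum ler_nat -sum1_card big_mkcond /= in hG *.
  by apply: leq_trans hG _; apply: leq_sum => e _; case: (e \in _).
case: (boolP [exists e, low T r eta e F]) => [/existsP[e le]|/existsPn nl].
  left; apply: Or44; rewrite (bigD1 e) //= le mulr1 -[leLHS]/(true%:R) lerDl.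
  by apply: sumr_ge0 => g _; rewrite mulr_ge0.
have -> : (true%:R : R) = 1 by [].
right; rewrite mul1r; have [hE|hE] := leP (Er F) (tgt / 2).
  by move: bad; rewrite good.
rewrite -ler_pdivrMl ?divr_gt0 // mulr1 invf_div; exact: ltW.
Qed.

Lemma Nfail : SP (fun F => (~~ @samples_within R p c t n k m tgt F)%:R) <= failure_bound m%:R * NP.
Proof.
have N0 : 0 <= NP by rewrite /NP -(@sum_proper R n k m); apply: sumr_ge0.
apply: le_trans (ler_sum _ (fun F Fp => bad_le Fp)) _.
have EE (p1 p2 p3 p4 p5 : R) : (p1 + p2 + p3 + p4 + p5) * NP = p1 * NP + p2 * NP + p3 * NP + p4 * NP + p5 * NP by ring.
rewrite !big_split /= /failure_bound EE; apply: lerD; [apply: lerD; [apply: lerD; [apply: lerD|]|]|].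
- exact: (lower_tail k3 kn (m := m) a01 mk).
- exact: SP_bic.
- rewrite -mulr_sumr -mulrA; apply: ler_wpM2l; first by rewrite invr_ge0.
  rewrite exchange_big /= -mulrA -[m in m%:R]card_ord mulr_natl -sumr_const.
  by apply: ler_sum => e _; exact: SP_G0.
- rewrite exchange_big /= -mulrA -[m in m%:R]card_ord mulr_natl -sumr_const.
  by apply: ler_sum => e _; exact: SP_low.
rewrite -mulr_sumr -[leRHS]mulrA; apply: ler_wpM2l; first by rewrite divr_ge0 // ltW.
have -> : \sum_(F : formula n k m | proper_formula F) (a <= Mr R F)%R%:R * Er F =
  \sum_e (T%:R * (k%:R * SP (fun F => (a <= Mr R F)%R%:R * h0 R T r e F)) +
   sq%:R * ((k * r.+1)%:R * SP (fun F => (a <= Mr R F)%R%:R * h1 R T r sq e F))).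
  transitivity (\sum_e \sum_(F : formula n k m | proper_formula F) (a <= Mr R F)%R%:R *
     (T%:R * (k%:R * h0 R T r e F) + sq%:R * ((k * r.+1)%:R * h1 R T r sq e F))).
    by rewrite exchange_big /=; apply: eq_bigr => F _; rewrite /Er mulr_sumr.
  apply: eq_bigr => e _; rewrite /SP !mulr_sumr -big_split /=; apply: eq_bigr => F _; ring.
have -> : (T%:R * (k%:R * (m%:R * (a^-1 * bt))) + sq%:R * ((k * r.+1)%:R * (m%:R * (a^-1 * (G * bt))))) * NP =
  \sum_(e < m) (T%:R * (k%:R * (a^-1 * bt * NP)) + sq%:R * ((k * r.+1)%:R * (a^-1 * (G * bt) * NP))).
  rewrite sumr_const card_ord -[RHS]mulr_natl; ring.
apply: ler_sum => e _; apply: lerD; apply: ler_wpM2l => //; apply: ler_wpM2l => //; [exact: SP_h0|exact: SP_h1].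
Qed.

Lemma Pr_bound : 1 - failure_bound m%:R <= Pr_Fk R (@samples_within R p c t n k m tgt).
Proof.
have NPE : NP = #|@proper_formula n k m|%:R.
  rewrite /NP -(@sum_proper R n k m) sumr_const -[LHS]mulr_natl mulr1; congr _%:R; exact: eq_card.
have N0 : 0 < NP.
  have kn' : (k <= n)%N by move: kn; clear; lia.
  pose c0 : clause n k := [tuple (widen_ord kn' j, true) | j < k].
  pose F0 : formula n k m := [tuple c0 | _ < m].
  have F0p : proper_formula F0.
    apply/all_tnthP => i; rewrite tnth_mktuple properE; apply/injectiveP => x y.
    by rewrite !ffunE !tnth_mktuple => /(congr1 val) /= /val_inj.
  by rewrite /NP -(@sum_proper R n k m) (bigD1 F0) //= ltr_pwDl ?ltr01 // sumr_ge0.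
have PE : Pr_Fk R (@samples_within R p c t n k m tgt) = (NP - SP (fun F => (~~ @samples_within R p c t n k m tgt F)%:R)) / NP.
  rewrite /Pr_Fk -[NP in NP - _](@sum_proper R n k m) /SP -sumrB mulr_suml.
  rewrite big_mkcond [RHS]big_mkcond /=; apply: eq_bigr => F _; rewrite /uniform -NPE.
  by case: samples_within; case: proper_formula; rewrite /= ?subr0 ?subrr ?mul0r.
rewrite PE ler_pdivlMr // mulrBl mul1r lerD2l lerN2; exact: Nfail.
Qed.

End Final.
End FailureProb.

(** * Orders of growth up to logarithmic factors *)

Module Growth.
Local Open Scope classical_set_scope.
Local Open Scope ring_scope.

Section Growth.
Variable R : realType.
Implicit Types (c : R) (f g : nat -> R).
Let lg n := up_log 2 n.

(** Powers of the logarithm are hidden and exponents add under products, so the asymptotics reduce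
    to linear arithmetic on the exponents. *)
Definition Oc c f := exists K N, forall n, (2 <= n)%N -> 0 <= f n <= K * (lg n)%:R ^+ N * n%:R `^ c.

Lemma lg_gt0 n : (2 <= n)%N -> (0 < lg n)%N.
Proof. by move=> n2; rewrite /lg up_log_gt0. Qed.

Lemma lg1 n : (2 <= n)%N -> 1 <= (lg n)%:R :> R.
Proof. by move=> /lg_gt0 h; rewrite ler1n. Qed.

Lemma lgX N N' n : (2 <= n)%N -> (N <= N')%N -> (lg n)%:R ^+ N <= (lg n)%:R ^+ N' :> R.
Proof. by move=> n2 NN; apply: ler_weXn2l => //; exact: lg1. Qed.

Lemma pow_gt0 n c : (2 <= n)%N -> 0 < n%:R `^ c.
Proof. by move=> n2; rewrite powR_gt0 // ltr0n; apply: leq_trans n2. Qed.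

Lemma pow_ge1 n c : (2 <= n)%N -> 0 <= c -> 1 <= n%:R `^ c.
Proof. by move=> n2 c0; have := @ler_powR R n%:R _ 0 c c0; rewrite powRr0; apply; rewrite ler1n ltnW. Qed.
Lemma pow_le1 n c : (2 <= n)%N -> c <= 0 -> n%:R `^ c <= 1.
Proof. by move=> n2 c0; have := @ler_powR R n%:R _ c 0 c0; rewrite powRr0; apply; rewrite ler1n ltnW. Qed.

Lemma OcK c f : Oc c f -> exists K N, 0 <= K /\ forall n, (2 <= n)%N -> 0 <= f n <= K * (lg n)%:R ^+ N * n%:R `^ c.
Proof.
case=> K [N h]; exists K, N; split=> //.
have /andP[h1 h2] := h 2 isT.
have p : 0 < (lg 2)%:R ^+ N * 2%:R `^ c :> R.
  by rewrite mulr_gt0 ?pow_gt0 // exprn_gt0 // (lt_le_trans _ (lg1 _)).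
by rewrite -(pmulr_lge0 _ p) mulrA [X in 0 <= X](_ : _ = K * (lg 2)%:R ^+ N * 2%:R `^ c) ?(le_trans h1) //; ring.
Qed.

Lemma Oc_dom c f g K : 0 <= K -> (forall n, (2 <= n)%N -> 0 <= f n <= K * g n) -> Oc c g -> Oc c f.
Proof.
move=> K0 h [K' [N h']]; exists (K * K'), N => n n2.
have /andP[a1 a2] := h n n2; have /andP[b1 b2] := h' n n2; apply/andP; split=> //.
by apply: le_trans a2 _; rewrite -!mulrA; apply: ler_wpM2l => //; rewrite mulrA.
Qed.

Lemma OcM c c' f g : Oc c f -> Oc c' g -> Oc (c + c') (fun n => f n * g n).
Proof.
move=> [K [N h]] [K' [N' h']]; exists (K * K'), (N + N')%N => n n2.
have /andP[a1 a2] := h n n2; have /andP[b1 b2] := h' n n2; apply/andP; split; first exact: mulr_ge0.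
apply: le_trans (ler_pM a1 b1 a2 b2) _.
rewrite exprD powRD; last by rewrite pnatr_eq0 implybE -lt0n (ltnW n2) orbT.
by rewrite le_eqVlt; apply/orP; left; apply/eqP; ring.
Qed.

Lemma Oc_le c c' f : c <= c' -> Oc c f -> Oc c' f.
Proof.
move=> cc /OcK[K [N [K0 h]]]; exists K, N => n n2.
have /andP[a1 a2] := h n n2; rewrite a1; apply: le_trans a2 _.
apply: ler_wpM2l; first by rewrite mulr_ge0 ?exprn_ge0.
by apply: ler_powR => //; rewrite ler1n ltnW.
Qed.

Lemma OcD c f g : Oc c f -> Oc c g -> Oc c (fun n => f n + g n).
Proof.
move=> /OcK[K [N [K0 h]]] /OcK[K' [N' [K'0 h']]]; exists (K + K'), (N + N')%N => n n2.
have /andP[a1 a2] := h n n2; have /andP[b1 b2] := h' n n2; rewrite addr_ge0 //=.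
have P0 := ltW (pow_gt0 c n2).
rewrite !mulrDl; apply: lerD.
  apply: le_trans a2 _; apply: ler_wpM2r => //; apply: ler_wpM2l => //; apply: lgX => //; exact: leq_addr.
apply: le_trans b2 _; apply: ler_wpM2r => //; apply: ler_wpM2l => //; apply: lgX => //; exact: leq_addl.
Qed.

Lemma Oc_pow c : Oc c (fun n => n%:R `^ c).
Proof. by exists 1, 0%N => n n2; rewrite expr0 !mul1r powR_ge0 lexx. Qed.
Lemma Oc_cst K : 0 <= K -> Oc 0 (fun=> K).
Proof. by move=> K0; exists K, 0%N => n n2; rewrite expr0 powRr0 !mulr1 K0 lexx. Qed.
Lemma Oc_n : Oc 1 (fun n => n%:R).
Proof. by exists 1, 0%N => n n2; rewrite expr0 !mul1r powRr1 // lexx ler0n. Qed.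
Lemma Oc_lg : Oc 0 (fun n => (lg n)%:R).
Proof. by exists 1, 1%N => n n2; rewrite expr1 powRr0 mulr1 mul1r lexx ler0n. Qed.
Lemma OcM0 c f g : Oc 0 f -> Oc c g -> Oc c (fun n => f n * g n).
Proof. by move=> h1 h2; rewrite -[c]add0r; exact: OcM. Qed.
Lemma OcX0 f i : Oc 0 f -> Oc 0 (fun n => f n ^+ i).
Proof.
move=> h; elim: i => [|i IH]; first by under eq_fun do rewrite expr0; apply: Oc_cst.
by under eq_fun do rewrite exprS; exact: OcM0.
Qed.
Lemma Oc_nat0 (u : nat -> nat) K : (forall n, (2 <= n)%N -> (u n <= K * lg n)%N) -> Oc 0 (fun n => (u n)%:R).
Proof.
move=> h; apply: (@Oc_dom 0 _ (fun n => (lg n)%:R) K%:R) => //; last exact: Oc_lg.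
by move=> n n2; rewrite ler0n -natrM ler_nat h.
Qed.

Lemma ln2_gt0 : 0 < ln 2 :> R. Proof. by rewrite ln_gt0 // ltr1n. Qed.

Lemma ln_lg n : (2 <= n)%N -> ln n%:R <= (lg n)%:R * ln 2 :> R.
Proof.
move=> n2; have n0 : 0 < n%:R :> R by rewrite ltr0n ltnW.
rewrite mulr_natl -lnXn ?ltr0n // ler_ln ?posrE ?exprn_gt0 // -natrX ler_nat.
exact: up_logP.
Qed.

Lemma lg_ln n : (2 <= n)%N -> (lg n)%:R * ln 2 <= ln n%:R + ln 2 :> R.
Proof.
move=> n2; have n0 : 0 < n%:R :> R by rewrite ltr0n ltnW.
rewrite -(prednK (lg_gt0 n2)) -natr1 mulrDl mul1r lerD2r.
rewrite mulr_natl -lnXn ?ltr0n // ler_ln ?posrE ?exprn_gt0 // -natrX ler_nat.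
by apply/ltnW; apply: up_log_gtn; rewrite ?(ltnW n2).
Qed.

Lemma Oc_expn (x : R) (u : nat -> nat) c c0 : 0 < x ->
  (forall n, (2 <= n)%N -> (u n)%:R * ln x <= c * ln n%:R + c0) -> Oc c (fun n => x ^+ u n).
Proof.
move=> x0 h; exists (expR c0), 0%N => n n2; rewrite exprn_ge0 ?(ltW x0) //= expr0 mulr1.
have n0 : 0 < n%:R :> R by rewrite ltr0n ltnW.
rewrite /powR gt_eqF // -expRD -[X in X ^+ _](lnK (x := x)) ?posrE // -expRM_natl ler_expR addrC.
exact: h.
Qed.

Lemma lg_pow (g : R) : 0 < g -> exists2 K, 0 <= K & forall n, (2 <= n)%N -> (lg n)%:R <= K * n%:R `^ g.
Proof.
move=> g0; have l2 := ln2_gt0.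
exists (1 + (g * ln 2)^-1); first by rewrite addr_ge0 // invr_ge0 mulr_ge0 // ltW.
move=> n n2; have n0 : 0 < n%:R :> R by rewrite ltr0n ltnW.
have p1 : 1 <= n%:R `^ g by apply: pow_ge1 => //; exact: ltW.
have h : g * ln n%:R <= n%:R `^ g.
  rewrite -ln_powR -ler_expR lnK ?posrE ?pow_gt0 //.
  by apply: le_trans (expR_ge1Dx _); rewrite lerDr.
have := lg_ln n2; rewrite -ler_pdivlMr // => /le_trans; apply.
rewrite mulrDl divff ?gt_eqF // addrC mulrDl; apply: lerD; first by rewrite mul1r.
have E : (g * ln 2)^-1 * n%:R `^ g * ln 2 = n%:R `^ g / g by field; rewrite !gt_eqF.
rewrite ler_pdivrMr // E.
by rewrite ler_pdivlMr // mulrC.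
Qed.

(** Half of the exponent absorbs the logarithms, each being at most a constant times [n ^ g] for a
    [g] inversely proportional to their number. *)
Lemma Oc_lim c f : c < 0 -> Oc c f -> forall eps, 0 < eps -> \forall n \near \oo, f n <= eps.
Proof.
move=> c0 /OcK[K [N [K0 h]]] eps eps0.
pose g := - c / (2 * N.+1%:R).
have g0 : 0 < g by rewrite divr_gt0 ?oppr_gt0 // mulr_gt0.
have [K' K'0 hK] := lg_pow g0.
pose M := K * K' ^+ N + 1.
have M0 : 0 < M by rewrite ltr_wpDl // mulr_ge0 ?exprn_ge0.
have b n : (2 <= n)%N -> f n <= M * n%:R `^ (c / 2).
  move=> n2; have /andP[_ h2] := h n n2; apply: le_trans h2 _.
  have P := pow_gt0 c n2.
  apply: (@le_trans _ _ (K * (K' * n%:R `^ g) ^+ N * n%:R `^ c)).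
    apply: ler_wpM2r; first exact: ltW.
    apply: ler_wpM2l => //; rewrite lerXn2r ?nnegrE ?mulr_ge0 ?powR_ge0 // hK //.
  have nE : (n%:R == 0 :> R) = false by rewrite pnatr_eq0 -leqn0 leqNgt (ltnW n2).
  rewrite exprMn -(powR_mulrn N (powR_ge0 n%:R g)) -powRrM mulrA -mulrA -powRD ?nE ?implybT //.
  have le1 : n%:R `^ (g * N%:R + c) <= n%:R `^ (c / 2).
    apply: ler_powR; first by rewrite ler1n ltnW.
    have : g * N%:R <= - c / 2.
      rewrite /g -mulrA ler_wpM2l ?oppr_ge0 ?(ltW c0) // invfM -mulrA ler_piMr ?invr_ge0 //.
      by rewrite mulrC ler_pdivrMr // mul1r ler_nat.
    lra.
  apply: le_trans (ler_wpM2l _ le1) _; first by rewrite mulr_ge0 ?exprn_ge0.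
  by apply: ler_wpM2r; rewrite ?powR_ge0 // /M lerDl.
have e0 : 0 < eps / M by rewrite divr_gt0.
near=> n.
have n2 : (2 <= n)%N by near: n; exact: nbhs_infty_ge.
have n0 : 0 < n%:R :> R by rewrite ltr0n ltnW.
apply: le_trans (b n n2) _; rewrite mulrC -ler_pdivlMr //.
rewrite -(lnK (x := eps / M)) ?posrE // /powR gt_eqF // ler_expR.
have c2 : c / 2 < 0 by lra.
rewrite mulrC -ler_ndivrMr // -(expRK (ln (eps / M) / (c / 2))) ler_ln ?posrE ?expR_gt0 //.
near: n; exact: nbhs_infty_ger.
Unshelve. all: by end_near.
Qed.

Lemma exp_poly (j : nat) (y : R) : (0 < j)%N -> 0 < y -> expR (- y) <= (j%:R / y) ^+ j.
Proof.
move=> j0 y0; have jr : 0 < j%:R :> R by rewrite ltr0n.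
have -> : - y = j%:R * (- (y / j%:R)) by field; rewrite gt_eqF.
rewrite expRM_natl; apply: lerXn2r; rewrite ?nnegrE ?expR_ge0 //; first by rewrite divr_ge0 // ltW.
rewrite expRN -[j%:R / y]invf_div lef_pV2 ?posrE ?expR_gt0 ?divr_gt0 //.
by apply: le_trans (expR_ge1Dx _); rewrite lerDr.
Qed.

Lemma Oc_sq (u : nat -> nat) : (forall n, (u n * u n <= n)%N) -> Oc (1/2) (fun n => (u n)%:R).
Proof.
move=> h; exists 1, 0%N => n n2; rewrite ler0n expr0 !mul1r powR12_sqrt //.
by rewrite -(ler_pXn2r (n := 2)) ?nnegrE ?sqrtr_ge0 // sqr_sqrtr // -natrX ler_nat expnS expn1 h.
Qed.

Lemma sq_up (u : nat -> nat) n : (n <= (u n).+1 * (u n).+1)%N -> n%:R `^ (1/2) <= (u n).+1%:R :> R.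
Proof.
move=> h; rewrite div1r powR12_sqrt // -(ler_pXn2r (n := 2)) ?nnegrE ?sqrtr_ge0 //.
by rewrite sqr_sqrtr // -natrX ler_nat expnS expn1.
Qed.

Lemma Oc_sqV (u : nat -> nat) : (forall n, (n <= (u n).+1 * (u n).+1)%N) -> Oc (- (1/2)) (fun n => (u n).+1%:R^-1).
Proof.
move=> h; exists 1, 0%N => n n2; have := sq_up (h n); rewrite invr_ge0 ler0n expr0 !mul1r powRN => h'.
by rewrite lef_pV2 ?posrE ?pow_gt0.
Qed.

(** With about [sqrt n] attempts the probability is at most [expR (- n ^ (1/4) / 2)], and [exp_poly]
    extracts from this any desired inverse power of [n]. *)
Lemma Oc_miss (u : nat -> nat) (j : nat) : (forall n, (u n * u n <= n)%N) -> (forall n, (n <= (u n).+1 * (u n).+1)%N) ->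
  (0 < j)%N -> Oc (- (j%:R / 4)) (fun n => (1 - n%:R `^ (- (1/4))) ^+ u n).
Proof.
move=> h1 h2 j0; exists ((2 * j%:R) ^+ j), 0%N => n n2; rewrite expr0 mulr1.
have n0 : 0 < n%:R :> R by rewrite ltr0n ltnW.
set e := n%:R `^ (- (1/4)).
have e1 : e <= 1 by apply: pow_le1 => //; lra.
have e0 : 0 < e by exact: pow_gt0.
rewrite exprn_ge0 ?subr_ge0 //=.
have u1 : (1 <= u n)%N by case E: (u n) (h2 n) => [|//]; move: n2; clear; lia.
have ub : n%:R `^ (1/2) / 2 <= (u n)%:R :> R.
  rewrite ler_pdivrMr //; apply: le_trans (sq_up (h2 n)) _.
  by rewrite -natrM ler_nat; move: u1; clear; lia.
have y0 : 0 < n%:R `^ (1/4) / 2 :> R by rewrite divr_gt0 ?pow_gt0.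
apply: (@le_trans _ _ (expR (- (n%:R `^ (1/4) / 2)))).
  apply: (@le_trans _ _ (expR (- e) ^+ u n)).
    by rewrite lerXn2r ?nnegrE ?expR_ge0 ?subr_ge0 // (le_trans _ (expR_ge1Dx _)).
  rewrite -expRM_natl ler_expR mulrN lerN2.
  apply: le_trans (ler_wpM2r (ltW e0) ub).
  rewrite mulrAC /e -powRD ?pnatr_eq0 ?implybE -?lt0n ?(ltnW n2) ?orbT //.
  by rewrite (_ : 1/2 + - (1/4) = 1/4) //; lra.
apply: le_trans (exp_poly j0 y0) _.
rewrite invf_div mulrA exprMn [j%:R * 2]mulrC; apply: ler_wpM2l; first by rewrite exprn_ge0 // mulr_ge0.
rewrite -powRN -powR_mulrn ?powR_ge0 // -powRrM.
by rewrite (_ : - (1 / 4) * j%:R = - (j%:R / 4)) //; lra.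
Qed.

Definition van f := forall eps, 0 < eps -> \forall n \near \oo, f n <= eps.

Lemma van_Oc c f : c < 0 -> Oc c f -> van f.
Proof. by move=> c0 h eps; exact: Oc_lim c0 h eps. Qed.

Lemma vanD f g : van f -> van g -> van (fun n => f n + g n).
Proof.
move=> hf hg eps e0; have e2 : 0 < eps / 2 by rewrite divr_gt0.
have hf2 := hf _ e2; have hg2 := hg _ e2.
near=> n; rewrite (splitr eps); apply: lerD; by near: n.
Unshelve. all: by end_near.
Qed.

End Growth.
End Growth.

(** * Choice of the parameters as functions of [n] *)

Module Asymptotics.
Import Weights Resign CoinTree Switching Moments LowerTail Refinement RunningTime PlantedEvents FailureProb Growth.
Local Open Scope classical_set_scope.
Local Open Scope ring_scope.

Lemma Kb_ge0 (R : realType) k : 0 <= tail_const R k.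
Proof.
rewrite /tail_const; cbv zeta; apply: mulr_ge0; first by apply: exprn_ge0; exact: ler0n.
apply: addr_ge0; first exact: ler0n.
apply: mulr_ge0.
  apply: mulr_ge0; first by apply: mulr_ge0; exact: ler0n.
  rewrite invr_ge0; apply: exprn_ge0; exact: expR_ge0.
apply: addr_ge0; last exact: ler01.
by apply: mulr_ge0; [exact: ler0n|exact: expR_ge0].
Qed.

(** The program can contain natural constants only, so the search radius is a rational multiple of
    the logarithm. *)
Lemma rat_between (R : realType) (x y : R) : 0 <= x -> x < y -> exists a b : nat,
  (0 < b)%N /\ x <= a%:R / b%:R <= y.
Proof.
move=> x0 xy; have xy0 : 0 < y - x by rewrite subr_gt0.
pose b := (Num.bound (y - x)^-1).+1.
have b0 : 0 < b%:R :> R by rewrite ltr0n.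
have hb : 1 <= b%:R * (y - x).
  rewrite -ler_pdivrMr // div1r ltW // (lt_trans (archi_boundP _)) ?invr_ge0 ?ltW //.
  by rewrite ltr_nat.
have by0 : 0 <= b%:R * y by rewrite mulr_ge0 // ltW // (le_lt_trans x0).
have /andP[h1 h2] := truncn_itv by0.
exists (Num.truncn (b%:R * y)), b; split=> //; apply/andP; split.
  rewrite ler_pdivlMr //; move: h2; rewrite -natr1 => h2.
  by move: hb h2; rewrite mulrBr [x * _]mulrC; set u := b%:R * y; set v := b%:R * x; set w := (_)%:R; move=> *; lra.
by rewrite ler_pdivrMr // [y * _]mulrC.
Qed.

(* The choice of [ra / rb] makes [d k] to the power [r n] lie between
   [n ^ (1/52)] and [n ^ (1/45)], up to constants: the upper bound makes two meeting short
   cycles unlikely, the lower bound makes [(1 - delta) ^ r n] beat the target. *)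
Section Asym.
Variables (R : realType) (delta : R) (k : nat) (d : R).
Hypotheses (de0 : 0 < delta) (de1 : delta < 1) (k3 : (2 < k)%N)
  (d_gt : 1 / (k%:R - 1) < d) (d_lt : d < (1 - delta) * ((2 ^+ (k - 1) - 1) / (k%:R - 1))).
Variables (C C1 ra rb : nat).
Let D : R := d * k%:R.
Let lam : R := 1 - delta.
Let lD := ln D.
Hypotheses (rb0 : (0 < rb)%N) (hra : ln 2 / (52 * lD) <= ra%:R / rb%:R <= ln 2 / (45 * lD)).
Let tau := delta / (55 * lD).
Let theta := delta / (52 * lD).
Variable ep : R.
Hypotheses (ep0 : 0 < ep) (ep1 : ep <= 1 / 100) (ep2 : tau + 2 * ep <= theta).
Hypotheses (hC : d <= C%:R) (C1ra : (ra < C1)%N) (C1l : (tau + ep + 2) * ln 2 <= C1%:R * - ln lam)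
  (C1q : tau + 2 <= C1%:R).

Let kR1 : 0 < k%:R - 1 :> R. Proof. by rewrite subr_gt0 ltr1n ltnW. Qed.
Let k0 : 0 < k%:R :> R. Proof. by rewrite ltr0n; apply: leq_trans k3. Qed.
Let d0 : 0 < d. Proof. by apply: lt_trans d_gt; rewrite divr_gt0. Qed.
Let kD : k%:R / (k%:R - 1) < D.
Proof. by rewrite mulrC /D ltr_pM2r //; move: d_gt; rewrite div1r. Qed.
Let D1 : 1 < D.
Proof. by apply: lt_trans kD; rewrite ltr_pdivlMr // mul1r gtrBl. Qed.
Let D0 : 0 < D. Proof. exact: lt_trans D1. Qed.
Let lD0 : 0 < lD. Proof. by rewrite ln_gt0. Qed.
Let lam0 : 0 < lam. Proof. by rewrite subr_gt0. Qed.
Let lam1 : lam < 1. Proof. by rewrite /lam gtrBl. Qed.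
Let l2 : 0 < ln 2 :> R. Proof. exact: ln2_gt0. Qed.
Let tau0 : 0 < tau. Proof. by rewrite divr_gt0 // mulr_gt0. Qed.
Let p2k : 1 < 2 ^+ k.-1 :> R.
Proof. by rewrite exprn_egt1 ?ltr1n //; move: k3; case: (k) => [|[|]]. Qed.
Let q : R := 2 ^- k.-1.
Let q0 : 0 < q. Proof. by rewrite invr_gt0 exprn_gt0. Qed.
Let kap : R := (2 ^+ k.-1 - 1)^-1.
Let kap0 : 0 < kap. Proof. by rewrite invr_gt0 subr_gt0. Qed.
Let dkap : d * (k%:R - 1) * kap < lam.
Proof.
move: d_lt; rewrite subn1 mulrA ltr_pdivlMr // => h.
by rewrite /kap ltr_pdivrMr // subr_gt0.
Qed.

Let T n := Tn C1 n.
Let r n := rn ra rb n.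
Let sq n := sqf n.
Let mR n : R := d * n%:R / k%:R.
Let aa n : R := n%:R `^ (- ep).
Let eta n : R := n%:R `^ (- (1 / 4)).
Let tgt n : R := n%:R `^ (- tau).

Lemma r_lt_T n : (2 <= n)%N -> (r n < T n)%N.
Proof.
move=> n2; rewrite /r /rn /T /Tn; apply: leq_ltn_trans (leq_div _ _) _.
by rewrite ltn_pmul2r // (@lg_gt0 n).
Qed.

Lemma Oc_T : Oc 0 (fun n => (T n)%:R : R).
Proof. by apply: (@Oc_nat0 R T C1). Qed.
Lemma Oc_T1 : Oc 0 (fun n => (T n).+1%:R : R).
Proof.
apply: (@Oc_nat0 R (fun n => (T n).+1) C1.+1) => n n2; rewrite mulSn addnC -addn1 leq_add2l.
exact: (@lg_gt0 n).
Qed.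
Lemma Oc_T2 : Oc 0 (fun n => (T n).+2%:R : R).
Proof.
apply: (@Oc_nat0 R (fun n => (T n).+2) C1.+2) => n n2; have := @lg_gt0 n n2.
by rewrite /T /Tn /lgn; set l := up_log 2 n; clear; nia.
Qed.
Lemma Oc_Z : Oc 0 (fun n => (Zb (T n))%:R : R).
Proof.
apply: (@Oc_nat0 R (fun n => Zb (T n)) (3 * C1 + 4)) => n n2; have := @lg_gt0 n n2.
by rewrite /Zb /T /Tn /lgn; set l := up_log 2 n; clear; nia.
Qed.
Lemma Oc_r : Oc 0 (fun n => (r n)%:R : R).
Proof. by apply: (@Oc_nat0 R r ra) => n n2; exact: leq_div. Qed.
Lemma Oc_r1 : Oc 0 (fun n => (r n).+1%:R : R).
Proof.
apply: (@Oc_nat0 R (fun n => (r n).+1) ra.+1) => n n2; have := @lg_gt0 n n2.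
have : (r n <= ra * up_log 2 n)%N by exact: leq_div.
by set l := up_log 2 n; set x := r n; clear; nia.
Qed.
Lemma Oc_kr1 : Oc 0 (fun n => (k * (r n).+1)%:R : R).
Proof. by under eq_fun do rewrite natrM; apply: OcM0; [apply: Oc_cst|exact: Oc_r1]. Qed.
Lemma Oc_V : Oc (-1) (fun n => n%:R^-1 : R).
Proof. by exists 1, 0%N => n n2; rewrite invr_ge0 ler0n expr0 !mul1r powR_inv1 // lexx. Qed.
Lemma Oc_m : Oc 1 mR.
Proof.
apply: (@Oc_dom R 1 _ (fun n => n%:R) (d / k%:R)); [by rewrite divr_ge0 // ltW| |exact: Oc_n].
move=> n _; rewrite /mR mulrAC lexx andbT; by rewrite mulr_ge0 // divr_ge0 // ltW.
Qed.

Let rhi n : (2 <= n)%N -> (r n)%:R <= ra%:R / rb%:R * (up_log 2 n)%:R :> R.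
Proof.
move=> n2; have rb' : 0 < rb%:R :> R by rewrite ltr0n.
by rewrite mulrAC ler_pdivlMr // -!natrM ler_nat; exact: leq_divM.
Qed.
Let rlo n : (2 <= n)%N -> ra%:R / rb%:R * (up_log 2 n)%:R <= (r n)%:R + 1 :> R.
Proof.
move=> n2; have rb' : 0 < rb%:R :> R by rewrite ltr0n.
rewrite mulrAC ler_pdivrMr // natr1 -!natrM ler_nat; apply/ltnW; exact: ltn_ceil.
Qed.

Lemma Oc_Dr : Oc (1/45) (fun n => D ^+ r n).
Proof.
apply: (@Oc_expn R D r (1/45) ((1/45) * ln 2) D0) => n n2; rewrite -/lD.
have /andP[_ h2] := hra.
apply: (@le_trans _ _ (ra%:R / rb%:R * (up_log 2 n)%:R * lD)).
  by apply: ler_wpM2r (rhi n2); exact: ltW.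
apply: (@le_trans _ _ (ln 2 / (45 * lD) * (up_log 2 n)%:R * lD)).
  by apply: ler_wpM2r; [exact: ltW|apply: ler_wpM2r].
have -> : ln 2 / (45 * lD) * (up_log 2 n)%:R * lD = 1 / 45 * ((up_log 2 n)%:R * ln 2) by field; rewrite gt_eqF.
by rewrite -mulrDr ler_wpM2l // lg_ln.
Qed.

Lemma Oc_Dr1 : Oc (1/45) (fun n => D ^+ (r n).+1).
Proof.
by under eq_fun do rewrite exprS; apply: OcM0; [apply: Oc_cst; exact: ltW|exact: Oc_Dr].
Qed.

Let lnlam : delta <= - ln lam.
Proof.
rewrite lerNr -(expRK (- delta)) ler_ln ?posrE ?expR_gt0 //.
by apply: le_trans (expR_ge1Dx _).
Qed.

(** [- ln (1 - delta) >= delta] turns the lower bound on [r n] into the exponent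
    [delta / (52 * lD)]. *)
Lemma Oc_lamr : Oc (- theta) (fun n => lam ^+ r n).
Proof.
apply: (@Oc_expn R lam r (- theta) (- ln lam) lam0) => n n2.
have /andP[h1 _] := hra; have L0 : 0 <= - ln lam by apply: le_trans lnlam; exact: ltW.
have hL := ln_lg R n2.
have key : theta * ln n%:R <= ((r n)%:R + 1) * - ln lam.
  apply: (@le_trans _ _ (ra%:R / rb%:R * (up_log 2 n)%:R * - ln lam)); last by apply: ler_wpM2r (rlo n2).
  apply: (@le_trans _ _ (ln 2 / (52 * lD) * (up_log 2 n)%:R * delta)); last first.
    apply: ler_pM => //; first by rewrite mulr_ge0 // divr_ge0 ?mulr_ge0 ?ltW.
      exact: ltW.
    by apply: ler_wpM2r.
  have -> : ln 2 / (52 * lD) * (up_log 2 n)%:R * delta = theta * ((up_log 2 n)%:R * ln 2).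
    by rewrite /theta; field; rewrite gt_eqF.
  by apply: ler_wpM2l; [rewrite divr_ge0 ?mulr_ge0 ?ltW|].
by move: key; rewrite mulrDl mul1r !mulrN !mulNr; set u := _ * ln n%:R; set v := _%:R * ln lam; move=> *; lra.
Qed.

Lemma Oc_lamT : Oc (- (tau + ep + 2)) (fun n => lam ^+ (T n).+1).
Proof.
apply: (@Oc_expn R lam (fun n => (T n).+1) (- (tau + ep + 2)) 0 lam0) => n n2.
have hL := ln_lg R n2; have l1 : 1 <= (up_log 2 n)%:R :> R := lg1 R n2.
have L0 : 0 <= - ln lam by apply: le_trans lnlam; exact: ltW.
have t0 : 0 <= tau + ep + 2 by rewrite !addr_ge0 // ltW.
have key : (tau + ep + 2) * ln n%:R <= (T n)%:R * - ln lam.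
  apply: (@le_trans _ _ ((tau + ep + 2) * ((up_log 2 n)%:R * ln 2))); first by apply: ler_wpM2l.
  rewrite /T /Tn natrM mulrCA [leRHS]mulrAC mulrC; apply: ler_wpM2r => //.
have k2 : (T n)%:R * - ln lam <= (T n).+1%:R * - ln lam by apply: ler_wpM2r => //; rewrite ler_nat.
have := le_trans key k2; rewrite mulrN mulNr addr0 lerNr; done.
Qed.

Lemma Oc_qT : Oc (- (tau + 2)) (fun n => q ^+ T n).
Proof.
apply: (@Oc_expn R q T (- (tau + 2)) 0 q0) => n n2.
have hL := ln_lg R n2.
have kp : (0 < k.-1)%N by move: k3; case: (k) => [|[|]].
have lq : ln 2 <= - ln q.
  rewrite /q lnV ?posrE ?exprn_gt0 // opprK lnXn // -[X in _ <= X]mulr_natr ler_peMr ?ler1n //; exact: ltW.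
have key : (tau + 2) * ln n%:R <= (T n)%:R * - ln q.
  apply: (@le_trans _ _ ((tau + 2) * ((up_log 2 n)%:R * ln 2))).
    by apply: ler_wpM2l => //; rewrite addr_ge0 // ltW.
  rewrite mulrA; apply: ler_pM => //.
  - by rewrite mulr_ge0 // addr_ge0 // ltW.
  - exact: ltW.
  by rewrite /T /Tn natrM; apply: ler_wpM2r.
by move: key; rewrite mulrN mulNr addr0 lerNr.
Qed.

Lemma Oc_aV : Oc ep (fun n => (aa n)^-1).
Proof. by under eq_fun do rewrite /aa powRN invrK; exact: Oc_pow. Qed.
Lemma Oc_tV : Oc tau (fun n => 2 / tgt n).
Proof. by under eq_fun do rewrite /tgt powRN invrK; apply: OcM0; [apply: Oc_cst|exact: Oc_pow]. Qed.
Lemma Oc_eta : Oc (- (1/4)) eta. Proof. exact: Oc_pow. Qed.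

Lemma Oc_wT : Oc (-1) (fun n => wT n k D (Zb (T n))).
Proof.
have h : Oc 0 (fun n => D * (2 * k%:R ^+ 2 * (Zb (T n))%:R ^+ 2)).
  apply: OcM0; first by apply: Oc_cst; exact: ltW.
  apply: OcM0; first by apply: Oc_cst; rewrite mulr_ge0 ?exprn_ge0.
  exact: OcX0 Oc_Z.
exact: (OcM0 h Oc_V).
Qed.

Lemma Oc_DrwT : Oc (1/45 - 1) (fun n => D ^+ r n * wT n k D (Zb (T n))).
Proof. exact: (OcM Oc_Dr Oc_wT). Qed.

Lemma Oc_G : Oc (1/45 - 1) (fun n => (r n)%:R * (D ^+ r n * wT n k D (Zb (T n)))).
Proof. exact: (OcM0 Oc_r Oc_DrwT). Qed.

(** The inverse is [2 ^ (k - 1) / (2 ^ (k - 1) - 1)], at most [k / (k - 1)] because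
    [k <= 2 ^ (k - 1)]; the lower bound on [d] places this below [d k]. *)
Lemma rho_D : 0 <= (Resign.rho R k)^-1 <= D.
Proof.
have rE : (Resign.rho R k)^-1 = 2 ^+ k.-1 * kap.
  rewrite rho_q // /kap; move: p2k; set p := 2 ^+ k.-1 => p1.
  have p0 : p != 0 by rewrite gt_eqF // (lt_trans ltr01).
  have p1' : p - 1 != 0 by rewrite subr_eq0 gt_eqF.
  by field; rewrite p0 p1'.
rewrite rE; apply/andP; split; first by rewrite mulr_ge0 ?exprn_ge0 // ltW.
apply: le_trans (ltW kD); rewrite /kap ler_pdivrMr ?subr_gt0 // mulrAC ler_pdivlMr //.
rewrite !mulrBr !mulr1 mulrC lerD2l lerN2 -natrX ler_nat.
have := ltn_expl k.-1 (isT : (1 < 2)%N); by move: k3; case: (k) => // k' _.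
Qed.

Lemma Oc_rho : Oc (1/45) (fun n => (Resign.rho R k)^-1 ^+ (r n).+1).
Proof.
have /andP[h1 h2] := rho_D.
apply: (@Oc_dom R _ _ (fun n => D ^+ (r n).+1) 1) => //; last exact: Oc_Dr1.
by move=> n _; rewrite mul1r exprn_ge0 //= lerXn2r // nnegrE // ltW.
Qed.

(** The exponent needed for one switch: [1] for the number of clauses, [tau] for the target, one
    [ep] for the transfer from the planted model, and one [ep] to make the bound vanish. *)
Let be := 1 + tau + 2 * ep.

Lemma Oc_bt : Oc (- be) (fun n => bad_weight n k (T n) (r n) D lam).
Proof.
apply: OcD.
  have h : Oc 0 (fun n => D * (Zb (T n))%:R / lam).
    under eq_fun do rewrite mulrAC; apply: OcM0; last exact: Oc_Z.
    by apply: Oc_cst; rewrite divr_ge0 // ltW.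
  apply: (Oc_le _ (OcM0 h Oc_lamT)); rewrite /be; move: ep1 ep0; move=> *; lra.
have h1 : Oc 0 (fun n => ((T n).+1 * (T n).+2)%:R : R).
  by under eq_fun do rewrite natrM; exact: OcM0 Oc_T1 Oc_T2.
have h2 : Oc 0 (fun n => D ^+ 3 * (Zb (T n))%:R ^+ 2 / lam ^+ 2).
  under eq_fun do rewrite mulrAC; apply: OcM0; last exact: OcX0 Oc_Z.
  by apply: Oc_cst; rewrite divr_ge0 ?exprn_ge0 // ltW.
apply: (Oc_le _ (OcM0 h1 (OcM (OcM0 h2 Oc_lamr) Oc_wT))); rewrite /be; move: ep2; move=> *; lra.
Qed.

Lemma Oc_mabt : Oc (- (tau + ep)) (fun n => mR n * ((aa n)^-1 * bad_weight n k (T n) (r n) D lam)).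
Proof. apply: (Oc_le _ (OcM Oc_m (OcM Oc_aV Oc_bt))); rewrite /be; lra. Qed.

Lemma van_Phi : van (fun n => failure_bound n k (T n) (r n) (sq n) D lam (aa n) (eta n) (tgt n) (mR n)).
Proof.
have e1 := ep1; have e0 := ep0.
have OG := Oc_G.
rewrite /failure_bound; apply: vanD; [apply: vanD; [apply: vanD; [apply: vanD; [apply: vanD|]|]|]|].
- apply: (@van_Oc R (- (1/2))); first by lra.
  have h : Oc (- (3/2)) (fun n => tail_const R k / (n%:R * Num.sqrt n%:R)).
    apply: (Oc_le (c := 0 + - (3/2))); first by lra.
    apply: OcM; first by apply: Oc_cst; exact: Kb_ge0.
    exists 1, 0%N => n n2; rewrite invr_ge0 mulr_ge0 ?sqrtr_ge0 //= expr0 !mul1r.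
    have n0 : 0 < n%:R :> R by rewrite ltr0n ltnW.
    rewrite -powR12_sqrt // -{1}(powRr1 (a := n%:R)) // -powRD; last by rewrite gt_eqF ?implybT.
    by rewrite -powRN (_ : - (1 + 2^-1) = - (3 / 2)) //; lra.
  apply: (Oc_le _ (OcM Oc_m h)); lra.
- have ee : 0 < expR (-120) :> R := expR_gt0 _.
  apply: (@van_Oc R (- (expR (-120) * ep))); first by rewrite oppr_lt0 mulr_gt0.
  apply: (@Oc_dom R _ _ (fun n => n%:R `^ (- (expR (-120) * ep))) (expR (5/3))); first exact: expR_ge0.
    move=> n n2; rewrite mulr_ge0 ?expR_ge0 //=.
    have n0 : 0 < n%:R :> R by rewrite ltr0n ltnW.
    by rewrite /aa ln_powR /powR gt_eqF // mulNr mulrN mulrA mulNr lexx.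
  exact: Oc_pow.
- apply: (@van_Oc R (2/45 - 1)); first by lra.
  have h : Oc (1/45 - 1) (fun n => D * (Zb (T n))%:R * D ^+ (r n).+1 * wT n k D (Zb (T n))).
    apply: (Oc_le _ (OcM (OcM (OcM0 (Oc_cst (ltW D0)) Oc_Z) Oc_Dr1) Oc_wT)); lra.
  apply: (Oc_le _ (OcM Oc_m (OcM0 Oc_r (OcM0 Oc_r1 (OcM Oc_DrwT h))))); lra.
(* The expected number of clauses on short cycles is of order [n ^ (1/45)] up to logarithms, far
   below the cap [sqrt n]. *)
- apply: (@van_Oc R (1/45 - 1/2)); first by lra.
  apply: (Oc_le _ (OcM (Oc_sqV R sqf_up) (OcM Oc_m OG))); lra.
(* Here [eta = n ^ (-1/4)] beats the number of clauses on short cycles, the factors [rho^-1] and the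
   loss of the transfer. *)
- apply: (@van_Oc R (ep + 2/45 - 1/4)); first by lra.
  apply: (Oc_le _ (OcM Oc_m (OcM Oc_aV (OcM (OcM Oc_eta Oc_rho) OG)))); lra.
apply: (@van_Oc R (- ep)); first by lra.
have h1 : Oc (- (tau + ep)) (fun n => (T n)%:R * (k%:R * (mR n * ((aa n)^-1 * bad_weight n k (T n) (r n) D lam)))).
  by apply: OcM0 Oc_T _; apply: OcM0 Oc_mabt; apply: Oc_cst.
have h2 : Oc (- (tau + ep)) (fun n => (sq n)%:R * ((k * (r n).+1)%:R * (mR n * ((aa n)^-1 *
    ((r n)%:R * (D ^+ r n * wT n k D (Zb (T n))) * bad_weight n k (T n) (r n) D lam))))).
  apply: (Oc_le _ (OcM (Oc_sq R (fun n => sqi_sq n n)) (OcM0 Oc_kr1 (OcM Oc_m (OcM Oc_aV (OcM OG Oc_bt)))))).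
  rewrite /be; lra.
apply: (Oc_le _ (OcM Oc_tV (OcD h1 h2))); lra.
Qed.

Lemma van_det : van (fun n => 2 / tgt n * (mR n * q ^+ T n + (sq n)%:R * (1 - eta n) ^+ sq n)).
Proof.
(* [Oc_miss] offers every inverse power of [n]; [j] is large enough to beat the target
   [n ^ (- tau)]. *)
pose j := (Num.bound (4 * (tau + 1))).+1.
have hj : 4 * (tau + 1) <= j%:R.
  rewrite ltW // (lt_trans (archi_boundP _)) ?ltr_nat // mulr_ge0 // addr_ge0 // ltW //.
have t0 := tau0.
apply: (@van_Oc R (- (1/2))); first by lra.
have h1 : Oc (- (tau + 1/2)) (fun n => mR n * q ^+ T n).
  apply: (Oc_le _ (OcM Oc_m Oc_qT)); lra.
have h2 : Oc (- (tau + 1/2)) (fun n => (sq n)%:R * (1 - eta n) ^+ sq n).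
  apply: (Oc_le _ (OcM (Oc_sq R (fun n => sqi_sq n n)) (Oc_miss R (fun n => sqi_sq n n) sqf_up (isT : (0 < j)%N)))).
  by move: hj; set x := j%:R; move=> *; lra.
apply: (Oc_le _ (OcM Oc_tV (OcD h1 h2))); lra.
Qed.

Lemma Pr_asym (eps : R) : 0 < eps -> \forall n \near \oo, forall m : nat, m%:R = d * n%:R / k%:R ->
  1 - eps <= Pr_Fk R (@samples_within R (prog k C C1 ra rb) (word_const k C C1 ra rb) (time_bound k C C1 ra rb n) n k m
     (n%:R `^ (- tau))).
Proof.
move=> eps0.
have hP := van_Phi eps0; have hd := van_det (ltr01 : 0 < 1 :> R).
near=> n => m mE.
have n2k : (2 * k <= n)%N by near: n; exact: nbhs_infty_ge.
have n2 : (2 <= n)%N by move: n2k k3; clear; lia.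
have n0 : 0 < n%:R :> R by rewrite ltr0n ltnW.
have tg0 : 0 < tgt n by rewrite powR_gt0.
have mRE : mR n = m%:R by rewrite mE.
have Phi_le : failure_bound n k (T n) (r n) (sq n) D lam (aa n) (eta n) (tgt n) (mR n) <= eps by near: n.
have det_le : 2 / tgt n * (mR n * q ^+ T n + (sq n)%:R * (1 - eta n) ^+ sq n) <= 1 by near: n.
apply: (@le_trans _ _ (1 - failure_bound n k (T n) (r n) (sq n) D lam (aa n) (eta n) (tgt n) (mR n))).
  by rewrite lerD2l lerN2.
rewrite mRE; apply: Pr_bound => //.
- exact: r_lt_T.
- exact: ltW.
- rewrite mE /x1 /D; apply: ler_of_eqA; field; by rewrite !gt_eqF.
- exact: ltW.
- rewrite mE /xl -/kap; apply: le_trans (ltW dkap); apply: ler_of_eqA; field.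
  by rewrite !gt_eqF // subr_gt0.
- by rewrite powR_gt0 //= pow_le1 // oppr_le0 ltW.
- exact: powR_ge0.
- by apply: pow_le1 => //; lra.
- have -> : 2 ^- k.-1 / (1 - 2 ^- k.-1) = kap :> R.
    rewrite /kap; field; rewrite !gt_eqF ?subr_gt0 ?exprn_gt0 //; exact: p2k.
  rewrite mE; have k3R : 3 <= k%:R :> R by rewrite ler_nat.
  have dk1 : d * (k%:R - 1) * kap < 1 by exact: lt_trans dkap lam1.
  rewrite mulrAC ler_pdivrMr // mulrAC [leRHS]mulrAC.
  have : d * kap <= k%:R / 6.
    apply: (@le_trans _ _ (1 / 2)); last by move: k3R; set x := k%:R; move=> *; lra.
    rewrite ler_pdivlMr //; apply: le_trans (ltW dk1).
    rewrite [leRHS]mulrAC; apply: ler_wpM2l; first by rewrite mulr_ge0 // ltW.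
    by move: k3R; set x := k%:R; move=> *; lra.
  by move=> h; rewrite [leLHS]mulrC -[leRHS]mulrA ler_wpM2l // ltW.
- move: det_le; rewrite mRE mulrC mulrA ler_pdivrMr // mul1r => h.
  by rewrite ler_pdivlMr //; exact: h.
move=> F Fp v; apply: prog_law => //.
rewrite -(ler_nat R) mE natrM ler_pdivrMr //; apply: (@le_trans _ _ (C%:R * n%:R)).
  by apply: ler_wpM2r.
by rewrite ler_peMr ?mulr_ge0 // ler1n; move: k3; case: (k).
Unshelve. all: by end_near.
Qed.

End Asym.
End Asymptotics.

(** * Running time and final choice of the constants *)

Import Moments RunningTime Growth Asymptotics.
Local Open Scope classical_set_scope.
Local Open Scope ring_scope.

Lemma prog_time (R : realType) (k C C1 ra rb : nat) : (2 < k)%N ->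
  (fun n : nat => (time_bound k C C1 ra rb n)%:R : R^o) =O_\oo (fun n : nat => (n%:R * ln n%:R) ^+ 2 : R^o).
Proof.
move=> k3; have [K hK] := bo_Tt C C1 ra rb k3.
have l2 : 0 < ln 2 :> R by exact: ln2_gt0.
pose K1 : R := K%:R * (6 / ln 2) ^+ 2 + 1.
apply/eqO_exP; exists K1; first by rewrite ltr_wpDl // mulr_ge0 // exprn_ge0 // divr_ge0 // ltW.
near=> n.
have n2 : (2 <= n)%N by near: n; exact: nbhs_infty_ge.
have n0 : 0 < n%:R :> R by rewrite ltr0n ltnW.
have ln0 : ln 2 <= ln n%:R :> R by rewrite ler_ln ?posrE // ler_nat.
have lnp : 0 < ln n%:R :> R by exact: lt_le_trans ln0.
rewrite ger0_norm // ger0_norm; last by rewrite exprn_ge0 // mulr_ge0 // ltW.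
apply: (@le_trans _ _ (K%:R * (gF n)%:R)); first by rewrite -natrM ler_nat.
have hX : (gX n)%:R <= 2 * n%:R :> R.
  by rewrite -natrM ler_nat /gX; move: n2; clear; lia.
have hY : (gY n)%:R <= 3 / ln 2 * ln n%:R :> R.
  have -> : (gY n)%:R = (up_log 2 n)%:R + 1 :> R by rewrite /gY /lgn natr1 ?addn1.
  have h := lg_ln R n2; rewrite mulrAC ler_pdivlMr // mulrDl mul1r.
  by move: h ln0; set u := ln n%:R; set v := ln 2; set w := _ * v; move=> *; lra.
have gE : (gF n)%:R = ((gX n)%:R * (gY n)%:R) ^+ 2 :> R by rewrite /gF /gm /gXY /gm !natrM expr2.
rewrite gE; apply: (@le_trans _ _ (K%:R * (6 / ln 2 * (n%:R * ln n%:R)) ^+ 2)).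
  apply: ler_wpM2l => //; rewrite lerXn2r ?nnegrE ?mulr_ge0 ?invr_ge0 ?(ltW n0) ?(ltW lnp) ?(ltW l2) //.
  have -> : 6 / ln 2 * (n%:R * ln n%:R) = 2 * n%:R * (3 / ln 2 * ln n%:R) :> R by field; rewrite gt_eqF.
  exact: ler_pM.
rewrite exprMn mulrA; apply: ler_wpM2r; last by rewrite lerDl.
by rewrite exprn_ge0 // mulr_ge0 // ltW.
Unshelve. all: by end_near.
Qed.

Theorem theorem1p5 (R : realType) (delta : R) (k : nat) (d : R)
    (delta_gt0 : 0 < delta) (delta_lt1 : delta < 1) (k_ge2 : (2 <= k)%N)
    (d_gt : 1 / (k%:R - 1) < d)
    (d_lt : d < (1 - delta) * ((2 ^+ (k - 1) - 1) / (k%:R - 1))) :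
  exists (p : program) (c : nat) (T : nat -> nat),
    [/\ (0 < c)%N,
        runs_in_time p c k T,
        (fun n : nat => (T n)%:R : R^o) =O_\oo
          (fun n : nat => (n%:R * ln n%:R) ^+ 2 : R^o)
      & forall eps : R, 0 < eps ->
          \forall n \near \oo, forall m : nat, m%:R = d * n%:R / k%:R ->
            1 - eps <=
            Pr_Fk R (@samples_within R p c (T n) n k m
                       (n%:R `^ (- (delta / (55 * ln (d * k%:R))))))].
Proof.
(* For [k = 2] the bounds on [d] read [1 < d < 1 - delta], which is impossible. *)
have k3 : (2 < k)%N.
  rewrite ltn_neqAle k_ge2 andbT; apply/eqP => k2; move: d_gt d_lt; rewrite -k2 /= expr1.
  by move=> h1 h2; exfalso; move: h1 h2 delta_gt0; rewrite (_ : 2%:R - 1 = 1 :> R) ?divr1; lra.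
have kR1 : 0 < k%:R - 1 :> R by rewrite subr_gt0 ltr1n.
have k0 : 0 < k%:R :> R by rewrite ltr0n; apply: leq_trans k3.
have D1 : 1 < d * k%:R.
  apply: (@lt_trans _ _ ((k%:R - 1)^-1 * k%:R)).
    by rewrite mulrC ltr_pdivlMr // mul1r gtrBl.
  by rewrite ltr_pM2r //; move: d_gt; rewrite div1r.
pose lD := ln (d * k%:R); have lD0 : 0 < lD by rewrite ln_gt0.
have l2 : 0 < ln 2 :> R by exact: ln2_gt0.
pose tau := delta / (55 * lD); pose theta := delta / (52 * lD).
have tau0 : 0 < tau by rewrite divr_gt0 // mulr_gt0.
have tt : tau < theta.
  by rewrite /tau /theta ltr_pM2l // ltf_pV2 ?posrE ?mulr_gt0 // ltr_pM2r // ltr_nat.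
(* [ep] is spent twice in the gap between [tau] and [theta]; the cap [1 / 100] keeps the remaining
   exponents negative. *)
pose ep := Num.min ((theta - tau) / 2) (1 / 100).
have ep0 : 0 < ep by rewrite lt_min divr_gt0 ?subr_gt0 //= divr_gt0.
have ep1 : ep <= 1 / 100 by rewrite ge_min lexx orbT.
have ep2 : tau + 2 * ep <= theta.
  have : ep <= (theta - tau) / 2 by rewrite ge_min lexx.
  by move=> *; lra.
have [ra [rb [rb0 hra]]] : exists a b : nat, (0 < b)%N /\
    ln 2 / (52 * lD) <= a%:R / b%:R <= ln 2 / (45 * lD).
  apply: rat_between; first by rewrite divr_ge0 ?mulr_ge0 ?ltW.
  by rewrite ltr_pM2l // ltf_pV2 ?posrE ?mulr_gt0 // ltr_pM2r // ltr_nat.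
have lam0 : 0 < 1 - delta by rewrite subr_gt0.
have L0 : 0 < - ln (1 - delta) by rewrite oppr_gt0 ln_lt0 // lam0 gtrBl.
have bP (x : R) : 0 <= x -> x <= (Num.bound x)%:R by move=> /archi_boundP /ltW.
pose C := Num.bound d.
pose c1 := Num.bound ((tau + ep + 2) * ln 2 / - ln (1 - delta)).
pose c2 := Num.bound (tau + 2).
(* One summand per demand on [T n]: it exceeds [r n], makes unfinished clusters unlikelier than
   [n ^ (- (tau + ep + 2))], and makes a single clause stay violated with probability below
   [n ^ (- (tau + 2))], up to constants and logarithms. *)
pose C1 := (ra.+1 + c1 + c2)%N.
have d0 : 0 < d by apply: lt_trans d_gt; rewrite divr_gt0.
have s0 : 0 <= tau + ep + 2 by rewrite !addr_ge0 // ltW.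
exists (prog k C C1 ra rb), (word_const k C C1 ra rb), (time_bound k C C1 ra rb); split.
- by rewrite /word_const addn3.
- by move=> n m F bs; apply: prog_halts => //; rewrite size_tuple.
- exact: prog_time.
move=> eps eps0; apply: (@Pr_asym R delta k d delta_gt0 delta_lt1 k3 d_gt d_lt C C1 ra rb rb0 hra ep ep0 ep1 ep2); last exact: eps0.
- exact: bP (ltW d0).
- by rewrite /C1 -addnA; exact: leq_addr.
- have h : (tau + ep + 2) * ln 2 / - ln (1 - delta) <= c1%:R.
    by apply: bP; rewrite divr_ge0 ?mulr_ge0 // ltW.
  rewrite -ler_pdivrMr; last exact: L0.
  by apply: le_trans h _; rewrite ler_nat /C1 addnAC; exact: leq_addl.
have h : tau + 2 <= c2%:R by apply: bP; rewrite addr_ge0 // ltW.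
by apply: le_trans h _; rewrite ler_nat /C1; exact: leq_addl.
Qed.
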